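(* For $p=2$ we have the norm identity $$\big\|\boldsymbol\partial^\downarrow[\bar{\boldsymbol\partial}^\downarrow]^{-1}_{\min}f\big\|_{L^2(\mathbb{H})}=\big\|f+\tfrac{\mathrm{i}}{2}\big([\bar{\boldsymbol\partial}^\downarrow]^{-1}_{\min}f+[\boldsymbol\partial^\downarrow]^{-1}_{\min}f\big)\big\|_{L^2(\mathbb{H})},\qquad f\in L^2(\mathbb{H}),$$ while for general $p$ with $1<p<+\infty$, for all $f\in L^p(\mathbb{H})$, $$\frac{1}{B(p)}\big\|f+\tfrac{\mathrm{i}}{2}\big([\bar{\boldsymbol\partial}^\downarrow]^{-1}_{\min}f+[\boldsymbol\partial^\downarrow]^{-1}_{\min}f\big)\big\|_{L^p(\mathbb{H})}\le\big\|\boldsymbol\partial^\downarrow[\bar{\boldsymbol\partial}^\downarrow]^{-1}_{\min}f\big\|_{L^p(\mathbb{H})}\le B(p)\,\big\|f+\tfrac{\mathrm{i}}{2}\big([\bar{\boldsymbol\partial}^\downarrow]^{-1}_{\min}f+[\boldsymbol\partial^\downarrow]^{-1}_{\min}f\big)\big\|_{L^p(\mathbb{H})}.$$ The constants $1/B(p)$ and $B(p)$ are sharp: the former cannot be replaced by a larger constant, and the latter cannot be replaced by a smaller constant, if the inequalities are to hold for all $f\in L^p(\mathbb{H})$.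
   Context: $\mathbb{C}_+=\{z\in\mathbb{C}:\operatorname{Im}z>0\}$, and $\mathrm{d}A(z)=\mathrm{d}x\,\mathrm{d}y/\pi$ for $z=x+\mathrm{i}y$. For $1<p<+\infty$, the notation $L^p(\mathbb{H})$ stands for the space $L^p_{-p}(\mathbb{C}_+)$ of measurable functions $f$ on $\mathbb{C}_+$ with norm $\|f\|_{L^p(\mathbb{H})}^p=\int_{\mathbb{C}_+}|f(z)|^p(\operatorname{Im}z)^{-p}\,\mathrm{d}A(z)<+\infty$. Write $\boldsymbol\partial=\frac12(\partial_x-\mathrm{i}\partial_y)$, $\bar{\boldsymbol\partial}=\frac12(\partial_x+\mathrm{i}\partial_y)$ (derivatives in the sense of distributions on $\mathbb{C}_+$) and $\mathbf{M}[f](z)=(\operatorname{Im}z)f(z)$; $\mathbf{M}^n$ is multiplication by $(\operatorname{Im}z)^n$ for integer $n$. Put $$\boldsymbol\partial^\downarrow=\mathbf{M}^2\boldsymbol\partial\mathbf{M}^{-1},\qquad \bar{\boldsymbol\partial}^\downarrow=\mathbf{M}^2\bar{\boldsymbol\partial}\mathbf{M}^{-1}.$$ For suitable $f$ on $\mathbb{C}_+$, let $$\mathbf{C}^\downarrow[f](z)=\int_{\mathbb{C}_+}\Big(\frac{1}{z-w}-\frac{1}{z-\bar w}\Big)f(w)\,\mathrm{d}A(w),\qquad \bar{\mathbf{C}}^\downarrow[f](z)=\int_{\mathbb{C}_+}\Big(\frac{1}{\bar z-\bar w}-\frac{1}{\bar z-w}\Big)f(w)\,\mathrm{d}A(w),\quad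 z\in\mathbb{C}_+.$$ The operators $[\bar{\boldsymbol\partial}^\downarrow]^{-1}_{\min}$ and $[\boldsymbol\partial^\downarrow]^{-1}_{\min}$ are $$[\bar{\boldsymbol\partial}^\downarrow]^{-1}_{\min}=\mathbf{M}\mathbf{C}^\downarrow\mathbf{M}^{-2},\qquad [\boldsymbol\partial^\downarrow]^{-1}_{\min}=\mathbf{M}\bar{\mathbf{C}}^\downarrow\mathbf{M}^{-2},$$ which act boundedly on $L^p(\mathbb{H})$ for $1<p<+\infty$. For $p=2$ they are characterized by: $u=[\bar{\boldsymbol\partial}^\downarrow]^{-1}_{\min}f$ (respectively $u=[\boldsymbol\partial^\downarrow]^{-1}_{\min}f$) is the unique solution of $\bar{\boldsymbol\partial}^\downarrow u=f$ (respectively $\boldsymbol\partial^\downarrow u=f$) of minimal norm in $L^2(\mathbb{H})$. $B(p)$ denotes the operator norm on $L^p(\mathbb{C},\mathrm{d}A)$ of the Beurling transform $\mathbf{B}[f](z)=-\mathrm{pv}\int_{\mathbb{C}}\frac{f(w)}{(z-w)^2}\,\mathrm{d}A(w)$, which is bounded for $1<p<+\infty$ (''pv'' denotes principal value). *)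

(* Defs.v *)
From HB Require Import structures.
From mathcomp Require Import all_boot all_order all_algebra.
From mathcomp Require Import all_classical all_reals all_analysis.
From mathcomp Require Import complex.

Set Implicit Arguments.
Unset Strict Implicit.
Unset Printing Implicit Defensive.

Import Order.TTheory GRing.Theory Num.Theory.
Import numFieldNormedType.Exports.

Local Open Scope classical_set_scope.
Local Open Scope ring_scope.

(* The domain of every function is R * R, with (x, y) standing for x + iy, so
   that the product topology and the product Lebesgue measure apply directly;
   the values are in R[i]. *)
Section plane.
Context {R : realType}.
Local Notation plane := (R * R)%type.
Local Notation C := (complex R).
Implicit Types (z w v : plane) (f g phi : plane -> C).

Definition pt z : C := Complex z.1 z.2.

Definition upper : set plane := [set z | 0 < z.2].

Definition plane_leb := (@lebesgue_measure R \x @lebesgue_measure R)%E.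

(* Integrals against dA = dx dy / pi: [area_int] for extended-real (nonnegative)
   integrands, [cint] for complex integrands, through the real and imaginary
   parts. *)
Definition area_int (D : set plane) (F : plane -> \bar R) : \bar R :=
  ((pi^-1)%:E * \int[plane_leb]_(z in D) F z)%E.

Definition cint (D : set plane) f : C :=
  Complex (pi^-1 * \int[plane_leb]_(z in D) complex.Re (f z))
          (pi^-1 * \int[plane_leb]_(z in D) complex.Im (f z)).

Definition cmeasurable (D : set plane) f : Prop :=
  measurable_fun D (fun z => complex.Re (f z)) /\
  measurable_fun D (fun z => complex.Im (f z)).

(* L^p(C, dA). *)
Definition norm_LpC (p : R) f : \bar R :=
  (area_int setT (fun z => (Normc.normc (f z) `^ p)%:E) `^ p^-1)%E.

Definition in_LpC (p : R) f : Prop :=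
  cmeasurable setT f /\ (norm_LpC p f < +oo)%E.

(* L^p(H) = L^p_{-p}(C_+); only the values on C_+ matter. *)
Definition norm_LpH (p : R) f : \bar R :=
  (area_int upper (fun z => (Normc.normc (f z) `^ p * z.2 `^ (- p))%:E) `^ p^-1)%E.

Definition in_LpH (p : R) f : Prop :=
  cmeasurable upper f /\ (norm_LpH p f < +oo)%E.

(* M^n, for an integer n. *)
Definition mulIm (n : int) f : plane -> C := fun z => (z.2 ^ n)%:C%C * f z.

Definition Cdown f : plane -> C := fun z =>
  cint upper (fun w =>
    ((pt z - pt w)^-1 - (pt z - (pt w)^*%C)^-1) * f w).

Definition Cbardown f : plane -> C := fun z =>
  cint upper (fun w =>
    (((pt z)^*%C - (pt w)^*%C)^-1 - ((pt z)^*%C - pt w)^-1) * f w).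

Definition dbardown_inv f : plane -> C := mulIm 1 (Cdown (mulIm (- 2%:Z) f)).

Definition ddown_inv f : plane -> C := mulIm 1 (Cbardown (mulIm (- 2%:Z) f)).

(* C^oo in the real sense: every iterated directional derivative is (Frechet)
   differentiable everywhere. *)
Definition smooth (F : plane -> R) : Prop :=
  forall (s : seq plane) z,
    differentiable (foldr (fun v (G : plane -> R) => 'D_v G) F s) z.

(* C_c^oo(C_+), each element being extended by zero to the plane. *)
Definition test_fun phi : Prop :=
  [/\ smooth (fun z => complex.Re (phi z)),
      smooth (fun z => complex.Im (phi z)),
      compact (closure [set z | phi z != 0]) &
      closure [set z | phi z != 0] `<=` upper].

Definition dir_deriv v phi : plane -> C := fun z =>
  Complex ('D_v (fun x => complex.Re (phi x)) z)
          ('D_v (fun x => complex.Im (phi x)) z).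

Definition dz phi : plane -> C := fun z =>
  2^-1 * (dir_deriv (1, 0) phi z - 'i%C * dir_deriv (0, 1) phi z).

(* Distributions on C_+ are functionals that are only ever evaluated at elements
   of [test_fun]; the pairing is bilinear (no conjugation). *)
Definition distr : Type := (plane -> C) -> C.

Definition distr_of f : distr := fun phi => cint upper (fun z => f z * phi z).

Definition distr_dz (T : distr) : distr := fun phi => - T (dz phi).

Definition distr_mulIm (n : int) (T : distr) : distr :=
  fun phi => T (mulIm n phi).

Definition ddown (T : distr) : distr :=
  distr_mulIm 2 (distr_dz (distr_mulIm (- 1%:Z) T)).

Definition represents g (T : distr) : Prop :=
  forall phi, test_fun phi -> T phi = distr_of g phi.

(* The L^p(H)-norm of a distribution: the norm of the function of L^p(H) that
   represents it (such a function is unique almost everywhere, so the infimum is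
   over a single value), and +oo if the distribution is not in L^p(H). *)
Definition distr_norm_LpH (p : R) (T : distr) : \bar R :=
  ereal_inf [set norm_LpH p g | g in [set g | in_LpH p g /\ represents g T]].

Definition beurling_trunc (e : R) f : plane -> C := fun z =>
  - cint [set w | e < Normc.normc (pt z - pt w)]
      (fun w => f w / (pt z - pt w) ^+ 2).

Definition beurling f : plane -> C := fun z =>
  Complex (lim ((fun e => complex.Re (beurling_trunc e f z)) @ 0^'+))
          (lim ((fun e => complex.Im (beurling_trunc e f z)) @ 0^'+)).

(* B(p), as an extended real number, so that no appeal to its finiteness is
   needed to define it. *)
Definition beurling_norm (p : R) : \bar R :=
  ereal_sup [set norm_LpC p (beurling f) | f in
    [set f | in_LpC p f /\ (norm_LpC p f <= 1)%E]].

End plane.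

(* Main.v *)
Require Import Defs.
From HB Require Import structures.
From mathcomp Require Import all_boot all_order all_algebra.
From mathcomp Require Import all_classical all_reals all_analysis.
From mathcomp Require Import measurable_realfun complex ring lra.

(** Write f = y a with y = Im z, and let v, v' be the two potentials of a / y.
Adding to y v a logarithmic potential of a gives a function W on the half plane with
dbar W = G := a + (i/2)(v + v') and d W = k weakly, where y k is the distribution to be measured;
both norms on L^p(H) thus become L^p norms of dbar W and d W.
As |W| is at most 2 y times a positive kernel applied to |a|, which Schur's test bounds on L^p, cutting W off
near the boundary and at infinity and mollifying gives smooth compactly supported W_n with dbar W_n -> G and
d W_n -> k. Hence both inequalities, since B(p) is the best constant in |d u| <= B |dbar u| for smooth
compactly supported u; for p = 2 integration by parts gives B(2) <= 1.
For sharpness, W = -2i y^2 d h is explicit for smooth h, and translating h upwards to height s -> oo leaves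
|d d h| <= c |dbar d h| in the limit; functions dbar d h, resp. dbar dbar h, are dense in L^p. *)

Set Implicit Arguments.
Unset Strict Implicit.
Unset Printing Implicit Defensive.

Import Order.TTheory GRing.Theory Num.Theory.
Import numFieldNormedType.Exports.

Local Open Scope classical_set_scope.
Local Open Scope ring_scope.

Local Notation normc := Normc.normc.
Local Notation leb := lebesgue_measure.
Local Notation normcM := Normc.normcM.
Local Notation mfun := (measurable_fun setT).
Local Notation mcomp := measurableT_comp.
Local Notation mEFin := measurable_EFinP.
Local Notation le_via y := (@le_trans _ _ y).
Local Notation mfst := measurable_fst.
Local Notation msnd := measurable_snd.
Local Notation mfunM := measurable_funM.
Local Notation mfunB := measurable_funB.
Local Notation mfunD := measurable_funD.
Local Notation mcst := measurable_cst.
Local Notation "x %:C" := (real_complex _ x) (format "x %:C") : ring_scope.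
Local Notation "x ^*" := (conjc x) : ring_scope.
Local Notation Re := complex.Re.
Local Notation Im := complex.Im.
Local Notation aint := (area_int setT).
Local Notation nLp := norm_LpC.
Local Notation "'evt' n , P" := (exists N, forall n, (N <= n)%N -> P) (at level 200, n name).
Local Notation normcV := Normc.normcV.

(** * Measurability of complex-valued functions on the plane *)

Section measurability.
Context {R : realType}.
Local Notation plane := (R * R)%type.
Local Notation C := (complex R).

(** The logarithm enters because the function to be measured is k = y d v = d (y v) + (i/2) v, and
    (i/2) v is itself d of i/2 times the potential with kernel (log |z - w|^2 - log |z - conj w|^2)
    / Im w. The dbar of that potential has the conjugate kernel, whence v' in G. The reflected pole
    makes the kernel vanish on the real line, so W / y lies in L^p; a cutoff near the boundary has
    gradient of size 1 / y and costs exactly that factor. Three obstacles shape the rest. B(p) may a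
    priori be +oo; since +oo * 0 = 0, the upper bound then still claims something when G is null,
    and this case has its own argument. Principal values are reached through truncations: the
    truncated transform of dbar u averages d u over discs, which gives uniform bounds, and Fatou's
    lemma passes to the limit. The norm of a distribution is an infimum over representing functions:
    any two of them are L^p limits of the same sequence d W_n. As only smooth functions may test a
    distribution, the cutoffs and mollifiers are built inside an explicit class of smooth
    expressions. *)

Definition cmfun d (T : measurableType d) (f : T -> C) : Prop :=
 mfun (fun z => Re (f z)) /\
 mfun (fun z => Im (f z)).

Lemma complex_ext (z w : C) : Re z = Re w -> Im z = Im w -> z = w.
Proof. by case: z=> a b; case: w=> c d /= -> ->. Qed.
Lemma half_gt0 (e : R) : 0 < e -> 0 < e / 2.
Proof. by move=> e0; rewrite divr_gt0. Qed.

Section closure.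
Context d (T : measurableType d).
Implicit Types f g : T -> C.

Lemma cmfun_cst (c : C) : cmfun (fun _ : T => c).
Proof. by split; exact: mcst. Qed.
Lemma cmfunD f g : cmfun f -> cmfun g -> cmfun (fun z => f z + g z).
Proof.
move=> [f1 f2] [g1 g2]; split.
 by under eq_fun do rewrite raddfD /=; exact: mfunD.
by under eq_fun do rewrite raddfD /=; exact: mfunD.
Qed.
Lemma cmfunM f g : cmfun f -> cmfun g -> cmfun (fun z => f z * g z).
Proof.
move=> [f1 f2] [g1 g2]; split.
 rewrite (_ : (fun _ => _) = (fun z => Re (f z) * Re (g z) -
 Im (f z) * Im (g z))).
 by apply: mfunB; exact: mfunM.
 by apply/funext=> z; case: (f z)=> a b; case: (g z).
rewrite (_ : (fun _ => _) = (fun z => Re (f z) * Im (g z) +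
 Im (f z) * Re (g z))).
 by apply: mfunD; exact: mfunM.
by apply/funext=> z; case: (f z)=> a b; case: (g z)=> c e /=.
Qed.
Lemma cmfunJ f : cmfun f -> cmfun (fun z => (f z)^*).
Proof.
move=> [f1 f2]; split.
 by rewrite (_ : (fun _ => _) = (fun z => Re (f z)))//; apply/funext=> z; case: (f z).
rewrite (_ : (fun _ => _) = (fun z => - Im (f z))).
 exact: mcomp.
by apply/funext=> z; case: (f z).
Qed.
Lemma cmfun_real (f : T -> R) : mfun f ->
 cmfun (fun z => (f z)%:C).
Proof. by move=> mf; split=> //=; exact: mcst. Qed.
Lemma cmfunN f : cmfun f -> cmfun (fun z => - f z).
Proof.
move=> mf; under eq_fun do rewrite -mulN1r.
exact: cmfunM (cmfun_cst _) mf.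
Qed.
Lemma cmfunB f g : cmfun f -> cmfun g -> cmfun (fun z => f z - g z).
Proof. by move=> mf mg; apply: cmfunD=> //; exact: cmfunN. Qed.
Lemma meas_normc f : cmfun f -> mfun (fun z => normc (f z)).
Proof.
move=> [f1 f2].
rewrite (_ : (fun _ => _) = (fun z => Num.sqrt (Re (f z) ^+ 2 +
 Im (f z) ^+ 2))); last by apply/funext=> z; case: (f z).
apply: (@mcomp _ _ _ _ _ _ (@Num.sqrt R)).
 exact: continuous_measurable_fun (@sqrt_continuous R).
by apply: mfunD; exact: measurable_funX.
Qed.
(** Inversion is continuous off 0, and the remaining piece is a single point. *)
Lemma meas_inv (f : T -> R) : mfun f ->
 mfun (fun z => (f z)^-1).
Proof.
move=> mf; apply: (@mcomp _ _ _ _ _ _ (@GRing.inv R))=> //.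
rewrite -(setUv [set 0 : R]); apply/measurable_funU=> //.
 exact: measurableC.
split; first exact: measurable_fun_set1.
apply: open_continuous_measurable_fun; first by rewrite openC; exact: closed_eq.
by move=> x; rewrite inE /= => /eqP x0; exact: inv_continuous.
Qed.
Lemma cmfunV f : cmfun f -> cmfun (fun z => (f z)^-1).
Proof.
move=> mf.
have mn := meas_normc mf.
rewrite (_ : (fun _ => _) = (fun z => ((normc (f z) ^+ 2)^-1)%:C * (f z)^*)).
 apply: cmfunM; last exact: cmfunJ.
 by apply: cmfun_real; apply: meas_inv; exact: measurable_funX.
apply/funext=> z; case: (f z)=> a b.
rewrite /normc /= sqr_sqrtr ?addr_ge0 ?sqr_ge0 // /GRing.inv /=.
by apply/eqP; rewrite eq_complex /= !mul0r subr0 addr0 mulrN ![_^-1 * _]mulrC !eqxx.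
Qed.
Lemma cmfun_comp d' (T' : measurableType d') (h : T' -> T) f :
 mfun h -> cmfun f -> cmfun (fun z => f (h z)).
Proof.
move=> mh [f1 f2]; split.
 exact: (mcomp f1 mh).
exact: (mcomp f2 mh).
Qed.

End closure.

Lemma cmfun_pt : cmfun (@pt R).
Proof. by split; [exact: mfst|exact: msnd]. Qed.
(** The sigma-algebra is the product one: an open set is the countable union of the boxes with
    rational corners that it contains. *)
Lemma open_measurable_plane (U : set plane) : open U -> measurable U.
Proof.
move=> oU.
pose Q (r : rat) : R := ratr r.
pose box (q : (rat * rat) * (rat * rat)) : set plane :=
 `]Q q.1.1, Q q.1.2[%classic `*` `]Q q.2.1, Q q.2.2[%classic.
have -> : U = \bigcup_(q in [set q | box q `<=` U]) box q.
 apply/seteqP; split=> [[x y] Uxy|z [q /= qU /qU]//].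
 move: oU; rewrite openE=> /(_ _ Uxy) [[A B] /= [Ax By] ABU].
 have [e e0 eA] := Ax; have [f f0 fB] := By.
 move: e0 f0=> /= e0 f0.
 have [a] : exists q : rat, ratr q \in `]x - e, x[ by apply: rat_in_itvoo; lra.
 rewrite in_itv /= => /andP[a1 a2].
 have [b] : exists q : rat, ratr q \in `]x, x + e[ by apply: rat_in_itvoo; lra.
 rewrite in_itv /= => /andP[b1 b2].
 have [c] : exists q : rat, ratr q \in `]y - f, y[ by apply: rat_in_itvoo; lra.
 rewrite in_itv /= => /andP[c1 c2].
 have [d] : exists q : rat, ratr q \in `]y, y + f[ by apply: rat_in_itvoo; lra.
 rewrite in_itv /= => /andP[d1 d2].
 exists ((a, b), (c, d)).
 move=> [u v] []; rewrite /= !in_itv /= /Q=> /andP[u1 u2] /andP[v1 v2]; apply: ABU; split=> /=.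
 by apply: eA; rewrite /ball_ /= ltr_norml; apply/andP; split; lra.
 by apply: fB; rewrite /ball_ /= ltr_norml; apply/andP; split; lra.
 by split=> /=; rewrite in_itv /=; apply/andP.
rewrite bigcup_mkcond; apply: countable_bigcupT_measurable; first exact: countableP.
move=> q; case: ifPn=> // _.
by apply: measurableX; exact: measurable_itv.
Qed.
Lemma continuous_measurable_plane (f : plane -> R) :
 continuous f -> mfun f.
Proof.
move=> /continuousP cf; apply: (measurability _ (RGenOpens.measurableE R)).
move=> _ [_ [a [b ->] <-]]; rewrite setTI.
by apply: open_measurable_plane; apply: cf; exact: interval_open.
Qed.

End measurability.

(** * Planar Lebesgue measure as a sigma-finite measure *)

Section plane_measure.
Context {R : realType}.
Local Notation plane := (R * R)%type.
Local Notation C := (complex R).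

(** [plane_leb] under a name of its own, which carries the sigma-finite structure that Fubini's
    theorem requires. *)
Definition lam2 : set (measurableTypeR R * measurableTypeR R) -> \bar R := (@leb R \x @leb R)%E.
HB.instance Definition _ := Measure.on lam2.

Lemma lam2_sigma_finite : sigma_finite setT lam2.
Proof.
have /sigma_finiteP[F [TF ndF Foo]] := sigma_finiteT (@leb R).
exists (fun n => F n `*` F n).
 apply/esym; rewrite -subTset=> -[x y] _.
 have [[n _ Fx] [k _ Fy]] : (\bigcup_n F n) x /\ (\bigcup_n F n) y by rewrite -TF.
 exists (maxn n k)=> //; split=> /=.
 - by move: x Fx; exact/subsetPset/ndF/leq_maxl.
 - by move: y Fy; exact/subsetPset/ndF/leq_maxr.
move=> k; have [mF Fk] := Foo k; split; first exact: measurableX.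
by rewrite /lam2 product_measure1E// lte_mul_pinfty// ge0_fin_numE.
Qed.

HB.instance Definition _ :=
 @Measure_isSigmaFinite.Build _ _ _ lam2 lam2_sigma_finite.

Lemma area_intE D (F : plane -> \bar R) :
 area_int D F = ((pi^-1)%:E * \int[lam2]_(z in D) F z)%E.
Proof. by []. Qed.
Lemma cintE D (f : plane -> C) : cint D f =
 Complex (pi^-1 * \int[lam2]_(z in D) Re (f z))
 (pi^-1 * \int[lam2]_(z in D) Im (f z)).
Proof. by []. Qed.

End plane_measure.

(** * Invariance of Lebesgue measure under reflections and translations *)

Section reflection.
Context {R : realType}.
Local Notation plane := (R * R)%type.
Local Notation C := (complex R).
Local Notation mu := (@lam2 R).

(** Reflections are the basic maps: convolutions use z - w directly, and a translation is two
    reflections, z + h = h - (0 - z). *)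
Definition refl1 (a : measurableTypeR R) (x : measurableTypeR R) : measurableTypeR R :=
 (a : R) - (x : R).

Lemma meas_refl1 a : mfun (refl1 a).
Proof. by apply: mfunB=> //; exact: mcst. Qed.

HB.instance Definition _ a := isMeasurableFun.Build _ _ _ _ (refl1 a) (meas_refl1 a).

Lemma leb_refl1 a (A : set (measurableTypeR R)) : measurable A ->
 pushforward leb (refl1 a) A = leb A.
Proof.
move=> mA; apply/esym/lebesgue_measure_unique=> //= _ [[c d]] _ <-.
rewrite /pushforward /=.
rewrite (_ : _ @^-1` _ = `[a - d, a - c[%classic); last first.
 by apply/seteqP; split=> x /=; rewrite !in_itv /= /refl1=> /andP[? ?]; apply/andP; split; lra.
rewrite !lebesgue_measure_itv /= !lte_fin ltrD2l ltrN2.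
by case: ifP=> // _; rewrite -!EFinB; congr EFin; lra.
Qed.
Definition refl2 (h : plane) (z : measurableTypeR R * measurableTypeR R) :
 measurableTypeR R * measurableTypeR R := (h.1 - z.1, h.2 - z.2).

Lemma meas_refl2 h : mfun (refl2 h).
Proof.
apply/measurable_fun_pairP; split.
 by apply: mfunB; [exact: mcst|exact: mfst].
by apply: mfunB; [exact: mcst|exact: msnd].
Qed.

HB.instance Definition _ a := isMeasurableFun.Build _ _ _ _ (refl2 a) (meas_refl2 a).

Lemma leb_refl2 (h : plane) (A : set (measurableTypeR R * measurableTypeR R)) : measurable A ->
 pushforward mu (refl2 h) A = mu A.
Proof.
move=> mA; apply/esym; apply: product_measure_unique=> // X Y mX mY.
transitivity (mu (refl2 h @^-1` (X `*` Y))); first by [].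
have -> : refl2 h @^-1` (X `*` Y) = (refl1 h.1 @^-1` X) `*` (refl1 h.2 @^-1` Y) by [].
rewrite /lam2 product_measure1E //.
- by congr (_ * _)%E; [exact: (@leb_refl1 h.1)|exact: (@leb_refl1 h.2)].
- by rewrite -[X in measurable X]setTI; exact: meas_refl1.
- by rewrite -[X in measurable X]setTI; exact: meas_refl1.
Qed.
Lemma ge0_integral_reflB (h : plane) (f : plane -> \bar R) : mfun f ->
 (forall z, (0 <= f z)%E) ->
 (\int[mu]_z f (h - z)%R = \int[mu]_z f z)%E.
Proof.
move=> mf f0.
transitivity (\int[pushforward mu (refl2 h)]_z f z)%E.
 by rewrite ge0_integral_pushforward//; exact: meas_refl2.
apply: eq_measure_integral=> A mA _; exact: leb_refl2.
Qed.
Lemma meas_reflB (h : plane) : mfun (fun z : plane => h - z).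
Proof. exact: meas_refl2. Qed.
Lemma meas_shift (h : plane) : mfun (fun z : plane => z + h).
Proof.
rewrite (_ : (fun _ => _) = (fun z => h - (0 - z))); last first.
 by apply/funext=> z; rewrite sub0r opprK addrC.
exact: (mcomp (meas_reflB h) (meas_reflB 0)).
Qed.
Lemma ge0_integral_shift (h : plane) (f : plane -> \bar R) : mfun f ->
 (forall z, (0 <= f z)%E) ->
 (\int[mu]_z f (z + h)%R = \int[mu]_z f z)%E.
Proof.
move=> mf f0; rewrite -[RHS](ge0_integral_reflB h)//.
rewrite -[RHS](ge0_integral_reflB 0)//.
 by apply: eq_integral=> z _; rewrite sub0r opprK addrC.
exact: (mcomp mf (meas_reflB h)).
Qed.
Lemma integrable_reflB (h : plane) (f : plane -> R) :
 mu.-integrable setT (EFin \o f) ->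
 mu.-integrable setT (EFin \o (fun z => f (h - z))).
Proof.
move=> /integrableP[mf If]; apply/integrableP; split.
 exact: (mcomp mf (meas_reflB h)).
rewrite (ge0_integral_reflB h (f := fun z => `|(EFin \o f) z|%E))//.
exact: mcomp.
Qed.
Lemma Rintegral_reflB (h : plane) (f : plane -> R) :
 mfun f ->
 \int[mu]_z f (h - z) = \int[mu]_z f z.
Proof.
move=> mf; have mf' : mfun (EFin \o f) by exact/mEFin.
rewrite /Rintegral; congr fine.
rewrite integralE [RHS]integralE; congr (_ - _)%E.
 rewrite -(ge0_integral_reflB h (f := (EFin \o f)^\+%E)).
 - by apply: eq_integral=> z _; rewrite !funeposE.
 - exact: measurable_funepos mf'.
 - by move=> z; exact: funepos_ge0.
rewrite -(ge0_integral_reflB h (f := (EFin \o f)^\-%E)).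
- by apply: eq_integral=> z _; rewrite !funenegE.
- exact: measurable_funeneg mf'.
- by move=> z; exact: funeneg_ge0.
Qed.
Lemma integrable_shift (h : plane) (f : plane -> R) :
 mu.-integrable setT (EFin \o f) ->
 mu.-integrable setT (EFin \o (fun z => f (z + h))).
Proof.
move=> If; have := integrable_reflB 0 (integrable_reflB h If).
by congr (integrable _ _ _); apply/funext=> z /=; rewrite sub0r opprK addrC.
Qed.
Lemma Rintegral_shift (h : plane) (f : plane -> R) :
 mfun f -> \int[mu]_z f (z + h) = \int[mu]_z f z.
Proof.
move=> mf; rewrite -[RHS](Rintegral_reflB h)// -[RHS](Rintegral_reflB 0).
 by apply: eq_Rintegral=> z _; rewrite sub0r opprK addrC.
exact: (mcomp mf (meas_reflB h)).
Qed.

End reflection.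

Section half_plane.
Context {R : realType}.
Local Notation plane := (R * R)%type.
Local Notation C := (complex R).
Local Notation mu := (@lam2 R).
Local Notation cI := (@cint R setT).

(** * The modulus of a complex number *)

Section modulus.
Implicit Types a b c : C.

Lemma normc_ge0 a : 0 <= normc a.
Proof. by case: a=> x y /=; exact: sqrtr_ge0. Qed.
Lemma normcD a b : normc (a + b) <= normc a + normc b.
Proof. exact: (@le_normcD R a b). Qed.
Lemma normcD_le a b r : normc a + normc b <= r -> normc (a + b) <= r.
Proof. exact: le_trans (normcD _ _). Qed.
Lemma normcNE a : normc (- a) = normc a.
Proof. exact: (@normcN R a). Qed.
Lemma normc_distC a b : normc (a - b) = normc (b - a).
Proof. by rewrite -normcNE opprB. Qed.
Lemma normc_conj a : normc a^* = normc a.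
Proof. by case: a=> x y /=; rewrite sqrrN. Qed.
Lemma normc_sqr a : normc a ^+ 2 = Re a ^+ 2 + Im a ^+ 2.
Proof. by case: a=> x y /=; rewrite sqr_sqrtr // addr_ge0 // sqr_ge0. Qed.
Lemma normc_Re a : `|Re a| <= normc a.
Proof.
rewrite -(ler_pXn2r (n := 2)) ?nnegrE ?normr_ge0 ?normc_ge0 // normc_sqr.
by rewrite real_normK ?num_real // lerDl sqr_ge0.
Qed.
Lemma normc_Im a : `|Im a| <= normc a.
Proof.
rewrite -(ler_pXn2r (n := 2)) ?nnegrE ?normr_ge0 ?normc_ge0 // normc_sqr.
by rewrite real_normK ?num_real // lerDr sqr_ge0.
Qed.
Lemma normc_le_ReIm a : normc a <= `|Re a| + `|Im a|.
Proof.
rewrite -(ler_pXn2r (n := 2)) ?nnegrE ?addr_ge0 ?normr_ge0 ?normc_ge0 //.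
rewrite normc_sqr sqrrD !real_normK ?num_real // -addrA lerD2l lerDr.
by rewrite mulrn_wge0 // mulr_ge0.
Qed.
Lemma normc_real (x : R) : normc x%:C = `|x|.
Proof. by rewrite /= expr0n addr0 sqrtr_sqr. Qed.
Lemma normc_ger0 (x : R) : 0 <= x -> normc x%:C = x.
Proof. by move=> x0; rewrite normc_real ger0_norm. Qed.
Lemma normc0 : normc (0 : C) = 0.
Proof. by rewrite -[0]/((0 : R)%:C) normc_real normr0. Qed.
Lemma normc_eq0 a : (normc a == 0) = (a == 0).
Proof.
by apply/eqP/eqP=> [/Normc.eq0_normc //|->]; rewrite normc0.
Qed.
Lemma normc_gt0 a : (0 < normc a) = (a != 0).
Proof. by rewrite lt_def normc_ge0 andbT normc_eq0. Qed.
Lemma normc_mul_conj a : a * a^* = (normc a ^+ 2)%:C.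
Proof.
rewrite normc_sqr; case: a=> x y; apply/eqP; rewrite eq_complex /=.
by rewrite mulrN opprK !expr2 mulrN [y * x]mulrC addNr !eqxx.
Qed.
Lemma normcX a n : normc (a ^+ n) = normc a ^+ n.
Proof.
elim: n=> [|n ih]; first by rewrite !expr0 normc_real normr1.
by rewrite !exprS normcM ih.
Qed.
Lemma normc_lerB a b : normc a - normc b <= normc (a - b).
Proof.
by rewrite lerBlDr; apply: le_trans (normcD _ _); rewrite subrK.
Qed.

End modulus.

(** * Integrable complex functions and their integrals *)

Section complex_integral.
Implicit Types f g : plane -> C.

Definition rintg (f : plane -> R) := mu.-integrable setT (EFin \o f).

Definition cintg f :=
 rintg (fun z => Re (f z)) /\ rintg (fun z => Im (f z)).

Lemma rintgP (f : plane -> R) : rintg f <->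
 mfun f /\ (\int[mu]_z `|f z|%:E < +oo)%E.
Proof.
split=> [/integrableP[mf If]|[mf If]].
 by split; [exact/mEFin|].
by apply/integrableP; split; [exact/mEFin|].
Qed.
Lemma le_rintg (f g : plane -> R) : mfun f ->
 (forall z, `|f z| <= g z) -> rintg g -> rintg f.
Proof.
move=> mf fg; apply: le_integrable=> //; first exact/mEFin.
by move=> z _; rewrite /= lee_fin (le_trans (fg z)) // ler_norm.
Qed.
Lemma cintg_cmfun f : cintg f -> cmfun f.
Proof. by move=> [/rintgP[m1 _] /rintgP[m2 _]]; split. Qed.
Lemma le_cintg f (g : plane -> R) : cmfun f ->
 (forall z, normc (f z) <= g z) -> rintg g -> cintg f.
Proof.
move=> [m1 m2] fg ig; split; apply: (le_rintg _ _ ig)=> // z.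
 exact: le_trans (normc_Re _) (fg z).
exact: le_trans (normc_Im _) (fg z).
Qed.
Lemma rintg_normc f : cintg f -> rintg (fun z => normc (f z)).
Proof.
move=> If; have mf := meas_normc (cintg_cmfun If).
case: If=> i1 i2.
have : rintg (fun z => `|Re (f z)| + `|Im (f z)|).
 exact: (integrableD measurableT (integrable_abse i1) (integrable_abse i2)).
by apply: le_rintg=> // z; rewrite ger0_norm ?normc_ge0 // normc_le_ReIm.
Qed.
Lemma cintgP f : cintg f <->
 cmfun f /\ (\int[mu]_z (normc (f z))%:E < +oo)%E.
Proof.
split=> [If|[mf If]].
 split; first exact: cintg_cmfun.
 have /rintgP[_] := rintg_normc If.
 by under eq_integral do rewrite ger0_norm ?normc_ge0 //.
apply: (@le_cintg _ (fun z => normc (f z)))=> //.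
apply/rintgP; split; first exact: meas_normc.
by under eq_integral do rewrite ger0_norm ?normc_ge0 //.
Qed.
Lemma cintgD f g : cintg f -> cintg g ->
 cintg (fun z => f z + g z).
Proof.
move=> [f1 f2] [g1 g2]; split.
 have := integrableD measurableT f1 g1.
 by rewrite /rintg; congr integrable; apply/funext=> z /=; rewrite raddfD.
have := integrableD measurableT f2 g2.
by rewrite /rintg; congr integrable; apply/funext=> z /=; rewrite raddfD.
Qed.
Lemma cintgZ (c : C) f : cintg f -> cintg (fun z => c * f z).
Proof.
move=> If; apply: (@le_cintg _ (fun z => normc c * normc (f z))).
- by apply: cmfunM; [exact: cmfun_cst|exact: cintg_cmfun].
- by move=> z; rewrite normcM.
- exact: (integrableZl _ (normc c) (rintg_normc If)).
Qed.
Lemma cintgN f : cintg f -> cintg (fun z => - f z).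
Proof. by move=> /(cintgZ (-1)); under eq_fun do rewrite mulN1r. Qed.
Lemma cintgB f g : cintg f -> cintg g ->
 cintg (fun z => f z - g z).
Proof. by move=> If /cintgN; exact: cintgD. Qed.
Lemma cintgJ f : cintg f -> cintg (fun z => (f z)^*).
Proof.
move=> If; apply: (le_cintg _ _ (rintg_normc If)).
 exact: cmfunJ (cintg_cmfun If).
by move=> z; rewrite normc_conj.
Qed.
Lemma eq_cint D f g : {in D, f =1 g} -> cint D f = cint D g.
Proof.
by move=> fg; rewrite !cintE; congr Complex; congr (_ * _);
 apply: eq_Rintegral=> z Dz; rewrite fg.
Qed.
Lemma eq_cintT f g : f =1 g -> cI f = cI g.
Proof. by move=> fg; apply: eq_cint=> z _. Qed.
Lemma cint0 : cI (fun=> 0) = 0.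
Proof.
rewrite cintE /= (_ : Rintegral _ _ _ = 0) ?mulr0 //.
by rewrite /Rintegral integral0.
Qed.
Lemma cintD f g : cintg f -> cintg g ->
 cI (fun z => f z + g z) = cI f + cI g.
Proof.
move=> [f1 f2] [g1 g2]; rewrite !cintE; apply/eqP; rewrite eq_complex /= -!mulrDr.
by apply/andP; split; apply/eqP; congr (_ * _); rewrite -RintegralD //;
 apply: eq_Rintegral=> z _; rewrite raddfD.
Qed.
Lemma cintZ (c : C) f : cintg f -> cI (fun z => c * f z) = c * cI f.
Proof.
case: c=> a b [f1 f2]; rewrite !cintE; apply/eqP; rewrite eq_complex /=.
have E (x y u v : R) : x * (pi^-1 * u) - y * (pi^-1 * v) = pi^-1 * (x * u - y * v) by ring.
have E' (x y u v : R) : x * (pi^-1 * u) + y * (pi^-1 * v) = pi^-1 * (x * u + y * v) by ring.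
rewrite E E'; apply/andP; split; apply/eqP; congr (_ * _).
 rewrite -!RintegralZl // -RintegralB //; try exact: (integrableZl measurableT _ f1);
 try exact: (integrableZl measurableT _ f2).
 by apply: eq_Rintegral=> z _; case: (f z).
rewrite -!RintegralZl // -RintegralD //; try exact: (integrableZl measurableT _ f1);
 try exact: (integrableZl measurableT _ f2).
by apply: eq_Rintegral=> z _; case: (f z).
Qed.
Lemma cintN f : cintg f -> cI (fun z => - f z) = - cI f.
Proof.
by move=> If; rewrite -[RHS]mulN1r -cintZ //; apply: eq_cintT=> z; rewrite mulN1r.
Qed.
Lemma cintB f g : cintg f -> cintg g ->
 cI (fun z => f z - g z) = cI f - cI g.
Proof. by move=> If Ig; rewrite cintD ?cintN //; exact: cintgN. Qed.
Lemma cintJ f : cintg f -> cI (fun z => (f z)^*) = (cI f)^*.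
Proof.
move=> [f1 f2]; rewrite cintE /=; congr Complex.
 by congr (_ * _); apply: eq_Rintegral=> z _; case: (f z).
rewrite -mulrN; congr (_ * _); rewrite -mulN1r -RintegralZl //.
by apply: eq_Rintegral=> z _; rewrite mulN1r; case: (f z).
Qed.
(** Multiplying by the conjugate of the integral makes the integral real and nonnegative, after
    which only the real part of the integrand has to be bounded. *)
Lemma normc_cint_le f : cintg f ->
 normc (cI f) <= pi^-1 * \int[mu]_z normc (f z).
Proof.
move=> If; have [->|I0] := eqVneq (cI f) 0.
 rewrite normc0 mulr_ge0 ?invr_ge0 ?pi_ge0 //.
 by apply: Rintegral_ge0=> z _; exact: normc_ge0.
move: (erefl (cI f)) I0; move: {2 3}(cI f)=> I EI I0; rewrite EI.
rewrite -(ler_pM2l (x := normc I)) ?normc_gt0 //.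
have IcZ := cintgZ (I^*) If.
have -> : normc I * normc I = Re (cI (fun z => I^* * f z)).
 have -> : cI (fun z => I^* * f z) = I * I^* by rewrite cintZ // EI mulrC.
 by rewrite normc_mul_conj expr2.
rewrite [X in X <= _]/= mulrCA ler_wpM2l ?invr_ge0 ?pi_ge0 //.
rewrite -RintegralZl //; last exact: rintg_normc.
apply: le_Rintegral=> //.
- by case: IcZ.
- exact: (integrableZl _ (normc I) (rintg_normc If)).
- move=> z _; apply: le_trans (ler_norm _) _; apply: le_trans (normc_Re _) _.
 by rewrite normcM normc_conj.
Qed.
Lemma cint_reflB h f : cmfun f -> cI (fun z => f (h - z)) = cI f.
Proof.
move=> [m1 m2]; rewrite !cintE.
by rewrite (Rintegral_reflB h m1) (Rintegral_reflB h m2).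
Qed.
Lemma cint_shift h f : cmfun f -> cI (fun z => f (z + h)) = cI f.
Proof.
move=> [m1 m2]; rewrite !cintE.
by rewrite (Rintegral_shift h m1) (Rintegral_shift h m2).
Qed.
Lemma cintg_shift h f : cintg f -> cintg (fun z => f (z + h)).
Proof. by move=> [i1 i2]; split; [exact: (integrable_shift h i1)|exact: (integrable_shift h i2)]. Qed.
Lemma cint_upper f : cint upper f = cI (fun z => if 0 < z.2 then f z else 0).
Proof.
rewrite !cintE; congr Complex; congr (_ * _); rewrite Rintegral_mkcond;
 apply: eq_Rintegral=> z _; rewrite /patch /=; case: ifPn=> h; case: ifPn=> // h'.
- by move: h; rewrite inE /upper /= (negbTE h').
- by move: h; rewrite notin_setE /upper /= h'.
- by move: h; rewrite inE /upper /= (negbTE h').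
- by move: h; rewrite notin_setE /upper /= h'.
Qed.

End complex_integral.

(** * Theorems of Fubini and Tonelli *)

Section generic_Fubini.
Context d (T : measurableType d).
Variable m : {sigma_finite_measure set T -> \bar R}.

(** [Rintegral] takes [fine] of the inner integral, hence a default value where that integral is
    infinite. This happens on a null set only, so the identity between extended-real iterated
    integrals carries over. *)
Lemma Rintegral_Fubini_gen (F : T * T -> R) :
 mfun F ->
 (\int[m]_z \int[m]_w `|F (z, w)|%:E < +oo)%E ->
 m.-integrable setT (EFin \o (fun z => \int[m]_w F (z, w))) /\
 \int[m]_z (\int[m]_w F (z, w)) = \int[m]_w (\int[m]_z F (z, w)).
Proof.
move=> mF IF.
have iF : (m \x m)%E.-integrable setT (EFin \o F).
 by apply/integrable12ltyP=> //; exact/mEFin.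
have iF' : (m \x m)%E.-integrable setT (EFin \o (fun zw => F (zw.2, zw.1))).
 apply/integrable12ltyP.
 apply/mEFin; apply: (mcomp mF).
 exact: measurable_swap.
 rewrite /= -(@fubini_tonelli _ _ _ _ _ m m (fun zw => `|F zw|%:E)) //.
 by apply/mEFin; exact: mcomp.
have key (G : T * T -> R) : (m \x m)%E.-integrable setT (EFin \o G) ->
 ae_eq m setT (EFin \o (fun z => \int[m]_w G (z, w))) (fubini_F m (EFin \o G)).
 move=> iG; have := ae_integrable1 iG.
 apply: filterS=> z iGz _; rewrite /= /fubini_F /Rintegral fineK //.
 exact: integrable_fin_num.
have mkey (G : T * T -> R) : (m \x m)%E.-integrable setT (EFin \o G) ->
 mfun (fun z => \int[m]_w G (z, w)).
 move=> iG; rewrite /Rintegral.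
 have /integrableP[h _] := integrable_fubini_F iG.
 exact: (mcomp (@fine_measurable R setT measurableT) h).
have ikey (G : T * T -> R) : (m \x m)%E.-integrable setT (EFin \o G) ->
 m.-integrable setT (EFin \o (fun z => \int[m]_w G (z, w))).
 move=> iG; have /integrableP[m1 i1] := integrable_fubini_F iG.
 apply/integrableP; split; first exact/mEFin/mkey.
 rewrite (ae_eq_integral (fun z => `|fubini_F m (EFin \o G) z|%E)) //.
 - by apply: mcomp=> //; exact/mEFin/mkey.
 - exact: mcomp.
 - by apply: filterS (key _ iG)=> z /(_ I) ->.
have Ikey (G : T * T -> R) : (m \x m)%E.-integrable setT (EFin \o G) ->
 (\int[m]_z (\int[m]_w G (z, w))%:E = \int[m]_z \int[m]_w (G (z, w))%:E)%E.
 move=> iG; apply: ae_eq_integral=> //; first exact/mEFin/mkey.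
 by have /integrableP[] := integrable_fubini_F iG.
 exact: key.
split; first exact: ikey.
rewrite /Rintegral; congr fine.
rewrite (Ikey _ iF) (Ikey _ iF'); exact: (Fubini iF).
Qed.
Lemma fubini_tonelli_le (G H : T * T -> R) : mfun G ->
 mfun H -> (forall zw, 0 <= G zw <= H zw) ->
 (\int[m]_z \int[m]_w (G (z, w))%:E <= \int[m]_z \int[m]_w (H (z, w))%:E)%E.
Proof.
move=> mG mH le; apply: ge0_le_integral=> //.
- by move=> z _; apply: integral_ge0=> w _; rewrite lee_fin; case/andP: (le (z, w)).
- apply: (@measurable_fun_fubini_tonelli_F _ _ _ _ _ m (EFin \o G))=> [|x].
 exact/mEFin.
 by rewrite lee_fin; case/andP: (le x).
- apply: (@measurable_fun_fubini_tonelli_F _ _ _ _ _ m (EFin \o H))=> [|x].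
 exact/mEFin.
 by rewrite lee_fin; case/andP: (le x)=> ? /(le_trans _); apply.
- move=> z _; apply: ge0_le_integral=> //.
 + by move=> w _; rewrite lee_fin; case/andP: (le (z, w)).
 + by apply/mEFin; exact: (measurable_fun_pair2 z mG).
 + by apply/mEFin; exact: (measurable_fun_pair2 z mH).
 + by move=> w _; rewrite lee_fin; case/andP: (le (z, w)).
Qed.

End generic_Fubini.

Section Fubini.

Lemma tonelli (f : plane * plane -> R) : mfun f ->
 (forall zw, 0 <= f zw) ->
 (\int[mu]_z \int[mu]_w (f (z, w))%:E = \int[mu]_w \int[mu]_z (f (z, w))%:E)%E.
Proof.
move=> mf f0; apply: (@fubini_tonelli _ _ _ _ _ lam2 lam2 (EFin \o f)).
 exact/mEFin.
by move=> x; rewrite lee_fin.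
Qed.
Lemma meas_tonelli (f : plane * plane -> R) : mfun f ->
 (forall zw, 0 <= f zw) ->
 mfun (fun z => \int[mu]_w (f (z, w))%:E)%E.
Proof.
move=> mf f0; apply: (@measurable_fun_fubini_tonelli_F _ _ _ _ _ lam2 (EFin \o f)).
 exact/mEFin.
by move=> x; rewrite lee_fin.
Qed.
Lemma cint_Fubini (F : plane * plane -> C) : cmfun F ->
 (\int[mu]_z \int[mu]_w (normc (F (z, w)))%:E < +oo)%E ->
 cintg (fun z => cI (fun w => F (z, w))) /\
 cI (fun z => cI (fun w => F (z, w))) = cI (fun w => cI (fun z => F (z, w))).
Proof.
move=> mF IF; have mn := meas_normc mF; case: mF=> m1 m2.
have mS : mfun (fun zw : plane * plane => (zw.2, zw.1)) by exact: measurable_swap.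
have IF' : (\int[mu]_w \int[mu]_z (normc (F (z, w)))%:E < +oo)%E.
 by rewrite -(tonelli (f := fun zw => normc (F zw))) // => zw; exact: normc_ge0.
have aux (G : plane * plane -> R) : mfun G ->
 (forall zw, `|G zw| <= normc (F zw)) ->
 (\int[mu]_z \int[mu]_w `|G (z, w)|%:E < +oo)%E /\
 (\int[mu]_w \int[mu]_z `|G (z, w)|%:E < +oo)%E.
 move=> mG le; have mG' : mfun (fun zw => `|G zw|) by exact: mcomp.
 split.
 apply: le_lt_trans IF; apply: (fubini_tonelli_le lam2 mG' mn)=> zw.
 by rewrite normr_ge0 le.
 apply: le_lt_trans IF'.
 apply: (fubini_tonelli_le lam2 (mcomp mG' mS) (mcomp mn mS))=> zw /=.
 by rewrite normr_ge0 le.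
have [a1 b1] := aux _ m1 (fun zw => normc_Re _).
have [a2 b2] := aux _ m2 (fun zw => normc_Im _).
have [i1 e1] := @Rintegral_Fubini_gen _ _ lam2 _ m1 a1.
have [i2 e2] := @Rintegral_Fubini_gen _ _ lam2 _ m2 a2.
have [j1 _] := @Rintegral_Fubini_gen _ _ lam2 _ (mcomp m1 mS) b1.
have [j2 _] := @Rintegral_Fubini_gen _ _ lam2 _ (mcomp m2 mS) b2.
split.
 split; [exact: (integrableZl measurableT pi^-1 i1)|exact: (integrableZl measurableT pi^-1 i2)].
have split_cint (G : plane * plane -> C) : cI (fun z => cI (fun w => G (z, w))) =
 Complex (pi^-1 * \int[mu]_z (pi^-1 * \int[mu]_w Re (G (z, w))))
 (pi^-1 * \int[mu]_z (pi^-1 * \int[mu]_w Im (G (z, w)))) by [].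
rewrite split_cint (split_cint (fun zw => F (zw.2, zw.1))).
rewrite (RintegralZl _ measurableT i1) (RintegralZl _ measurableT i2).
by rewrite (RintegralZl _ measurableT j1) (RintegralZl _ measurableT j2) e1 e2.
Qed.

End Fubini.

(** * L^p norms: inequalities, limit theorems, completeness *)

Section Lp.
Implicit Types f g : plane -> C.
Local Open Scope ereal_scope.

Lemma limn_einf_ge (u : nat -> \bar R) c N :
 (forall n, (N <= n)%N -> c <= u n) -> c <= limn_einf u.
Proof.
move=> cu; rewrite limn_einf_lim.
have ndu := nondecreasing_einfs u.
rewrite (cvg_lim _ (ereal_nondecreasing_cvgn ndu)) //.
apply: (le_via (einfs u N)); last by apply: ereal_sup_ubound; exists N.
by apply: le_ereal_inf_tmp=> _ [m /= Nm <-]; exact: cu.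
Qed.
Lemma limn_einf_le (u : nat -> \bar R) c N :
 (forall n, (N <= n)%N -> u n <= c) -> limn_einf u <= c.
Proof.
move=> cu; rewrite limn_einf_lim.
have ndu := nondecreasing_einfs u.
rewrite (cvg_lim _ (ereal_nondecreasing_cvgn ndu)) //.
apply: ub_ereal_sup=> _ [m _ <-].
apply: (le_via (u (maxn m N))); last by apply: cu; exact: leq_maxr.
by apply: ereal_inf_lbound; exists (maxn m N)=> //=; exact: leq_maxl.
Qed.
(** The integral of a nonnegative function is the supremum over the simple functions below it,
    whatever its measurability. *)
Lemma le_integral_lower (f g : plane -> \bar R) : (forall z, 0 <= f z) ->
 (forall z, f z <= g z) -> \int[mu]_z f z <= \int[mu]_z g z.
Proof.
move=> f0 fg; rewrite !ge0_integralTE //; last by move=> z; exact: le_trans (fg z).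
apply: le_ereal_sup=> _ [h /= hf <-]; exists h=> //= z.
exact: le_trans (hf z) (fg z).
Qed.
Definition powint (p : R) f : \bar R := aint (fun z => (normc (f z) `^ p)%:E).

Lemma area_int_ge0 D (F : plane -> \bar R) : (forall z, D z -> 0 <= F z) ->
 0 <= area_int D F.
Proof.
by move=> F0; apply: mule_ge0; [rewrite lee_fin invr_ge0 pi_ge0|exact: integral_ge0].
Qed.
Lemma le_area_int (F G : plane -> \bar R) : (forall z, 0 <= F z) ->
 (forall z, F z <= G z) -> aint F <= aint G.
Proof.
move=> F0 FG; apply: lee_wpmul2l; first by rewrite lee_fin invr_ge0 pi_ge0.
exact: le_integral_lower.
Qed.
Lemma powint_ge0 p f : 0 <= powint p f.
Proof. by apply: area_int_ge0=> z _; rewrite lee_fin powR_ge0. Qed.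
Lemma norm_LpCE p f : nLp p f = powint p f `^ p^-1.
Proof. by []. Qed.
Lemma norm_LpC_ge0 p f : 0 <= nLp p f.
Proof. exact: poweR_ge0. Qed.
Lemma ler_powR_nneg (p x y : R) : (0 <= p)%R -> (0 <= x)%R -> (x <= y)%R ->
 (x `^ p <= y `^ p)%R.
Proof.
move=> p0 x0 xy; apply: ge0_ler_powR=> //; rewrite nnegrE //.
exact: le_trans xy.
Qed.
Lemma le_poweR (p : R) (x y : \bar R) : (0 <= p)%R -> 0 <= x -> x <= y -> x `^ p <= y `^ p.
Proof.
move=> p0 x0 xy; apply: gt0_ler_poweR=> //; rewrite in_itv /= ?x0 leey //.
by rewrite (le_trans x0 xy).
Qed.
Lemma poweRVK (p : R) (x : \bar R) : (0 < p)%R -> 0 <= x -> (x `^ p^-1) `^ p = x.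
Proof. by move=> p0 x0; rewrite -poweRrM mulVf ?gt_eqF // poweRe1. Qed.
Lemma poweRKV (p : R) (x : \bar R) : (0 < p)%R -> 0 <= x -> (x `^ p) `^ p^-1 = x.
Proof. by move=> p0 x0; rewrite -poweRrM mulfV ?gt_eqF // poweRe1. Qed.
Lemma powint_norm p f : (0 < p)%R -> powint p f = nLp p f `^ p.
Proof. by move=> p0; rewrite norm_LpCE poweRVK // powint_ge0. Qed.
Lemma powint_le (p : R) f (c : R) : (0 < p)%R -> nLp p f <= c%:E ->
 powint p f <= (c `^ p)%:E.
Proof.
move=> p0 fc; rewrite powint_norm // -poweR_EFin.
by apply: le_poweR=> //; [exact: ltW|exact: norm_LpC_ge0].
Qed.
Lemma norm_LpC_le (p : R) f (c : \bar R) : (0 < p)%R -> 0 <= c ->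
 powint p f <= c `^ p -> nLp p f <= c.
Proof.
move=> p0 c0 fc; rewrite norm_LpCE -(poweRKV p0 c0).
by apply: le_poweR; [rewrite invr_ge0 ltW|exact: powint_ge0|].
Qed.
Lemma norm_LpC_mono p f g : (0 < p)%R -> (forall z, normc (f z) <= normc (g z))%R ->
 nLp p f <= nLp p g.
Proof.
move=> p0 fg; rewrite !norm_LpCE.
apply: le_poweR; [by rewrite invr_ge0 ltW|exact: powint_ge0|].
apply: le_area_int=> z; rewrite lee_fin ?powR_ge0 //.
by apply: ler_powR_nneg; rewrite ?normc_ge0 // ltW.
Qed.
Lemma eq_norm_LpC p f g : (forall z, normc (f z) = normc (g z)) ->
 nLp p f = nLp p g.
Proof.
move=> fg; rewrite !norm_LpCE /powint.
by rewrite (_ : (fun z => (normc (f z) `^ p)%:E) = (fun z => (normc (g z) `^ p)%:E)) //;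
 apply/funext=> z; rewrite fg.
Qed.
Lemma meas_powR p f : cmfun f ->
 mfun (fun z => normc (f z) `^ p)%R.
Proof.
move=> mf; apply: (@mcomp _ _ _ _ _ _ (@powR R ^~ p))=> //.
exact: meas_normc.
Qed.
Lemma meas_powE p f : cmfun f -> mfun (fun z => (normc (f z) `^ p)%:E).
Proof. by move=> mf; apply/mEFin; exact: meas_powR. Qed.
Lemma norm_LpC0 p : (0 < p)%R -> nLp p (fun _ : plane => 0%R) = 0.
Proof.
move=> p0; rewrite norm_LpCE /powint !area_intE.
under eq_integral do rewrite normc0 powR0 ?gt_eqF //.
by rewrite integral0 mule0 poweR0r // invr_eq0 gt_eqF.
Qed.
Lemma norm_LpCZ (p : R) (c : C) f : (0 < p)%R -> cmfun f ->
 nLp p (fun z => c * f z)%R = (normc c)%:E * nLp p f.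
Proof.
move=> p0 mf; rewrite !norm_LpCE.
have -> : powint p (fun z => c * f z)%R = (normc c `^ p)%:E * powint p f.
 rewrite /powint !area_intE muleCA; congr (_ * _).
 have -> : \int[mu]_z (normc (c * f z)%R `^ p)%:E =
 \int[mu]_z ((normc c `^ p)%:E * (normc (f z) `^ p)%:E).
 by apply: eq_integral=> z _; rewrite -EFinM normcM powRM ?normc_ge0.
 rewrite ge0_integralZl //.
 - by exact: meas_powE.
 - by move=> z _; rewrite lee_fin powR_ge0.
 - by rewrite lee_fin powR_ge0.
rewrite poweRM ?powint_ge0 ?lee_fin ?powR_ge0 //; congr (_ * _).
by rewrite -[RHS](poweRKV p0) ?lee_fin ?normc_ge0 // !poweR_EFin.
Qed.
Lemma norm_LpC_Lnorm p f : (0 < p)%R ->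
 nLp p f = (pi^-1 `^ p^-1)%:E * 'N[mu]_(p%:E)[EFin \o (fun z => normc (f z))].
Proof.
move=> p0; rewrite norm_LpCE /powint !area_intE poweRM.
- rewrite poweR_EFin unlock /=.
 by under [in RHS]eq_integral do rewrite /= ger0_norm ?normc_ge0 //.
- by rewrite lee_fin invr_ge0 pi_ge0.
- by apply: integral_ge0=> z _; rewrite lee_fin powR_ge0.
Qed.
Lemma norm_LpCD (p : R) f g : (1 <= p)%R -> cmfun f -> cmfun g ->
 nLp p (fun z => f z + g z)%R <= nLp p f + nLp p g.
Proof.
move=> p1 mf mg; have p0 : (0 < p)%R by exact: lt_le_trans p1.
pose h z : C := ((normc (f z) + normc (g z))%:C)%C.
apply: (le_via (nLp p h)).
 apply: norm_LpC_mono=> // z; rewrite normc_ger0 ?addr_ge0 ?normc_ge0 //.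
 exact: normcD.
rewrite !norm_LpC_Lnorm // -ge0_muleDr ?Lnorm_ge0 //.
apply: lee_wpmul2l; first by rewrite lee_fin powR_ge0.
have := minkowski_EFin mu (meas_normc mf) (meas_normc mg) p1.
apply: le_trans; rewrite le_eqVlt; apply/orP; left; apply/eqP.
apply: eq_Lnorm=> z /=; rewrite expr0n /= addr0 sqrtr_sqr ger0_norm //.
by rewrite addr_ge0 // normc_ge0.
Qed.
Lemma norm_LpCB (p : R) f g : (1 <= p)%R -> cmfun f -> cmfun g ->
 nLp p (fun z => f z - g z)%R <= nLp p f + nLp p g.
Proof.
move=> p1 mf mg; apply: le_trans (norm_LpCD p1 mf (cmfunN mg)) _.
by rewrite (@eq_norm_LpC _ (fun z => - g z)%R g) // => z; rewrite normcNE.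
Qed.
(** Fatou's lemma in a one-sided form: |f| need only be at most the lower limit of |u n|. This form
    also applies to [beurling], whose defining limit might not exist at some points. *)
Lemma norm_LpC_Fatou (p : R) f (u : nat -> plane -> C) (c : \bar R) N : (0 < p)%R ->
 (forall n, cmfun (u n)) ->
 (forall z e, (0 < e)%R -> evt n, (normc (f z) <= normc (u n z) + e)%R) ->
 (forall n, (N <= n)%N -> nLp p (u n) <= c) ->
 nLp p f <= c.
Proof.
move=> p0 mm fu uc.
have c0 : 0 <= c by apply: le_trans (norm_LpC_ge0 p (u N)) (uc _ (leqnn N)).
apply: norm_LpC_le=> //.
pose v n z := (normc (u n z) `^ p)%:E.
have mv n : mfun (v n).
 by exact: meas_powE.
have v0 n z : 0 <= v n z by rewrite lee_fin powR_ge0.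
apply: (le_via (aint (fun z => limn_einf (v ^~ z)))).
 apply: le_area_int=> z; first by rewrite lee_fin powR_ge0.
 have [->|f0] := eqVneq (normc (f z)) 0%R.
 by rewrite powR0 ?gt_eqF //; apply: (limn_einf_ge (N := 0))=> n _.
 have {}f0 : (0 < normc (f z))%R by rewrite lt_def f0 normc_ge0.
 have cp : {for normc (f z), continuous (@powR R ^~ p)}.
 by apply/differentiable_continuous/derivable1_diffP/derivable_powR; rewrite in_itv /= f0.
 apply/lee_addgt0Pr=> e e0.
 move/cvgrPdist_lt: cp=> /(_ _ e0) [d /= d0 cp].
 (* A positive number below |f z| and so close to it that s^p is within e of |f z|^p; eventually |u
    n z| >= s. *)
 pose s := Num.max (normc (f z) - d / 2)%R (normc (f z) / 2)%R.
 have sf : (s < normc (f z))%R by rewrite gt_max; apply/andP; split; lra.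
 have s0 : (0 < s)%R by rewrite lt_max; apply/orP; right; lra.
 have fse : (normc (f z) `^ p - s `^ p < e)%R.
 apply: le_lt_trans (ler_norm _) _; apply: cp; rewrite /ball_ /= ger0_norm ?subr_ge0 ?(ltW sf) //.
 have : (normc (f z) - d / 2 <= s)%R by rewrite le_max lexx.
 lra.
 have sf0 : (0 < normc (f z) - s)%R by rewrite subr_gt0.
 have [M HM] := fu z _ sf0.
 apply: (le_via ((s `^ p)%:E + e%:E)); first by rewrite -EFinD lee_fin; lra.
 rewrite leeD2r //; apply: (limn_einf_ge (N := M))=> n Mn.
 rewrite lee_fin; apply: ler_powR_nneg; [exact: ltW|exact: ltW|].
 by have := HM n Mn; lra.
rewrite !area_intE.
apply: (le_via (pi^-1%:E * limn_einf (fun n => \int[mu]_z v n z))).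
 by apply: lee_wpmul2l; [rewrite lee_fin invr_ge0 pi_ge0|exact: fatou].
have pi0 : (0 < pi^-1 :> R)%R by rewrite invr_gt0 pi_gt0.
rewrite -lee_pdivlMl ?invr_gt0 ?pi_gt0 //.
apply: (limn_einf_le (N := N))=> n Nn.
rewrite lee_pdivlMl //.
apply: (le_via (powint p (u n))); first by rewrite /powint area_intE.
rewrite powint_norm //; by apply: le_poweR; rewrite ?norm_LpC_ge0 ?(ltW p0) //; exact: uc.
Qed.
Lemma ae_norm_LpC (p : R) f g : cmfun f -> cmfun g ->
 {ae mu, forall z, f z = g z} -> nLp p f = nLp p g.
Proof.
move=> mf mg fg; rewrite !norm_LpCE /powint !area_intE.
have -> // : \int[mu]_z (normc (f z) `^ p)%:E = \int[mu]_z (normc (g z) `^ p)%:E.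
apply: ae_eq_integral=> //.
- by exact: meas_powE.
- by exact: meas_powE.
- by case: fg=> [A [mA A0 sA]]; exists A; split=> // z /= h; apply: sA=> /= fg; apply: h=> _; rewrite fg.
Qed.
Lemma cvg_powR_0 (p : R) (v : nat -> R) : (0 < p)%R -> (forall n, 0 <= v n)%R ->
 v @ \oo --> (0 : R)%R -> (fun n => v n `^ p)%R @ \oo --> (0 : R)%R.
Proof.
move=> p0 v0 /cvgrPdist_lt cv; apply/cvgrPdist_lt=> e e0.
have e'0 : (0 < e `^ p^-1)%R by rewrite powR_gt0.
move: (cv _ e'0); apply: filterS=> n.
rewrite !sub0r !normrN ger0_norm ?v0 // ger0_norm ?powR_ge0 // => ve.
rewrite (_ : e = (e `^ p^-1) `^ p)%R; last by rewrite -powRrM mulVf ?gt_eqF // powRr1 // ltW.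
by apply: gt0_ltr_powR; rewrite // nnegrE ?v0 // powR_ge0.
Qed.
Lemma cvge0_le (v : nat -> \bar R) e : v @ \oo --> 0 -> (0 < e)%R ->
 evt n, v n <= e%:E.
Proof.
move=> cv e0.
have : nbhs (0 : \bar R) [set y | y < e%:E].
 by apply: open_nbhs_nbhs; split; [exact: open_ereal_lt_ereal|rewrite /= lte_fin].
by move=> /cv[N _ HN]; exists N=> n Nn; apply: ltW; exact: HN.
Qed.
Lemma norm_LpC_dominated (p : R) (u : nat -> plane -> C) (g : plane -> R) :
 (0 < p)%R -> (forall n, cmfun (u n)) -> mfun g ->
 (forall n z, (normc (u n z) <= g z)%R) ->
 nLp p (fun z => (g z)%:C)%C < +oo ->
 (forall z, (fun n => normc (u n z)) @ \oo --> (0 : R)%R) ->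
 forall e, (0 < e)%R -> evt n, nLp p (u n) <= e%:E.
Proof.
move=> p0 mm mg ug gp u0 e e0.
have g0 z : (0 <= g z)%R by apply: le_trans (ug 0%N z); exact: normc_ge0.
have pi0 : (0 < pi^-1 :> R)%R by rewrite invr_gt0 pi_gt0.
have ig : mu.-integrable setT (fun z => (g z `^ p)%:E).
 apply/integrableP; split.
 by apply/mEFin; exact: (@mcomp _ _ _ _ _ _ (@powR R ^~ p)).
 move: gp; rewrite norm_LpCE=> /(lty_poweRy (r := p^-1)).
 rewrite invr_eq0 gt_eqF // => /(_ isT); rewrite /powint area_intE.
 under [X in _ * X]eq_integral do rewrite normc_real.
 under [X in _ -> X < _]eq_integral do rewrite gee0_abs ?lee_fin ?powR_ge0 // -[g _]ger0_norm ?g0 //.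
 by rewrite -lte_pdivlMl // gt0_muley // lte_fin invr_gt0.
have mun n : mfun (fun z => (normc (u n z) `^ p)%:E).
 by exact: meas_powE.
have cv0 z : (fun n => (normc (u n z) `^ p)%:E) @ \oo --> 0.
 apply: cvg_EFin; first by near=> n.
 by apply: cvg_powR_0=> // n; exact: normc_ge0.
have dom n z : `|(normc (u n z) `^ p)%:E| <= (g z `^ p)%:E.
 rewrite gee0_abs ?lee_fin ?powR_ge0 //; apply: ler_powR_nneg; rewrite ?normc_ge0 //.
 exact: ltW.
have [_ _ ] := @dominated_convergence _ _ _ mu setT measurableT
 (fun n z => (normc (u n z) `^ p)%:E) (fun=> 0) (fun z => (g z `^ p)%:E)
 mun (mcst _) (aeW mu (fun z _ => cv0 z)) ig (aeW mu (fun z n _ => dom n z)).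
rewrite integral0=> cv.
have pe0 : (0 < pi * e `^ p)%R by rewrite mulr_gt0 ?pi_gt0 ?powR_gt0.
have [N HN] := cvge0_le cv pe0.
exists N=> n Nn; apply: norm_LpC_le=> //; first by rewrite lee_fin ltW.
rewrite /powint area_intE poweR_EFin lee_pdivrMl ?pi_gt0 // -EFinM; exact: HN.
Unshelve. all: by end_near. Qed.
Lemma hoelder_area (p q : R) f g : (0 < p)%R -> (0 < q)%R -> (p^-1 + q^-1 = 1)%R ->
 cmfun f -> cmfun g ->
 aint (fun z => (normc (f z) * normc (g z))%:E) <= nLp p f * nLp q g.
Proof.
move=> p0 q0 pq mf mg; rewrite !norm_LpC_Lnorm // muleACA -EFinM -powRD ?pq ?oner_eq0 //.
rewrite powRr1 ?invr_ge0 ?pi_ge0 // !area_intE; apply: lee_wpmul2l.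
 by rewrite lee_fin invr_ge0 pi_ge0.
have := hoelder mu (meas_normc mf) (meas_normc mg) p0 q0 pq.
apply: le_trans; rewrite Lnorm1; rewrite le_eqVlt; apply/orP; left; apply/eqP.
by apply: eq_integral=> z _ /=; rewrite ger0_norm // mulr_ge0 // normc_ge0.
Qed.
Lemma cintg_area f : cmfun f -> aint (fun z => (normc (f z))%:E) < +oo ->
 cintg f.
Proof.
move=> mf; rewrite !area_intE=> h; apply/cintgP; split=> //.
have pi0 : (0 < pi^-1 :> R)%R by rewrite invr_gt0 pi_gt0.
rewrite ltNge leye_eq; apply/negP=> /eqP E; move: h.
by rewrite [X in _ * X]E gt0_muley ?ltxx // lte_fin.
Qed.
Lemma normc_cint_area f : cmfun f ->
 (normc (cI f))%:E <= aint (fun z => (normc (f z))%:E).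
Proof.
move=> mf; have [h|] := ltP (aint (fun z => (normc (f z))%:E)) +oo; last first.
 by rewrite leye_eq=> /eqP ->; rewrite leey.
have If := cintg_area mf h.
apply: (le_via (pi^-1 * \int[mu]_z normc (f z))%:E).
 by rewrite lee_fin; exact: normc_cint_le.
rewrite EFinM !area_intE; apply: lee_wpmul2l; first by rewrite lee_fin invr_ge0 pi_ge0.
rewrite /Rintegral fineK //.
exact: (integrable_fin_num measurableT (rintg_normc If)).
Qed.
Lemma hoelder_cint (p q : R) f g : (0 < p)%R -> (0 < q)%R -> (p^-1 + q^-1 = 1)%R ->
 cmfun f -> cmfun g ->
 (normc (cI (fun z => f z * g z)%R))%:E <= nLp p f * nLp q g.
Proof.
move=> p0 q0 pq mf mg; apply: le_trans (normc_cint_area (cmfunM mf mg)) _.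
under [X in area_int _ X]eq_fun do rewrite normcM.
exact: hoelder_area.
Qed.
Lemma hoelder_cintg (p q : R) f g : (0 < p)%R -> (0 < q)%R -> (p^-1 + q^-1 = 1)%R ->
 cmfun f -> cmfun g -> nLp p f < +oo -> nLp q g < +oo ->
 cintg (fun z => f z * g z)%R.
Proof.
move=> p0 q0 pq mf mg fp gq; apply: cintg_area; first exact: cmfunM.
under [X in area_int _ X]eq_fun do rewrite normcM.
apply: le_lt_trans (hoelder_area p0 q0 pq mf mg) _.
by rewrite lte_mul_pinfty ?norm_LpC_ge0 // ge0_fin_numE ?norm_LpC_ge0.
Qed.
Lemma cmfun_if (A : set plane) f : measurable A -> cmfun f ->
 cmfun (fun z => if z \in A then f z else 0%R).
Proof.
move=> mA mf.
rewrite (_ : (fun _ => _) = (fun z => ((\1_A z : R)%:C * f z)%R)).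
 by apply: cmfunM=> //; apply: cmfun_real; exact: measurable_indic.
by apply/funext=> z; rewrite indicE; case: ifP; rewrite ?mul1r ?mul0r.
Qed.
Lemma meas_upper : measurable (@upper R).
Proof.
rewrite (_ : upper = setT `*` `]0%R, +oo[%classic); last first.
 by apply/seteqP; split=> z /=; rewrite /upper /= in_itv /= andbT=> // -[].
by apply: measurableX=> //; exact: measurable_itv.
Qed.
Lemma in_upper (z : plane) : (z \in @upper R) = (0 < z.2)%R.
Proof. by apply/idP/idP; rewrite inE. Qed.
Lemma cmeasurable_upper f : cmeasurable upper f <->
 cmfun (fun z : plane => if (0 < z.2)%R then f z else 0%R).
Proof.
have E (h : C -> R) : h 0%R = 0%R ->
 (fun z => h (if (0 < z.2)%R then f z else 0%R)) = (h \o f) \_ (@upper R).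
 by move=> h0; apply/funext=> z; rewrite /patch in_upper; case: ifP.
rewrite /cmeasurable /cmfun (E (@Re R)) // (E (@Im R)) //.
by split=> -[m1 m2]; split; apply/(measurable_restrictT _ meas_upper).
Qed.
(** The weight (Im z)^(-p) is the p-th power of 1 / Im z, so it can be absorbed into the
    function. *)
Lemma norm_LpHE (p : R) f : (0 < p)%R ->
 norm_LpH p f = nLp p (fun z => if (0 < z.2)%R then (z.2^-1)%:C * f z else 0%R)%R.
Proof.
move=> p0; rewrite /norm_LpH norm_LpCE /powint !area_intE integral_mkcond.
have -> // : (fun z : plane => (normc (f z) `^ p * z.2 `^ - p)%:E) \_ (@upper R) =
 (fun z => (normc (if (0 < z.2)%R then (z.2^-1)%:C * f z else 0%R)%R `^ p)%:E).
apply/funext=> z; rewrite /patch in_upper; case: ifP=> z0; last first.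
 by rewrite normc0 powR0 ?gt_eqF.
rewrite normcM normc_ger0 ?invr_ge0 ?(ltW z0) //.
rewrite powRM ?invr_ge0 ?normc_ge0 ?(ltW z0) // mulrC.
by rewrite -[in RHS]powR_inv1 ?(ltW z0) // -powRrM mulN1r.
Qed.
Lemma exists_fast_subseq (P : nat -> nat -> R -> Prop) :
 (forall e, (0 < e)%R -> exists N, forall n m, (N <= n)%N -> (N <= m)%N -> P n m e) ->
 exists psi : nat -> nat, forall k n m, (psi k <= n)%N -> (psi k <= m)%N ->
 P n m (2^-1 ^+ k)%R /\ (psi k <= psi k.+1)%N.
Proof.
move=> cau.
have c k : exists N, forall n m, (N <= n)%N -> (N <= m)%N -> P n m (2^-1 ^+ k)%R.
 by apply: cau; rewrite exprn_gt0 // invr_gt0.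
have [phi Hphi] := choice c.
(* Summing the chosen thresholds makes the sequence of indices nondecreasing. *)
exists (fun k => \sum_(i < k.+1) phi i)%N=> k n m kn km; split.
 by apply: Hphi; apply: leq_trans; try eassumption; rewrite big_ord_recr /= leq_addl.
by rewrite [X in (_ <= X)%N]big_ord_recr /= leq_addr.
Qed.
Lemma norm_LpC_sum (p : R) (d : nat -> plane -> C) (c : nat -> R) n : (1 <= p)%R ->
 (forall k, cmfun (d k)) -> (forall k, nLp p (d k) <= (c k)%:E) ->
 cmfun (fun z => \sum_(k < n) (normc (d k z))%:C)%R /\
 nLp p (fun z => \sum_(k < n) (normc (d k z))%:C)%R <= (\sum_(k < n) c k)%:E.
Proof.
move=> p1 md dc; have p0 : (0 < p)%R by exact: lt_le_trans p1.
elim: n=> [|n [ih1 ih2]].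
 rewrite (_ : (fun _ => _) = (fun=> 0%R)); last by apply/funext=> z; rewrite big_ord0.
 by rewrite norm_LpC0 // big_ord0; split=> //; exact: cmfun_cst.
have E : (fun z => \sum_(k < n.+1) (normc (d k z))%:C)%R =
 (fun z => (\sum_(k < n) (normc (d k z))%:C) + (normc (d n z))%:C)%R.
 by apply/funext=> z; rewrite big_ord_recr.
have md' : cmfun (fun z => (normc (d n z))%:C).
 by apply: cmfun_real; exact: meas_normc.
rewrite E; split; first exact: cmfunD.
apply: le_trans (norm_LpCD p1 ih1 md') _.
rewrite big_ord_recr EFinD; apply: leeD=> //.
apply: le_trans (dc n); rewrite (@eq_norm_LpC _ _ (d n)) // => z.
by rewrite normc_ger0 ?normc_ge0.
Qed.
Lemma sum_half_le2 n : (\sum_(k < n) (2^-1 : R) ^+ k <= 2)%R.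
Proof.
have -> : (\sum_(k < n) (2^-1 : R) ^+ k = 2 - 2 * 2^-1 ^+ n)%R.
 elim: n=> [|n ih]; first by rewrite big_ord0 expr0 mulr1 subrr.
 rewrite big_ord_recr /= ih exprS; lra.
by rewrite gerBl mulr_ge0 // exprn_ge0 // invr_ge0.
Qed.

(** Riesz-Fischer: along a fast subsequence the sum of the successive distances has a finite p-th
    power integral, so the subsequence converges wherever that sum is finite. Fatou's lemma then
    bounds the distance from u n to the limit. *)
Theorem norm_LpC_complete (p : R) (u : nat -> plane -> C) : (1 <= p)%R ->
 (forall n, cmfun (u n)) ->
 (forall e, (0 < e)%R -> exists N, forall n m, (N <= n)%N -> (N <= m)%N ->
 nLp p (fun z => u n z - u m z)%R <= e%:E) ->
 exists k, cmfun k /\ forall e, (0 < e)%R -> evt n, nLp p (fun z => u n z - k z)%R <= e%:E.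
Proof.
move=> p1 mm cau; have p0 : (0 < p)%R by exact: lt_le_trans p1.
have [psi Hpsi] := exists_fast_subseq cau.
pose d k z := (u (psi k.+1) z - u (psi k) z)%R.
have md k : cmfun (d k) by exact: cmfunB.
have dn k : nLp p (d k) <= ((2^-1 : R) ^+ k)%:E.
 have [_ le] := Hpsi k _ _ (leqnn _) (leqnn _).
 by have [] := Hpsi k _ _ le (leqnn _).
pose T n z := (\sum_(k < n) normc (d k z))%R.
have TE n z : (\sum_(k < n) (normc (d k z))%:C)%R = (T n z)%:C.
 by rewrite /T rmorph_sum.
have T0 n z : (0 <= T n z)%R by apply: sumr_ge0=> k _; exact: normc_ge0.
have ndT z m n : (m <= n)%N -> (T m z <= T n z)%R.
 move=> mn; rewrite /T -!(big_mkord xpredT (fun k => normc (d k z))).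
 by rewrite [leRHS](big_cat_nat (n := m)) //= lerDl; apply: sumr_ge0=> k _; exact: normc_ge0.
have mT n : mfun (T n).
 have [[m1 _] _] := norm_LpC_sum n p1 md dn.
 by apply: eq_measurable_fun m1=> z _; rewrite TE.
have IT n : \int[mu]_z (T n z `^ p)%:E <= (pi * 2 `^ p)%:E.
 have [_] := norm_LpC_sum n p1 md dn.
 rewrite (_ : (fun _ => _) = (fun z => (T n z)%:C)); last by apply/funext=> z; exact: TE.
 move=> h; have {}h : nLp p (fun z => (T n z)%:C) <= 2%:E.
 by apply: le_trans h _; rewrite lee_fin sum_half_le2.
 have := powint_le p0 h; rewrite /powint area_intE.
 under eq_integral do rewrite normc_ger0 ?T0 //.
 by move=> h'; rewrite EFinM -lee_pdivrMl ?pi_gt0.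
have mTp n : mfun (fun z => (T n z `^ p)%:E).
 by apply/mEFin; exact: (@mcomp _ _ _ _ _ _ (@powR R ^~ p)).
pose G z := limn_einf (fun n => (T n z `^ p)%:E).
have mG : mfun G.
 apply: (emeasurable_fun_cvg (fun n z => einfs (fun n => (T n z `^ p)%:E) n))=> [n|z _].
 exact: (measurable_fun_einfs mTp).
 by rewrite /G limn_einf_lim; exact/ereal_nondecreasing_is_cvgn/nondecreasing_einfs.
have G0 z : 0 <= G z by apply: (limn_einf_ge (N := 0))=> n _; rewrite lee_fin powR_ge0.
have TG n z : (T n z `^ p)%:E <= G z.
 apply: (limn_einf_ge (N := n))=> m nm; rewrite lee_fin.
 by apply: ler_powR_nneg=> //; [exact: ltW|exact: ndT].
have iG : mu.-integrable setT G.
 apply/integrableP; split=> //.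
 under eq_integral do rewrite gee0_abs //.
 apply: (@le_lt_trans _ _ (pi * 2 `^ p)%:E); last exact: ltry.
 have Tp0 n z : setT z -> 0 <= (T n z `^ p)%:E by rewrite lee_fin powR_ge0.
 have F := @fatou _ _ _ mu _ measurableT _ mTp Tp0; apply: le_trans F _.
 by apply: (limn_einf_le (N := 0))=> n _; exact: IT.
pose A := [set z | G z < +oo].
have mA : measurable A.
 by rewrite -[A]setTI; exact: (emeasurable_fun_infty_o measurableT mG).
(* Set to 0 off A, the subsequence converges at every point, which makes the limit measurable; the
   complement of A is null. *)
pose u' j z := if z \in A then u (psi j) z else 0%R.
have mu' j : cmfun (u' j) by apply: cmfun_if.
have ubT z : A z -> exists M, forall n, (T n z <= M)%R.
 move=> Az; exists ((fine (G z)) `^ p^-1)%R=> n.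
 have fG : G z \is a fin_num by rewrite ge0_fin_numE.
 have h := TG n z; rewrite -(fineK fG) lee_fin in h.
 have -> : T n z = ((T n z `^ p) `^ p^-1)%R by rewrite -powRrM mulfV ?gt_eqF // powRr1.
 by apply: ler_powR_nneg=> //; [rewrite invr_ge0 ltW|exact: powR_ge0].
have cvgd z (h : {additive C -> R}) : (forall a, `|h a| <= normc a)%R -> A z ->
 cvgn (fun j => h (u' j z)).
 move=> hle Az; have [M HM] := ubT z Az.
 have E : (fun j => h (u' j z)) = (fun j => h (u (psi 0%N) z) + series (fun k => h (d k z)) j)%R.
 apply/funext=> j; rewrite /u' mem_set // /series /= /d.
 elim: j=> [|j ih]; first by rewrite big_geq // addr0.
 by rewrite big_nat_recr //= addrA -ih raddfB addrC subrK.
 rewrite E; apply: is_cvgD; first exact: is_cvg_cst.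
 apply: normed_cvg; apply: nondecreasing_is_cvgn.
 by apply: nondecreasing_series=> k _ _; exact: normr_ge0.
 exists M=> _ [n _ <-] /=; apply: le_trans (HM n).
 by rewrite /series /= big_mkord; apply: ler_sum.
have cvgA (h : {additive C -> R}) z : (forall a, `|h a| <= normc a)%R ->
 cvgn (fun j => h (u' j z)).
 move=> hle; have [zA|zA] := boolP (z \in A); first by apply: cvgd=> //; rewrite inE in zA.
 rewrite (_ : (fun _ => _) = (fun=> h 0%R)); first exact: is_cvg_cst.
 by apply/funext=> j; rewrite /u' (negbTE zA).
have cRe z := cvgA (@Re R) z (@normc_Re).
have cIm z := cvgA (@Im R) z (@normc_Im).
pose k z : C := Complex (limn (fun j => Re (u' j z))) (limn (fun j => Im (u' j z))).
have mk : cmfun k.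
 split=> /=.
 by apply: (measurable_fun_cvg (h := fun j z => Re (u' j z)))=> [j|z _]; [case: (mu' j)|exact: cRe].
 by apply: (measurable_fun_cvg (h := fun j z => Im (u' j z)))=> [j|z _]; [case: (mu' j)|exact: cIm].
have aeA : {ae mu, forall z, A z}.
 have := integrable_ae measurableT iG.
 by apply: filterS=> z /(_ I) fz; rewrite /A /=; rewrite ge0_fin_numE in fz.
exists k; split=> // e e0.
have [J HJ] : exists J, ((2^-1 : R) ^+ J <= e)%R.
 have : (fun j => (2^-1 : R) ^+ j)%R @ \oo --> (0 : R)%R.
 by apply: cvg_expr; rewrite ger0_norm ?invr_ge0 // invf_lt1 // ltr1n.
 move/cvgrPdist_lt=> /(_ _ e0)[J _ HJ]; exists J.
 have := HJ J (leqnn J); rewrite /= sub0r normrN ger0_norm ?exprn_ge0 ?invr_ge0 //.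
 exact: ltW.
exists (psi J)=> n Jn.
have psi_mono j : (J <= j)%N -> (psi J <= psi j)%N.
 elim: j=> [|j ih]; first by rewrite leqn0=> /eqP ->.
 rewrite leq_eqVlt=> /orP[/eqP -> //|Jj]; apply: leq_trans (ih _) _=> //.
 by have [] := Hpsi j _ _ (leqnn _) (leqnn _).
apply: (@norm_LpC_Fatou _ _ (fun j z => u n z - u' j z)%R _ J)=> //.
- by move=> j; exact: cmfunB.
- move=> z e' e'0.
 have e2 : (0 < e' / 2)%R by rewrite divr_gt0.
 move/cvgrPdist_lt: (cRe z)=> /(_ _ e2)[J1 _ HJ1].
 move/cvgrPdist_lt: (cIm z)=> /(_ _ e2)[J2 _ HJ2].
 exists (maxn J1 J2)=> j; rewrite geq_max=> /andP[j1 j2].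
 have -> : (u n z - k z = (u n z - u' j z) + (u' j z - k z))%R by rewrite addrA subrK.
 apply: normcD_le; rewrite lerD2l normc_distC.
 apply: le_trans (normc_le_ReIm _) _.
 have := HJ1 j j1; have := HJ2 j j2; rewrite /= !raddfB /=; lra.
- move=> j Jj; rewrite (@ae_norm_LpC _ _ (fun z => u n z - u (psi j) z)%R).
 + have [h _] := Hpsi J n (psi j) Jn (psi_mono _ Jj).
 by apply: le_trans h _; rewrite lee_fin.
 + exact: cmfunB.
 + exact: cmfunB.
 + case: aeA=> X [mX X0 sX]; exists X; split=> // z /= h; apply: sX=> /= Az.
 by apply: h; rewrite /u' mem_set.
Qed.

End Lp.

(** * Directional and Wirtinger derivatives *)

Section directional.
Implicit Types (v z : plane) (F G : plane -> C) (f g : plane -> R).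

(** Reduces directional derivatives to one real variable, where the chain rule and the mean value
    theorem are available. *)
Lemma is_derive_lineP v z f d :
 is_derive z v f d <-> is_derive (0 : R) 1 (fun t : R => f (t *: v + z)) d.
Proof.
have E : (fun h : R => h^-1 *: ((f \o shift z) (h *: v) - f z)) =
 (fun h : R => h^-1 *: (((fun t : R => f (t *: v + z)) \o shift 0) (h *: (1 : R)) -
 (fun t : R => f (t *: v + z)) 0)).
 by apply/funext=> h /=; rewrite scale0r add0r addr0 [h *: 1]mulr1.
split=> -[dx <-].
 by apply: DeriveDef; rewrite /derivable /derive /= -?E.
by apply: DeriveDef; rewrite /derivable /derive /= ?E.
Qed.
Lemma is_derive_line v z f d (t : R) : is_derive (t *: v + z) v f d ->
 is_derive t 1 (fun t : R => f (t *: v + z)) d.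
Proof.
move=> /is_derive_lineP[dx <-].
have E : (fun h : R => h^-1 *: (((fun s : R => f (s *: v + (t *: v + z))) \o shift 0) (h *: (1 : R)) -
 (fun s : R => f (s *: v + (t *: v + z))) 0)) =
 (fun h : R => h^-1 *: (((fun s : R => f (s *: v + z)) \o shift t) (h *: (1 : R)) -
 (fun s : R => f (s *: v + z)) t)).
 by apply/funext=> h /=; rewrite scale0r add0r addr0 addrA -scalerDl.
by apply: DeriveDef; rewrite /derivable /derive /= -E.
Qed.
Lemma is_derive_comp_dir v z (h : R -> R) f (h' d : R) :
 is_derive (f z) 1 h h' -> is_derive z v f d ->
 is_derive z v (fun w => h (f w)) (h' * d).
Proof.
move=> dh /is_derive_lineP df; apply/is_derive_lineP.
apply: (is_derive1_comp (f := h) (g := fun t : R => f (t *: v + z))) df.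
by rewrite scale0r add0r.
Qed.
Lemma is_derive_fst v z : is_derive z v (fun w : plane => w.1) v.1.
Proof.
apply/is_derive_lineP=> /=.
rewrite (_ : (fun t : R => _) = (fun t : R => t * v.1 + z.1)) //.
by apply: is_derive_eq; rewrite addr0 scaler0 add0r [_ *: _]mulr1.
Qed.
Lemma is_derive_snd v z : is_derive z v (fun w : plane => w.2) v.2.
Proof.
apply/is_derive_lineP=> /=.
rewrite (_ : (fun t : R => _) = (fun t : R => t * v.2 + z.2)) //.
by apply: is_derive_eq; rewrite addr0 scaler0 add0r [_ *: _]mulr1.
Qed.
Lemma is_derive_congr v z f g d d' : f =1 g -> d = d' ->
 is_derive z v f d -> is_derive z v g d'.
Proof. by move=> /funext -> ->. Qed.
Lemma is_derive_uniq v z f d d' : is_derive z v f d -> is_derive z v f d' -> d = d'.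
Proof. by move=> [_ <-] [_ <-]. Qed.
Lemma lipschitz_dir v f (f' : plane -> R) M : (forall z, is_derive z v f (f' z)) ->
 (forall z, `|f' z| <= M) ->
 forall z (h : R), `|f (h *: v + z) - f z| <= M * `|h|.
Proof.
move=> df fM z h.
have M0 : 0 <= M by apply: le_trans (fM z).
have dl (t : R) : is_derive t 1 (fun t : R => f (t *: v + z)) (f' (t *: v + z)).
 exact: is_derive_line.
have cl : continuous (fun t : R => f (t *: v + z)).
 by move=> t; apply/differentiable_continuous/derivable1_diffP; case: (dl t).
have [h0|h0|->] := ltgtP h 0.
- have [c _ E] := MVT h0 (fun t _ => dl t) (continuous_subspaceT cl).
 move: E; rewrite scale0r add0r sub0r distrC=> ->.
 by rewrite normrM normrN ler_wpM2r.
- have [c _ E] := MVT h0 (fun t _ => dl t) (continuous_subspaceT cl).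
 move: E; rewrite scale0r add0r subr0=> ->.
 by rewrite normrM ler_wpM2r.
- by rewrite scale0r add0r subrr !normr0 mulr0.
Qed.
Definition isD v F z (d : C) : Prop :=
 is_derive z v (fun w => Re (F w)) (Re d) /\
 is_derive z v (fun w => Im (F w)) (Im d).

Lemma isD_cst v z c : isD v (fun=> c) z 0.
Proof. by split; exact: is_derive_cst. Qed.
Lemma isD_ext v F G z d d' : F =1 G -> d = d' -> isD v F z d -> isD v G z d'.
Proof. by move=> /funext -> ->. Qed.
Lemma isDD v F G z a b : isD v F z a -> isD v G z b ->
 isD v (fun w => F w + G w) z (a + b).
Proof.
move=> [f1 f2] [g1 g2]; split; rewrite raddfD.
 have := is_deriveD f1 g1.
 by congr (is_derive _ _ _ _); apply/funext=> w /=; rewrite raddfD.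
have := is_deriveD f2 g2.
by congr (is_derive _ _ _ _); apply/funext=> w /=; rewrite raddfD.
Qed.
Lemma isDM v F G z a b : isD v F z a -> isD v G z b ->
 isD v (fun w => F w * G w) z (F z * b + a * G z).
Proof.
move=> [f1 f2] [g1 g2].
have e1 := is_deriveB (is_deriveM f1 g1) (is_deriveM f2 g2).
have e2 := is_deriveD (is_deriveM f1 g2) (is_deriveM f2 g1).
split.
 apply: is_derive_congr e1=> [w|].
 by rewrite !fctE; case: (F w)=> ? ?; case: (G w).
 move: (F z) (G z) a b {f1 f2 g1 g2 e2}=> [x y] [x' y'] [s t] [s' t'] /=.
 rewrite /GRing.scale /=; ring.
apply: is_derive_congr e2=> [w|].
 by rewrite !fctE; case: (F w)=> ? ?; case: (G w).
move: (F z) (G z) a b {f1 f2 g1 g2 e1}=> [x y] [x' y'] [s t] [s' t'] /=.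
rewrite /GRing.scale /=; ring.
Qed.
Lemma isDJ v F z a : isD v F z a -> isD v (fun w => (F w)^*) z a^*.
Proof.
move=> [f1 f2]; split.
 apply: is_derive_congr f1=> [w|]; first by case: (F w).
 by case: a {f2}.
apply: is_derive_congr (is_deriveN f2)=> [w|].
 by rewrite !fctE; case: (F w).
by case: a {f1 f2}.
Qed.
Lemma isD_real v f z d : is_derive z v f d -> isD v (fun w => (f w)%:C) z d%:C.
Proof. by move=> df; split=> //=; exact: is_derive_cst. Qed.
Lemma isD_dir_deriv v F z a : isD v F z a -> dir_deriv v F z = a.
Proof. by case: a=> x y [[_ /= d1] [_ /= d2]]; rewrite /dir_deriv d1 d2. Qed.

(* [wd F z a b]: at [z] the Wirtinger derivatives of [F] are [a] (holomorphic) and [b] (antiholomorphic). *)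
Definition wd F z (a b : C) : Prop :=
 isD (1, 0) F z (a + b) /\ isD (0, 1) F z ('i%C * (a - b)).

Lemma wd_ext F G z a b a' b' : F =1 G -> a = a' -> b = b' -> wd F z a b -> wd G z a' b'.
Proof. by move=> /funext -> -> ->. Qed.
Lemma wd_cst z c : wd (fun=> c) z 0 0.
Proof. by rewrite /wd addr0 subrr mulr0; split; exact: isD_cst. Qed.
Lemma wdD F G z a b a' b' : wd F z a b -> wd G z a' b' ->
 wd (fun w => F w + G w) z (a + a') (b + b').
Proof.
move=> [f1 f2] [g1 g2]; split.
 by apply: (isD_ext _ _ (isDD f1 g1))=> //; ring.
by apply: (isD_ext _ _ (isDD f2 g2))=> //; ring.
Qed.
Lemma wdM F G z a b a' b' : wd F z a b -> wd G z a' b' ->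
 wd (fun w => F w * G w) z (F z * a' + a * G z) (F z * b' + b * G z).
Proof.
move=> [f1 f2] [g1 g2]; split.
 by apply: (isD_ext _ _ (isDM f1 g1))=> //; ring.
by apply: (isD_ext _ _ (isDM f2 g2))=> //; ring.
Qed.
Lemma wdZ c F z a b : wd F z a b -> wd (fun w => c * F w) z (c * a) (c * b).
Proof.
move=> dF; apply: wd_ext (wdM (wd_cst z c) dF)=> //; by rewrite mul0r addr0.
Qed.
Lemma wdN F z a b : wd F z a b -> wd (fun w => - F w) z (- a) (- b).
Proof.
move=> dF; apply: wd_ext (wdZ (-1) dF)=> [w||]; by rewrite mulN1r.
Qed.
Lemma wdB F G z a b a' b' : wd F z a b -> wd G z a' b' ->
 wd (fun w => F w - G w) z (a - a') (b - b').
Proof. by move=> dF dG; exact: wdD dF (wdN dG). Qed.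
Lemma wdJ F z a b : wd F z a b -> wd (fun w => (F w)^*) z b^* a^*.
Proof.
move=> [f1 f2]; split.
 by apply: (isD_ext _ _ (isDJ f1))=> //; rewrite rmorphD addrC.
apply: (isD_ext _ _ (isDJ f2))=> //.
by case: a b {f1 f2}=> [s t] [x y]; apply/eqP; rewrite eq_complex /=;
 apply/andP; split; apply/eqP; ring.
Qed.
Lemma ii : ('i%C : C) * 'i%C = -1.
Proof. by rewrite -expr2 sqr_i. Qed.
Lemma wd_pt z : wd (@pt R) z 1 0.
Proof.
rewrite /wd addr0 subr0 mulr1; split; split;
 by [exact: is_derive_fst|exact: is_derive_snd].
Qed.
Lemma complex2_neq0 : (2 : C) != 0.
Proof. by rewrite pnatr_eq0. Qed.
Lemma wd_im z : wd (fun w => (w.2)%:C) z (- 'i%C / 2) ('i%C / 2).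
Proof.
split.
 rewrite mulNr addNr; apply: (isD_ext (F := fun w => (w.2)%:C) (d := 0%:C))=> //.
 exact: isD_real (is_derive_snd _ _).
apply: (isD_ext (F := fun w => (w.2)%:C) (d := 1%:C))=> //.
 have -> : ('i%C : C) * (- 'i%C / 2 - 'i%C / 2) = - ('i%C * 'i%C) by field.
 by rewrite ii opprK.
exact: isD_real (is_derive_snd _ _).
Qed.
Lemma isD_inv v F z a : F z != 0 -> isD v F z a ->
 isD v (fun w => (F w)^-1) z (- a / F z ^+ 2).
Proof.
move=> F0 dF.
pose n2 w := Re (F w) ^+ 2 + Im (F w) ^+ 2.
have n0 : n2 z != 0 by rewrite /n2 -normc_sqr expf_neq0 // normc_eq0.
have E : (fun w => (F w)^-1) = (fun w => ((n2 w)^-1)%:C * (F w)^*).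
 apply/funext=> w; rewrite /n2; case: (F w)=> s t /=.
 rewrite /GRing.inv /=; apply/eqP; rewrite eq_complex /= !mul0r subr0 addr0.
 by rewrite mulrN ![_^-1 * _]mulrC !eqxx.
have [f1 f2] := dF.
have d2 : is_derive z v n2 (2 * (Re (F z) * Re a + Im (F z) * Im a)).
 apply: is_derive_congr (is_deriveD (is_deriveM f1 f1) (is_deriveM f2 f2))=> [w|].
 by rewrite !fctE /n2 !expr2.
 rewrite /GRing.scale /=; ring.
have d2' : is_derive z v (fun w => (n2 w)^-1) (- (n2 z) ^- 2 *
 (2 * (Re (F z) * Re a + Im (F z) * Im a))).
 apply: (is_derive_comp_dir (h := fun y : R => y^-1)) d2.
 by have := is_deriveV (f := id) n0 (is_derive_id (n2 z) 1); rewrite [_ *: _]mulr1.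
rewrite E; apply: (isD_ext _ _ (isDM (isD_real d2') (isDJ dF)))=> //.
have nF : ((n2 z)%:C : C) = F z * (F z)^* by rewrite normc_mul_conj normc_sqr.
have nC0 : (F z)^* != 0 by rewrite conjc_eq0.
have R2 (u c : C) : ((2 * (Re u * Re c + Im u * Im c))%:C : C) =
 u * c^* + u^* * c.
 by case: u c=> [x y] [s t]; apply: complex_ext=> /=; ring.
rewrite [X in _ + X * _ = _](_ : _ = - (((n2 z)%:C)%C ^+ 2)^-1 *
 (F z * a^* + (F z)^* * a)); last first.
 by rewrite -R2 -rmorphXn -fmorphV -rmorphN -rmorphM.
rewrite [X in X * _ + _](_ : _ = (((n2 z)%:C)%C)^-1); last by rewrite fmorphV.
rewrite nF.
field; rewrite /=.
by rewrite F0 nC0.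
Qed.
Lemma wd_inv F z a b : F z != 0 -> wd F z a b ->
 wd (fun w => (F w)^-1) z (- a / F z ^+ 2) (- b / F z ^+ 2).
Proof.
move=> F0 [f1 f2]; split.
 by apply: (isD_ext _ _ (isD_inv F0 f1))=> //; rewrite -mulrDl opprD.
apply: (isD_ext _ _ (isD_inv F0 f2))=> //; ring.
Qed.
Lemma wd_comp (h : R -> R) f z (h' : R) a b : is_derive (f z) 1 h h' ->
 wd (fun w => (f w)%:C) z a b ->
 wd (fun w => (h (f w))%:C) z (h'%:C * a) (h'%:C * b).
Proof.
move=> dh [[f1 f1'] [f2 f2']]; split.
 have E : Im (a + b) = 0 by have := is_derive_uniq f1' (is_derive_cst _ _ _).
 apply: (isD_ext _ _ (isD_real (is_derive_comp_dir dh f1)))=> //.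
 rewrite -mulrDr; case: (a + b) E=> s t /= ->.
 by apply/eqP; rewrite eq_complex /= !mul0r mulr0 subr0 addr0 !eqxx.
have E : Im ('i%C * (a - b)) = 0 by have := is_derive_uniq f2' (is_derive_cst _ _ _).
apply: (isD_ext _ _ (isD_real (is_derive_comp_dir dh f2)))=> //.
rewrite -mulrBr mulrCA; case: ('i%C * (a - b)) E=> s t /= ->.
by apply/eqP; rewrite eq_complex /= !mul0r mulr0 subr0 addr0 !eqxx.
Qed.
Lemma wd_dz F z a b : wd F z a b -> dz F z = a.
Proof.
move=> [/isD_dir_deriv f1 /isD_dir_deriv f2]; rewrite /dz f1 f2 mulrA ii mulN1r opprK.
have -> : a + b + (a - b) = 2 * a by ring.
by rewrite mulKf // complex2_neq0.
Qed.
Lemma wd_shift F z h a b : wd F (z + h) a b -> wd (fun w => F (w + h)) z a b.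
Proof.
have S v f d : is_derive (z + h) v f d -> is_derive z v (fun w => f (w + h)) d.
 by move=> /is_derive_lineP df; apply/is_derive_lineP; under eq_fun do rewrite -addrA.
by move=> [[? ?] [? ?]]; split; split; exact: S.
Qed.

End directional.

(** * Integrals of derivatives of compactly supported functions *)

Section integration_by_parts.
Implicit Types (v z : plane) (F G : plane -> C) (f g : plane -> R).

Lemma norm_planeE z : `|z| = Num.max `|z.1| `|z.2|.
Proof. by []. Qed.
Lemma boxE r : [set z : plane | `|z| <= r] = `[- r, r]%classic `*` `[- r, r]%classic.
Proof.
apply/seteqP; split=> z /=; rewrite !in_itv /= norm_planeE ge_max !ler_norml.
 by move=> /andP[].
by move=> [-> ->].
Qed.
Lemma meas_box r : measurable [set z : plane | `|z| <= r].
Proof.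
rewrite (_ : mkset _ = `[- r, r]%classic `*` `[- r, r]%classic).
 by apply: measurableX; exact: measurable_itv.
exact: boxE.
Qed.
Lemma rintg_box r M : rintg (fun z => if `|z| <= r then M else 0).
Proof.
pose A := [set z : plane | `|z| <= r]; have mA : measurable A by exact: meas_box.
have E : (fun z : plane => if `|z| <= r then M else 0) = (fun z => M * \1_A z).
 apply/funext=> z; rewrite indicE; case: ifP=> zr.
 by rewrite mem_set ?mulr1.
 by rewrite memNset ?mulr0 // /A /= zr.
apply/rintgP; split.
 by rewrite E; apply: mfunM=> //; exact: measurable_indic.
under eq_integral=> z _ do rewrite (congr1 (fun h => h z) E) normrM EFinM.
rewrite ge0_integralZl //; last first.
 by apply/mEFin; apply: mcomp=> //; exact: measurable_indic.
under eq_integral=> z _ do rewrite ger0_norm ?indicE ?ler0n // -indicE.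
rewrite integral_indic // setIT; apply: lte_mul_pinfty=> //.
pose I : set (measurableTypeR R) := `[- r, r]%classic.
have HI : (leb I < +oo)%E.
 by rewrite lebesgue_measure_itv /=; case: ifP=> _; rewrite ?ltry // -EFinB ltry.
have : ((leb \x leb) (I `*` I) < +oo)%E.
 rewrite product_measure1E //; try exact: measurable_itv.
 by apply: lte_mul_pinfty=> //; rewrite ge0_fin_numE.
by rewrite /I -boxE.
Qed.
Lemma cvg_difference_quotient v z f d : is_derive z v f d ->
 (fun n : nat => n.+1%:R * (f (n.+1%:R^-1 *: v + z) - f z)) @ \oo --> d.
Proof.
move=> [df <-]; move/cvgrPdist_lt: df=> cf; apply/cvgrPdist_lt=> e e0.
have [d0 /= d00 H] := cf e e0.
have /cvgrPdist_lt/(_ d0 d00)[N _ HN] := @cvg_harmonic R.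
exists N=> // n Nn; have /= := HN n Nn; rewrite /harmonic=> Hn.
have := H (n.+1%:R^-1); rewrite /ball_ /= => /(_ Hn).
rewrite invr_eq0 pnatr_eq0 /= => /(_ isT).
by rewrite invrK /shift.
Qed.

(* Difference quotients of [f] have integral zero by translation invariance. *)
Lemma Rintegral_dir_deriv v f f' r L : `|v| <= 1 -> rintg f ->
 mfun f' -> (forall z, r < `|z| -> f z = 0) ->
 (forall z h, `|f (h *: v + z) - f z| <= L * `|h|) ->
 {ae mu, forall z, is_derive z v f (f' z)} ->
 rintg f' /\ \int[mu]_z f' z = 0.
Proof.
move=> v1 If mf' supp lip df.
have mf : mfun f by case/rintgP: If.
pose h (n : nat) : R := n.+1%:R^-1.
have h0 n : 0 < h n by rewrite invr_gt0.
have h1 n : h n <= 1 by rewrite invf_le1 // ler1n.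
pose D n z := n.+1%:R * (f (h n *: v + z) - f z).
have Ish n : rintg (fun z => f (h n *: v + z)).
 have := integrable_shift (h n *: v) If.
 by congr (integrable _ _ _); apply/funext=> z /=; rewrite addrC.
have ID n : rintg (D n).
 exact: (integrableZl measurableT _ (integrableB measurableT (Ish n) If)).
have D0 n : \int[mu]_z D n z = 0.
 rewrite (RintegralZl _ measurableT (integrableB measurableT (Ish n) If)).
 rewrite (RintegralB measurableT (Ish n) If).
 under eq_Rintegral do rewrite addrC.
 by rewrite Rintegral_shift // subrr mulr0.
(* The increments have length at most 1, so beyond r + 1 both values of f vanish; this gives an
   integrable majorant. *)
have Dle n z : `|D n z| <= if `|z| <= r + 1 then L else 0.
 case: ifPn=> [_|].
 rewrite normrM ger0_norm ?ler0n // -ler_pdivlMl // mulrC.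
 by apply: le_trans (lip z (h n)) _; rewrite ger0_norm // ltW.
 rewrite -ltNge=> rz.
 rewrite /D supp ?supp ?subrr ?mulr0 ?normr0 //; first by lra.
 have := ler_normB (h n *: v + z) (h n *: v); rewrite addrAC subrr add0r.
 have : `|h n *: v| <= 1.
 by rewrite normrZ ger0_norm ?(ltW (h0 n)) // -[leRHS]mulr1 ler_pM // ltW.
 lra.
have mD n : mfun (EFin \o D n) by case/integrableP: (ID n).
have cvD : {ae mu, forall z, setT z -> (fun n => (D n z)%:E) @ \oo --> (f' z)%:E}.
 case: df=> [N [mN N0 sN]]; exists N; split=> // z /= nz; apply: sN=> /= dfz.
 apply: nz=> _; apply: cvg_EFin; first by near=> n.
 exact: cvg_difference_quotient.
have mEf' : mfun (EFin \o f') by exact/mEFin.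
have [If' _ cv] := @dominated_convergence _ _ _ mu setT measurableT (fun n => EFin \o D n)
 (EFin \o f') (fun z => (if `|z| <= r + 1 then L else 0)%:E) mD
 mEf' cvD (rintg_box _ _) (aeW mu (fun z n _ => Dle n z)).
split=> //.
have E0 : (fun n => \int[mu]_z (EFin \o D n) z)%E = (fun=> 0%E).
 apply/funext=> n.
 by rewrite -[LHS]fineK ?(integrable_fin_num measurableT (ID n)) // -/(Rintegral _ _ _) D0.
rewrite E0 in cv; rewrite /Rintegral.
by rewrite -(cvg_lim (@ereal_hausdorff R) cv) lim_cst.
Unshelve. all: by end_near. Qed.
Definition lip_axes (L : R) F : Prop := forall v z h, v = (1, 0) \/ v = (0, 1) ->
 normc (F (h *: v + z) - F z) <= L * `|h|.

(** The derivatives along both axes have integral 0, and A and B are fixed linear combinations of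
    them. *)
Lemma cint_wd0 F A B r L : cintg F -> cmfun A -> cmfun B ->
 (forall z, r < `|z| -> F z = 0) ->
 lip_axes L F ->
 {ae mu, forall z, wd F z (A z) (B z)} ->
 [/\ cintg A, cI A = 0, cintg B & cI B = 0].
Proof.
move=> [i1 i2] mA mB supp lip dF.
have n10 : `|((1, 0) : plane)| <= 1 by rewrite norm_planeE /= normr0 normr1 max_l.
have n01 : `|((0, 1) : plane)| <= 1 by rewrite norm_planeE /= normr0 normr1 max_r.
have key v (d : plane -> C) : v = (1, 0) \/ v = (0, 1) -> cmfun d -> {ae mu, forall z, isD v F z (d z)} ->
 cintg d /\ cI d = 0.
 move=> vv [m1 m2] dd; have v1 : `|v| <= 1 by case: vv=> ->.
 have d1 : {ae mu, forall z, is_derive z v (fun w => Re (F w)) (Re (d z))}.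
 by case: dd=> [N [mN N0 sN]]; exists N; split=> // z /= nz; apply: sN=> /= -[].
 have d2 : {ae mu, forall z, is_derive z v (fun w => Im (F w)) (Im (d z))}.
 by case: dd=> [N [mN N0 sN]]; exists N; split=> // z /= nz; apply: sN=> /= -[].
 have [] := @Rintegral_dir_deriv v _ _ r L v1 i1 m1 _ _ d1.
 - by move=> z /supp ->.
 - move=> z h; apply: le_trans (lip v z h vv).
 by rewrite -raddfB normc_Re.
 have [] := @Rintegral_dir_deriv v _ _ r L v1 i2 m2 _ _ d2.
 - by move=> z /supp ->.
 - move=> z h; apply: le_trans (lip v z h vv).
 by rewrite -raddfB normc_Im.
 by move=> j2 e2 j1 e1; split=> //; rewrite cintE e1 e2 mulr0.
have [j1 e1] : cintg (fun z => A z + B z) /\ cI (fun z => A z + B z) = 0.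
 apply: (key (1, 0)); [by left|exact: cmfunD|].
 by case: dF=> [N [mN N0 sN]]; exists N; split=> // z /= nz; apply: sN=> /= -[].
have [j2 e2] : cintg (fun z => 'i%C * (A z - B z)) /\ cI (fun z => 'i%C * (A z - B z)) = 0.
 apply: (key (0, 1)); [by right|by apply: cmfunM; [exact: cmfun_cst|exact: cmfunB]|].
 by case: dF=> [N [mN N0 sN]]; exists N; split=> // z /= nz; apply: sN=> /= -[].
have c2 := @complex2_neq0.
have EA : A = (fun z => 2^-1 * (A z + B z) - 2^-1 * ('i%C * ('i%C * (A z - B z)))).
 by apply/funext=> z; rewrite [in X in _ - X]mulrA ii mulN1r; field.
have EB : B = (fun z => 2^-1 * (A z + B z) + 2^-1 * ('i%C * ('i%C * (A z - B z)))).
 by apply/funext=> z; rewrite [in X in _ + X]mulrA ii mulN1r; field.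
have k1 := cintgZ 2^-1 j1.
have k2 := cintgZ 2^-1 (cintgZ 'i%C j2).
have l1 : cI (fun z => 2^-1 * (A z + B z)) = 0 by rewrite cintZ // e1 mulr0.
have l2 : cI (fun z => 2^-1 * ('i%C * ('i%C * (A z - B z)))) = 0.
 by rewrite (cintZ _ (cintgZ _ j2)) (cintZ _ j2) e2 !mulr0.
split.
- by rewrite EA; exact: cintgB.
- by rewrite EA cintB // l1 l2 subr0.
- by rewrite EB; exact: cintgD.
- by rewrite EB cintD // l1 l2 addr0.
Qed.

End integration_by_parts.

(** * Functions of class C^n in terms of Wirtinger derivatives *)

Section smooth_classes.
Implicit Types (v z : plane) (F G : plane -> C) (f g : plane -> R).

Definition dzb F : plane -> C := fun z =>
 2^-1 * (dir_deriv (1, 0) F z + 'i%C * dir_deriv (0, 1) F z).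

Lemma wd_dzb F z a b : wd F z a b -> dzb F z = b.
Proof.
move=> [/isD_dir_deriv f1 /isD_dir_deriv f2]; rewrite /dzb f1 f2 mulrA ii mulN1r.
have -> : a + b + - (a - b) = 2 * b by ring.
by rewrite mulKf // complex2_neq0.
Qed.

#[local] Opaque dz dzb.

Definition ccont F : Prop := continuous (fun z => Re (F z)) /\
 continuous (fun z => Im (F z)).

Lemma ccont_cmfun F : ccont F -> cmfun F.
Proof. by move=> [c1 c2]; split; exact: continuous_measurable_plane. Qed.
Lemma ccontD F G : ccont F -> ccont G -> ccont (fun z => F z + G z).
Proof.
move=> [f1 f2] [g1 g2]; split; under eq_fun do rewrite raddfD.
 by move=> z; apply: continuousD; [exact: f1|exact: g1].
by move=> z; apply: continuousD; [exact: f2|exact: g2].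
Qed.
Lemma ccontM F G : ccont F -> ccont G -> ccont (fun z => F z * G z).
Proof.
move=> [f1 f2] [g1 g2]; split.
 rewrite (_ : (fun _ => _) = (fun z => Re (F z) * Re (G z) -
 Im (F z) * Im (G z))).
 move=> z; apply: (@continuousB _ _ _ (fun z => Re (F z) * Re (G z))
 (fun z => Im (F z) * Im (G z))).
 by apply: continuousM; [exact: f1|exact: g1].
 by apply: continuousM; [exact: f2|exact: g2].
 by apply/funext=> z; case: (F z)=> a b; case: (G z).
rewrite (_ : (fun _ => _) = (fun z => Re (F z) * Im (G z) +
 Im (F z) * Re (G z))).
 move=> z; apply: (@continuousD _ _ _ (fun z => Re (F z) * Im (G z))
 (fun z => Im (F z) * Re (G z))).
 by apply: continuousM; [exact: f1|exact: g2].
 by apply: continuousM; [exact: f2|exact: g1].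
by apply/funext=> z; case: (F z)=> a b; case: (G z)=> c e.
Qed.
Lemma ccont_cst c : ccont (fun=> c).
Proof. by split=> z; exact: cst_continuous. Qed.
Lemma ccontJ F : ccont F -> ccont (fun z => (F z)^*).
Proof.
move=> [f1 f2]; split.
 by rewrite (_ : (fun _ => _) = (fun z => Re (F z))) //; apply/funext=> z; case: (F z).
rewrite (_ : (fun _ => _) = (fun z => - Im (F z))).
 by move=> z; apply: continuousN; exact: f2.
by apply/funext=> z; case: (F z).
Qed.
Lemma continuous_planeD (h : plane) : continuous (fun w : plane => w + h).
Proof. by move=> w; apply: continuousD; [exact: id|exact: cst_continuous]. Qed.
Lemma ccont_shift F (h : plane) : ccont F -> ccont (fun z => F (z + h)).
Proof.
move=> [f1 f2]; split=> z.
 by apply: (@continuous_comp _ _ _ (fun w : plane => w + h) (fun w => Re (F w)));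
 [exact: continuous_planeD|exact: f1].
by apply: (@continuous_comp _ _ _ (fun w : plane => w + h) (fun w => Im (F w)));
 [exact: continuous_planeD|exact: f2].
Qed.

(** From order 2 on, the commutation of [dz] and [dzb] is part of the definition. It is proved for
    explicit expressions and then inherited by sums, products, conjugates, translates and
    convolutions, in place of a general theorem on mixed derivatives. *)
Inductive Ck : nat -> (plane -> C) -> Prop :=
| Ck_zero F : ccont F -> Ck 0 F
| Ck_succ n F : ccont F -> (forall z, wd F z (dz F z) (dzb F z)) ->
 Ck n (dz F) -> Ck n (dzb F) -> ((0 < n)%N -> dz (dzb F) =1 dzb (dz F)) -> Ck n.+1 F.

Lemma Ck_cont n F : Ck n F -> ccont F.
Proof. by case. Qed.
Lemma Ck_inv n F : Ck n.+1 F -> [/\ ccont F, forall z, wd F z (dz F z) (dzb F z),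
 Ck n (dz F), Ck n (dzb F) & (0 < n)%N -> dz (dzb F) =1 dzb (dz F)].
Proof. by move=> H; inversion H. Qed.
Lemma Ck_wd n F z : Ck n.+1 F -> wd F z (dz F z) (dzb F z).
Proof. by case/Ck_inv. Qed.
Lemma Ck_dz n F : Ck n.+1 F -> Ck n (dz F).
Proof. by case/Ck_inv. Qed.
Lemma Ck_dzb n F : Ck n.+1 F -> Ck n (dzb F).
Proof. by case/Ck_inv. Qed.
Lemma Ck_sym n F z : Ck n.+2 F -> dz (dzb F) z = dzb (dz F) z.
Proof. by case/Ck_inv=> _ _ _ _ /(_ isT). Qed.
Lemma CkS n F : Ck n.+1 F -> Ck n F.
Proof.
elim: n F=> [|n ih] F /Ck_inv[cF w a b s]; first exact: Ck_zero.
by apply: Ck_succ=> //; [exact: ih|exact: ih|move=> _; exact: s].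
Qed.
Lemma Ck_le m n F : (m <= n)%N -> Ck n F -> Ck m F.
Proof.
by elim: n=> [|n ih]; [rewrite leqn0=> /eqP ->|
 rewrite leq_eqVlt=> /orP[/eqP -> //|mn] /CkS; exact: ih].
Qed.
Lemma Ck_intro n F A B : ccont F -> (forall z, wd F z (A z) (B z)) -> Ck n A -> Ck n B ->
 ((0 < n)%N -> dz B =1 dzb A) -> Ck n.+1 F /\ dz F = A /\ dzb F = B.
Proof.
move=> cF dF cA cB s.
have EA : dz F = A by apply/funext=> z; exact: wd_dz (dF z).
have EB : dzb F = B by apply/funext=> z; exact: wd_dzb (dF z).
split; last by split.
by apply: Ck_succ=> [//||||]; rewrite ?EA ?EB.
Qed.
Lemma dzD F G : Ck 1 F -> Ck 1 G -> dz (fun z => F z + G z) = (fun z => dz F z + dz G z) /\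
 dzb (fun z => F z + G z) = (fun z => dzb F z + dzb G z).
Proof.
move=> F1 G1; split; apply/funext=> z.
 exact: wd_dz (wdD (Ck_wd z F1) (Ck_wd z G1)).
exact: wd_dzb (wdD (Ck_wd z F1) (Ck_wd z G1)).
Qed.
Lemma dzM F G : Ck 1 F -> Ck 1 G ->
 dz (fun z => F z * G z) = (fun z => F z * dz G z + dz F z * G z) /\
 dzb (fun z => F z * G z) = (fun z => F z * dzb G z + dzb F z * G z).
Proof.
move=> F1 G1; split; apply/funext=> z.
 exact: wd_dz (wdM (Ck_wd z F1) (Ck_wd z G1)).
exact: wd_dzb (wdM (Ck_wd z F1) (Ck_wd z G1)).
Qed.
Lemma CkD n F G : Ck n F -> Ck n G -> Ck n (fun z => F z + G z).
Proof.
elim: n F G=> [|n ih] F G cF cG; first by apply/Ck_zero/ccontD; [exact: Ck_cont cF|exact: Ck_cont cG].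
apply: (proj1 (@Ck_intro n (fun z => F z + G z) (fun z => dz F z + dz G z)
 (fun z => dzb F z + dzb G z) _ _ _ _ _)).
- exact: ccontD (Ck_cont cF) (Ck_cont cG).
- by move=> z; exact: wdD (Ck_wd z cF) (Ck_wd z cG).
- by apply: ih; exact: Ck_dz.
- by apply: ih; exact: Ck_dzb.
- case: n {ih} cF cG=> // n cF cG _ z.
 have [-> _] := dzD (Ck_le (isT : 1 <= n.+1)%N (Ck_dzb cF)) (Ck_le (isT : 1 <= n.+1)%N (Ck_dzb cG)).
 have [_ ->] := dzD (Ck_le (isT : 1 <= n.+1)%N (Ck_dz cF)) (Ck_le (isT : 1 <= n.+1)%N (Ck_dz cG)).
 by rewrite (Ck_sym _ cF) (Ck_sym _ cG).
Qed.
Lemma CkM n F G : Ck n F -> Ck n G -> Ck n (fun z => F z * G z).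
Proof.
elim: n F G=> [|n ih] F G cF cG; first by apply/Ck_zero/ccontM; [exact: Ck_cont cF|exact: Ck_cont cG].
apply: (proj1 (@Ck_intro n (fun z => F z * G z) (fun z => F z * dz G z + dz F z * G z)
 (fun z => F z * dzb G z + dzb F z * G z) _ _ _ _ _)).
- exact: ccontM (Ck_cont cF) (Ck_cont cG).
- by move=> z; exact: wdM (Ck_wd z cF) (Ck_wd z cG).
- by apply: CkD; apply: ih; (exact: CkS || exact: Ck_dz).
- by apply: CkD; apply: ih; (exact: CkS || exact: Ck_dzb).
- case: n {ih} cF cG=> // n cF cG _ z.
 have l1 : (1 <= n.+1)%N by [].
 have l2 : (1 <= n.+2)%N by [].
 have F1 := Ck_le l2 cF; have G1 := Ck_le l2 cG.
 have Fz := Ck_le l1 (Ck_dz cF); have Gz := Ck_le l1 (Ck_dz cG).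
 have Fb := Ck_le l1 (Ck_dzb cF); have Gb := Ck_le l1 (Ck_dzb cG).
 rewrite (wd_dz (wdD (wdM (Ck_wd z F1) (Ck_wd z Gb)) (wdM (Ck_wd z Fb) (Ck_wd z G1)))).
 rewrite (wd_dzb (wdD (wdM (Ck_wd z F1) (Ck_wd z Gz)) (wdM (Ck_wd z Fz) (Ck_wd z G1)))).
 rewrite (Ck_sym _ cF) (Ck_sym _ cG).
 move: (F z) (G z) (dz F z) (dz G z) (dzb F z) (dzb G z) (dzb (dz F) z) (dzb (dz G) z)=> *; ring.
Qed.
Lemma dz_cst c : dz (fun _ : plane => c) = (fun=> 0) /\ dzb (fun _ : plane => c) = (fun=> 0).
Proof.
by split; apply/funext=> z; [exact: wd_dz (wd_cst z c)|exact: wd_dzb (wd_cst z c)].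
Qed.
Lemma Ck_cst n c : Ck n (fun=> c).
Proof.
elim: n c=> [|n ih] c; first by apply: Ck_zero; exact: ccont_cst.
apply: (proj1 (@Ck_intro n _ (fun=> 0) (fun=> 0) _ _ _ _ _))=> //.
- exact: ccont_cst.
- by move=> z; exact: wd_cst.
- by move=> _ z; have [-> ->] := dz_cst 0.
Qed.
Lemma CkZ n c F : Ck n F -> Ck n (fun z => c * F z).
Proof. by move=> cF; apply: CkM=> //; exact: Ck_cst. Qed.
Lemma CkJ n F : Ck n F -> Ck n (fun z => (F z)^*).
Proof.
elim: n F=> [|n ih] F cF; first by apply/Ck_zero/ccontJ; exact: Ck_cont cF.
apply: (proj1 (@Ck_intro n (fun z => (F z)^*) (fun z => (dzb F z)^*)
 (fun z => (dz F z)^*) _ _ _ _ _)).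
- exact: ccontJ (Ck_cont cF).
- by move=> z; exact: wdJ (Ck_wd z cF).
- by apply: ih; exact: Ck_dzb.
- by apply: ih; exact: Ck_dz.
- case: n {ih} cF=> // n cF _ z.
 have l1 : (1 <= n.+1)%N by [].
 rewrite (wd_dz (wdJ (Ck_wd z (Ck_le l1 (Ck_dz cF))))).
 by rewrite (wd_dzb (wdJ (Ck_wd z (Ck_le l1 (Ck_dzb cF))))) (Ck_sym _ cF).
Qed.
Lemma dzJ F : Ck 1 F -> dz (fun z => (F z)^*) = (fun z => (dzb F z)^*) /\
 dzb (fun z => (F z)^*) = (fun z => (dz F z)^*).
Proof.
by move=> F1; split; apply/funext=> z;
 [exact: wd_dz (wdJ (Ck_wd z F1))|exact: wd_dzb (wdJ (Ck_wd z F1))].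
Qed.
Lemma Ck_shift n F (h : plane) : Ck n F -> Ck n (fun z => F (z + h)).
Proof.
elim: n F=> [|n ih] F cF; first by apply/Ck_zero/ccont_shift; exact: Ck_cont cF.
apply: (proj1 (@Ck_intro n _ (fun z => dz F (z + h)) (fun z => dzb F (z + h)) _ _ _ _ _)).
- exact: ccont_shift (Ck_cont cF).
- by move=> z; exact: wd_shift (Ck_wd _ cF).
- by apply: ih; exact: Ck_dz.
- by apply: ih; exact: Ck_dzb.
- case: n {ih} cF=> // n cF _ z.
 have l1 : (1 <= n.+1)%N by [].
 rewrite (wd_dz (wd_shift (Ck_wd (z + h) (Ck_le l1 (Ck_dzb cF))))).
 by rewrite (wd_dzb (wd_shift (Ck_wd (z + h) (Ck_le l1 (Ck_dz cF))))) (Ck_sym _ cF).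
Qed.
Lemma dz_shift F (h : plane) : Ck 1 F -> dz (fun z => F (z + h)) = (fun z => dz F (z + h)) /\
 dzb (fun z => F (z + h)) = (fun z => dzb F (z + h)).
Proof.
by move=> F1; split; apply/funext=> z;
 [exact: wd_dz (wd_shift (Ck_wd _ F1))|exact: wd_dzb (wd_shift (Ck_wd _ F1))].
Qed.
Definition bsupp r F : Prop := forall z, r < `|z| -> F z = 0.

Lemma box_compact r : compact [set z : plane | `|z| <= r].
Proof. by rewrite boxE; apply: compact_setX; exact: segment_compact. Qed.
Lemma ccont_bounded r F : ccont F -> exists M, 0 <= M /\ forall z, `|z| <= r -> normc (F z) <= M.
Proof.
have key f : continuous f -> exists M, forall z : plane, `|z| <= r -> `|f z| <= M.
 move=> cf; have := continuous_compact (continuous_subspaceT cf) (@box_compact r).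
 move=> /compact_bounded[N [_ HN]]; exists (N + 1)=> z zr.
 by apply: HN; [lra|exists z].
move=> [/key[M HM] /key[N HN]]; exists (`|M| + `|N|); split; first exact: addr_ge0.
move=> z zr; apply: le_trans (normc_le_ReIm _) _.
by apply: lerD; [apply: le_trans (HM z zr) (ler_norm _)|apply: le_trans (HN z zr) (ler_norm _)].
Qed.
Lemma cb_bounded r F : ccont F -> bsupp r F -> exists M, 0 <= M /\ forall z, normc (F z) <= M.
Proof.
move=> cF sF; have [M [M0 HM]] := @ccont_bounded r F cF; exists M; split=> // z.
have [/HM //|rz] := leP `|z| r.
by rewrite sF // normc0.
Qed.
Lemma bb_cintg r M F : cmfun F -> bsupp r F -> (forall z, normc (F z) <= M) ->
 cintg F.
Proof.
move=> mF sF FM; apply: (le_cintg mF _ (@rintg_box r M))=> z.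
by case: ifPn=> //; rewrite -ltNge=> rz; rewrite sF // normc0.
Qed.
Lemma cb_cintg r F : ccont F -> bsupp r F -> cintg F.
Proof.
move=> cF sF; have [M [M0 HM]] := cb_bounded cF sF.
exact: bb_cintg (ccont_cmfun cF) sF HM.
Qed.
Lemma wd_0_outside F r z : bsupp r F -> r < `|z| -> wd F z 0 0.
Proof.
move=> sF rz.
have nz : \forall w \near z, F w = 0.
 have : nbhs z [set w : plane | r < `|w|].
 apply: open_nbhs_nbhs; split=> //.
 by apply: (@open_comp _ _ (fun w : plane => `|w|) [set x | r < x])=> [w _|]; [exact: norm_continuous|exact: open_gt].
 by apply: filterS=> w; exact: sF.
have key v : isD v F z 0.
 split; apply: (@near_eq_is_derive _ _ _ (fun=> 0))=> //; try exact: is_derive_cst.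
 by apply: filterS nz=> w ->.
 by apply: filterS nz=> w ->.
by rewrite /wd addr0 subr0 mulr0; split; exact: key.
Qed.
Lemma bsupp_dz r F : bsupp r F -> bsupp r (dz F) /\ bsupp r (dzb F).
Proof.
move=> sF; split=> z rz; first exact: wd_dz (wd_0_outside sF rz).
exact: wd_dzb (wd_0_outside sF rz).
Qed.
Lemma Ck1_lip r F : Ck 1 F -> bsupp r F -> exists L, 0 <= L /\ lip_axes L F.
Proof.
move=> F1 sF; have [s1 s2] := bsupp_dz sF.
have [M [M0 HM]] := cb_bounded (Ck_cont (Ck_dz F1)) s1.
have [N [N0 HN]] := cb_bounded (Ck_cont (Ck_dzb F1)) s2.
exists (2 * (M + N)); split; first by rewrite mulr_ge0 // addr_ge0.
move=> v z h vv.
have dv : exists d : plane -> C, (forall z, isD v F z (d z)) /\ (forall z, normc (d z) <= M + N).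
 case: vv=> ->.
 exists (fun z => dz F z + dzb F z); split=> w; first by have [] := Ck_wd w F1.
 by apply: normcD_le; exact: lerD.
 exists (fun z => 'i%C * (dz F z - dzb F z)); split=> w; first by have [] := Ck_wd w F1.
 rewrite normcM (_ : normc 'i%C = 1) ?mul1r; last by rewrite /= expr0n expr1n add0r sqrtr1.
 by apply: normcD_le; rewrite normcNE; exact: lerD.
have [d [dd dM]] := dv.
apply: le_trans (normc_le_ReIm _) _; rewrite !raddfB /= mulr2n mulrDl mulrDl mul1r.
apply: lerD.
 apply: (@lipschitz_dir v (fun w => Re (F w)) (fun w => Re (d w)))=> w.
 by have [] := dd w.
 exact: le_trans (normc_Re _) (dM w).
apply: (@lipschitz_dir v (fun w => Im (F w)) (fun w => Im (d w)))=> w.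
 by have [] := dd w.
exact: le_trans (normc_Im _) (dM w).
Qed.
Lemma cint_dz0 r F : Ck 1 F -> bsupp r F -> cI (dz F) = 0 /\ cI (dzb F) = 0.
Proof.
move=> F1 sF; have [L [L0 HL]] := Ck1_lip F1 sF.
have [] // := @cint_wd0 F (dz F) (dzb F) r L.
- exact: cb_cintg (Ck_cont F1) sF.
- exact: ccont_cmfun (Ck_cont (Ck_dz F1)).
- exact: ccont_cmfun (Ck_cont (Ck_dzb F1)).
- by apply: aeW=> z; exact: Ck_wd F1.
Qed.
Lemma cint_ibp r F G : Ck 1 F -> Ck 1 G -> bsupp r G ->
 cI (fun z => F z * dz G z) = - cI (fun z => dz F z * G z) /\
 cI (fun z => F z * dzb G z) = - cI (fun z => dzb F z * G z).
Proof.
move=> F1 G1 sG.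
have sFG : bsupp r (fun z => F z * G z) by move=> z /sG ->; rewrite mulr0.
have [e1 e2] := cint_dz0 (CkM F1 G1) sFG.
have [E1 E2] := dzM F1 G1.
have [s1 s2] := bsupp_dz sG.
have i1 : cintg (fun z => F z * dz G z).
 apply: (@cb_cintg r); last by move=> z /s1 ->; rewrite mulr0.
 exact: ccontM (Ck_cont F1) (Ck_cont (Ck_dz G1)).
have i2 : cintg (fun z => F z * dzb G z).
 apply: (@cb_cintg r); last by move=> z /s2 ->; rewrite mulr0.
 exact: ccontM (Ck_cont F1) (Ck_cont (Ck_dzb G1)).
have j1 : cintg (fun z => dz F z * G z).
 apply: (@cb_cintg r); last by move=> z /sG ->; rewrite mulr0.
 exact: ccontM (Ck_cont (Ck_dz F1)) (Ck_cont G1).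
have j2 : cintg (fun z => dzb F z * G z).
 apply: (@cb_cintg r); last by move=> z /sG ->; rewrite mulr0.
 exact: ccontM (Ck_cont (Ck_dzb F1)) (Ck_cont G1).
split; apply/eqP; rewrite -addr_eq0.
 by rewrite -cintD // -E1 e1.
by rewrite -cintD // -E2 e2.
Qed.

(* The kernel [T] need only be Lipschitz, hence differentiable off a null set. *)
Lemma cint_ibp_lip r T A B LT MT G : cmfun T -> cmfun A -> cmfun B ->
 (forall z, normc (T z) <= MT) -> lip_axes LT T -> {ae mu, forall z, wd T z (A z) (B z)} ->
 (forall z, normc (A z) <= LT) -> (forall z, normc (B z) <= LT) ->
 Ck 1 G -> bsupp r G ->
 cI (fun z => T z * dz G z) = - cI (fun z => A z * G z) /\
 cI (fun z => T z * dzb G z) = - cI (fun z => B z * G z).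
Proof.
move=> mT mA mB TM lT dT AM BM G1 sG.
have [L [L0 HL]] := Ck1_lip G1 sG.
have [M [M0 HM]] := cb_bounded (Ck_cont G1) sG.
have [s1 s2] := bsupp_dz sG.
have [M1 [M10 HM1]] := cb_bounded (Ck_cont (Ck_dz G1)) s1.
have [M2 [M20 HM2]] := cb_bounded (Ck_cont (Ck_dzb G1)) s2.
have mG := ccont_cmfun (Ck_cont G1).
have mG1 := ccont_cmfun (Ck_cont (Ck_dz G1)); have mG2 := ccont_cmfun (Ck_cont (Ck_dzb G1)).
have int H K MH MK : cmfun H -> cmfun K -> (forall z, normc (H z) <= MH) ->
 (forall z, normc (K z) <= MK) -> bsupp r K -> cintg (fun z => H z * K z).
 move=> mH mK HH HK sK; apply: (@bb_cintg r (MH * MK)).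
 - exact: cmfunM.
 - by move=> z /sK ->; rewrite mulr0.
 - by move=> z; rewrite normcM ler_pM // normc_ge0.
have i1 := int _ _ _ _ mT mG1 TM HM1 s1; have i2 := int _ _ _ _ mT mG2 TM HM2 s2.
have j1 := int _ _ _ _ mA mG AM HM sG; have j2 := int _ _ _ _ mB mG BM HM sG.
have i0 := int _ _ _ _ mT mG TM HM sG.
have sTG : forall z, r < `|z| -> T z * G z = 0 by move=> z /sG ->; rewrite mulr0.
have lTG : lip_axes (MT * L + LT * M) (fun z => T z * G z).
 move=> v z h vv.
 have -> : T (h *: v + z) * G (h *: v + z) - T z * G z =
 T (h *: v + z) * (G (h *: v + z) - G z) + (T (h *: v + z) - T z) * G z by ring.
 have -> : (MT * L + LT * M) * `|h| = MT * (L * `|h|) + (LT * `|h|) * M by ring.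
 apply: normcD_le; rewrite !normcM.
 by apply: lerD; apply: ler_pM; rewrite ?normc_ge0 //; [exact: HL|exact: lT].
have dTG : {ae mu, forall z, wd (fun z => T z * G z) z (T z * dz G z + A z * G z)
 (T z * dzb G z + B z * G z)}.
 case: dT=> [N [mN N0 sN]]; exists N; split=> // z /= nz; apply: sN=> /= dTz.
 by apply: nz; exact: wdM dTz (Ck_wd z G1).
have [_ e1 _ e2] := cint_wd0 i0 (cmfunD (cmfunM mT mG1) (cmfunM mA mG))
 (cmfunD (cmfunM mT mG2) (cmfunM mB mG)) sTG lTG dTG.
split; apply/eqP; rewrite -addr_eq0.
 by rewrite -cintD // e1.
by rewrite -cintD // e2.
Qed.

End smooth_classes.

(** * Flat functions of one real variable *)

Section flat_functions.
Implicit Types (p : {poly R}) (x : R).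

(** The polynomial factor in 1/x makes the family stable under differentiation: the derivative of
    p(1/x) exp(-1/x) is x^(-2) (p - p')(1/x) exp(-1/x), which [flatD] records. *)
Definition flat p x : R := if 0 < x then p.[x^-1] * expR (- x^-1) else 0.

Lemma exprn_expR_le n (u : R) : 0 <= u -> u ^+ n * expR (- u) <= n`!%:R.
Proof.
move=> u0; rewrite expRN ler_pdivrMr ?expR_gt0 //.
case: n=> [|n].
 by rewrite expr0 mul1r -expR0 ler_expR.
have h := expR_ge1Dxn n u0.
rewrite mulrC -ler_pdivrMr ?ltr0n ?fact_gt0 //.
by apply: le_trans h; rewrite lerDr.
Qed.
(** With u = 1/x, the monomial of degree i is controlled by u^(i+2) exp(-u) <= (i+2)!, which leaves
    two spare powers of x. This gives differentiability at 0. *)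
Lemma flat_le_sqr p : exists M, 0 <= M /\ forall x, `|x| <= 1 -> `|flat p x| <= M * x ^+ 2.
Proof.
exists (\sum_(i < size p) `|p`_i| * (i.+2)`!%:R); split.
 by apply: sumr_ge0=> i _; rewrite mulr_ge0.
move=> x x1; rewrite /flat; case: ifPn=> x0; last first.
 by rewrite normr0 mulr_ge0 ?sqr_ge0 // sumr_ge0 // => i _; rewrite mulr_ge0.
rewrite horner_coef mulr_suml; apply: le_trans (ler_norm_sum _ _ _) _.
rewrite mulr_suml; apply: ler_sum=> i _.
rewrite !normrM -!mulrA ler_wpM2l // normrX !ger0_norm ?expR_ge0 ?invr_ge0 ?(ltW x0) //.
rewrite -ler_pdivrMr ?exprn_gt0 // -exprVn.
have u0 : 0 <= x^-1 by rewrite invr_ge0 ltW.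
apply: le_trans (exprn_expR_le i.+2 u0).
have -> : x^-1 ^+ i.+2 = x^-1 ^+ i * x^-1 ^+ 2 by rewrite -exprD addn2.
by rewrite mulrAC.
Qed.
Definition flatD p : {poly R} := 'X^2 * (p - p^`()).

Lemma is_derive0_sqr (f : R -> R) M : f 0 = 0 ->
 (forall x, `|x| <= 1 -> `|f x| <= M * x ^+ 2) -> is_derive (0 : R) 1 f 0.
Proof.
move=> f0 HM.
have cv : (fun h : R => h^-1 *: ((f \o shift 0) (h *: (1 : R)) - f 0)) @ 0^' --> (0 : R).
 apply/cvgrPdist_lt=> e e0.
 have M1 : 0 < `|M| + 1 by rewrite ltr_wpDl.
 have d0 : 0 < Num.min 1 (e / (`|M| + 1)) by rewrite lt_min ltr01 divr_gt0.
 exists (Num.min 1 (e / (`|M| + 1)))=> //= h; rewrite /ball_ /= sub0r normrN lt_min=> /andP[h1 h2] hn0.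
 rewrite f0 subr0 addr0 [h *: 1]mulr1 sub0r normrN normrM normfV.
 have hp : 0 < `|h| by rewrite normr_gt0.
 rewrite -ltr_pdivlMl ?invr_gt0 // invrK.
 apply: le_lt_trans (HM h (ltW h1)) _.
 rewrite -[h ^+ 2]real_normK ?num_real // expr2 mulrA mulrC ltr_pM2l //.
 apply: (@le_lt_trans _ _ ((`|M| + 1) * `|h|)).
 by rewrite ler_wpM2r // (le_trans (ler_norm _)) // lerDl.
 by rewrite mulrC -ltr_pdivlMr.
by apply: DeriveDef; [apply/cvg_ex; exists 0|exact: cvg_lim].
Qed.
Lemma is_derive_flat p x : is_derive x 1 (flat p) (flat (flatD p) x).
Proof.
have [x0|x0|->] := ltgtP x 0.
- rewrite [flat (flatD p) x]/flat ltNge (ltW x0) /=.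
 have d0 : is_derive x 1 (cst (0 : R)) (0 : R) by exact: is_derive_cst.
 apply: near_eq_is_derive d0.
 have : nbhs x [set y | y < 0] by apply: open_nbhs_nbhs; split=> //; exact: open_lt.
 by apply: filterS=> y /= y0; rewrite /flat ltNge (ltW y0).
- rewrite [flat (flatD p) x]/flat x0.
 have xn0 : x != 0 by rewrite gt_eqF.
 have dV : is_derive x 1 (fun y : R => y^-1) (- x ^- 2).
 by have := is_deriveV (f := id) xn0 (is_derive_id x 1); rewrite [_ *: _]mulr1.
 have d1 : is_derive x 1 (fun y => p.[y^-1]) (p^`().[x^-1] * (- x ^- 2)).
 exact: (is_derive1_comp (f := horner p) (g := fun y : R => y^-1)).
 have d2 : is_derive x 1 (fun y => expR (- y^-1)) (expR (- x^-1) * (x ^- 2)).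
 have dN := is_deriveN dV; rewrite opprK in dN.
 exact: (is_derive1_comp (f := expR) (g := fun y : R => - y^-1)).
 have d3 : is_derive x 1 (fun y => p.[y^-1] * expR (- y^-1)) ((flatD p).[x^-1] * expR (- x^-1)).
 have <- : p.[x^-1] *: (expR (- x^-1) / x ^+ 2) + expR (- x^-1) *: (p^`().[x^-1] * - x ^- 2) =
 (flatD p).[x^-1] * expR (- x^-1).
 rewrite /flatD !hornerE /= /GRing.scale /= !exprVn; ring.
 exact: is_deriveM d1 d2.
 apply: near_eq_is_derive d3.
 have : nbhs x [set y | 0 < y] by apply: open_nbhs_nbhs; split=> //; exact: open_gt.
 by apply: filterS=> y /= y0; rewrite /flat y0.
- rewrite [flat (flatD p) 0]/flat ltxx.
 have [M [M0 HM]] := flat_le_sqr p.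
 apply: (is_derive0_sqr _ HM); first by rewrite /flat ltxx.
Qed.
Lemma flat_ge0 x : 0 <= flat 1 x.
Proof. by rewrite /flat; case: ifP=> // _; rewrite hornerC mul1r expR_ge0. Qed.
Lemma flat1_gt0 x : 0 < x -> 0 < flat 1 x.
Proof. by move=> x0; rewrite /flat x0 hornerC mul1r expR_gt0. Qed.
Lemma flat_le0 p x : x <= 0 -> flat p x = 0.
Proof. by rewrite /flat ltNge=> ->. Qed.

End flat_functions.

(** * An explicit class of smooth functions *)

Section expressions.

(* A class of smooth functions on the plane closed under differentiation. *)
Inductive ex : Type :=
| EX | EY | EC of R | EFlat of {poly R} & ex | EAdd of ex & ex | EMul of ex & ex
| EInv of {posnum R} & ex & ex | ELn of {posnum R} & ex & ex.

Fixpoint ev e (z : plane) : R :=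
 match e with
 | EX => z.1
 | EY => z.2
 | EC c => c
 | EFlat p e => flat p (ev e z)
 | EAdd e f => ev e z + ev f z
 | EMul e f => ev e z * ev f z
 | EInv d e f => (d%:num + (ev e z ^+ 2 + ev f z ^+ 2))^-1
 | ELn d e f => ln (d%:num + (ev e z ^+ 2 + ev f z ^+ 2))
 end.

Fixpoint der (v : plane) e : ex :=
 match e with
 | EX => EC v.1
 | EY => EC v.2
 | EC c => EC 0
 | EFlat p e => EMul (EFlat (flatD p) e) (der v e)
 | EAdd e f => EAdd (der v e) (der v f)
 | EMul e f => EAdd (EMul e (der v f)) (EMul (der v e) f)
 | EInv d e f => EMul (EMul (EC (- 2)) (EMul (EInv d e f) (EInv d e f)))
 (EAdd (EMul e (der v e)) (EMul f (der v f)))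
 | ELn d e f => EMul (EMul (EC 2) (EInv d e f)) (EAdd (EMul e (der v e)) (EMul f (der v f)))
 end.

Lemma ev_den_gt0 (d : {posnum R}) (a b : R) : 0 < d%:num + (a ^+ 2 + b ^+ 2).
Proof. by rewrite ltr_pwDl // addr_ge0 // sqr_ge0. Qed.
Lemma is_derive_ev v e z : is_derive z v (ev e) (ev (der v e) z).
Proof.
have sq f : is_derive z v (ev f) (ev (der v f) z) ->
 is_derive z v (fun w => ev f w ^+ 2) (2 * (ev f z * ev (der v f) z)).
 move=> df; apply: is_derive_congr (is_deriveM df df)=> [w|]; first by rewrite fctE expr2.
 by rewrite /GRing.scale /=; ring.
have den (d : {posnum R}) g f : is_derive z v (ev g) (ev (der v g) z) ->
 is_derive z v (ev f) (ev (der v f) z) ->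
 is_derive z v (fun w => d%:num + (ev g w ^+ 2 + ev f w ^+ 2))
 (2 * (ev g z * ev (der v g) z + ev f z * ev (der v f) z)).
 move=> /sq de /sq df.
 apply: is_derive_congr (is_deriveD (is_derive_cst (d%:num : R) z v) (is_deriveD de df))=> //.
 by rewrite add0r mulrDr.
elim: e=> [||c|p e ih|e ih f ih'|e ih f ih'|d e ih f ih'|d e ih f ih'] /=.
- exact: is_derive_fst.
- exact: is_derive_snd.
- exact: is_derive_cst.
- exact: is_derive_comp_dir (is_derive_flat p _) ih.
- exact: is_deriveD.
- apply: is_derive_congr (is_deriveM ih ih')=> // .
 by rewrite /GRing.scale /=; ring.
- have n0 := lt0r_neq0 (ev_den_gt0 d (ev e z) (ev f z)).
 have dV := is_deriveV (f := id) n0 (is_derive_id _ (1 : R)).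
 apply: is_derive_congr (is_derive_comp_dir dV (den d e f ih ih'))=> //.
 by rewrite /GRing.scale /= expr2 invfM; ring.
- have dL := is_derive1_ln (ev_den_gt0 d (ev e z) (ev f z)).
 apply: is_derive_congr (is_derive_comp_dir dL (den d e f ih ih'))=> //.
 by ring.
Qed.
Lemma fst_differentiable (z : plane) : differentiable (fst : plane -> R) z.
Proof.
have := @linear_differentiable R plane R (fst : {linear plane -> R}) z.
by apply=> w; exact: cvg_fst.
Qed.
Lemma snd_differentiable (z : plane) : differentiable (snd : plane -> R) z.
Proof.
have := @linear_differentiable R plane R (snd : {linear plane -> R}) z.
by apply=> w; exact: cvg_snd.
Qed.
Lemma ev_differentiable e (z : plane) : differentiable (ev e) z.
Proof.
have M f g : differentiable (f : plane -> R) z -> differentiable (g : plane -> R) z ->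
 differentiable (fun w => f w * g w) z.
 by move=> df dg; exact: differentiableM.
elim: e=> [||c|p e ih|e ih f ih'|e ih f ih'|d e ih f ih'|d e ih f ih'] /=.
- exact: fst_differentiable.
- exact: snd_differentiable.
- exact: differentiable_cst.
- apply: (@differentiable_comp _ _ _ _ (ev e) (flat p))=> //.
 by apply/derivable1_diffP; case: (is_derive_flat p (ev e z)).
- exact: differentiableD.
- exact: M.
- have n0 := lt0r_neq0 (ev_den_gt0 d (ev e z) (ev f z)).
 apply: (@differentiable_comp _ _ _ _ (fun w => d%:num + (ev e w ^+ 2 + ev f w ^+ 2))
 (fun y : R => y^-1)).
 apply: (@differentiableD _ _ _ (fun=> d%:num)); first exact: differentiable_cst.
 by apply: (@differentiableD _ _ _ (fun w => ev e w ^+ 2)); [exact: M|exact: M].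
 by apply/derivable1_diffP; case: (is_deriveV (f := id) n0 (is_derive_id _ (1 : R))).
- apply: (@differentiable_comp _ _ _ _ (fun w => d%:num + (ev e w ^+ 2 + ev f w ^+ 2)) (@ln R)).
 apply: (@differentiableD _ _ _ (fun=> d%:num)); first exact: differentiable_cst.
 by apply: (@differentiableD _ _ _ (fun w => ev e w ^+ 2)); [exact: M|exact: M].
 by apply/derivable1_diffP; case: (is_derive1_ln (ev_den_gt0 d (ev e z) (ev f z))).
Qed.
Lemma smooth_ev e : smooth (ev e).
Proof.
move=> s z.
have -> : foldr (fun v (G : plane -> R) => 'D_v G) (ev e) s = ev (foldr der e s).
 elim: s=> // v s ih /=; rewrite ih; apply/funext=> w.
 by case: (is_derive_ev v (foldr der e s) w).
exact: ev_differentiable.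
Qed.
(** Symmetry of mixed derivatives by structural induction; it supplies the commutation clause of
    [Ck] for all expressions. *)
Lemma ev_der_comm u v e z : ev (der u (der v e)) z = ev (der v (der u e)) z.
Proof.
elim: e=> [||c|p e ih|e ih f ih'|e ih f ih'|d e ih f ih'|d e ih f ih'] //=.
- by rewrite ih; ring.
- by rewrite ih ih'.
- by rewrite ih ih'; ring.
- by rewrite ih ih'; ring.
- by rewrite ih ih'; ring.
Qed.
Definition evc e (z : plane) : C := (ev e z)%:C.

Lemma wd_evc e z : wd (evc e) z
 (2^-1 * (evc (der (1, 0) e) z - 'i%C * evc (der (0, 1) e) z))
 (2^-1 * (evc (der (1, 0) e) z + 'i%C * evc (der (0, 1) e) z)).
Proof.
have c2 := @complex2_neq0.
split.
 by apply: isD_ext (isD_real (is_derive_ev (1, 0) e z))=> //; rewrite /evc; field.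
apply: isD_ext (isD_real (is_derive_ev (0, 1) e z))=> //.
rewrite -/(evc _ _); set a := evc _ z; set b := evc _ z.
have -> : 'i%C * (2^-1 * (b - 'i%C * a) - 2^-1 * (b + 'i%C * a)) = - ('i%C * 'i%C) * a :> C.
 by field.
by rewrite ii opprK mul1r.
Qed.
Lemma ccont_evc e : ccont (evc e).
Proof.
split=> z; last exact: cst_continuous.
exact: differentiable_continuous (ev_differentiable e z).
Qed.
Lemma Ck_evc n e : Ck n (evc e).
Proof.
elim: n e=> [|n ih] e; first by apply: Ck_zero; exact: ccont_evc.
apply: (proj1 (@Ck_intro n _ _ _ (ccont_evc e) (wd_evc e) _ _ _)).
- by apply/CkZ/CkD; [exact: ih|rewrite (_ : (fun _ => _) = (fun z => - 1 * ('i%C * evc (der (0, 1) e) z)));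
 [do 2 apply: CkZ; exact: ih|apply/funext=> z; rewrite mulN1r]].
- by apply/CkZ/CkD; [exact: ih|apply: CkZ; exact: ih].
move=> _ z.
set ex := der (1, 0) e; set ey := der (0, 1) e.
rewrite (wd_dz (wdZ 2^-1 (wdD (wd_evc ex z) (wdZ 'i%C (wd_evc ey z))))).
rewrite (wd_dzb (wdZ 2^-1 (wdB (wd_evc ex z) (wdZ 'i%C (wd_evc ey z))))).
have -> : evc (der (1, 0) ey) z = evc (der (0, 1) ex) z by rewrite /evc ev_der_comm.
move: (evc (der (1, 0) ex) z) (evc (der (0, 1) ex) z) (evc (der (0, 1) ey) z)=> a b c.
ring.
Qed.

End expressions.

(** * Mass of the regularized point mass *)

Section mass.

Lemma integralT_sym (f F : R -> R) (l : R) : (forall x, 0 <= f x) -> continuous f ->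
 f =1 f \o -%R -> (forall x : R, is_derive x (1 : R) F (f x)) -> F 0 = 0 -> F x @[x --> +oo] --> l ->
 (\int[leb]_x (f x)%:E = (2 * l)%:E)%E.
Proof.
move=> f0 fc fsym dF F0 Fl.
rewrite (ge0_symfun_integralT f0 fc fsym).
have -> : [set x : R | 0 <= x] = `[0, +oo[%classic.
 by apply/seteqP; split=> x /=; rewrite in_itv /= andbT.
rewrite (@ge0_continuous_FTC2y R f F 0 l) ?F0 ?sube0 //.
- exact: continuous_subspaceT.
- apply: cvg_at_right_filter; rewrite -{2}F0.
 have /derivable1_diffP/differentiable_continuous : derivable F 0 1 by case: (dF 0).
 by [].
- by move=> x _; rewrite derive1E; case: (dF x).
Qed.
Definition sq (z : plane) : R := z.1 ^+ 2 + z.2 ^+ 2.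

Lemma sq_ge0 z : 0 <= sq z.
Proof. by rewrite addr_ge0 // sqr_ge0. Qed.
Lemma sqD_gt0 (d : R) z : 0 < d -> 0 < sq z + d.
Proof. by move=> d0; rewrite ltr_wpDl ?sq_ge0. Qed.
Lemma normc_pt2 z : normc (pt z) ^+ 2 = sq z.
Proof. by rewrite normc_sqr. Qed.
(** The dbar of conj z / (|z|^2 + d), a smoothed Cauchy kernel; an approximate identity as d tends
    to 0. *)
Definition sig (d : R) z := d / (sq z + d) ^+ 2.

Lemma sig_ge0 (d : R) z : 0 < d -> 0 <= sig d z.
Proof. by move=> d0; rewrite divr_ge0 ?sqr_ge0 // ltW. Qed.
Lemma cvgy_inv : (x : R)^-1 @[x --> +oo] --> (0 : R).
Proof.
apply/cvgrPdist_lt=> e e0; near=> x.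
have x0 : 0 < x by near: x; exact: nbhs_pinfty_gt.
rewrite sub0r normrN gtr0_norm ?invr_gt0 //.
rewrite -[e]invrK ltf_pV2 ?posrE ?invr_gt0 //; near: x; apply: nbhs_pinfty_gt; exact: num_real.
Unshelve. all: by end_near. Qed.
Lemma is_derive_sqD (d y : R) : is_derive y (1 : R) (fun y : R => y ^+ 2 + d) (2 * y).
Proof.
have <- : (y *: (1 : R) + y *: (1 : R)) + 0 = 2 * y by rewrite /GRing.scale /=; ring.
exact: is_deriveD (is_deriveM (is_derive_id y 1) (is_derive_id y 1)) (is_derive_cst d y 1).
Qed.
Lemma is_derive_inv_sqD (d y : R) : y ^+ 2 + d != 0 ->
 is_derive y (1 : R) (fun y : R => (y ^+ 2 + d)^-1) (- (y ^+ 2 + d) ^- 2 * (2 * y)).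
Proof. by move=> n; have := is_deriveV (f := fun y : R => y ^+ 2 + d) n (is_derive_sqD d y). Qed.
Lemma is_derive_atan_scale (c y : R) : c != 0 ->
 is_derive y (1 : R) (fun y : R => atan (c^-1 * y)) (c / (y ^+ 2 + c ^+ 2)).
Proof.
move=> cn0; have dc : is_derive y (1 : R) (fun y : R => c^-1 * y) (c^-1 * 1).
 have <- : c^-1 *: (1 : R) + y *: (0 : R) = c^-1 * 1 by rewrite scaler0 addr0.
 exact: is_deriveM (is_derive_cst c^-1 y (1 : R)) (is_derive_id y (1 : R)).
have := is_derive1_comp (is_derive1_atan (c^-1 * y)) dc; congr is_derive.
have n1 : y ^+ 2 + c ^+ 2 != 0 by rewrite gt_eqF // ltr_wpDl ?sqr_ge0 // exprn_even_gt0.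
have n2 : 1 + (c^-1 * y) ^+ 2 != 0 by rewrite gt_eqF // ltr_pwDl // sqr_ge0.
by field; rewrite cn0 /= n1.
Qed.
Lemma cvgy_atan_scale (c : R) : 0 < c -> atan (c^-1 * y) @[y --> +oo] --> pi / 2.
Proof.
move=> c0; apply: (@cvg_comp _ _ _ (fun y : R => c^-1 * y) atan _ +oo); last exact: cvgy_atan.
apply/cvgryPge=> A; near=> y.
rewrite mulrC ler_pdivlMr //; near: y; exact: nbhs_pinfty_ge.
Unshelve. all: by end_near. Qed.
Lemma integral_inv_sqr2 (c : R) : 0 < c ->
 (\int[leb]_y ((y ^+ 2 + c ^+ 2) ^- 2)%:E = (pi / (2 * c ^+ 3))%:E)%E.
Proof.
move=> c0; have cn0 : c != 0 by rewrite gt_eqF.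
have den (y : R) : 0 < y ^+ 2 + c ^+ 2 by rewrite ltr_wpDl ?sqr_ge0 // exprn_gt0.
pose F (y : R) := (2 * c ^+ 2)^-1 * (y * (y ^+ 2 + c ^+ 2)^-1) + (2 * c ^+ 3)^-1 * atan (c^-1 * y).
have dF (y : R) : is_derive y (1 : R) F ((y ^+ 2 + c ^+ 2) ^- 2).
 have n1 := lt0r_neq0 (den y).
 have := is_deriveD (is_deriveZ (2 * c ^+ 2)^-1 (is_deriveM (is_derive_id y (1 : R)) (is_derive_inv_sqD n1)))
 (is_deriveZ (2 * c ^+ 3)^-1 (is_derive_atan_scale y cn0)).
 rewrite /GRing.scale /=; congr is_derive.
 by field; rewrite cn0 /= n1.
rewrite (@integralT_sym _ F (pi / (4 * c ^+ 3))) //.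
- by congr EFin; field.
- by move=> y; rewrite invr_ge0 sqr_ge0.
- move=> y; have -> : (fun y : R => (y ^+ 2 + c ^+ 2) ^- 2) =
 (fun y : R => (y ^+ 2 + c ^+ 2)^-1 * (y ^+ 2 + c ^+ 2)^-1).
 by apply/funext=> t; rewrite -invfM -expr2.
 have ct : {for y, continuous (fun y : R => (y ^+ 2 + c ^+ 2)^-1)}.
 by apply: differentiable_continuous; apply/derivable1_diffP; case: (is_derive_inv_sqD (lt0r_neq0 (den y))).
 exact: (@continuousM _ _ _ _ y ct ct).
- by move=> y /=; rewrite sqrrN.
- by rewrite /F !mul0r !mulr0 atan0 mulr0 addr0.
have -> : pi / (4 * c ^+ 3) = (2 * c ^+ 2)^-1 * 0 + (2 * c ^+ 3)^-1 * (pi / 2) :> R.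
 by field.
apply: cvgD; apply: cvgMr; last exact: cvgy_atan_scale.
apply: (@squeeze_cvgr _ _ _ _ (fun _ => 0) (fun y : R => y^-1)); last 2 first.
- exact: cvg_cst.
- exact: cvgy_inv.
near=> y.
have y0 : 0 < y by near: y; exact: nbhs_pinfty_gt.
rewrite divr_ge0 ?(ltW y0) ?(ltW (den y)) //= ler_pdivrMr //.
by rewrite mulrDr expr2 mulKf ?gt_eqF // lerDl mulr_ge0 ?sqr_ge0 // invr_ge0 ltW.
Unshelve. all: by end_near. Qed.
Lemma integral_inv_sqrt3 (d : R) : 0 < d ->
 (\int[leb]_x (Num.sqrt (x ^+ 2 + d) ^- 3)%:E = (2 / d)%:E)%E.
Proof.
move=> d0; have dn0 : d != 0 by rewrite gt_eqF.
pose s (x : R) : R := Num.sqrt (x ^+ 2 + d).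
have den (y : R) : 0 < y ^+ 2 + d by rewrite ltr_wpDl ?sqr_ge0.
have s0 x : 0 < s x by rewrite sqrtr_gt0.
have s2 x : s x ^+ 2 = x ^+ 2 + d by rewrite sqr_sqrtr // ltW.
have ds (y : R) : is_derive y (1 : R) s ((2 * s y)^-1 * (2 * y)).
 exact: (@is_derive1_comp _ Num.sqrt (fun y : R => y ^+ 2 + d) y _ _ (is_derive1_sqrt (den y)) (is_derive_sqD d y)).
have dinv (y : R) : is_derive y (1 : R) (fun y : R => (s y)^-1)
 (- (s y) ^- 2 * ((2 * s y)^-1 * (2 * y))).
 have := is_deriveV (f := s) (lt0r_neq0 (s0 y)) (ds y).
 by rewrite /GRing.scale.
pose F (y : R) := d^-1 * (y * (s y)^-1).
have dF (y : R) : is_derive y (1 : R) F ((s y) ^- 3).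
 have := is_deriveZ d^-1 (is_deriveM (is_derive_id y (1 : R)) (dinv y)).
 rewrite /GRing.scale /=; congr is_derive.
 have n1 := lt0r_neq0 (s0 y).
 have -> : s y ^- 3 = d^-1 * ((s y ^+ 2 - y ^+ 2) * s y ^- 3) by rewrite s2; field; rewrite n1.
 by field; rewrite n1 dn0.
rewrite (@integralT_sym _ F d^-1) //.
- move=> y; have -> : (fun y : R => Num.sqrt (y ^+ 2 + d) ^- 3) =
 (fun y : R => (s y)^-1 * ((s y)^-1 * (s y)^-1)).
 by apply/funext=> t; rewrite -!invfM -expr2 -exprS.
 have ct : {for y, continuous (fun y : R => (s y)^-1)}.
 by apply: differentiable_continuous; apply/derivable1_diffP; case: (dinv y).
 exact: (@continuousM _ _ _ _ y ct (@continuousM _ _ _ _ y ct ct)).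
- by move=> y /=; rewrite sqrrN.
- by rewrite /F mul0r mulr0.
rewrite -[X in _ --> X]mulr1; apply: cvgMr.
apply: (@squeeze_cvgr _ _ _ _ (fun y : R => 1 - d * y^-1) (fun _ => 1)); last 2 first.
- rewrite -[X in _ --> X]subr0 -(mulr0 d); apply: cvgB; first exact: cvg_cst.
 by apply: cvgMr; exact: cvgy_inv.
- exact: cvg_cst.
near=> y.
have y0 : 0 < y by near: y; exact: nbhs_pinfty_gt.
have y1 : 1 < y by near: y; exact: nbhs_pinfty_gt.
have ys : y <= s y by rewrite -ler_sqr ?nnegrE ?(ltW y0) ?(ltW (s0 y)) // s2 lerDl ltW.
rewrite ler_pdivrMr // mul1r ys andbT ler_pdivlMr //.
rewrite -(ler_pM2r y0) mulrAC mulrBl mul1r mulrVK ?unitfE ?gt_eqF //.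
have h : s y * (s y - y) <= d * s y.
 apply: (le_via ((s y + y) * (s y - y))).
 by apply: ler_wpM2r; [rewrite subr_ge0|rewrite lerDl ltW].
 rewrite mulrC -subr_sqr s2 addrAC subrr add0r ler_peMr ?(ltW d0) //.
 exact: le_trans (ltW y1) ys.
rewrite mulrBl -expr2 in h *.
have : (s y - y) * y <= (s y - y) * s y by rewrite ler_wpM2l ?subr_ge0.
lra.
Unshelve. all: by end_near. Qed.
Lemma ccont_sq : continuous sq.
Proof.
move=> z; have f : {for z, continuous (@fst R R)} by exact: cvg_fst.
have s : {for z, continuous (@snd R R)} by exact: cvg_snd.
exact: continuousD (continuousM f f) (continuousM s s).
Qed.
Lemma meas_sig (d : R) : mfun (sig d).
Proof.
apply: mfunM; first exact: mcst.
apply/meas_inv/measurable_funX/mfunD; last exact: mcst.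
exact: continuous_measurable_plane ccont_sq.
Qed.
(** Iterated integration with explicit primitives: the inner integral is (d pi / 2) (x^2 +
    d)^(-3/2), the outer one contributes 2 / d, and the total pi is cancelled by the normalization
    of dA. *)
Lemma mass_sig (d : R) : 0 < d -> aint (fun z => (sig d z)%:E) = 1%E.
Proof.
move=> d0; rewrite area_intE.
rewrite (fubini_tonelli1 (m1 := leb) (m2 := leb) (fun z : plane => (sig d z)%:E)); last 2 first.
- by apply/mEFin; exact: meas_sig.
- by move=> z; rewrite lee_fin sig_ge0.
rewrite /fubini_F.
have E x : (\int[leb]_y (sig d (x, y))%:E = (d * pi / 2 * Num.sqrt (x ^+ 2 + d) ^- 3)%:E)%E.
 have s0 : 0 < Num.sqrt (x ^+ 2 + d) by rewrite sqrtr_gt0 ltr_wpDl ?sqr_ge0.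
 under eq_integral.
 move=> y _; rewrite /sig /sq /= -addrA [y ^+ 2 + d]addrC addrA addrC.
 rewrite -[x ^+ 2 + d]sqr_sqrtr; last by rewrite ltW // ltr_wpDl ?sqr_ge0.
 rewrite EFinM; over.
 rewrite ge0_integralZl_EFin ?(ltW d0) //; last 2 first.
 - by move=> y _; rewrite lee_fin invr_ge0 sqr_ge0.
 - apply/mEFin/meas_inv/measurable_funX/mfunD; last exact: mcst.
 exact: measurable_funX.
 rewrite integral_inv_sqr2 // -EFinM; congr EFin.
 by field; rewrite gt_eqF.
under eq_integral do rewrite E EFinM.
rewrite ge0_integralZl_EFin ?divr_ge0 ?mulr_ge0 ?pi_ge0 ?(ltW d0) //; last first.
- apply/mEFin/meas_inv/measurable_funX.
 apply: mcomp; first by apply: continuous_measurable_fun; exact: sqrt_continuous.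
 by apply/mfunD; [exact: measurable_funX|exact: mcst].
rewrite integral_inv_sqrt3 // -!EFinM; congr EFin.
have p0 : (pi : R) != 0 by rewrite gt_eqF // pi_gt0.
have dn0 := lt0r_neq0 d0.
clear E; move: (pi : R) p0=> P p0.
by field; rewrite p0 dn0.
Qed.

End mass.

(** * Power integrals on the line and local integrability of 1 / |z| *)

Section line_integrals.

Lemma ge0_integral_refl1 (a : R) (f : R -> \bar R) : mfun f ->
 (forall x, (0 <= f x)%E) -> (\int[leb]_x f (a - x)%R = \int[leb]_x f x)%E.
Proof.
move=> mf f0.
transitivity (\int[pushforward leb (refl1 a)]_x f x)%E.
 by rewrite ge0_integral_pushforward//; exact: meas_refl1.
apply: eq_measure_integral=> A mA _; exact: leb_refl1.
Qed.
Lemma ge0_integral_shift1 (a : R) (f : R -> \bar R) : mfun f ->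
 (forall x, (0 <= f x)%E) -> (\int[leb]_x f (x - a)%R = \int[leb]_x f x)%E.
Proof.
move=> mf f0; rewrite -[RHS](ge0_integral_refl1 0) //.
rewrite -[RHS](ge0_integral_refl1 a) //; last first.
 by apply: (mcomp mf); exact: meas_refl1.
by apply: eq_integral=> x _; congr f; rewrite sub0r opprB.
Qed.
Definition ind_pow (s r t : R) : R := if (0 < t) && (t <= r) then t `^ (- s) else 0.

Lemma ind_pow_ge0 s r t : 0 <= ind_pow s r t.
Proof. by rewrite /ind_pow; case: ifP=> // _; exact: powR_ge0. Qed.
Lemma meas_powR_fun (a : R) : mfun (fun t : R => t `^ a).
Proof. exact: measurable_powR. Qed.
Lemma meas_ind_pow s r : mfun (ind_pow s r).
Proof.
apply: measurable_fun_if=> //.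
- apply: measurable_and; [exact: measurable_fun_ltr|exact: measurable_fun_ler].
- exact: measurable_funTS (meas_powR_fun _).
Qed.
(** The integrand is singular at 0: the fundamental theorem applies on [r / (i + 2), r], and
    monotone convergence exhausts ]0, r]. *)
Lemma integral_ind_pow s r : 0 < s -> s < 1 -> 0 < r ->
 (\int[leb]_t (ind_pow s r t)%:E <= (r `^ (1 - s) / (1 - s))%:E)%E.
Proof.
move=> s0 s1 r0; have s10 : 0 < 1 - s by rewrite subr_gt0.
pose f (t : R) : R := t `^ (- s).
pose F (i : nat) : set R := `[r / i.+2%:R, r]%classic.
have ri (i : nat) : 0 < r / i.+2%:R by rewrite divr_gt0.
have ri1 (i : nat) : r / i.+2%:R < r by rewrite ltr_pdivrMr // ltr_pMr // ltr1n.
have cf (t : R) : 0 < t -> {for t, continuous f}.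
 move=> t0; apply: differentiable_continuous; apply/derivable1_diffP.
 by case: (is_derive1_powR (- s) t0).
have dF (t : R) : 0 < t -> is_derive t (1 : R) (fun t : R => (1 - s)^-1 * t `^ (1 - s)) (f t).
 move=> t0; have := is_deriveZ (1 - s)^-1 (is_derive1_powR (1 - s) t0).
 by rewrite /GRing.scale /= mulKf ?gt_eqF // addrAC subrr add0r.
have IF i : (\int[leb]_(t in F i) (f t)%:E <= (r `^ (1 - s) / (1 - s))%:E)%E.
 rewrite (@continuous_FTC2 R f (fun t : R => (1 - s)^-1 * t `^ (1 - s)) _ _ (ri1 i)).
 - rewrite -EFinB lee_fin [X in X - _]mulrC gerBl mulr_ge0 ?powR_ge0 // invr_ge0 ltW //.
 - apply: continuous_in_subspaceT=> t; rewrite inE /= in_itv /= => /andP[h _].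
 by apply: cf; exact: lt_le_trans h.
 - have cF (t : R) : 0 < t -> {for t, continuous (fun t : R => (1 - s)^-1 * t `^ (1 - s))}.
 move=> t0; apply: differentiable_continuous; apply/derivable1_diffP.
 by case: (dF t t0).
 split.
 + by move=> t; rewrite in_itv /= => /andP[h _]; case: (dF t (lt_trans (ri i) h)).
 + by apply: cvg_at_right_filter; exact: cF.
 + by apply: cvg_at_left_filter; exact: cF.
 - by move=> t; rewrite in_itv /= => /andP[h _]; rewrite derive1E; case: (dF t (lt_trans (ri i) h)).
have UF : \bigcup_i F i = [set t | (0 < t) && (t <= r)].
 apply/seteqP; split=> t /=.
 by case=> i _; rewrite /F /= in_itv /= => /andP[h ->]; rewrite (lt_le_trans (ri i) h).
 move=> /andP[t0 tr]; exists (Num.bound (r / t))=> //; rewrite /F /= in_itv /= tr andbT.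
 rewrite ler_pdivrMr // mulrC -ler_pdivrMr //; apply: ltW.
 apply: lt_trans (archi_boundP (ltW (divr_gt0 r0 t0))) _.
 by rewrite ltr_nat -addn2 -[X in (X < _)%N]addn0 ltn_add2l.
have mf : mfun (fun t => (f t)%:E) by apply/mEFin; exact: meas_powR_fun.
have -> : (\int[leb]_t (ind_pow s r t)%:E = \int[leb]_(t in \bigcup_i F i) (f t)%:E)%E.
 rewrite UF [RHS]integral_mkcond; apply: eq_integral=> t _; rewrite patchE /ind_pow.
 by case: ifPn=> h; [rewrite mem_set|rewrite memNset //; exact/negP].
have /cvg_lim <- // : (\int[leb]_(t in F i) (f t)%:E)%E @[i --> \oo] -->
 (\int[leb]_(t in \bigcup_i F i) (f t)%:E)%E.
 apply: ge0_nondecreasing_set_cvg_integral.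
 - move=> i j ij; apply/subsetPset=> t; rewrite /F /= !in_itv /= => /andP[h ->]; rewrite andbT.
 by apply: le_trans h; rewrite ler_pM2l // lef_pV2 ?posrE // ler_nat.
 - by move=> i; exact: measurable_itv.
 - by move=> i; exact: measurable_funTS.
 - by move=> i t _; rewrite lee_fin powR_ge0.
apply: lime_le; last by near=> i; exact: IF.
apply/cvg_ex; eexists; apply: ge0_nondecreasing_set_cvg_integral.
- move=> i j ij; apply/subsetPset=> t; rewrite /F /= !in_itv /= => /andP[h ->]; rewrite andbT.
 by apply: le_trans h; rewrite ler_pM2l // lef_pV2 ?posrE // ler_nat.
- by move=> i; exact: measurable_itv.
- by move=> i; exact: measurable_funTS.
- by move=> i t _; rewrite lee_fin powR_ge0.
Unshelve. all: by end_near. Qed.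
Definition ind_pow2 s r t : R := ind_pow s r t + ind_pow s r (0 - t).

Lemma ind_pow2_ge0 s r t : 0 <= ind_pow2 s r t.
Proof. by rewrite addr_ge0 ?ind_pow_ge0. Qed.
Lemma meas_ind_pow2 s r : mfun (ind_pow2 s r).
Proof.
apply: mfunD; first exact: meas_ind_pow.
apply: (mcomp (meas_ind_pow s r)).
by apply: mfunB=> //; exact: mcst.
Qed.
Lemma integral_ind_pow2 s r : 0 < s -> s < 1 -> 0 < r ->
 (\int[leb]_t (ind_pow2 s r t)%:E <= (2 * (r `^ (1 - s) / (1 - s)))%:E)%E.
Proof.
move=> s0 s1 r0; rewrite /ind_pow2.
have m := meas_ind_pow s r.
have mE : mfun (fun t => (ind_pow s r t)%:E) by exact/mEFin.
under eq_integral do rewrite EFinD.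
rewrite ge0_integralD //; last 3 first.
- by move=> t _; rewrite lee_fin ind_pow_ge0.
- by move=> t _; rewrite lee_fin ind_pow_ge0.
- apply: (mcomp mE).
 by apply: mfunB=> //; exact: mcst.
rewrite (ge0_integral_refl1 0 mE); last by move=> t; rewrite lee_fin ind_pow_ge0.
by rewrite mulrDl !mul1r EFinD; apply: leeD; exact: integral_ind_pow.
Qed.
Lemma ind_pow2E s r t : t != 0 -> ind_pow2 s r t = if `|t| <= r then `|t| `^ (- s) else 0.
Proof.
move=> t0; rewrite /ind_pow2 /ind_pow sub0r oppr_gt0.
case: (ltgtP t 0) t0=> // h _ /=.
 by rewrite add0r ltr0_norm.
by rewrite addr0 gtr0_norm.
Qed.
(** The null set on which the product majorant of 1 / |z| fails, because [ind_pow] takes the value 0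
    at 0. *)
Definition axes : set plane := [set z | z.1 = 0 \/ z.2 = 0].

Lemma meas_axes : measurable axes.
Proof.
have -> : axes = ([set 0] `*` setT) `|` (setT `*` [set 0]).
 by apply/seteqP; split=> z /=; rewrite /axes /=; [case=> h; [left|right]|case=> [][]; [left|right]].
by apply: measurableU; apply: measurableX.
Qed.
Lemma axes0 : mu axes = 0%E.
Proof.
have -> : axes = ([set 0] `*` setT) `|` (setT `*` [set 0]).
 by apply/seteqP; split=> z /=; rewrite /axes /=; [case=> h; [left|right]|case=> [][]; [left|right]].
have m1 : measurable ([set 0] `*` setT : set plane) by apply: measurableX.
have m2 : measurable (setT `*` [set 0] : set plane) by apply: measurableX.
have e1 : mu ([set 0] `*` setT : set plane) = 0%E.
 by rewrite /lam2 product_measure1E //= lebesgue_measure_set1 mul0e.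
have e2 : mu (setT `*` [set 0] : set plane) = 0%E.
 by rewrite /lam2 product_measure1E //= lebesgue_measure_set1 mule0.
pose m : {measure set (measurableTypeR R * measurableTypeR R) -> \bar R} := mu.
by rewrite -e1; exact: (@measureU0 _ _ _ m _ _ m1 m2 e2).
Qed.
Lemma lam2_point (a : plane) : mu [set a] = 0%E.
Proof.
have -> : [set a] = [set a.1] `*` [set a.2].
 by apply/seteqP; split=> z /=; [move=> ->|case: z a=> x y [x' y'] /= [-> ->]].
by rewrite /lam2 product_measure1E //= !lebesgue_measure_set1 mul0e.
Qed.
Lemma normc_pt_le (z : plane) : normc (pt z) <= 2 * `|z|.
Proof.
apply: le_trans (normc_le_ReIm _) _; rewrite mulrDl !mul1r norm_planeE.
by apply: lerD; rewrite le_max lexx ?orbT.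
Qed.
Lemma le_normc_pt (z : plane) : `|z| <= normc (pt z).
Proof. by rewrite norm_planeE ge_max; apply/andP; split; [exact: (normc_Re (pt z))|exact: (normc_Im (pt z))]. Qed.
Definition invabs (r : R) z : R := if `|z| <= r then (normc (pt z))^-1 else 0.

Lemma invabs_ge0 r z : 0 <= invabs r z.
Proof. by rewrite /invabs; case: ifP=> // _; rewrite invr_ge0 normc_ge0. Qed.
Lemma meas_invabs r : mfun (invabs r).
Proof.
apply: measurable_fun_if=> //.
- have -> : (fun z : plane => `|z| <= r) = (fun z => z \in [set z : plane | `|z| <= r]).
 by apply/funext=> z; rewrite mem_setE.
 apply: (@measurable_fun_bool _ _ _ _ true).
 rewrite setTI (_ : _ @^-1` _ = [set z : plane | `|z| <= r]); first exact: meas_box.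
 by apply/seteqP; split=> z /=; rewrite mem_setE.
- by apply: measurable_funTS; apply: meas_inv; apply: meas_normc; exact: cmfun_pt.
Qed.
(** Since |x| |y| <= |z|^2, one has 1 / |z| <= |x|^(-1/2) |y|^(-1/2) off the axes, a product of
    integrable functions of one variable. This takes the place of polar coordinates. *)
Lemma rintg_invabs r : 0 < r -> rintg (invabs r).
Proof.
move=> r0; apply/rintgP; split; first exact: meas_invabs.
have m2 := @meas_ind_pow2 2^-1 r.
pose G (z : plane) : \bar R := (ind_pow2 2^-1 r z.1 * ind_pow2 2^-1 r z.2)%:E.
have mG : mfun G.
 apply/mEFin; apply: mfunM.
 exact: (mcomp m2 mfst).
 exact: (mcomp m2 msnd).
have G0 z : (0 <= G z)%E by rewrite lee_fin mulr_ge0 ?ind_pow2_ge0.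
apply: (@le_lt_trans _ _ (\int[mu]_z G z)%E).
 apply: ae_ge0_le_integral=> //.
 - by apply/mEFin; apply: mcomp=> //; exact: meas_invabs.
 exists axes; split; [exact: meas_axes|exact: axes0|].
 move=> z /= H; apply: contrapT=> nz; apply: H=> _.
 have z1 : z.1 != 0 by apply/eqP=> e; apply: nz; left.
 have z2 : z.2 != 0 by apply/eqP=> e; apply: nz; right.
 rewrite /G !ind_pow2E // ger0_norm ?invabs_ge0 // lee_fin /invabs norm_planeE ge_max.
 case: ifP=> /= [/andP[-> ->]|]; last by move=> _; rewrite mulr_ge0 //; case: ifP=> // _; exact: powR_ge0.
 have p1 : 0 < `|z.1| by rewrite normr_gt0.
 have p2 : 0 < `|z.2| by rewrite normr_gt0.
 have p : 0 < `|z.1| * `|z.2| by rewrite mulr_gt0.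
 rewrite -/(normc (pt z)).
 have n0 : 0 < normc (pt z) by apply: lt_le_trans p1 _; exact: (normc_Re (pt z)).
 rewrite -powRM // powRN lef_pV2 ?posrE ?powR_gt0 // powR12_sqrt ?(ltW p) //.
 rewrite -ler_sqr ?nnegrE ?sqrtr_ge0 ?normc_ge0 // sqr_sqrtr ?(ltW p) // normc_pt2 /sq.
 rewrite -[z.1 ^+ 2]real_normK ?num_real // -[z.2 ^+ 2]real_normK ?num_real //.
 by have := sqr_ge0 (`|z.1| - `|z.2|); have := sqr_ge0 (`|z.1| + `|z.2|); nra.
rewrite (fubini_tonelli1 (m1 := leb) (m2 := leb) G mG G0) /fubini_F /G /=.
pose c := (\int[leb]_t (ind_pow2 2^-1 r t)%:E)%E.
have mE : mfun (fun t => (ind_pow2 2^-1 r t)%:E) by exact/mEFin.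
have coo : (c < +oo)%E.
 by apply: le_lt_trans (integral_ind_pow2 _ _ r0) _; rewrite ?ltry ?invr_gt0 // invf_lt1 // ltr1n.
have c0 : (0 <= c)%E by apply: integral_ge0=> t _; rewrite lee_fin ind_pow2_ge0.
have E x : (\int[leb]_y (ind_pow2 2^-1 r x * ind_pow2 2^-1 r y)%:E = (ind_pow2 2^-1 r x)%:E * c)%E.
 under eq_integral do rewrite EFinM.
 rewrite ge0_integralZl_EFin ?ind_pow2_ge0 //.
 by move=> y _; rewrite lee_fin ind_pow2_ge0.
under eq_integral do rewrite E.
rewrite ge0_integralZr //; last by move=> y _; rewrite lee_fin ind_pow2_ge0.
by rewrite -/c lte_mul_pinfty // ge0_fin_numE.
Qed.

End line_integrals.

(** * Continuity of translations in L^1 *)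

Section translation.

Lemma integral_supp_bounded (g : R -> R) r M : mfun g ->
 (forall x, `|g x| <= M) -> (forall x, r < `|x| -> g x = 0) ->
 (leb : {measure set (measurableTypeR R) -> \bar R}).-integrable setT (EFin \o g).
Proof.
move=> mg gM g0; have M0 : 0 <= M := le_trans (normr_ge0 _) (gM 0).
pose E : set R := `[- r, r]%classic; have mE : measurable E by exact: measurable_itv.
apply/integrableP; split; first exact/mEFin.
have Eoo : (leb E < +oo)%E.
 by rewrite /E lebesgue_measure_itv //=; case: ifP=> // _; rewrite -EFinD ltry.
have gE x : `|g x| <= M * \1_E x.
 rewrite indicE mem_setE in_itv /= -ler_norml.
 by case: (leP `|x| r)=> h; rewrite ?mulr1 // g0 // normr0 mulr0.
apply: (@le_lt_trans _ _ (\int[leb]_x (M%:E * (\1_E x)%:E))%E).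
 apply: ge0_le_integral=> //.
 - by apply: mcomp=> //; exact/mEFin.
 - by apply: measurable_funeM; apply/mEFin; exact: measurable_indic.
 - by move=> x _; rewrite /= -EFinM lee_fin; exact: gE.
rewrite ge0_integralZl_EFin //; last first.
 by apply/mEFin; exact: measurable_indic.
rewrite integral_indic // setIT; exact: lte_mul_pinfty.
Qed.
Lemma integrable_step r c : leb.-integrable setT (EFin \o (fun x : R => if `|x| <= r then c else 0)).
Proof.
apply: (@integral_supp_bounded _ r `|c|)=> [|x|x h]; last by rewrite leNgt h.
 by apply: measurable_fun_if=> //; apply: measurable_fun_ler=> //; exact: measurable_normr.
by case: ifP=> _; rewrite ?normr0.
Qed.
Lemma cvge0_intro (u : nat -> \bar R) : (forall n, 0 <= u n)%E ->
 (forall e, 0 < e -> evt n, (u n <= e%:E)%E) -> u @ \oo --> 0%E.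
Proof.
move=> u0 H; apply/fine_cvgP; split.
 have [N HN] := H 1 ltr01; exists N=> // n /= Nn.
 by rewrite ge0_fin_numE // (le_lt_trans (HN n Nn)) ?ltry.
apply/cvgrPdist_le=> e e0; have [N HN] := H e e0; exists N=> // n /= Nn.
have h := HN n Nn.
have f : u n \is a fin_num by rewrite ge0_fin_numE // (le_lt_trans h) ?ltry.
by rewrite sub0r normrN ger0_norm ?fine_ge0 // -lee_fin fineK.
Qed.
(** f is approximated in L^1 by a continuous h on |x| <= r + 2. Shifts are at most 1, so the
    integrand vanishes beyond r + 1 and all shifted points that matter stay in the larger interval,
    where h is bounded. *)
Lemma translation1 (f : R -> R) (r M : R) (a : R^nat) : mfun f ->
 (forall x, `|f x| <= M) -> (forall x, r < `|x| -> f x = 0) ->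
 (forall n, `|a n| <= 1) -> a @ \oo --> (0 : R) ->
 (fun n => \int[leb]_x `|f (x - a n) - f x|%:E)%E @ \oo --> 0%E.
Proof.
move=> mf fM f0 a1 a0.
pose E s : set R := `[- s, s]%classic; have mE s : measurable (E s) by exact: measurable_itv.
have EE s x : (x \in E s) = (`|x| <= s) by rewrite mem_setE in_itv /= -ler_norml.
have Eoo s : (leb (E s) < +oo)%E.
 by rewrite /E lebesgue_measure_itv //=; case: ifP=> // _; rewrite -EFinD ltry.
have iE : leb.-integrable (E (r + 2)) (EFin \o f).
 by apply: integrableS (integral_supp_bounded mf fM f0)=> //; exact: mE.
have [g [gc gi gcv]] := approximation_continuous_integrable (mE _) (Eoo _) iE.
apply: cvge0_intro=> [n|e e0]; first exact: integral_ge0.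
have e3 : 0 < e / 3 by rewrite divr_gt0.
have [N1 /(_ N1 (leqnn _)) HN1] := cvge0_le gcv e3.
pose h := g N1; have ch : continuous h := gc N1.
have mh : mfun h := continuous_measurable_fun ch.
have [B HB] : exists B, forall x, `|x| <= r + 2 -> `|h x| <= B.
 have cb : compact (h @` E (r + 2)).
 by apply: continuous_compact; [exact: continuous_subspaceT|exact: segment_compact].
 have [B [_ HB]] := compact_bounded cb; exists (B + 1)=> x xE.
 by apply: (HB (B + 1)); rewrite ?ltrDl //; exists x=> //; apply: set_mem; rewrite EE.
have mg (k : R -> R) n : mfun k -> mfun (fun x : R => k (x - a n)).
 by move=> mk; apply: (mcomp mk); apply: mfunB=> //; exact: mcst.
have mN (k l : R -> R) : mfun k -> mfun l ->
 mfun (fun x => `|k x - l x|%:E).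
 by move=> mk ml; apply/mEFin; apply: mcomp=> //; exact: mfunB.
have ms x n : `|x| <= r + 1 -> `|x - a n| <= r + 2.
 by move=> xr; have := ler_normB x (a n); have := a1 n; lra.
have [N2 HN2] : evt n, (\int[leb]_(x in E (r + 1)%R) `|h (x - a n) - h x|%:E <= (e / 3)%:E)%E.
 apply: cvge0_le e3.
 have := @dominated_convergence _ _ _ leb (E (r + 1)) (mE _) (fun n x => (h (x - a n))%:E)
 (fun x => (h x)%:E) (EFin \o (fun x => if `|x| <= r + 1 then B else 0)).
 case=> //.
 - by move=> n; apply: measurable_funTS; apply/mEFin; exact: mg.
 - by apply: measurable_funTS; exact/mEFin.
 - exists set0; split=> // x /= H; apply: H=> _; apply: cvg_EFin; first by exists 0%N.
 have xa : (fun n => (x : R) - a n) @ \oo --> (x : R).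
 by rewrite -[X in _ --> X]subr0; apply: cvgB=> //; exact: cvg_cst.
 exact: cvg_comp xa (ch x).
 - by apply: integrableS (integrable_step (r + 1) B)=> //; exact: mE.
 - exists set0; split=> // x /= H; apply: H=> n /mem_set; rewrite EE=> xr.
 by rewrite /= xr lee_fin; apply: HB; exact: ms.
exists N2=> n Nn.
pose u : R -> \bar R := (fun x => `|f x - h x|%:E) \_ (E (r + 2)).
pose v : R -> \bar R := (fun x => `|h (x - a n) - h x|%:E) \_ (E (r + 1)).
have mu : mfun u by apply/(measurable_restrictT _ (mE _)); apply: measurable_funTS; exact: mN.
have mv : mfun v.
 by apply/(measurable_restrictT _ (mE _)); apply: measurable_funTS; apply: mN=> //; exact: mg.
have u0 x : (0 <= u x)%E by rewrite /u patchE; case: ifP.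
have v0 x : (0 <= v x)%E by rewrite /v patchE; case: ifP.
have mua : mfun (fun x : R => u (x - a n)).
 by apply: (mcomp mu); apply: mfunB=> //; exact: mcst.
apply: (le_via (\int[leb]_x (u (x - a n)%R + v x + u x))%E).
 apply: ge0_le_integral=> //.
 - by apply: mN=> //; exact: mg.
 - by apply: emeasurable_funD=> //; exact: emeasurable_funD.
 move=> x _; case: (leP `|x| (r + 1))=> xr.
 rewrite /u /v !patchE !EE xr ms // ifT; last by apply: le_trans xr _; rewrite lerD2l ler1n.
 rewrite -!EFinD lee_fin.
 have -> : f (x - a n) - f x = ((f (x - a n) - h (x - a n)) + (h (x - a n) - h x)) + (h x - f x).
 by ring.
 apply: le_trans (ler_normD _ _) _; apply: lerD; last by rewrite distrC.
 exact: ler_normD.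
 rewrite !f0 ?subrr ?normr0 ?adde_ge0 //; first by apply: lt_trans xr; rewrite ltrDl.
 by have := lerB_dist x (a n); have := a1 n; lra.
rewrite ge0_integralD //; last 2 first.
- by move=> x _; rewrite adde_ge0.
- exact: emeasurable_funD.
rewrite ge0_integralD // (ge0_integral_shift1 (a n) (f := u)) // /u /v -!integral_mkcond.
have -> : e%:E = ((e / 3)%:E + (e / 3)%:E + (e / 3)%:E)%E by rewrite -!EFinD; congr EFin; field.
by apply: leeD=> //; apply: leeD=> //; exact: HN2.
Qed.
(** The one-dimensional case applies on each vertical line; these inner integrals are bounded and
    vanish for |x| > r, so dominated convergence integrates them. *)
Lemma translation_inner (F : R * R -> R) (r M : R) (b : R^nat) :
 mfun (F : measurableTypeR R * measurableTypeR R -> R) ->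
 (forall z, `|F z| <= M) -> (forall z : plane, r < `|z| -> F z = 0) ->
 (forall n, `|b n| <= 1) -> b @ \oo --> (0 : R) ->
 (fun n => \int[leb]_x \int[leb]_y `|F (x, y - b n) - F (x, y)|%:E)%E @ \oo --> 0%E.
Proof.
move=> mF FM F0 b1 b0; have M0 : 0 <= M := le_trans (normr_ge0 _) (FM 0).
have mx x : mfun (fun y => F (x, y)) by exact: (mcomp mF (measurable_pair1 _)).
have F0x x (y : R) : r < `|y| -> F (x, y) = 0.
 by move=> yr; apply: F0; apply: lt_le_trans yr _; rewrite norm_planeE le_max lexx orbT.
have inner x := @translation1 _ r M b (mx x) (fun y => FM (x, y)) (F0x x) b1 b0.
pose c := 2 * M * (2 * `|r| + 4).
pose d (x : R) : R := if `|x| <= r then c else 0.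
have c0 : 0 <= c by rewrite mulr_ge0 ?mulr_ge0 // addr_ge0 ?mulr_ge0.
have id : leb.-integrable setT (EFin \o d) := integrable_step r c.
have mG n : mfun (fun z : measurableTypeR R * measurableTypeR R =>
 `|F (z.1, z.2 - b n) - F z|%:E).
 apply/mEFin; apply: mcomp=> //; apply: mfunB=> //.
 rewrite (_ : (fun _ => _) = F \o (fun z : plane => z + (0, - b n))).
 exact: (mcomp mF (meas_shift _)).
 apply/funext=> -[x y] /=.
 by have -> : (x, y) + (0, - b n) = (x + 0, y - b n) :> plane by []; rewrite addr0.
have mI n : mfun (fun x => \int[leb]_y `|F (x, y - b n) - F (x, y)|%:E)%E.
 have G0 (z : R * R) : (0 <= `|F (z.1, z.2 - b n) - F z|%:E)%E by rewrite lee_fin.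
 exact: (@measurable_fun_fubini_tonelli_F _ _ _ _ R leb _ (mG n) G0).
have hd n x : (`|\int[leb]_y `|F (x, y - b n) - F (x, y)|%:E| <= (d x)%:E)%E.
 rewrite gee0_abs ?integral_ge0 // /d; case: (leP `|x| r)=> xr; last first.
 rewrite integral0_eq // => y _; rewrite !F0 ?subrr ?normr0 //; apply: lt_le_trans xr _.
 by rewrite norm_planeE le_max lexx.
 by rewrite norm_planeE le_max lexx.
 pose E : set R := `[- (`|r| + 1), `|r| + 1]%classic.
 have mE : measurable E by exact: measurable_itv.
 have lE : leb E = (2 * `|r| + 2)%:E.
 rewrite /E lebesgue_measure_itv /= lte_fin ifT; last by have := normr_ge0 r; lra.
 by rewrite -EFinB; congr EFin; ring.
 apply: (le_via (\int[leb]_y ((2 * M)%:E * (\1_E y)%:E))%E).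
 apply: ge0_le_integral=> //.
 - exact: (mcomp (mG n) (measurable_pair1 x)).
 - by apply: measurable_funeM; apply/mEFin; exact: measurable_indic.
 move=> y _; rewrite -EFinM lee_fin indicE mem_setE in_itv /= -ler_norml.
 case: (leP `|y| (`|r| + 1))=> yr; rewrite ?mulr1 ?mulr0.
 rewrite mulrDl !mul1r; apply: le_trans (ler_normB _ _) _; exact: lerD.
 have := lerB_dist y (b n); have := b1 n; have := ler_norm r=> *.
 rewrite !F0 ?subrr ?normr0 //; rewrite norm_planeE lt_max; apply/orP; right=> /=; lra.
 rewrite ge0_integralZl_EFin ?mulr_ge0 //; last by apply/mEFin; exact: measurable_indic.
 rewrite integral_indic // setIT.
 apply: (le_via ((2 * M)%:E * leb E)%E); first exact: lexx.
 rewrite lE.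
 by rewrite -EFinM lee_fin /c ler_wpM2l ?mulr_ge0 //; lra.
have aed : {ae leb, forall x : R, forall n, setT x ->
 (`|\int[leb]_y `|F (x, (y - b n)%R) - F (x, y)|%:E| <= (EFin \o d) x)%E}.
 by exists set0; split=> // x /= H; apply: H=> n _; exact: hd.
have aeh : {ae leb, forall x : R, setT x ->
 (fun n => \int[leb]_y `|F (x, (y - b n)%R) - F (x, y)|%:E)%E @ \oo --> 0%E}.
 by exists set0; split=> // x /= H; apply: H=> _; exact: inner.
have [_ _ ] := @dominated_convergence _ _ _ leb setT measurableT _ (fun=> 0%E) (EFin \o d) mI
 (mcst _) aeh id aed.
by rewrite integral0.
Qed.

End translation.

(** * Continuity of translations in L^p *)

Section Lp_translation.
Implicit Types (f : plane -> C).

(** The shift is performed one coordinate at a time, and translation invariance removes the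
    coordinate already treated. *)
Lemma translation2 (F : plane -> R) (r M : R) (w : nat -> plane) :
 mfun F -> (forall z, `|F z| <= M) -> (forall z : plane, r < `|z| -> F z = 0) ->
 (forall n, `|w n| <= 1) -> (fun n => `|w n|) @ \oo --> (0 : R) ->
 forall e, 0 < e -> evt n, (\int[mu]_z `|F (z - w n) - F z|%:E <= e%:E)%E.
Proof.
move=> mF FM F0 w1 w0 e e0.
have e2 := half_gt0 e0.
have c0 (u : nat -> R) : (forall n, `|u n| <= `|w n|) -> u @ \oo --> (0 : R).
 move=> uw; apply/norm_cvg0P; apply: squeeze_cvgr w0; last exact: cvg_cst.
 by near=> n; rewrite normr_ge0 uw.
have a_le n : `|(w n).1| <= `|w n| by rewrite [leRHS]norm_planeE le_max lexx.
have b_le n : `|(w n).2| <= `|w n| by rewrite [leRHS]norm_planeE le_max lexx orbT.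
have mS : mfun (fun z : plane => F (z.2, z.1)).
 apply: (mcomp mF); apply/measurable_fun_pairP; split.
 exact: msnd.
 exact: mfst.
have S0 (z : plane) : r < `|z| -> F (z.2, z.1) = 0.
 by move=> zr; apply: F0; rewrite norm_planeE /= maxC -norm_planeE.
have [N1 HN1] := cvge0_le (translation_inner mF FM F0 (fun n => le_trans (b_le n) (w1 n)) (c0 _ b_le)) e2.
have [N2 HN2] := cvge0_le (translation_inner mS (fun z => FM _) S0
 (fun n => le_trans (a_le n) (w1 n)) (c0 _ a_le)) e2.
exists (maxn N1 N2)=> n; rewrite geq_max=> /andP[n1 n2].
have mD (u v : plane) : mfun (fun z : plane => `|F (z - u) - F (z - v)|%:E).
 apply/mEFin; apply: mcomp=> //; apply: mfunB.
 exact: (mcomp mF (meas_shift _)).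
 exact: (mcomp mF (meas_shift _)).
have D0 (u v z : plane) : (0 <= `|F (z - u) - F (z - v)|%:E)%E by rewrite lee_fin.
pose a : plane := ((w n).1, 0); pose b : plane := (0, (w n).2).
have wab : w n = b + a.
 by rewrite /a /b; case: (w n)=> x y /=; rewrite -[LHS]/(x, y) -[RHS]/(0 + x, y + 0) add0r addr0.
apply: (le_via (\int[mu]_z (`|F (z - w n) - F (z - a)|%:E + `|F (z - a) - F (z - 0)|%:E))%E).
 apply: ge0_le_integral=> //.
 - by have := mD (w n) 0; under eq_fun do rewrite subr0.
 - by apply: emeasurable_funD; exact: mD.
 - by move=> z _; rewrite subr0 -EFinD lee_fin ler_distD.
rewrite ge0_integralD //; last 2 first.
- exact: mD.
- exact: mD.
have -> : e%:E = ((e / 2)%:E + (e / 2)%:E)%E by rewrite -EFinD -splitr.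
apply: leeD.
 have -> : (\int[mu]_z `|F (z - w n) - F (z - a)|%:E = \int[mu]_z `|F (z - b) - F (z - 0)|%:E)%E.
 rewrite -[RHS](ge0_integral_shift (- a)) //.
 by apply: eq_integral=> z _; rewrite wab opprD addrA [z - b - a]addrAC subr0.
 have -> : (\int[mu]_z `|F (z - b) - F (z - 0)|%:E)%E = _ :=
 fubini_tonelli1 (m1 := leb) (m2 := leb) (fun z : plane => `|F (z - b) - F (z - 0)|%:E) (mD _ _) (D0 _ _).
 rewrite /fubini_F.
 apply: le_trans (HN1 n n1); rewrite le_eqVlt; apply/orP; left; apply/eqP.
 apply: eq_integral=> x _; apply: eq_integral=> y _; rewrite subr0.
 by have -> : (x, y) - b = (x - 0, y - (w n).2) :> plane by []; rewrite subr0.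
have -> : (\int[mu]_z `|F (z - a) - F (z - 0)|%:E)%E = _ :=
 fubini_tonelli2 (m1 := leb) (m2 := leb) (fun z : plane => `|F (z - a) - F (z - 0)|%:E) (mD _ _) (D0 _ _).
rewrite /fubini_G.
apply: le_trans (HN2 n n2); rewrite le_eqVlt; apply/orP; left; apply/eqP.
apply: eq_integral=> x _; apply: eq_integral=> y _; rewrite subr0.
by have -> : (y, x) - a = (y - (w n).1, x - 0) :> plane by []; rewrite subr0.
Unshelve. all: by end_near. Qed.
Lemma norm_LpC_shift p f (h : plane) : cmfun f -> nLp p (fun z => f (z + h)) = nLp p f.
Proof.
move=> mf; rewrite !norm_LpCE /powint !area_intE.
rewrite (ge0_integral_shift h (f := fun z => (normc (f z) `^ p)%:E)) //; last first.
 by move=> z; rewrite lee_fin powR_ge0.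
by exact: meas_powE.
Qed.
Lemma powR_le_mul (p t B : R) : 1 <= p -> 0 <= t <= B -> t `^ p <= B `^ (p - 1) * t.
Proof.
move=> p1 /andP[t0 tB]; have [->|tn0] := eqVneq t 0.
 by rewrite powR0 ?mulr0 // gt_eqF // (lt_le_trans ltr01).
have tp : 0 < t by rewrite lt_neqAle eq_sym tn0.
have -> : t `^ p = t `^ (p - 1) * t.
 by rewrite -{3}(powRr1 t0) -powRD ?subrK // tn0 implybT.
by rewrite ler_wpM2r // ler_powR_nneg // subr_ge0.
Qed.
(** Otherwise some shifts w n with |w n| < 1 / (n + 1) would all violate the bound, against the
    sequential L^1 statement. For values at most B, t^p <= B^(p-1) t passes from L^1 to L^p. *)
Lemma bounded_translation (p : R) f (r M : R) : 1 <= p -> cmfun f -> (forall z, normc (f z) <= M) ->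
 bsupp r f -> forall e, 0 < e -> exists2 d : R, 0 < d & forall w : plane, `|w| < d ->
 (nLp p (fun z => (f (z - w) - f z)%R) <= e%:E)%E.
Proof.
move=> p1 mf fM f0 e e0; have p0 : 0 < p := lt_le_trans ltr01 p1.
apply: contrapT=> H.
have /choice [w Hw] : forall n : nat, exists w : plane, `|w| < n.+1%:R^-1 /\
 ~ (nLp p (fun z => (f (z - w) - f z)%R) <= e%:E)%E.
 move=> n; apply: contrapT=> Hn; apply: H; exists n.+1%:R^-1; first by rewrite invr_gt0.
 by move=> w wn; apply: contrapT=> nh; apply: Hn; exists w.
have w1 n : `|w n| <= 1.
 by apply: ltW; apply: lt_le_trans (Hw n).1 _; rewrite invf_le1 // ler1n.
have w0 : (fun n => `|w n|) @ \oo --> (0 : R).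
 apply: squeeze_cvgr (@cvg_harmonic R); last exact: cvg_cst.
 by near=> n; rewrite normr_ge0 ltW //; case: (Hw n).
pose c := (M + M) `^ (p - 1).
have e1 : 0 < pi * e `^ p / (c + 1) / 2.
 by rewrite !divr_gt0 ?mulr_gt0 ?pi_gt0 ?powR_gt0 // ltr_wpDl ?powR_ge0.
have reM z : `|Re (f z)| <= M by apply: le_trans (normc_Re _) (fM z).
have imM z : `|Im (f z)| <= M by apply: le_trans (normc_Im _) (fM z).
have re0 (z : plane) : r < `|z| -> Re (f z) = 0 by move=> /f0 ->.
have im0 (z : plane) : r < `|z| -> Im (f z) = 0 by move=> /f0 ->.
have [N1 HN1] := translation2 mf.1 reM re0 w1 w0 e1.
have [N2 HN2] := translation2 mf.2 imM im0 w1 w0 e1.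
pose n := maxn N1 N2; case: (Hw n)=> _; apply.
have mD : cmfun (fun z : plane => f (z - w n) - f z).
 by apply: cmfunB=> //; exact: (cmfun_comp (meas_shift (- w n)) mf).
apply: norm_LpC_le=> //; first by rewrite lee_fin ltW.
rewrite /powint area_intE poweR_EFin lee_pdivrMl ?pi_gt0 // -EFinM.
have mT (g : plane -> R) : mfun g -> mfun (fun z : plane => `|g (z - w n) - g z|%:E).
 move=> mg; apply/mEFin; apply: mcomp=> //; apply: mfunB=> //.
 exact: (mcomp mg (meas_shift _)).
have m1 := mT _ mf.1; have m2 := mT _ mf.2.
apply: (le_via (\int[mu]_z (c%:E * (`|Re (f (z - w n)) - Re (f z)|%:E +
 `|Im (f (z - w n)) - Im (f z)|%:E)))%E).
 apply: ge0_le_integral=> //.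
 - by move=> z _; rewrite lee_fin powR_ge0.
 - by exact: meas_powE.
 - by apply: measurable_funeM; exact: emeasurable_funD.
 move=> z _; rewrite -EFinD -EFinM lee_fin.
 apply: le_trans (powR_le_mul p1 (B := M + M) _) _.
 rewrite normc_ge0 /=; apply: normcD_le; rewrite normcNE.
 exact: lerD.
 apply: ler_wpM2l; first exact: powR_ge0.
 apply: le_trans (normc_le_ReIm _) _.
 by case: (f (z - w n))=> a b; case: (f z)=> a' b' /=.
rewrite ge0_integralZl_EFin ?powR_ge0 //; last 2 first.
- by move=> z _; rewrite -EFinD lee_fin addr_ge0.
- exact: emeasurable_funD.
rewrite ge0_integralD //.
apply: (le_via (c%:E * ((pi * e `^ p / (c + 1) / 2)%:E + (pi * e `^ p / (c + 1) / 2)%:E))%E).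
 apply: lee_wpmul2l; first by rewrite lee_fin powR_ge0.
 by apply: leeD; [apply: HN1; exact: leq_maxl|apply: HN2; exact: leq_maxr].
rewrite -EFinD -splitr -EFinM lee_fin mulrA ler_pdivrMr ?ltr_wpDl ?powR_ge0 //.
by rewrite mulrC ler_wpM2l ?mulr_ge0 ?pi_ge0 ?powR_ge0 // lerDl.
Unshelve. all: by end_near. Qed.
Definition trunc (n : nat) f : plane -> C := fun z =>
 if (`|z| <= n%:R) && (normc (f z) <= n%:R) then f z else 0.

Lemma meas_norm_plane : mfun (fun z : plane => `|z|).
Proof. by apply: continuous_measurable_plane; exact: norm_continuous. Qed.
Lemma cmfun_ifb (b : plane -> bool) f g : mfun b -> cmfun f -> cmfun g ->
 cmfun (fun z => if b z then f z else g z).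
Proof.
move=> mb [f1 f2] [g1 g2]; split.
- rewrite (_ : (fun _ => _) = (fun z => if b z then Re (f z) else Re (g z))).
 by apply: measurable_fun_if=> //; exact: measurable_funTS.
 by apply/funext=> z; case: ifP.
- rewrite (_ : (fun _ => _) = (fun z => if b z then Im (f z) else Im (g z))).
 by apply: measurable_fun_if=> //; exact: measurable_funTS.
 by apply/funext=> z; case: ifP.
Qed.
Lemma truncP n f : cmfun f -> [/\ cmfun (trunc n f), forall z, normc (trunc n f z) <= n%:R,
 bsupp n%:R (trunc n f) & forall z, normc (f z - trunc n f z) <= normc (f z)].
Proof.
move=> mf; split.
- apply: (@cmfun_ifb _ f (fun=> 0))=> //.
 apply: measurable_and; apply: measurable_fun_ler=> //; [exact: meas_norm_plane|exact: meas_normc].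
- by move=> z; rewrite /trunc; case: ifP=> [/andP[]//|_]; rewrite normc0.
- by move=> z nz; rewrite /trunc leNgt nz.
- by move=> z; rewrite /trunc; case: ifP=> _; rewrite ?subr0 // subrr normc0 normc_ge0.
Qed.
Lemma trunc_cvg (p : R) f : 0 < p -> cmfun f -> (nLp p f < +oo)%E ->
 forall e, 0 < e -> evt n, (nLp p (fun z => (f z - trunc n f z)%R) <= e%:E)%E.
Proof.
move=> p0 mf fp.
apply: (@norm_LpC_dominated p (fun n z => f z - trunc n f z) (fun z => normc (f z))).
- exact: p0.
- by move=> n; apply: cmfunB=> //; case: (truncP n mf).
- exact: meas_normc.
- by move=> n z; case: (truncP n mf).
- rewrite (@eq_norm_LpC p _ f) // => z; rewrite normc_ger0 //; exact: normc_ge0.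
- move=> z; apply/cvgrPdist_lt=> e e0.
 exists (maxn (Num.bound `|z|) (Num.bound (normc (f z))))=> // n /=; rewrite geq_max=> /andP[h1 h2].
 rewrite /trunc ifT ?subrr ?normc_real ?normr0 ?subrr ?normr0 //; apply/andP; split.
 by apply/ltW/(lt_le_trans (archi_boundP (normr_ge0 _))); rewrite ler_nat.
 by apply/ltW/(lt_le_trans (archi_boundP (normc_ge0 _))); rewrite ler_nat.
Qed.
Lemma norm_LpC_translation (p : R) f : 1 <= p -> cmfun f -> (nLp p f < +oo)%E ->
 forall e, 0 < e -> exists2 d : R, 0 < d & forall w : plane, `|w| < d ->
 (nLp p (fun z => (f (z - w) - f z)%R) <= e%:E)%E.
Proof.
move=> p1 mf fp e e0; have p0 : 0 < p := lt_le_trans ltr01 p1.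
have e3 : 0 < e / 3 by rewrite divr_gt0.
have [N /(_ N (leqnn _)) HN] := trunc_cvg p0 mf fp e3.
have [mt tM t0 _] := truncP N mf.
have [d d0 Hd] := bounded_translation p1 mt tM t0 e3.
exists d=> // w wd; pose g := trunc N f.
have mh : cmfun (fun z => f z - g z) by exact: cmfunB.
have mc h (u : plane) : cmfun h -> cmfun (fun z : plane => h (z + u)).
 by move=> mh'; apply: cmfun_comp=> //; exact: meas_shift.
have -> : (fun z => f (z - w) - f z) =
 (fun z => ((f (z - w) - g (z - w)) + (g (z - w) - g z)) - (f z - g z)).
 by apply/funext=> z; ring.
have m1 : cmfun (fun z : plane => f (z - w) - g (z - w)) by exact: (mc _ _ (- w) mh).
have m2 : cmfun (fun z : plane => g (z - w) - g z) by apply: cmfunB=> //; exact: (mc _ _ (- w) mt).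
have -> : e%:E = ((e / 3)%:E + (e / 3)%:E + (e / 3)%:E)%E by rewrite -!EFinD; congr EFin; field.
apply: le_trans (norm_LpCB p1 (cmfunD m1 m2) mh) _; apply: leeD=> //.
apply: le_trans (norm_LpCD p1 m1 m2) _; apply: leeD; last exact: Hd.
by rewrite (norm_LpC_shift p (- w) mh).
Qed.

End Lp_translation.

(** * Convolution with probability densities and mollification in L^p *)

Section convolution_inequality.

Lemma meas_sub_plane : mfun (fun zw : plane * plane => zw.1 - zw.2).
Proof.
apply/measurable_fun_pairP; split.
- apply: mfunB.
 exact: (mcomp mfst mfst).
 exact: (mcomp mfst msnd).
- apply: mfunB.
 exact: (mcomp msnd mfst).
 exact: (mcomp msnd msnd).
Qed.
Lemma area_intZ (c : R) (F : plane -> \bar R) : 0 <= c -> mfun F -> (forall z, (0 <= F z)%E) ->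
 (aint (fun z => c%:E * F z) = c%:E * aint F)%E.
Proof. by move=> c0 mF F0; rewrite !area_intE ge0_integralZl_EFin // muleCA. Qed.
Lemma area_tonelli (f : plane * plane -> R) : mfun f -> (forall zw, 0 <= f zw) ->
 (aint (fun z => aint (fun w => (f (z, w))%:E)) =
 aint (fun w => aint (fun z => (f (z, w))%:E)))%E.
Proof.
move=> mf f0; have ip : 0 <= pi^-1 :> R by rewrite invr_ge0 pi_ge0.
have mS : mfun (fun zw : plane * plane => f (zw.2, zw.1)).
 by apply: (mcomp mf); apply/measurable_fun_pairP; split; [exact: msnd|exact: mfst].
rewrite area_intE [RHS]area_intE; congr (_ * _)%E.
under eq_integral do rewrite area_intE.
under [in RHS]eq_integral do rewrite area_intE.
rewrite ge0_integralZl_EFin //; last 2 first.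
- by move=> z _; apply: integral_ge0=> w _; rewrite lee_fin.
- exact: meas_tonelli.
rewrite [RHS]ge0_integralZl_EFin //; last 2 first.
- by move=> z _; apply: integral_ge0=> w _; rewrite lee_fin.
- exact: (meas_tonelli mS).
by rewrite tonelli.
Qed.

Section kernel.
Variables (p q : R) (K : plane -> R).
Hypotheses (p0 : 0 < p) (q0 : 0 < q) (pq : p^-1 + q^-1 = 1).
Hypotheses (mK : mfun K) (K0 : forall z, 0 <= K z).
Hypothesis K1 : (aint (fun z => (K z)%:E) <= 1)%E.

(** Hölder's inequality after splitting K = K^(1/p) K^(1/q); the second factor has norm at most 1
    since K has mass at most 1. *)
Lemma jensen_cint (g : plane -> C) : cmfun g ->
 ((normc (cI (fun w => (K w)%:C * g w)) `^ p)%:E <=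
 aint (fun w => (K w * normc (g w) `^ p)%:E))%E.
Proof.
move=> mg.
have mKa (a : R) : cmfun (fun w => (K w `^ a)%:C : C).
 by apply: cmfun_real; exact: (mcomp (meas_powR_fun a)).
have mF : cmfun (fun w => (K w `^ p^-1)%:C * g w) by exact: cmfunM.
have h := hoelder_area p0 q0 pq mF (mKa q^-1).
have e1 : nLp q (fun w => (K w `^ q^-1)%:C) = (aint (fun z => (K z)%:E) `^ q^-1)%E.
 rewrite norm_LpCE; congr (_ `^ _)%E; rewrite /powint !area_intE; congr (_ * _)%E.
 apply: eq_integral=> z _; rewrite normc_ger0 ?powR_ge0 // -powRrM mulVf ?gt_eqF //.
 by rewrite powRr1.
have e2 : powint p (fun w => (K w `^ p^-1)%:C * g w) =
 aint (fun w => (K w * normc (g w) `^ p)%:E).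
 rewrite /powint !area_intE; congr (_ * _)%E; apply: eq_integral=> z _.
 rewrite normcM normc_ger0 ?powR_ge0 // powRM ?powR_ge0 ?normc_ge0 //.
 by rewrite -powRrM mulVf ?gt_eqF // powRr1.
have e3 : aint (fun z => (normc ((K z `^ p^-1)%:C * g z) * normc ((K z `^ q^-1)%:C : C))%:E) =
 aint (fun z => (normc ((K z)%:C * g z))%:E).
 rewrite !area_intE; congr (_ * _)%E; apply: eq_integral=> z _; congr EFin.
 rewrite !normcM !normc_real !ger0_norm ?powR_ge0 // mulrAC -powRD.
 by rewrite pq powRr1.
 by rewrite pq oner_eq0.
have h1 : (aint (fun z => (normc ((K z)%:C * g z))%:E) <=
 nLp p (fun w => ((K w `^ p^-1)%:C * g w)%R))%E.
 rewrite -e3; apply: le_trans h _; rewrite -[leRHS]mule1; apply: lee_wpmul2l; first exact: norm_LpC_ge0.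
 rewrite e1; have <- : ((1%:E : \bar R) `^ q^-1 = 1)%E by rewrite poweR_EFin powR1.
 apply: le_poweR=> //; first by rewrite invr_ge0 ltW.
 by apply: area_int_ge0=> z _; rewrite lee_fin.
have mKg : cmfun (fun w => (K w)%:C * g w) by apply: cmfunM=> //; exact: cmfun_real.
rewrite -poweR_EFin -e2 powint_norm //; apply: le_poweR; rewrite ?lee_fin ?normc_ge0 ?(ltW p0) //.
exact: le_trans (normc_cint_area mKg) h1.
Qed.
Lemma powint_conv_le (F : plane * plane -> C) : cmfun F ->
 (powint p (fun z => cI (fun w => (K w)%:C * F (z, w))%R) <=
 aint (fun w => (K w)%:E * powint p (fun z => F (z, w))))%E.
Proof.
move=> mF.
have mFz z : cmfun (fun w => F (z, w)) by exact: (cmfun_comp (measurable_pair1 z) mF).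
have mG : mfun (fun zw : plane * plane => K zw.2 * normc (F zw) `^ p).
 apply: mfunM; first exact: (mcomp mK msnd).
 apply: (mcomp (meas_powR_fun p)); exact: meas_normc.
have G0 (zw : plane * plane) : 0 <= K zw.2 * normc (F zw) `^ p by rewrite mulr_ge0 ?powR_ge0.
apply: (le_via (aint (fun z => aint (fun w => (K w * normc (F (z, w)) `^ p)%:E)))).
 apply: le_area_int=> z; first by rewrite lee_fin powR_ge0.
 exact: jensen_cint.
rewrite (area_tonelli mG G0); apply: le_area_int=> w.
 by apply: area_int_ge0=> z _; rewrite lee_fin; exact: (G0 (z, w)).
rewrite /powint -area_intZ //; last by move=> z; rewrite lee_fin powR_ge0.
by apply: meas_powE; exact: (cmfun_comp (measurable_pair2 w) mF).
Qed.
Lemma young (f : plane -> C) : cmfun f ->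
 (nLp p (fun z => cI (fun w => (K w)%:C * f (z - w))%R) <= nLp p f)%E.
Proof.
move=> mf.
have mF : cmfun (fun zw : plane * plane => f (zw.1 - zw.2)) := cmfun_comp meas_sub_plane mf.
apply: (norm_LpC_le p0 (norm_LpC_ge0 _ _)); rewrite -(powint_norm _ p0).
apply: le_trans (powint_conv_le mF) _.
under [X in aint X]eq_fun=> w do rewrite /= powint_norm // norm_LpC_shift // -powint_norm //.
rewrite area_intE ge0_integralZr //; last 3 first.
- exact/mEFin.
- by move=> z _; rewrite lee_fin.
- exact: powint_ge0.
rewrite muleA -area_intE -[leRHS]mul1e; apply: lee_wpmul2r=> //; exact: powint_ge0.
Qed.

End kernel.

Definition concentrating (K : nat -> plane -> R) := [/\ forall n, mfun (K n),
 forall n z, 0 <= K n z, forall n, aint (fun z => (K n z)%:E) = 1%E &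
 forall r e, 0 < r -> 0 < e -> evt n, (aint (fun z : plane => (if r <= `|z|%R then K n z else 0%R)%:E) <= e%:E)%E].

Lemma rintg_concentrating (K : nat -> plane -> R) n : concentrating K -> rintg (K n).
Proof.
move=> [mK K0 K1 _]; apply/rintgP; split=> //.
under eq_integral=> z _ do rewrite ger0_norm //.
have := K1 n; rewrite area_intE.
have : (0 <= \int[mu]_z (K n z)%:E)%E by apply: integral_ge0=> z _; rewrite lee_fin.
case: (\int[mu]_z (K n z)%:E)%E=> [x _ _||] //; first exact: ltry.
by rewrite gt0_muley // lte_fin invr_gt0 pi_gt0.
Qed.
Lemma cintg_real (g : plane -> R) : rintg g -> cintg (fun z => (g z)%:C).
Proof.
move=> ig; split=> //=; apply: (@le_rintg (fun=> 0) (fun z => `|g z|))=> //.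
- by move=> z; rewrite normr0.
have [mg lg'] := (rintgP _).1 ig; apply/rintgP; split.
 by apply: mcomp.
by under eq_integral do rewrite normr_id.
Qed.
Lemma conj_exponent (p : R) : 1 < p ->
 [/\ 0 < 1 - p^-1, 0 < (1 - p^-1)^-1 & p^-1 + (1 - p^-1)^-1^-1 = 1].
Proof.
move=> p1; have s0 : 0 < 1 - p^-1 by rewrite subr_gt0 invf_lt1 // (lt_trans ltr01).
by split; rewrite ?invr_gt0 // invrK addrC subrK.
Qed.
(** Mass 1 turns the difference into an average of the functions f(z - w) - f(z). For small w
    continuity of translations applies; the mass carried by the other w is small and meets the crude
    bound (2 ||f||)^p. *)
Lemma norm_LpC_mollify (p : R) (K : nat -> plane -> R) (f : plane -> C) : 1 < p ->
 concentrating K -> cmfun f -> (nLp p f < +oo)%E ->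
 (forall n z, cintg (fun w => (K n w)%:C * f (z - w))) ->
 forall e, 0 < e -> evt n, (nLp p (fun z => cI (fun w => (K n w)%:C * f (z - w)) - f z)%R <= e%:E)%E.
Proof.
move=> p1 [mK K0 K1 Kc] mf fp iKf e e0.
have p0 : 0 < p := lt_trans ltr01 p1.
have [_ q0 pq] := conj_exponent p1.
have pp1 := ltW p1.
have [B HB] : exists B : R, 0 <= B /\ forall w, (powint p (fun z => (f (z - w) - f z)%R) <= B%:E)%E.
 have fn : nLp p f \is a fin_num by rewrite ge0_fin_numE ?norm_LpC_ge0.
 exists ((2 * fine (nLp p f)) `^ p); split; first exact: powR_ge0.
 move=> w; apply: powint_le=> //.
 have mw : cmfun (fun z : plane => f (z - w)) := cmfun_comp (meas_shift (- w)) mf.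
 apply: le_trans (norm_LpCB pp1 mw mf) _; rewrite (norm_LpC_shift p (- w) mf).
 by rewrite -{1 2}(fineK fn) -EFinD lee_fin mulrDl mul1r.
case: HB=> B0 HB.
pose c := e `^ p / 2.
have c0 : 0 < c by rewrite divr_gt0 ?powR_gt0.
have d1 : 0 < c `^ p^-1 by rewrite powR_gt0.
have [d d0 Hd] := norm_LpC_translation pp1 mf fp d1.
have cB : 0 < c / (B + 1) by rewrite divr_gt0 // ltr_wpDl.
have [N HN] := Kc d _ d0 cB.
exists N=> n Nn.
have mF : cmfun (fun zw : plane * plane => f (zw.1 - zw.2) - f zw.1).
 by apply: cmfunB; [exact: cmfun_comp meas_sub_plane mf|exact: (cmfun_comp mfst)].
have rK : rintg (K n) by exact: rintg_concentrating.
have iK := cintg_real rK.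
have cK : cI (fun w => (K n w)%:C) = 1.
 have := K1 n; rewrite area_intE cintE /= /Rintegral integral0 mulr0.
 have : (0 <= \int[mu]_z (K n z)%:E)%E by apply: integral_ge0=> z _; rewrite lee_fin.
 case: (\int[mu]_z (K n z)%:E)%E=> [x _ [->]||] //=.
 by rewrite gt0_muley // lte_fin invr_gt0 pi_gt0.
have -> : (fun z => cI (fun w => (K n w)%:C * f (z - w)) - f z) =
 (fun z => cI (fun w => (K n w)%:C * (f (z - w) - f z))).
 apply/funext=> z.
 rewrite -{1}[f z]mulr1 -cK -cintZ // -cintB //; last exact: cintgZ.
 by apply: eq_cintT=> w; rewrite mulrBr [f z * _]mulrC.
apply: norm_LpC_le=> //; first by rewrite lee_fin ltW.
apply: le_trans (powint_conv_le p0 q0 pq (mK n) (K0 n) _ mF) _; first by rewrite K1.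
pose T (z : plane) : \bar R := (if d <= `|z| then K n z else 0)%:E.
have mT : mfun T.
 apply/mEFin; apply: measurable_fun_if=> //; last exact: measurable_funTS.
 by apply: measurable_fun_ler=> //; exact: meas_norm_plane.
have T0 z : (0 <= T z)%E by rewrite lee_fin; case: ifP.
apply: (le_via (aint (fun w => (c%:E * (K n w)%:E + B%:E * T w)%E))).
 apply: le_area_int=> w; first by apply: mule_ge0; rewrite ?lee_fin // powint_ge0.
 rewrite /T; case: (lerP d `|w|)=> dw.
 rewrite -[leLHS]add0e; apply: leeD; first by rewrite -EFinM lee_fin mulr_ge0 // ltW.
 by rewrite muleC; apply: lee_wpmul2r; rewrite ?lee_fin //; exact: HB.
 rewrite mule0 adde0 muleC; apply: lee_wpmul2r; first by rewrite lee_fin.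
 have := powint_le p0 (Hd w dw); rewrite -powRrM mulVf ?gt_eqF // powRr1 //; exact: ltW.
rewrite area_intE ge0_integralD //; last 4 first.
- by move=> w _; rewrite -EFinM lee_fin mulr_ge0 // ltW.
- by apply: measurable_funeM; apply/mEFin; exact: mK.
- by move=> w _; apply: mule_ge0=> //; rewrite lee_fin.
- exact: measurable_funeM.
rewrite !ge0_integralZl_EFin ?(ltW c0) //; last by apply/mEFin; exact: mK.
rewrite ge0_muleDr ?mule_ge0 ?lee_fin ?(ltW c0) ?integral_ge0 //; last by move=> w _; rewrite lee_fin.
rewrite !(muleCA (pi^-1)%:E) -!area_intE K1 mule1 poweR_EFin.
apply: (le_via (c%:E + B%:E * (c / (B + 1))%:E)%E).
 by apply: leeD=> //; apply: lee_wpmul2l; rewrite ?lee_fin //; exact: HN.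
rewrite -EFinM -EFinD lee_fin; have -> : e `^ p = c + c by rewrite /c -splitr.
by rewrite lerD2l mulrA ler_pdivrMr ?ltr_wpDl // mulrC ler_wpM2l ?(ltW c0) // lerDl.
by move=> w _; rewrite lee_fin.
Qed.

End convolution_inequality.

(** * Passage to the limit in integrals *)

Section convergence_of_integrals_pre.

Lemma aeW (P : plane -> Prop) : (forall z, P z) -> {ae mu, forall z, P z}.
Proof. by move=> HP; exists set0; split=> // z; apply. Qed.
Lemma rintgZ (c : R) (f : plane -> R) : rintg f -> rintg (fun z => c * f z).
Proof. by move=> h; exact: (integrableZl measurableT c h). Qed.

End convergence_of_integrals_pre.

Section convergence_of_integrals.

Lemma cint_cvg (u : nat -> plane -> C) (f : plane -> C) (g : plane -> R) :
 (forall n, cintg (u n)) -> cintg f -> rintg g ->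
 {ae mu, forall z, forall n, normc (u n z - f z) <= g z} ->
 {ae mu, forall z, forall e, 0 < e -> evt n, normc (u n z - f z) <= e} ->
 forall e, 0 < e -> evt n, normc (cI (u n) - cI f) <= e.
Proof.
move=> iu if_ ig dom cv e e0.
pose h n z := (normc (u n z - f z))%:E.
have ih n : cintg (fun z => u n z - f z) by exact: cintgB.
have mh n : mfun (h n).
 apply/mEFin; apply: meas_normc; exact: cintg_cmfun.
have ae1 : {ae mu, forall z, setT z -> (fun n => h n z) @ \oo --> 0%E}.
 case: cv=> N [mN N0 sN]; exists N; split=> // z /= nz; apply: sN=> /= H; apply: nz=> _.
 apply: cvge0_intro=> [n|d d0]; first by rewrite lee_fin normc_ge0.
 by have [M HM] := H d d0; exists M=> n Mn; rewrite lee_fin; exact: HM.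
have ae2 : {ae mu, forall z, forall n, setT z -> (`|h n z| <= (EFin \o g) z)%E}.
 case: dom=> N [mN N0 sN]; exists N; split=> // z /= nz; apply: sN=> /= H; apply: nz=> n _.
 by rewrite lee_fin ger0_norm ?normc_ge0 //; exact: H.
have [_ _ ] := @dominated_convergence _ _ _ mu setT measurableT h (fun=> 0%E) (EFin \o g) mh
 (mcst _) ae1 ig ae2.
rewrite integral0=> cvi.
have pe : 0 < pi * e by rewrite mulr_gt0 ?pi_gt0.
have [N HN] := cvge0_le cvi pe.
exists N=> n Nn; rewrite -cintB //; apply: le_trans (normc_cint_le (ih n)) _.
rewrite ler_pdivrMl ?pi_gt0 // -lee_fin /Rintegral fineK; first exact: HN.
exact: (integrable_fin_num measurableT (rintg_normc (ih n))).
Qed.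
Lemma cint_concentrating (K : nat -> plane -> R) (f : plane -> C) (z : plane) (M : R) :
 concentrating K -> cmfun f -> (forall z, normc (f z) <= M) ->
 (forall e, 0 < e -> exists2 d : R, 0 < d & forall w : plane, `|w| < d -> normc (f (z - w) - f z) <= e) ->
 forall e, 0 < e -> evt n, normc (cI (fun w => (K n w)%:C * f (z - w)) - f z) <= e.
Proof.
move=> [mK K0 K1 Kc] mf fM cf e e0.
have e2 := half_gt0 e0.
have M0 : 0 <= M := le_trans (normc_ge0 _) (fM 0).
have [d d0 Hd] := cf _ e2.
have eM : 0 < e / 2 / (M + M + 1) by rewrite divr_gt0 // ltr_wpDl ?addr_ge0.
have [N HN] := Kc d _ d0 eM.
exists N=> n Nn.
have iK : cintg (fun w => (K n w)%:C).
 apply: cintg_area; first exact: cmfun_real.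
 apply: (@le_lt_trans _ _ (aint (fun z => (K n z)%:E))); last by rewrite K1 ltry.
 by apply: le_area_int=> w; rewrite lee_fin ?normc_ge0 // normc_ger0.
have cK : cI (fun w => (K n w)%:C) = 1.
 have := K1 n; rewrite area_intE cintE /= /Rintegral integral0 mulr0.
 have : (0 <= \int[mu]_z (K n z)%:E)%E by apply: integral_ge0=> w _; rewrite lee_fin.
 case: (\int[mu]_z (K n z)%:E)%E=> [x _ [->]||] //=.
 by rewrite gt0_muley // lte_fin invr_gt0 pi_gt0.
have mfz : cmfun (fun w : plane => f (z - w)) := cmfun_comp (meas_reflB z) mf.
have iKf : cintg (fun w => (K n w)%:C * f (z - w)).
 apply: (@le_cintg _ (fun w => M * K n w)).
 - by apply: cmfunM=> //; exact: cmfun_real.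
 - by move=> w; rewrite normcM normc_ger0 // mulrC ler_wpM2r.
 by apply: rintgZ; case: iK.
have -> : cI (fun w => (K n w)%:C * f (z - w)) - f z =
 cI (fun w => (K n w)%:C * (f (z - w) - f z)).
 rewrite -{1}[f z]mulr1 -cK -cintZ // -cintB //; last exact: cintgZ.
 by apply: eq_cintT=> w; rewrite mulrBr [f z * _]mulrC.
have mD : cmfun (fun w => (K n w)%:C * (f (z - w) - f z)).
 by apply: cmfunM; [exact: cmfun_real|apply: cmfunB=> //; exact: cmfun_cst].
rewrite -lee_fin; apply: le_trans (normc_cint_area mD) _.
pose T (w : plane) : \bar R := (if d <= `|w| then K n w else 0)%:E.
have mT : mfun T.
 apply/mEFin; apply: measurable_fun_if=> //; last exact: measurable_funTS.
 by apply: measurable_fun_ler=> //; exact: meas_norm_plane.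
have T0 w : (0 <= T w)%E by rewrite lee_fin; case: ifP.
apply: (le_via (aint (fun w => ((e / 2)%:E * (K n w)%:E + (M + M)%:E * T w)%E))).
 apply: le_area_int=> w; first by rewrite lee_fin normc_ge0.
 rewrite normcM normc_ger0 // /T; case: (lerP d `|w|)=> dw.
 rewrite -[leLHS]add0e; apply: leeD; first by rewrite -EFinM lee_fin mulr_ge0 // ltW.
 rewrite -EFinM lee_fin mulrC; apply: ler_wpM2r=> //.
 by apply: normcD_le; rewrite normcNE lerD.
 by rewrite mule0 adde0 -EFinM lee_fin mulrC; apply: ler_wpM2r=> //; exact: Hd.
rewrite area_intE ge0_integralD //; last 4 first.
- by move=> w _; rewrite -EFinM lee_fin mulr_ge0 // ltW.
- by apply: measurable_funeM; apply/mEFin; exact: mK.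
- by move=> w _; apply: mule_ge0=> //; rewrite lee_fin addr_ge0.
- exact: measurable_funeM.
rewrite !ge0_integralZl_EFin ?(ltW e2) ?addr_ge0 //; last 2 first.
- by move=> w _; rewrite lee_fin.
- by apply/mEFin; exact: mK.
rewrite ge0_muleDr ?mule_ge0 ?lee_fin ?(ltW e2) ?addr_ge0 ?integral_ge0 //; last by move=> w _; rewrite lee_fin.
rewrite !(muleCA (pi^-1)%:E) -!area_intE K1 mule1.
apply: (le_via ((e / 2)%:E + (M + M)%:E * (e / 2 / (M + M + 1))%:E)%E).
 by apply: leeD=> //; apply: lee_wpmul2l; rewrite ?lee_fin ?addr_ge0 //; exact: HN.
rewrite -EFinM -EFinD lee_fin [leRHS]splitr lerD2l mulrCA ler_piMr ?(ltW e2) //.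
by rewrite ler_pdivrMr ?mul1r ?lerDl // ltr_wpDl ?addr_ge0.
Qed.
Lemma ccont_at (f : plane -> C) z : ccont f -> forall e, 0 < e ->
 exists2 d : R, 0 < d & forall w : plane, `|w| < d -> normc (f (z - w) - f z) <= e.
Proof.
move=> [c1 c2] e e0; have e2 := half_gt0 e0.
have /cvgrPdist_lt/(_ _ e2)/nbhs_ballP[d1 /= d10 H1] := c1 z.
have /cvgrPdist_lt/(_ _ e2)/nbhs_ballP[d2 /= d20 H2] := c2 z.
have d0 : 0 < Num.min d1 d2 by rewrite lt_min d10 d20.
exists (Num.min d1 d2)=> // w; rewrite lt_min=> /andP[wd1 wd2].
have b1 : ball z d1 (z - w) by rewrite -ball_normE /ball_ /= opprB addrC subrK.
have b2 : ball z d2 (z - w) by rewrite -ball_normE /ball_ /= opprB addrC subrK.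
apply: le_trans (normc_le_ReIm _) _; rewrite [leRHS]splitr.
have := H1 _ b1; have := H2 _ b2; rewrite distrC [X in _ -> X < _ -> _]distrC.
by case: (f (z - w))=> a b; case: (f z)=> a' b' /= h2 h1; apply: lerD; exact: ltW.
Qed.

End convergence_of_integrals.

(** * Smoothed Cauchy and logarithmic kernels, the Cauchy-Pompeiu formula *)

Section kernels.
Implicit Types (d : {posnum R}) (z w : plane).

Lemma sq_norm z : (sq z)%:C = pt z * (pt z)^*.
Proof. by rewrite normc_mul_conj normc_pt2. Qed.
Lemma le_norm_sq z : `|z| ^+ 2 <= sq z.
Proof. by rewrite -normc_pt2 ler_sqr ?nnegrE ?normc_ge0 // le_normc_pt. Qed.
Lemma conjcM (a b : C) : (a * b)^* = a^* * b^*. Proof. exact: rmorphM. Qed.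
Lemma conjcV (a : C) : (a^-1)^* = (a^*)^-1. Proof. exact: fmorphV. Qed.
Lemma conjcN (a : C) : (- a)^* = - a^*. Proof. exact: rmorphN. Qed.
Definition rk d z : C := ((sq z + d%:num)^-1)%:C.

Lemma rk_neq0 d z : pt z * (pt z)^* + d%:num%:C != 0.
Proof. by rewrite -sq_norm -rmorphD /= fmorph_eq0 gt_eqF // sqD_gt0. Qed.
Lemma rkE d z : rk d z = (pt z * (pt z)^* + d%:num%:C)^-1.
Proof. by rewrite /rk -sq_norm -rmorphD /= fmorphV. Qed.
Lemma rkM d z : rk d z * (pt z * (pt z)^*) = 1 - rk d z * d%:num%:C.
Proof. by rewrite rkE; field; exact: rk_neq0. Qed.
Lemma rk_evc d : rk d = evc (EInv d EX EY).
Proof. by apply/funext=> z; rewrite /rk /evc /= addrC. Qed.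
Lemma Ck_pt n : Ck n (@pt R).
Proof.
have -> : @pt R = (fun z => evc EX z + 'i%C * evc EY z).
 apply/funext=> z; apply/eqP; rewrite eq_complex /= !mul0r !mulr0 !mul1r subr0 add0r addr0.
 by rewrite add0r !eqxx.
by apply: CkD; [exact: Ck_evc|apply: CkZ; exact: Ck_evc].
Qed.
Lemma wd_rk d z : wd (rk d) z (- (pt z)^* * rk d z ^+ 2) (- pt z * rk d z ^+ 2).
Proof.
have h : wd (fun z : plane => pt z * (pt z)^* + d%:num%:C) z (pt z)^* (pt z).
 apply: wd_ext (wdD (wdM (wd_pt z) (wdJ (wd_pt z))) (wd_cst z d%:num%:C))=> //.
 - by rewrite conjc0 mulr0 add0r mul1r addr0.
 - by rewrite conjc1 mulr1 mul0r addr0 addr0.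
apply: wd_ext (wd_inv (rk_neq0 d z) h)=> [w||]; first by rewrite rkE.
- by rewrite rkE exprVn.
- by rewrite rkE exprVn.
Qed.
(** Smoothed Cauchy kernel: dominated by 1 / |z|, tending to 1 / z, with dbar equal to [sig]. *)
Definition Pk d z : C := (pt z)^* * rk d z.

Lemma Ck_Pk n d : Ck n (Pk d).
Proof. by apply: CkM; [exact: CkJ (Ck_pt n)|rewrite rk_evc; exact: Ck_evc]. Qed.
Lemma sigE d z : (sig d%:num z)%:C = d%:num%:C * rk d z ^+ 2.
Proof. by rewrite /sig /rk rmorphM /= -exprVn rmorphXn. Qed.
Lemma wd_Pk d z : wd (Pk d) z (- ((pt z)^* * rk d z) ^+ 2) (sig d%:num z)%:C.
Proof.
apply: wd_ext (wdM (wdJ (wd_pt z)) (wd_rk d z))=> //.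
- by rewrite conjc0 mul0r addr0; ring.
- rewrite conjc1 mul1r sigE.
 have -> : (pt z)^* * (- pt z * rk d z ^+ 2) + rk d z =
 rk d z * (1 - rk d z * (pt z * (pt z)^*)) by ring.
 by rewrite rkM; ring.
Qed.
(** Smoothed logarithm of |z|^2, whose d is [Pk]; hence dbar d of it is the approximate identity
    [sig]. *)
Definition Lk d : plane -> C := evc (ELn d EX EY).

Lemma LkE d z : Lk d z = (ln (sq z + d%:num))%:C.
Proof. by rewrite /Lk /evc /= [X in ln X]addrC. Qed.
Lemma wd_Lk d z : wd (Lk d) z (Pk d z) (Pk d z)^*.
Proof.
have h : wd (fun z : plane => (sq z + d%:num)%:C) z (pt z)^* (pt z).
 apply: wd_ext (wdD (wdM (wd_pt z) (wdJ (wd_pt z))) (wd_cst z d%:num%:C))=> //.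
 - by move=> w; rewrite rmorphD /= sq_norm.
 - by rewrite conjc0 mulr0 add0r mul1r addr0.
 - by rewrite conjc1 mulr1 mul0r addr0 addr0.
apply: wd_ext (wd_comp (is_derive1_ln (sqD_gt0 z (gt0 d))) h)=> [w||].
- by rewrite LkE.
- by rewrite /Pk mulrC.
- rewrite /Pk /rk; case: (pt z)=> a b; apply/eqP; rewrite eq_complex /=.
 by apply/andP; split; apply/eqP; ring.
Qed.
Lemma normc_Pk d z : normc (Pk d z) <= (normc (pt z))^-1.
Proof.
have [z0|n0] := eqVneq (pt z) 0.
 have -> : Pk d z = 0 by rewrite /Pk z0 conjc0 mul0r.
 by rewrite normc0 invr_ge0 normc_ge0.
have p0 : 0 < normc (pt z) by rewrite normc_gt0.
have s0 : 0 < sq z + d%:num by apply: sqD_gt0.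
rewrite /Pk normcM normc_conj /rk normc_ger0 ?invr_ge0 ?(ltW s0) //.
by rewrite ler_pdivrMr // ler_pdivlMl // -expr2 normc_pt2 lerDl.
Qed.
Lemma Pk_sub d z : Pk d z - (pt z)^-1 = - (d%:num%:C * rk d z / pt z).
Proof.
have [z0|n0] := eqVneq (pt z) 0.
 by rewrite /Pk z0 conjc0 invr0 mul0r mulr0 subr0 oppr0.
rewrite /Pk; apply: (mulIf n0); rewrite mulrBl mulVf // mulNr mulfVK //.
have -> : (pt z)^* * rk d z * pt z = rk d z * (pt z * (pt z)^*) by ring.
by rewrite rkM; ring.
Qed.
Definition rate (n : nat) : {posnum R} := (n.+1%:R^-1)%:pos.

Lemma rate_small e : 0 < e -> evt n, (rate n)%:num <= e.
Proof.
move=> e0; exists (Num.bound e^-1)=> n Nn /=.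
rewrite -[e]invrK lef_pV2 ?posrE ?invr_gt0 //; apply/ltW.
apply: lt_trans (archi_boundP _) _; first by rewrite invr_ge0 ltW.
by rewrite ltr_nat ltnS.
Qed.
Lemma rate_le1 n : (rate n)%:num <= 1.
Proof. by rewrite /= invf_le1 // ler1n. Qed.
(** Away from 0 every [sig d] is at most d times a constant multiple of [sig 1], whose mass is
    known; the factor d makes the tails small. *)
Lemma sig_tail (r : R) d z : 0 < r -> r <= `|z| ->
 sig d%:num z <= d%:num * ((1 + r ^+ 2) / r ^+ 2) ^+ 2 * sig 1 z.
Proof.
move=> r0 rz; have d0 : 0 < d%:num by [].
have r2 : 0 < r ^+ 2 by rewrite exprn_gt0.
have sr : r ^+ 2 <= sq z.
 by apply: le_trans (le_norm_sq z); rewrite ler_sqr ?nnegrE ?(ltW r0).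
have s0 : 0 < sq z := lt_le_trans r2 sr.
rewrite /sig mul1r -mulrA; apply: ler_wpM2l; first exact: (ltW (gt0 d)).
have A0 : 0 < (1 + r ^+ 2) / r ^+ 2 by rewrite divr_gt0 // ltr_wpDl.
have sd : 0 < sq z + d%:num := sqD_gt0 z d0.
have s1 : 0 < sq z + 1 := sqD_gt0 z ltr01.
rewrite ler_pdivlMr ?exprn_gt0 // ler_pdivrMl ?exprn_gt0 // -exprMn.
rewrite ler_sqr ?nnegrE; [|exact: ltW s1|by apply: mulr_ge0; exact: ltW].
by rewrite mulrA ler_pdivlMr //; have := gt0 d; nra.
Qed.
Lemma concentrating_sig : concentrating (fun n => sig (rate n)%:num).
Proof.
split=> [n|n z|n|r e r0 e0]; [exact: meas_sig|exact: sig_ge0|exact: mass_sig|].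
pose B := ((1 + r ^+ 2) / r ^+ 2) ^+ 2; have B0 : 0 <= B by exact: sqr_ge0.
have eB : 0 < e / (B + 1) by rewrite divr_gt0 // ltr_wpDl.
have [N HN] := rate_small eB; exists N=> n Nn.
have Br : 0 <= (rate n)%:num * B by exact: mulr_ge0.
apply: (le_via (aint (fun z => (((rate n)%:num * B)%:E * (sig 1 z)%:E)%E))).
 apply: le_area_int=> z; first by case: ifP; rewrite lee_fin ?sig_ge0.
 by rewrite -EFinM lee_fin; case: ifPn=> [rz|_]; [exact: sig_tail|rewrite mulr_ge0 ?sig_ge0].
rewrite area_intE ge0_integralZl_EFin //; last 2 first.
- by move=> z _; rewrite lee_fin sig_ge0.
- by apply/mEFin; exact: meas_sig.
rewrite muleCA -area_intE mass_sig // mule1 lee_fin mulrC.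
apply: le_trans (ler_wpM2l B0 (HN n Nn)) _.
by rewrite mulrA ler_pdivrMr ?ltr_wpDl // mulrC ler_wpM2l ?(ltW e0) // lerDl.
Qed.
Lemma rintg_kernel_invabs (F : plane -> C) r z : ccont F -> bsupp r F -> exists M : R, 0 <= M /\
 rintg (fun w => M * invabs (`|r| + `|z| + 1) (w - z)) /\
 forall w, normc (F w) * (normc (pt (w - z)))^-1 <= M * invabs (`|r| + `|z| + 1) (w - z).
Proof.
move=> cF bF; have [M [M0 HM]] := cb_bounded cF bF.
exists M; split=> //; split.
 have ri : 0 < `|r| + `|z| + 1 by rewrite ltr_wpDl ?addr_ge0.
 have h := integrable_shift (- z) (rintg_invabs ri); exact: (rintgZ M h).
move=> w; have [wr|wr] := leP `|w| r; last by rewrite bF // normc0 mul0r mulr_ge0 ?invabs_ge0.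
rewrite /invabs ifT; first by rewrite ler_wpM2r // invr_ge0 normc_ge0.
apply: le_trans (ler_normB _ _) _; have := ler_norm r; lra.
Qed.
Lemma cmfun_Pk d z : cmfun (fun w => Pk d (w - z)).
Proof. exact: ccont_cmfun (Ck_cont (Ck_shift (- z) (Ck_Pk 0 d))). Qed.
Lemma cmfun_inv_pt z : cmfun (fun w : plane => (pt (w - z))^-1).
Proof. by apply: cmfunV; apply: (cmfun_comp (meas_shift (- z))); exact: cmfun_pt. Qed.
Lemma cint_Pk_cvg (F : plane -> C) r z : ccont F -> bsupp r F -> forall e, 0 < e ->
 evt n, normc (cI (fun w => Pk (rate n) (w - z) * F w) - cI (fun w => (pt (w - z))^-1 * F w)) <= e.
Proof.
move=> cF bF; have [M [M0 [iM HM]]] := rintg_kernel_invabs z cF bF.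
have mF := ccont_cmfun cF.
apply: (@cint_cvg (fun n w => Pk (rate n) (w - z) * F w) (fun w => (pt (w - z))^-1 * F w)
 (fun w => 2 * (M * invabs (`|r| + `|z| + 1) (w - z)))).
- move=> n; apply: le_cintg iM; first by apply: cmfunM=> //; exact: cmfun_Pk.
 move=> w; rewrite normcM mulrC; apply: le_trans (HM w); apply: ler_wpM2l; first exact: normc_ge0.
 exact: normc_Pk.
- apply: le_cintg iM; first by apply: cmfunM=> //; exact: cmfun_inv_pt.
 by move=> w; rewrite normcM normcV mulrC; exact: HM.
- exact: rintgZ.
- apply: aeW=> w n; rewrite -mulrBl normcM mulrC.
 apply: (le_via (2 * (normc (F w) * (normc (pt (w - z)))^-1))); last by rewrite ler_wpM2l // HM.
 rewrite mulrCA; apply: ler_wpM2l; first exact: normc_ge0.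
 apply: normcD_le; rewrite normcNE normcV mulrDl mul1r lerD2r.
 exact: normc_Pk.
apply: aeW=> w e e0.
pose B := (normc (pt (w - z)))^-1 ^+ 3 * normc (F w).
have B0 : 0 <= B by rewrite mulr_ge0 ?normc_ge0 // exprn_ge0 // invr_ge0 normc_ge0.
have eB : 0 < e / (B + 1) by rewrite divr_gt0 // ltr_wpDl.
have [N HN] := rate_small eB; exists N=> n Nn.
rewrite -mulrBl Pk_sub normcM normcNE; set x := w - z.
have [x0|x0] := eqVneq (pt x) 0.
 by rewrite x0 invr0 mulr0 normc0 mul0r ltW.
have p0 : 0 < normc (pt x) by rewrite normc_gt0.
have s0 : 0 < sq x by rewrite -normc_pt2 exprn_gt0.
have sd : 0 < sq x + (rate n)%:num by apply: sqD_gt0.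
rewrite !normcM normcV /rk !normc_real [`|(_)^-1|]ger0_norm ?invr_ge0 ?(ltW sd) // ger0_norm //.
apply: (le_via ((rate n)%:num * B)).
 rewrite /B mulrA; apply: ler_wpM2r; first exact: normc_ge0.
 rewrite -mulrA; apply: ler_wpM2l=> //; rewrite exprSr; apply: ler_wpM2r.
 by rewrite invr_ge0 normc_ge0.
 by rewrite exprVn normc_pt2 -/x lef_pV2 ?posrE ?s0 ?sd // lerDl.
apply: le_trans (ler_wpM2r B0 (HN n Nn)) _.
by rewrite mulrAC ler_pdivrMr ?ltr_wpDl // ler_wpM2l ?(ltW e0) // lerDl.
by rewrite invr_ge0 ltW.
Qed.
Lemma normc_eq_small (a b : C) : (forall e, 0 < e -> normc (a - b) <= e) -> a = b.
Proof.
move=> H; apply/eqP; rewrite -subr_eq0 -normc_eq0 eq_le normc_ge0 andbT.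
by apply/ler_addgt0Pr=> e e0; rewrite add0r; exact: H.
Qed.
(** Integration by parts is carried out with the smooth kernel [Pk], whose dbar concentrates at 0;
    both sides then pass to the limit. *)
Lemma cauchy_pompeiu (F : plane -> C) r z : Ck 1 F -> bsupp r F ->
 cI (fun w => (pt (w - z))^-1 * dzb F w) = - F z.
Proof.
move=> CF bF; have [cF _ _ cdF _] := Ck_inv CF.
have [M [M0 HM]] := cb_bounded cF bF.
have bdF := (bsupp_dz bF).2.
apply: normc_eq_small=> e e0; have e2 := half_gt0 e0.
have [N1 H1] := cint_Pk_cvg z (Ck_cont cdF) bdF e2.
have [N2 H2] := cint_concentrating concentrating_sig (ccont_cmfun cF) HM (ccont_at z cF) e2.
pose n := maxn N1 N2.
have h1 := H1 n (leq_maxl _ _); have h2 := H2 n (leq_maxr _ _).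
have E : cI (fun w => Pk (rate n) (w - z) * dzb F w) = - cI (fun w => (sig (rate n)%:num w)%:C * F (z - w)).
 have [_ ->] := cint_ibp (Ck_shift (- z) (Ck_Pk 1 (rate n))) CF bF; congr (- _).
 have mG : cmfun (fun w => (sig (rate n)%:num w)%:C * F (z - w)).
 apply: cmfunM; first by apply: cmfun_real; exact: meas_sig.
 exact: (cmfun_comp (meas_reflB z) (ccont_cmfun cF)).
 rewrite -[RHS](cint_reflB z) //; apply: eq_cintT=> w.
 have [_ ->] := dz_shift (- z) (Ck_Pk 1 (rate n)).
 rewrite (wd_dzb (wd_Pk _ _)); congr (_ * _); last by congr F; rewrite opprB addrC subrK.
 by congr (_ %:C)%C; rewrite /sig /sq /= -[in RHS](sqrrN (_ - w.1)) -[in RHS](sqrrN (_ - w.2)) !opprB.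
rewrite E in h1.
have -> : cI (fun w => (pt (w - z))^-1 * dzb F w) - - F z =
 - ((- cI (fun w => (sig (rate n)%:num w)%:C * F (z - w)) - cI (fun w => (pt (w - z))^-1 * dzb F w)) +
 (cI (fun w => (sig (rate n)%:num w)%:C * F (z - w)) - F z)) by ring.
rewrite normcNE; apply: normcD_le; rewrite [leRHS]splitr; exact: lerD.
Qed.
Lemma cauchy_pompeiuJ (F : plane -> C) r z : Ck 1 F -> bsupp r F ->
 cI (fun w => ((pt (w - z))^*)^-1 * dz F w) = - F z.
Proof.
move=> CF bF; have bJ : bsupp r (fun z => (F z)^*) by move=> w /bF ->; rewrite conjc0.
have H := cauchy_pompeiu z (CkJ CF) bJ; rewrite (dzJ CF).2 in H.
suff -> : cI (fun w => ((pt (w - z))^*)^-1 * dz F w) =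
 (cI (fun w => (pt (w - z))^-1 * (dz F w)^*))^* by rewrite H conjcN conjcK.
rewrite -cintJ; first by apply: eq_cintT=> w; rewrite conjcM conjcV conjcK.
have [cF _ cdF _ _] := Ck_inv CF.
have [M [M0 [iM HM]]] := rintg_kernel_invabs z (Ck_cont cdF) (bsupp_dz bF).1.
apply: le_cintg iM.
 apply: cmfunM; first exact: cmfun_inv_pt.
 by apply: cmfunJ; exact: ccont_cmfun (Ck_cont cdF).
by move=> w; rewrite normcM normcV normc_conj mulrC; exact: HM.
Qed.

End kernels.

(** * Smoothness of convolutions *)

Section convolution_smooth.
Implicit Types (v z w : plane) (K : plane -> C).

Lemma mvt_dir v (f f' : plane -> R) z (h : R) : (forall z, is_derive z v f (f' z)) ->
 exists2 t : R, `|t| <= `|h| & f (h *: v + z) - f z = h * f' (t *: v + z).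
Proof.
move=> df.
have dl (t : R) : is_derive t 1 (fun t : R => f (t *: v + z)) (f' (t *: v + z)).
 exact: is_derive_line.
have cl : continuous (fun t : R => f (t *: v + z)).
 by move=> t; apply/differentiable_continuous/derivable1_diffP; case: (dl t).
have [h0|h0|->] := ltgtP h 0.
- have [c + E] := MVT h0 (fun t _ => dl t) (continuous_subspaceT cl).
 rewrite in_itv /= => /andP[hc c0]; exists c.
 by rewrite !ltr0_norm // lerN2 ltW.
 by move: E; rewrite scale0r add0r sub0r mulrN=> /(congr1 -%R); rewrite opprB opprK mulrC.
- have [c + E] := MVT h0 (fun t _ => dl t) (continuous_subspaceT cl).
 rewrite in_itv /= => /andP[c0 hc]; exists c; first by rewrite !gtr0_norm // ltW.
 by move: E; rewrite scale0r add0r subr0 mulrC.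
- by exists 0=> //; rewrite scale0r add0r subrr mul0r.
Qed.
Lemma taylor_dir v (f f' f'' : plane -> R) z (h L : R) : (forall z, is_derive z v f (f' z)) ->
 (forall z, is_derive z v f' (f'' z)) -> (forall s : R, `|s| <= `|h| -> `|f'' (s *: v + z)| <= L) ->
 `|f (h *: v + z) - f z - h * f' z| <= L * `|h| ^+ 2.
Proof.
move=> df df' HL; have L0 : 0 <= L by apply: le_trans (HL 0 _); rewrite ?normr0.
have [t th ->] := mvt_dir z h df; rewrite -mulrBr.
have [s st ->] := mvt_dir z t df'; rewrite !normrM mulrA mulrC expr2.
apply: ler_pM=> //; first by apply: HL; exact: le_trans th.
exact: ler_wpM2l.
Qed.
Lemma is_derive_intro v (f : plane -> R) z (d : R) : (forall e, 0 < e -> exists2 a : R, 0 < a &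
 forall h : R, `|h| < a -> `|f (h *: v + z) - f z - h * d| <= e * `|h|) -> is_derive z v f d.
Proof.
move=> H.
have cv : (fun h : R => h^-1 *: ((f \o shift z) (h *: v) - f z)) @ 0^' --> d.
 apply/cvgrPdist_le=> e e0; have [a a0 Ha] := H e e0.
 exists a=> //= h; rewrite /ball_ /= sub0r normrN=> ha hn0.
 have hp : 0 < `|h| by rewrite normr_gt0.
 rewrite distrC -(ler_pM2r hp) -normrM mulrBl mulrAC mulVf // mul1r [d * h]mulrC.
 exact: Ha.
by apply: DeriveDef; [apply/cvg_ex; exists d|exact: cvg_lim].
Qed.
Lemma isD_intro v F z (d : C) : (forall e, 0 < e -> exists2 a : R, 0 < a &
 forall h : R, `|h| < a -> normc (F (h *: v + z) - F z - h%:C * d) <= e * `|h|) -> isD v F z d.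
Proof.
move=> H; split; apply: is_derive_intro=> e e0; have [a a0 Ha] := H e e0; exists a=> // h ha;
 apply: le_trans (Ha h ha).
- apply: le_trans (normc_Re _); rewrite le_eqVlt; apply/orP; left; apply/eqP; congr `|_|.
 by case: (F _)=> p q; case: (F z)=> p' q'; case: d {H Ha}=> s t /=; ring.
- apply: le_trans (normc_Im _); rewrite le_eqVlt; apply/orP; left; apply/eqP; congr `|_|.
 by case: (F _)=> p q; case: (F z)=> p' q'; case: d {H Ha}=> s t /=; ring.
Qed.
Lemma taylor_isD v (F F' F'' : plane -> C) z (h L : R) : (forall z, isD v F z (F' z)) ->
 (forall z, isD v F' z (F'' z)) -> (forall s : R, `|s| <= `|h| -> normc (F'' (s *: v + z)) <= L) ->
 normc (F (h *: v + z) - F z - h%:C * F' z) <= 2 * L * `|h| ^+ 2.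
Proof.
move=> dF dF' HL; apply: le_trans (normc_le_ReIm _) _.
have -> : 2 * L * `|h| ^+ 2 = L * `|h| ^+ 2 + L * `|h| ^+ 2 by ring.
apply: lerD.
- have := @taylor_dir v _ _ _ z h L (fun z => (dF z).1) (fun z => (dF' z).1)
 (fun s hs => le_trans (normc_Re _) (HL s hs)).
 apply: le_trans; rewrite le_eqVlt; apply/orP; left; apply/eqP; congr `|_|.
 by case: (F _)=> p q; case: (F z)=> p' q'; case: (F' z)=> s t /=; ring.
- have := @taylor_dir v _ _ _ z h L (fun z => (dF z).2) (fun z => (dF' z).2)
 (fun s hs => le_trans (normc_Im _) (HL s hs)).
 apply: le_trans; rewrite le_eqVlt; apply/orP; left; apply/eqP; congr `|_|.
 by case: (F _)=> p q; case: (F z)=> p' q'; case: (F' z)=> s t /=; ring.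
Qed.
(** Two nearby points are joined by a horizontal and a vertical segment, with the mean value theorem
    and bounded derivatives on each. *)
Lemma wd_ccont (F A B : plane -> C) : (forall z, wd F z (A z) (B z)) ->
 (forall r : R, exists L : R, forall z, `|z| <= r -> normc (A z) <= L /\ normc (B z) <= L) -> ccont F.
Proof.
move=> dF HL.
have key (f fx fy : plane -> R) : (forall z, is_derive z (1, 0) f (fx z)) ->
 (forall z, is_derive z (0, 1) f (fy z)) ->
 (forall r : R, exists L : R, forall z, `|z| <= r -> `|fx z| <= L /\ `|fy z| <= L) -> continuous f.
 move=> dx dy H z; have [L HLz] := H (`|z| + 1).
 have L0 : 0 <= L by apply: le_trans (normr_ge0 (fx z)) _; apply: (HLz z _).1; rewrite lerDl.
 apply/cvgrPdist_le=> e e0.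
 have a0 : 0 < Num.min 1 (e / (2 * L + 1)).
 by rewrite lt_min ltr01 divr_gt0 // ltr_wpDl // mulr_ge0.
 suff : nbhs z [set u | `|f z - f u| <= e] by [].
 apply/nbhs_ballP; exists (Num.min 1 (e / (2 * L + 1)))=> //= u.
 rewrite -ball_normE /ball_ /= lt_min=> /andP[u1 u2].
 pose s := u.1 - z.1; pose t := u.2 - z.2.
 have st : `|s| <= `|z - u| /\ `|t| <= `|z - u|.
 split.
 rewrite /s distrC norm_planeE le_max; apply/orP; left; exact: lexx.
 rewrite /t distrC norm_planeE le_max; apply/orP; right; exact: lexx.
 have e2 : u = t *: (0, 1) + (s *: (1, 0) + z) :> plane.
 rewrite /s /t; case: (u) (z)=> u1' u2' [z1 z2] /=.
 rewrite -[RHS]/((u2' - z2) * 0 + ((u1' - z1) * 1 + z1), (u2' - z2) * 1 + ((u1' - z1) * 0 + z2)).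
 by rewrite !mulr0 !mulr1 !add0r !subrK.
 have [a ha E1] := mvt_dir z s dx.
 have [b hb E2] := mvt_dir (s *: (1, 0) + z) t dy.
 have b1 : `|fx (a *: (1, 0) + z)| <= L.
 apply: (HLz _ _).1; rewrite addrC; apply: le_trans (ler_normD _ _) _; rewrite lerD2l normrZ.
 rewrite [X in _ * X]norm_planeE /= normr1 normr0 (_ : Num.max 1 0 = 1 :> R) ?mulr1; last by rewrite max_l.
 by apply: le_trans ha _; apply: le_trans st.1 _; exact: ltW.
 have b2 : `|fy (b *: (0, 1) + (s *: (1, 0) + z))| <= L.
 apply: (HLz _ _).2; rewrite addrA addrC; apply: le_trans (ler_normD _ _) _; rewrite lerD2l.
 rewrite (_ : b *: (0, 1) + s *: (1, 0) = (s, b) :> plane); last first.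
 by rewrite -[LHS]/(b * 0 + s * 1, b * 1 + s * 0) !mulr0 !mulr1 add0r addr0.
 rewrite norm_planeE ge_max /=; apply/andP; split.
 by apply: le_trans st.1 _; exact: ltW.
 by apply: le_trans hb _; apply: le_trans st.2 _; exact: ltW.
 have -> : f z - f u = - ((f u - f (s *: (1, 0) + z)) + (f (s *: (1, 0) + z) - f z)) by ring.
 rewrite normrN {1}e2 E1 E2; apply: le_trans (ler_normD _ _) _; rewrite !normrM.
 apply: (le_via (`|z - u| * (2 * L + 1))).
 have := ler_pM (normr_ge0 t) (normr_ge0 _) st.2 b2.
 have := ler_pM (normr_ge0 s) (normr_ge0 _) st.1 b1.
 have := normr_ge0 (z - u); lra.
 by rewrite -ler_pdivlMr ?ltW // ltr_wpDl // mulr_ge0.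
have bR r : exists L : R, forall z, `|z| <= r -> normc (A z + B z) <= L /\ normc ('i%C * (A z - B z)) <= L.
 have [L HL'] := HL r; exists (L + L)=> z /HL'[h1 h2]; split.
 by apply: normcD_le; exact: lerD.
 rewrite normcM (_ : normc 'i%C = 1); last by rewrite /= expr0n /= expr1n add0r sqrtr1.
 by rewrite mul1r; apply: normcD_le; rewrite normcNE; exact: lerD.
split; [apply: (key _ _ _ (fun z => (dF z).1.1) (fun z => (dF z).2.1))|
 apply: (key _ _ _ (fun z => (dF z).1.2) (fun z => (dF z).2.2))]=> r;
 have [L HL'] := bR r; exists L=> z /HL'[h1 h2]; split;
 by [exact: le_trans (normc_Re _) h1|exact: le_trans (normc_Re _) h2|
 exact: le_trans (normc_Im _) h1|exact: le_trans (normc_Im _) h2].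
Qed.
Definition conv (f K : plane -> C) : plane -> C := fun z => cI (fun w => f w * K (z - w)).

Section fixed.
Variables (f : plane -> C) (r : R).
Hypotheses (if0 : cintg f) (fr : bsupp r f).

Let Cf := pi^-1 * \int[mu]_z normc (f z).

Lemma mass_ge0 : 0 <= Cf.
Proof. by rewrite mulr_ge0 ?invr_ge0 ?pi_ge0 // Rintegral_ge0 // => z _; exact: normc_ge0. Qed.
Lemma fint_integrable (G : plane -> C) B : cmfun G -> (forall w, `|w| <= r -> normc (G w) <= B) ->
 cintg (fun w => f w * G w).
Proof.
move=> mG HB; apply: (le_cintg (g := fun w => `|B| * normc (f w))).
- by apply: cmfunM=> //; exact: cintg_cmfun.
- move=> w; rewrite normcM mulrC.
 have [wr|/fr ->] := leP `|w| r; last by rewrite normc0 !mulr0.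
 by rewrite ler_wpM2r ?normc_ge0 // (le_trans (HB w wr)) // ler_norm.
- exact/rintgZ/rintg_normc.
Qed.
Lemma fint_bound (G : plane -> C) B : cmfun G -> (forall w, `|w| <= r -> normc (G w) <= B) ->
 normc (cI (fun w => f w * G w)) <= Cf * `|B|.
Proof.
move=> mG HB; have iG := fint_integrable mG HB.
apply: le_trans (normc_cint_le iG) _; rewrite /Cf -mulrA; apply: ler_wpM2l.
 by rewrite invr_ge0 pi_ge0.
have if_ : rintg (fun z => normc (f z)).
 exact: rintg_normc.
rewrite mulrC -(RintegralZl _ measurableT if_).
apply: le_Rintegral=> //; first exact: rintg_normc iG.
 exact: rintgZ.
move=> w _; rewrite normcM mulrC.
have [wr|/fr ->] := leP `|w| r; last by rewrite normc0 !mulr0.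
by rewrite ler_wpM2r ?normc_ge0 // (le_trans (HB w wr)) // ler_norm.
Qed.
Lemma ccont_refl K z : ccont K -> cmfun (fun w => K (z - w)).
Proof. by move=> /ccont_cmfun cK; exact: (cmfun_comp (meas_reflB z) cK). Qed.
Lemma ccont_local_bound K (s : R) : ccont K -> exists L : R, forall z, `|z| <= s ->
 forall w, `|w| <= r -> normc (K (z - w)) <= L.
Proof.
move=> cK; have [L [_ HL]] := ccont_bounded (s + r) cK.
exists L=> z zs w wr; apply: HL; apply: le_trans (ler_normB _ _) _; exact: lerD.
Qed.
Lemma conv_integrable K z : ccont K -> cintg (fun w => f w * K (z - w)).
Proof.
move=> cK; have [L HL] := ccont_local_bound `|z| cK.
by apply: (fint_integrable (B := L)); [exact: ccont_refl|exact: HL].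
Qed.
Lemma conv_local_bound K (s : R) : ccont K -> exists L : R, forall z, `|z| <= s -> normc (conv f K z) <= L.
Proof.
move=> cK; have [L HL] := ccont_local_bound s cK.
by exists (Cf * `|L|)=> z zs; apply: fint_bound; [exact: ccont_refl|exact: HL].
Qed.
Lemma convD K K' z : ccont K -> ccont K' ->
 conv f (fun u => K u + K' u) z = conv f K z + conv f K' z.
Proof.
move=> cK cK'; rewrite /conv -cintD; [|exact: conv_integrable|exact: conv_integrable].
by apply: eq_cintT=> w; rewrite mulrDr.
Qed.
Lemma convZ (c : C) K z : ccont K -> conv f (fun u => c * K u) z = c * conv f K z.
Proof.
move=> cK; rewrite /conv -cintZ; last exact: conv_integrable.
by apply: eq_cintT=> w; rewrite mulrCA.
Qed.
(** Differentiation under the integral: the second derivative bounds the Taylor remainder of K by a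
    multiple of h^2, uniformly over the bounded support of f. *)
Lemma conv_isD v K K' K'' z : `|v| <= 1 -> ccont K -> ccont K' -> ccont K'' ->
 (forall u, isD v K u (K' u)) -> (forall u, isD v K' u (K'' u)) ->
 isD v (conv f K) z (conv f K' z).
Proof.
move=> v1 cK cK' cK'' dK dK'; apply: isD_intro=> e e0.
have [L HL] := ccont_local_bound (`|z| + 1) cK''.
pose B := Cf * (2 * `|L|).
have B0 : 0 <= B by rewrite mulr_ge0 ?mass_ge0 // mulr_ge0.
exists (Num.min 1 (e / (B + 1))).
 by rewrite lt_min ltr01 divr_gt0 // ltr_wpDl.
move=> h; rewrite lt_min=> /andP[h1 h2].
rewrite /conv -cintZ; last exact: conv_integrable.
rewrite -cintB; [|exact: conv_integrable|exact: conv_integrable].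
rewrite -cintB; [|by apply: cintgB; exact: conv_integrable|by apply: cintgZ; exact: conv_integrable].
pose G w := K (h *: v + (z - w)) - K (z - w) - h%:C * K' (z - w).
rewrite (_ : cI _ = cI (fun w => f w * G w)); last first.
 by apply: eq_cintT=> w; rewrite /G addrA; ring.
have mG : cmfun G.
 apply: cmfunB; last by apply: cmfunM; [exact: cmfun_cst|exact: ccont_refl].
 apply: cmfunB; last exact: ccont_refl.
 have := ccont_refl (h *: v + z) cK; congr cmfun.
 by apply/funext=> w; rewrite addrA.
have bG w : `|w| <= r -> normc (G w) <= 2 * `|L| * `|h| ^+ 2.
 move=> wr; apply: (taylor_isD dK dK')=> s sh; rewrite addrA.
 apply: le_trans (ler_norm L); apply: HL=> //.
 rewrite addrC; apply: le_trans (ler_normD _ _) _; rewrite lerD2l normrZ.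
 by rewrite -[leRHS]mulr1; apply: ler_pM=> //; exact: le_trans sh (ltW h1).
apply: le_trans (fint_bound mG bG) _.
rewrite ger0_norm; last by rewrite !mulr_ge0.
rewrite [leLHS]mulrA -/B expr2 mulrA; apply: ler_wpM2r=> //.
apply: le_trans (ler_wpM2l B0 (ltW h2)) _.
by rewrite mulrA ler_pdivrMr ?ltr_wpDl // mulrC ler_wpM2l ?(ltW e0) // lerDl.
Qed.
Lemma conv_wd K z : Ck 2 K -> wd (conv f K) z (conv f (dz K) z) (conv f (dzb K) z).
Proof.
move=> CK; have [cK wK CA CB _] := Ck_inv CK.
have [cA wA CAA CAB _] := Ck_inv CA; have [cB wB CBA CBB _] := Ck_inv CB.
have nx : `|((1, 0) : plane)| <= 1 by rewrite norm_planeE /= normr1 normr0 ge_max lexx ler01.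
have ny : `|((0, 1) : plane)| <= 1 by rewrite norm_planeE /= normr1 normr0 ge_max lexx ler01.
split.
- rewrite -convD //.
 apply: (@conv_isD _ _ _ (fun u => (dz (dz K) u + dz (dzb K) u) + (dzb (dz K) u + dzb (dzb K) u)))=> //.
 + exact: ccontD.
 + exact: ccontD (ccontD (Ck_cont CAA) (Ck_cont CBA)) (ccontD (Ck_cont CAB) (Ck_cont CBB)).
 + by move=> u; case: (wK u).
 + by move=> u; case: (wdD (wA u) (wB u)).
- have cN : ccont (fun u => -1 * dzb K u) by apply: ccontM=> //; exact: ccont_cst.
 have E : 'i%C * (conv f (dz K) z - conv f (dzb K) z) =
 conv f (fun u => 'i%C * (dz K u + -1 * dzb K u)) z.
 by rewrite (convZ 'i%C z (ccontD cA cN)) (convD z cA cN) (convZ (-1) z cB) mulN1r.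
 rewrite E.
 apply: (@conv_isD _ _ _ (fun u => 'i%C * ('i%C * (dz (dz K) u + -1 * dz (dzb K) u) -
 'i%C * (dzb (dz K) u + -1 * dzb (dzb K) u))))=> //.
 + by apply: ccontM; [exact: ccont_cst|exact: ccontD].
 + have ccZ c (F : plane -> C) : ccont F -> ccont (fun u => c * F u).
 by move=> cF; apply: ccontM=> //; exact: ccont_cst.
 have c1 := ccontD (Ck_cont CAA) (ccZ (-1) _ (Ck_cont CBA)).
 have c2 := ccontD (Ck_cont CAB) (ccZ (-1) _ (Ck_cont CBB)).
 have c3 := ccontD (ccZ 'i%C _ c1) (ccZ (- 'i%C) _ c2).
 apply: ccZ; move: c3; congr ccont.
 by apply/funext=> u; rewrite (mulNr 'i%C).
 + by move=> u; have [_] := wK u; rewrite mulN1r.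
 + move=> u; have [_] := wdZ 'i%C (wdD (wA u) (wdZ (-1) (wB u))).
 by rewrite -mulrBr.
Qed.
Lemma conv_ccont K : Ck 2 K -> ccont (conv f K).
Proof.
move=> CK; apply: (wd_ccont (fun z => conv_wd z CK))=> s.
have [L1 H1] := conv_local_bound s (Ck_cont (Ck_dz CK)).
have [L2 H2] := conv_local_bound s (Ck_cont (Ck_dzb CK)).
exists (Num.max L1 L2)=> z zs; split.
 by apply: le_trans (H1 z zs) _; rewrite le_max lexx.
by apply: le_trans (H2 z zs) _; rewrite le_max lexx orbT.
Qed.
Lemma Ck_conv n K : (forall m, Ck m K) -> Ck n (conv f K) /\
 dz (conv f K) = conv f (dz K) /\ dzb (conv f K) = conv f (dzb K).
Proof.
have dE K' : (forall m, Ck m K') -> dz (conv f K') = conv f (dz K') /\ dzb (conv f K') = conv f (dzb K').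
 move=> CK; split; apply/funext=> z; [exact: wd_dz (conv_wd z (CK 2))|exact: wd_dzb (conv_wd z (CK 2))].
move=> CK; split; last exact: dE.
elim: n K CK=> [|n ih] K CK; first by apply: Ck_zero; exact: conv_ccont.
have CA m : Ck m (dz K) by apply: Ck_dz; exact: CK.
have CB m : Ck m (dzb K) by apply: Ck_dzb; exact: CK.
apply: (proj1 (@Ck_intro n _ _ _ (conv_ccont (CK 2)) (fun z => conv_wd z (CK 2)) (ih _ CA) (ih _ CB) _)).
move=> _ z; rewrite (dE _ CB).1 (dE _ CA).2; congr (conv f _ z).
by apply/funext=> u; exact: Ck_sym (CK 2).
Qed.

End fixed.

End convolution_smooth.

(** * The logarithmic kernel *)

Section logarithm.
Implicit Types (d : {posnum R}) (z w : plane).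

(** log |z|^2, with value 0 at the origin by the convention on [ln]. *)
Definition lg z : C := (ln (sq z))%:C.

Lemma ln_le_sub1 (x : R) : 0 < x -> ln x <= x - 1.
Proof. by move=> x0; rewrite -ler_expR lnK ?posrE //; have := expR_ge1Dx (x - 1); rewrite addrC subrK. Qed.
(** The difference is ln (1 + d / |z|^2). The first bound gives pointwise convergence, the second a
    locally integrable majorant independent of d, from 1 + t^2 <= (1 + t)^2 with t = 1 / |z|. *)
Lemma Lk_lg_sub d z : 0 < sq z -> d%:num <= 1 ->
 normc (Lk d z - lg z) <= d%:num / sq z /\ normc (Lk d z - lg z) <= 2 * (normc (pt z))^-1.
Proof.
move=> s0 d1; have sd : 0 < sq z + d%:num by exact: sqD_gt0.
have n0 : 0 < normc (pt z) by rewrite normc_gt0 -normc_eq0 -sqrf_eq0 normc_pt2 gt_eqF.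
have E : normc (Lk d z - lg z) = ln (1 + d%:num / sq z).
 rewrite LkE /lg -rmorphB normc_real -ln_div ?posrE //.
 have -> : (sq z + d%:num) / sq z = 1 + d%:num / sq z by rewrite mulrDl divff // gt_eqF.
 by rewrite ger0_norm // ln_ge0 // lerDl divr_ge0 // ltW.
have t0 : 0 < 1 + d%:num / sq z by rewrite ltr_pwDl // divr_ge0 // ltW.
rewrite E; split; first by apply: le_trans (ln_le_sub1 t0) _; rewrite addrAC subrr add0r.
set t := (normc (pt z))^-1; have tp : 0 < t by rewrite invr_gt0.
have t1 : 0 < 1 + t by rewrite ltr_pwDl // ltW.
apply: (le_via (ln ((1 + t) ^+ 2))).
 rewrite ler_ln ?posrE ?exprn_gt0 //.
 have h : d%:num / sq z <= t ^+ 2.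
 by rewrite /t exprVn normc_pt2 ler_piMl // invr_ge0 ltW.
 have := ltW tp; nra.
rewrite lnXn // -[X in X <= _]mulr_natl ler_wpM2l //.
by apply: le_trans (ln_le_sub1 t1) _; rewrite addrAC subrr add0r.
Qed.
Lemma normc_lg z : normc (lg z) <= 2 * (normc (pt z))^-1 + normc (pt z) ^+ 2.
Proof.
have i0 : 0 <= (normc (pt z))^-1 by rewrite invr_ge0 normc_ge0.
have [s0|s0] := ltP 0 (sq z); last first.
 by rewrite /lg ln0 // normc0 addr_ge0 ?sqr_ge0 // mulr_ge0.
have [_ h] := @Lk_lg_sub (1%:pos) z s0 (lexx _).
have -> : lg z = Lk 1%:pos z - (Lk 1%:pos z - lg z) by ring.
apply: normcD_le; rewrite normcNE addrC; apply: lerD=> //.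
rewrite LkE normc_ger0 ?normc_pt2; last by rewrite ln_ge0 // lerDr ltW.
by apply: le_trans (ln_le_sub1 _) _; [exact: sqD_gt0|rewrite addrK].
Qed.
Lemma cmfun_lg z : cmfun (fun w : plane => lg (w - z)).
Proof.
apply: (cmfun_comp (meas_shift (- z))); apply: cmfun_real.
apply: (mcomp (@measurable_ln R)); exact: continuous_measurable_plane (@ccont_sq).
Qed.
Lemma rintgD (f g : plane -> R) : rintg f -> rintg g -> rintg (fun z => f z + g z).
Proof. by move=> h k; exact: (integrableD measurableT h k). Qed.
Lemma lg_dominated (F : plane -> C) r z : ccont F -> bsupp r F -> exists2 g : plane -> R, rintg g &
 forall w, normc (lg (w - z)) * normc (F w) <= g w /\ 2 * (normc (pt (w - z)))^-1 * normc (F w) <= g w.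
Proof.
move=> cF bF; have [M [M0 [iM HM]]] := rintg_kernel_invabs z cF bF.
have cG : ccont (fun w => (sq (w - z))%:C * F w).
 rewrite (_ : (fun _ => _) = fun w => (pt (w - z) * (pt (w - z))^*) * F w); last first.
 by apply/funext=> w; rewrite sq_norm.
 have c1 := ccont_shift (- z) (Ck_cont (@Ck_pt 0)).
 exact: ccontM (ccontM c1 (ccontJ c1)) cF.
have bG : bsupp r (fun w => (sq (w - z))%:C * F w) by move=> w /bF ->; rewrite mulr0.
have iG := rintg_normc (cb_cintg cG bG).
exists (fun w => 2 * (M * invabs (`|r| + `|z| + 1) (w - z)) + normc ((sq (w - z))%:C * F w)).
 by apply: rintgD iG; exact: rintgZ.
have h2 w : 2 * (normc (pt (w - z)))^-1 * normc (F w) <= 2 * (M * invabs (`|r| + `|z| + 1) (w - z)).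
 by rewrite -mulrA ler_wpM2l // mulrC HM.
move=> w; split; last by apply: le_trans (h2 w) _; rewrite lerDl normc_ge0.
apply: le_trans (ler_wpM2r (normc_ge0 _) (normc_lg _)) _; rewrite mulrDl; apply: lerD=> //.
by rewrite normcM normc_real normc_pt2 ger0_norm // sq_ge0.
Qed.
Lemma cintg_lg (F : plane -> C) r z : ccont F -> bsupp r F ->
 cintg (fun w => lg (w - z) * F w).
Proof.
move=> cF bF; have [g ig Hg] := lg_dominated z cF bF.
apply: (le_cintg _ _ ig); first by apply: cmfunM; [exact: cmfun_lg|exact: ccont_cmfun].
by move=> w; rewrite normcM; case: (Hg w).
Qed.
Lemma cintg_inv_pt (F : plane -> C) r z : ccont F -> bsupp r F ->
 cintg (fun w => (pt (w - z))^-1 * F w).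
Proof.
move=> cF bF; have [M [M0 [iM HM]]] := rintg_kernel_invabs z cF bF.
apply: le_cintg iM; first by apply: cmfunM; [exact: cmfun_inv_pt|exact: ccont_cmfun].
by move=> w; rewrite normcM normcV mulrC; exact: HM.
Qed.
Lemma cint_Lk_cvg (F : plane -> C) r z : ccont F -> bsupp r F -> forall e, 0 < e ->
 evt n, normc (cI (fun w => Lk (rate n) (w - z) * F w) - cI (fun w => lg (w - z) * F w)) <= e.
Proof.
move=> cF bF; have [g ig Hg] := lg_dominated z cF bF; have mF := ccont_cmfun cF.
have zn : mu [set z] = 0%E by exact: lam2_point.
have mz : measurable [set z].
 by have -> : [set z] = [set z.1] `*` [set z.2];
 [apply/seteqP; split=> w /=; [move=> ->|case: w (z)=> x y [x' y'] /= [-> ->]]|exact: measurableX].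
have s0 w : w <> z -> 0 < sq (w - z).
 move=> wz; rewrite lt_neqAle sq_ge0 andbT eq_sym; apply/eqP=> /eqP.
 rewrite paddr_eq0 ?sqr_ge0 // !sqrf_eq0 !subr_eq0=> /andP[/eqP h1 /eqP h2]; apply: wz.
 by case: w (z) h1 h2=> x y [x' y'] /= -> ->.
apply: (@cint_cvg (fun n w => Lk (rate n) (w - z) * F w) (fun w => lg (w - z) * F w) g).
- move=> n; apply: (cb_cintg (r := r)).
 by apply: ccontM=> //; exact: ccont_shift (ccont_evc _).
 by move=> w /bF ->; rewrite mulr0.
- exact: cintg_lg cF bF.
- exact: ig.
- exists [set z]; split=> // w /= H; apply: contrapT=> nz; apply: H=> n.
 rewrite -mulrBl normcM; apply: le_trans (Hg w).2; apply: ler_wpM2r; first exact: normc_ge0.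
 by have [] := Lk_lg_sub (s0 w nz) (rate_le1 n).
exists [set z]; split=> // w /= H; apply: contrapT=> nz; apply: H=> e e0.
pose B := (sq (w - z))^-1 * normc (F w).
have B0 : 0 <= B by rewrite mulr_ge0 ?normc_ge0 // invr_ge0 sq_ge0.
have eB : 0 < e / (B + 1) by rewrite divr_gt0 // ltr_wpDl.
have [N HN] := rate_small eB; exists N=> n Nn.
rewrite -mulrBl normcM.
apply: (le_via ((rate n)%:num * B)).
 rewrite /B mulrA; apply: ler_wpM2r; first exact: normc_ge0.
 by have [] := Lk_lg_sub (s0 w nz) (rate_le1 n).
apply: le_trans (ler_wpM2r B0 (HN n Nn)) _.
by rewrite mulrAC ler_pdivrMr ?ltr_wpDl // ler_wpM2l ?(ltW e0) // lerDl.
Qed.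
Lemma dz_Lk d : dz (Lk d) = Pk d /\ dzb (Lk d) = (fun z => (Pk d z)^*).
Proof. by split; apply/funext=> z; [exact: wd_dz (wd_Lk d z)|exact: wd_dzb (wd_Lk d z)]. Qed.

(* In the sense of distributions, the log kernel has the Cauchy kernel as derivative. *)
Lemma cint_lg_dz (F : plane -> C) r z : Ck 1 F -> bsupp r F ->
 cI (fun w => lg (w - z) * dz F w) = - cI (fun w => (pt (w - z))^-1 * F w).
Proof.
move=> CF bF; have [cF _ cdF _ _] := Ck_inv CF.
apply: normc_eq_small=> e e0; have e2 := half_gt0 e0.
have [N1 H1] := cint_Lk_cvg z (Ck_cont cdF) (bsupp_dz bF).1 e2.
have [N2 H2] := cint_Pk_cvg z cF bF e2.
pose n := maxn N1 N2.
have h1 := H1 n (leq_maxl _ _); have h2 := H2 n (leq_maxr _ _).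
have CL : Ck 1 (Lk (rate n)) := Ck_evc 1 (ELn (rate n) EX EY).
have E : cI (fun w => Lk (rate n) (w - z) * dz F w) = - cI (fun w => Pk (rate n) (w - z) * F w).
 have [-> _] := cint_ibp (Ck_shift (- z) CL) CF bF; congr (- _).
 by rewrite (dz_shift (- z) CL).1 (dz_Lk _).1.
rewrite E in h1.
set X := cI (fun w => lg _ * _) in h1 *; set Y := cI (fun w => (pt _)^-1 * _) in h2 *.
set Z := cI (fun w => Pk _ _ * _) in h1 h2.
have -> : X - - Y = - ((- Z - X) + (Z - Y)) by ring.
rewrite normcNE; apply: normcD_le; rewrite [leRHS]splitr; exact: lerD.
Qed.
Lemma lgJ z : (lg z)^* = lg z.
Proof. by rewrite /lg conjc_real. Qed.
Lemma cint_lg_dzb (F : plane -> C) r z : Ck 1 F -> bsupp r F ->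
 cI (fun w => lg (w - z) * dzb F w) = - cI (fun w => ((pt (w - z))^*)^-1 * F w).
Proof.
move=> CF bF; have bJ : bsupp r (fun z => (F z)^*) by move=> w /bF ->; rewrite conjc0.
have := cint_lg_dz z (CkJ CF) bJ; rewrite (dzJ CF).1=> /(congr1 (@conjc R)).
have [cF _ _ cdF _] := Ck_inv CF.
have cJ := ccontJ (Ck_cont cdF).
have bdJ : bsupp r (fun w => (dzb F w)^*) by move=> w /(bsupp_dz bF).2 ->; rewrite conjc0.
rewrite conjcN -cintJ; last exact: cintg_lg cJ bdJ.
rewrite -cintJ; last exact: cintg_inv_pt (ccontJ cF) bJ.
under eq_cintT do rewrite conjcM lgJ conjcK.
by under [X in _ = - X]eq_cintT do rewrite conjcM conjcV conjcK.
Qed.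

End logarithm.

(** * Smooth cutoffs at infinity *)

Section cutoffs.
Implicit Types (z w : plane) (p : {poly R}).

Definition cut p n z : R := flat p (1 - sq z / n.+1%:R ^+ 2).

Lemma wd_sq z : wd (fun w : plane => (sq w)%:C) z (pt z)^* (pt z).
Proof.
apply: wd_ext (wdM (wd_pt z) (wdJ (wd_pt z)))=> //.
- by move=> w; rewrite sq_norm.
- by rewrite conjc0 mulr0 add0r mul1r.
- by rewrite conjc1 mulr1 mul0r addr0.
Qed.
Lemma wd_cut p n z : wd (fun w => (cut p n w)%:C) z
 ((cut (flatD p) n z)%:C * (- (pt z)^* / n.+1%:R ^+ 2))
 ((cut (flatD p) n z)%:C * (- pt z / n.+1%:R ^+ 2)).
Proof.
have w0 : wd (fun w : plane => (1 - sq w / n.+1%:R ^+ 2)%:C) z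
 (- (pt z)^* / n.+1%:R ^+ 2) (- pt z / n.+1%:R ^+ 2).
 apply: wd_ext (wdB (wd_cst z 1) (wdZ (n.+1%:R ^+ 2)^-1 (wd_sq z))).
 - move=> w; rewrite rmorphB rmorph1 rmorphM fmorphV rmorphXn rmorph_nat /= mulrC //.
 - by rewrite sub0r mulrC mulNr.
 - by rewrite sub0r mulrC mulNr.
exact: (wd_comp (is_derive_flat p _) w0).
Qed.
Lemma Ck_cut k p n : Ck k (fun w => (cut p n w)%:C).
Proof.
have -> : (fun w => (cut p n w)%:C : C) = evc (EFlat p (EAdd (EC 1)
 (EMul (EC (- (n.+1%:R ^+ 2)^-1)) (EAdd (EMul EX EX) (EMul EY EY))))).
 by apply/funext=> w; rewrite /evc /cut /= /sq -!expr2 mulNr [_^-1 * _]mulrC.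
exact: Ck_evc.
Qed.
Lemma cut_bound p : exists M : R, 0 <= M /\ forall n z, `|cut p n z| <= M.
Proof.
have [M [M0 HM]] := flat_le_sqr p; exists M; split=> // n z; rewrite /cut.
have t0 : 0 <= sq z / n.+1%:R ^+ 2 by rewrite divr_ge0 ?sq_ge0 // exprn_ge0.
have [t1|t1] := leP (sq z / n.+1%:R ^+ 2) 1; last by rewrite flat_le0 ?normr0 // subr_le0 ltW.
have a1 : `|1 - sq z / n.+1%:R ^+ 2| <= 1 by rewrite ger0_norm ?subr_ge0 // gerBl.
apply: le_trans (HM _ a1) _; rewrite ler_piMr // -[_ ^+ 2]ger0_norm ?sqr_ge0 // normrX.
by rewrite expr_le1.
Qed.
Lemma cut_out p n z : n.+1%:R <= `|z| -> cut p n z = 0.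
Proof.
move=> nz; rewrite /cut flat_le0 // subr_le0 ler_pdivlMr ?exprn_gt0 // mul1r.
by apply: le_trans (le_norm_sq z); rewrite ler_sqr ?nnegrE.
Qed.
(** The factor e normalizes the value at the origin to 1, since [flat 1 1] is 1 / e. *)
Definition chi n z : C := (expR 1 * cut 1 n z)%:C.

Lemma Ck_chi k n : Ck k (chi n).
Proof.
have -> : chi n = fun z => (expR 1)%:C * (cut 1 n z)%:C.
 by apply/funext=> z; rewrite /chi rmorphM.
exact: CkZ (Ck_cut _ _ _).
Qed.
Lemma bsupp_chi n : bsupp n.+1%:R (chi n).
Proof. by move=> z nz; rewrite /chi cut_out ?mulr0 // ltW. Qed.
Lemma chi_range n z : 0 <= expR 1 * cut 1 n z <= 1.
Proof.
rewrite mulr_ge0 ?expR_ge0 ?flat_ge0 //= /cut.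
set x := 1 - _; have x1 : x <= 1.
 by rewrite gerBl divr_ge0 ?sq_ge0 // exprn_ge0.
rewrite /flat; case: ifPn=> x0; last by rewrite mulr0.
rewrite hornerC mul1r -expRD -[X in _ <= X]expR0 ler_expR subr_le0.
by rewrite -[leLHS]invr1 lef_pV2 ?posrE.
Qed.
Lemma normc_chi n z : normc (chi n z) <= 1.
Proof. by rewrite /chi normc_real; case/andP: (chi_range n z)=> h ?; rewrite ger0_norm. Qed.
Lemma cvg_sq_div z : (fun n => sq z / n.+1%:R ^+ 2) @ \oo --> (0 : R).
Proof.
have h := @cvg_harmonic R.
have -> : (fun n => sq z / n.+1%:R ^+ 2) = (fun n : nat => sq z * (n.+1%:R^-1 * n.+1%:R^-1)).
 by apply/funext=> n; rewrite -expr2 exprVn.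
rewrite -(mulr0 (sq z)) -(mulr0 0); apply: cvgMr; apply: cvgM; exact: h.
Qed.
Lemma chi_cvg z : forall e, 0 < e -> evt n, normc (chi n z - 1) <= e.
Proof.
have E : (fun n => expR 1 * cut 1 n z) @ \oo --> (1 : R).
 have dd : {for (1 : R), continuous (flat 1)}.
 by apply/differentiable_continuous/derivable1_diffP; case: (is_derive_flat 1 (1 : R)).
 have c1 : (fun n => 1 - sq z / n.+1%:R ^+ 2) @ \oo --> (1 : R).
 by rewrite -[X in _ --> X]subr0; apply: cvgB; [exact: cvg_cst|exact: cvg_sq_div].
 have c2 : (fun n => flat 1 (1 - sq z / n.+1%:R ^+ 2)) @ \oo --> (expR (- 1) : R).
 have -> : expR (- 1) = flat 1 1 :> R by rewrite /flat ltr01 hornerC invr1 mul1r.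
 exact: continuous_cvg.
 have E1 : expR 1 * expR (- 1) = 1 :> R by rewrite -expRD subrr expR0.
 suff : (fun n => expR 1 * cut 1 n z) @ \oo --> expR 1 * expR (- 1)  by rewrite E1.
 exact: cvgMr c2.
move=> e e0; have /cvgrPdist_le/(_ e e0)[N _ HN] := E.
exists N=> n Nn; rewrite normc_distC /chi -(rmorph1 (real_complex R)) -rmorphB normc_real.
exact: HN.
Qed.

(* [dz] and [dzb] of the cutoffs are of size [|z| / n^2]. *)
Lemma dzb_chi n z : dzb (chi n) z = (expR 1)%:C * ((cut (flatD 1) n z)%:C * (- pt z / n.+1%:R ^+ 2))
 /\ dz (chi n) z = (expR 1)%:C * ((cut (flatD 1) n z)%:C * (- (pt z)^* / n.+1%:R ^+ 2)).
Proof.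
have E : chi n = fun z => (expR 1)%:C * (cut 1 n z)%:C.
 by apply/funext=> u; rewrite /chi rmorphM.
by rewrite E; have h := wdZ (expR 1)%:C (wd_cut 1 n z); rewrite (wd_dz h) (wd_dzb h).
Qed.
Lemma normc_natX (n k : nat) : normc (n%:R ^+ k : C) = n%:R ^+ k.
Proof. by rewrite normcX -(rmorph_nat (real_complex R)) normc_ger0. Qed.
Lemma dchi_bound : exists c : R, 0 <= c /\ forall n z,
 [/\ normc (dz (chi n) z) <= c * normc (pt z) / n.+1%:R ^+ 2,
 normc (dzb (chi n) z) <= c * normc (pt z) / n.+1%:R ^+ 2 &
 normc (dzb (dz (chi n)) z) <= c / n.+1%:R ^+ 2 /\
 (normc (dzb (dzb (chi n)) z) <= c / n.+1%:R ^+ 2)].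
Proof.
have [M1 [M10 H1]] := cut_bound (flatD 1).
have [M2 [M20 H2]] := cut_bound (flatD (flatD 1)).
have e0 := expR_ge0 (1 : R).
(* M1 and M2 bound the factors [flatD 1] and [flatD (flatD 1)]. The factor 2 comes from |z|^2 <= 2
   (n + 1)^2 on the box of half-side n + 1, outside which the cutoff vanishes. *)
exists (expR 1 * (M1 + M2 * 2)); split; first by rewrite mulr_ge0 // addr_ge0 // mulr_ge0.
move=> n z; have sp : 0 < (n.+1%:R : R) ^+ 2 by rewrite exprn_gt0.
have key (x : C) : normc x = normc (pt z) ->
 normc ((expR 1)%:C * ((cut (flatD 1) n z)%:C * (x / n.+1%:R ^+ 2))) <=
 expR 1 * (M1 + M2 * 2) * normc (pt z) / n.+1%:R ^+ 2.
 move=> xz; rewrite !normcM normcV !normc_real normc_natX xz (ger0_norm e0).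
 rewrite -[X in _ <= X]mulrA -[X in _ <= X]mulrA; apply: ler_wpM2l=> //.
 apply: ler_wpM2r; first by rewrite divr_ge0 ?normc_ge0 // ltW.
 by apply: le_trans (H1 n z) _; rewrite lerDl mulr_ge0.
have second (a b c' : C) : normc a = normc (pt z) -> normc b = normc (pt z) -> normc c' <= 1 ->
 normc ((expR 1)%:C * ((cut (flatD (flatD 1)) n z)%:C * (a / n.+1%:R ^+ 2) * (b / n.+1%:R ^+ 2) +
 (cut (flatD 1) n z)%:C * (c' / n.+1%:R ^+ 2))) <= expR 1 * (M1 + M2 * 2) / n.+1%:R ^+ 2.
 move=> az bz c1; rewrite normcM normc_real (ger0_norm e0) -[X in _ <= X]mulrA; apply: ler_wpM2l=> //.
 apply: normcD_le; rewrite addrC mulrDl; apply: lerD.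
 rewrite !normcM normcV normc_real normc_natX mulrA; apply: ler_wpM2r; first by rewrite invr_ge0 ltW.
 by rewrite -[leRHS]mulr1; apply: ler_pM; rewrite ?normc_ge0.
 rewrite !normcM normcV normc_real normc_natX az bz.
 have [nz|nz] := leP n.+1%:R `|z|.
 by rewrite cut_out // normr0 !mul0r mulr_ge0 ?mulr_ge0 // invr_ge0 ltW.
 rewrite mulrA; apply: ler_wpM2r; first by rewrite invr_ge0 ltW.
 rewrite -mulrA; apply: ler_pM=> //.
 by rewrite mulr_ge0 ?normc_ge0 // mulr_ge0 ?normc_ge0 // invr_ge0 ltW.
 rewrite mulrAC ler_pdivrMr // -expr2 normc_pt2 /sq mulrDl !mul1r.
 by apply: lerD; rewrite -[leLHS]real_normK ?num_real // ler_sqr ?nnegrE //;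
 apply: le_trans (ltW nz); rewrite norm_planeE le_max lexx ?orbT.
have n1 : normc (- pt z) = normc (pt z) by rewrite normcNE.
have n2 : normc (- (pt z)^*) = normc (pt z) by rewrite normcNE normc_conj.
have [b1 b2] := dzb_chi n z.
have E1 : dz (chi n) = fun z => (expR 1)%:C * ((cut (flatD 1) n z)%:C * (- (n.+1%:R ^+ 2)^-1 * (pt z)^*)).
 by apply/funext=> u; have [_ ->] := dzb_chi n u; congr (_ * (_ * _)); ring.
have E2 : dzb (chi n) = fun z => (expR 1)%:C * ((cut (flatD 1) n z)%:C * (- (n.+1%:R ^+ 2)^-1 * pt z)).
 by apply/funext=> u; have [-> _] := dzb_chi n u; congr (_ * (_ * _)); ring.
split; [rewrite b2; exact: key|rewrite b1; exact: key|split].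
- rewrite E1 (wd_dzb (wdZ (expR 1)%:C (wdM (wd_cut (flatD 1) n z)
 (wdZ (- (n.+1%:R ^+ 2)^-1) (wdJ (wd_pt z)))))) conjc1.
 have := second (- pt z) (- (pt z)^*) (-1) n1 n2; rewrite normcNE normc_real normr1=> /(_ (lexx _)).
 congr (normc (_ * _) <= _); rewrite addrC; congr (_ + _); ring.
- rewrite E2 (wd_dzb (wdZ (expR 1)%:C (wdM (wd_cut (flatD 1) n z)
 (wdZ (- (n.+1%:R ^+ 2)^-1) (wd_pt z))))).
 have := second (- pt z) (- pt z) 0 n1 n1; rewrite normc0=> /(_ ler01).
 congr (normc (_ * _) <= _); rewrite addrC; congr (_ + _); ring.
Qed.

End cutoffs.

(** * Real masses as complex integrals *)

Section mass.
Implicit Types (d : {posnum R}) (z w : plane).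

Lemma area_int_cint (g : plane -> R) (c : R) : rintg g -> (forall z, 0 <= g z) ->
 (aint (fun z => (g z)%:E) = c%:E <-> cI (fun z => (g z)%:C) = c%:C).
Proof.
move=> ig g0; rewrite area_intE cintE /= /Rintegral integral0 mulr0.
have /fineK E := integrable_fin_num measurableT ig.
rewrite -[X in ((pi^-1)%:E * X)%E]E -EFinM; split; first by case=> ->.
by case=> ->.
Qed.

End mass.

(** * The Cauchy kernel flattened in a disc *)

Section truncated_kernel.
Implicit Types (z w : plane).
Variable e : R.
Hypothesis e0 : 0 < e.

(* The kernel [1 / zeta] flattened inside the disc of radius [e], and its derivatives off the circle. *)
Definition nmax z : R := Num.max (normc (pt z)) e.
Definition Pt z : C := (pt z)^* * ((nmax z ^+ 2)^-1)%:C.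
Definition PtA z : C := if e < normc (pt z) then - (pt z ^+ 2)^-1 else 0.
Definition disc z : R := if normc (pt z) <= e then (e ^+ 2)^-1 else 0.

Lemma nmax_gt0 z : 0 < nmax z.
Proof. by rewrite lt_max e0 orbT. Qed.
Lemma nmax_ge z : normc (pt z) <= nmax z /\ e <= nmax z.
Proof. by rewrite !le_max !lexx orbT. Qed.
Lemma Pt_out z : e <= normc (pt z) -> Pt z = (pt z)^-1.
Proof.
move=> h; rewrite /Pt /nmax max_l //.
have n0 : pt z != 0 by rewrite -normc_gt0 (lt_le_trans e0).
have sn : (normc (pt z) ^+ 2)%:C = pt z * (pt z)^* by rewrite normc_mul_conj.
have c0 : (pt z)^* != 0 by rewrite -normc_gt0 normc_conj normc_gt0.
by rewrite fmorphV /= sn invfM mulrCA mulfV ?mulr1.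
Qed.
Lemma Pt_in z : normc (pt z) <= e -> Pt z = (e ^+ 2)^-1%:C * (pt z)^*.
Proof. by move=> h; rewrite /Pt /nmax max_r // mulrC. Qed.
Lemma Pt_bound z : normc (Pt z) <= e^-1.
Proof.
rewrite /Pt normcM normc_conj normc_ger0 ?invr_ge0 ?sqr_ge0 //.
have n0 := nmax_gt0 z; have [n1 n2] := nmax_ge z.
apply: (le_via (nmax z)^-1); last by rewrite lef_pV2 ?posrE.
by rewrite ler_pdivrMr ?exprn_gt0 // expr2 mulKf ?gt_eqF.
Qed.
(** [nmax] is 1-Lipschitz and at least e. The difference splits into a change of the numerator,
    costing 1 / e^2, and a change of the inverse square, costing 2 / e^2. *)
Lemma Pt_lip z w : normc (Pt z - Pt w) <= 3 / e ^+ 2 * normc (pt z - pt w).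
Proof.
have [a0 b0] := (nmax_gt0 z, nmax_gt0 w).
have [[za ea] [wb eb]] := (nmax_ge z, nmax_ge w).
have ab : `|nmax z - nmax w| <= normc (pt z - pt w).
 have h1 := normc_lerB (pt z) (pt w); have h2 := normc_lerB (pt w) (pt z); rewrite normc_distC in h2.
 have h3 := normc_ge0 (pt z - pt w).
 rewrite ler_norml /nmax; case: (leP (normc (pt z)) e)=> c1; case: (leP (normc (pt w)) e)=> c2;
 rewrite ?(max_r c1) ?(max_r c2) ?(max_l (ltW c1)) ?(max_l (ltW c2)); apply/andP; split; lra.
rewrite /Pt; set A := nmax z in a0 za ea ab *; set B := nmax w in b0 wb eb ab *.
have an0 : A != 0 by rewrite gt_eqF.
have bn0 : B != 0 by rewrite gt_eqF.
have -> : (pt z)^* * ((A ^+ 2)^-1)%:C - (pt w)^* * ((B ^+ 2)^-1)%:C =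
 (pt z - pt w)^* * ((A ^+ 2)^-1)%:C + (pt w)^* * ((B - A) * ((A + B) / (A ^+ 2 * B ^+ 2)))%:C.
 have -> : (B - A) * ((A + B) / (A ^+ 2 * B ^+ 2)) = (A ^+ 2)^-1 - (B ^+ 2)^-1 by field; rewrite an0 bn0.
 by rewrite (rmorphB (@conjc R)) [in RHS]rmorphB /=; ring.
apply: normcD_le.
rewrite !normcM !normc_conj !normc_real.
have -> : 3 / e ^+ 2 * normc (pt z - pt w) = normc (pt z - pt w) * (e ^+ 2)^-1 +
 normc (pt z - pt w) * (2 * (e ^+ 2)^-1) by ring.
have e2 : 0 < e ^+ 2 by rewrite exprn_gt0.
apply: lerD.
 apply: ler_wpM2l; first exact: normc_ge0.
 by rewrite ger0_norm ?invr_ge0 ?sqr_ge0 // lef_pV2 ?posrE ?exprn_gt0 // ler_sqr ?nnegrE // ltW.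
rewrite normrM distrC mulrCA; apply: ler_pM=> //; first by rewrite mulr_ge0 ?normc_ge0.
rewrite ger0_norm; last by rewrite divr_ge0 ?addr_ge0 ?mulr_ge0 ?sqr_ge0 // ltW.
apply: (le_via (B * ((A + B) / (A ^+ 2 * B ^+ 2)))).
 by apply: ler_wpM2r=> //; rewrite divr_ge0 ?addr_ge0 ?mulr_ge0 ?sqr_ge0 // ltW.
have -> : B * ((A + B) / (A ^+ 2 * B ^+ 2)) = A^-1 * B^-1 + A^-1 * A^-1 by field; rewrite an0 bn0.
have -> : 2 * (e ^+ 2)^-1 = e^-1 * e^-1 + e^-1 * e^-1 by rewrite expr2 invfM; ring.
have iA : A^-1 <= e^-1 by rewrite lef_pV2 ?posrE.
have iB : B^-1 <= e^-1 by rewrite lef_pV2 ?posrE.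
by apply: lerD; apply: ler_pM; rewrite ?invr_ge0 // ltW.
Qed.
(** Each vertical line meets the circle in at most two points. *)
Lemma circle_null z : mu [set w | normc (pt (w - z)) = e] = 0%E.
Proof.
rewrite /lam2 /product_measure1; apply: integral0_eq=> x _ /=.
apply: countable_lebesgue_measure0.
pose s := Num.sqrt (e ^+ 2 - (x - z.1) ^+ 2).
apply: (@sub_countable _ _ _ [set z.2 + s; z.2 - s]); last first.
 by apply: finite_set_countable; exact: finite_set2.
apply: subset_card_le=> y; rewrite /xsection /= inE=> h.
have hh : normc (pt ((x, y) - z)) = e := h.
have {}h : (y - z.2) ^+ 2 = e ^+ 2 - (x - z.1) ^+ 2.
 by have := normc_pt2 ((x, y) - z); rewrite hh /sq /= => ->; rewrite addrAC subrr add0r.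
have : `|y - z.2| = s by rewrite /s -h sqrtr_sqr.
case: (lerP 0 (y - z.2))=> y0.
 by rewrite ger0_norm // => <-; left; rewrite addrC subrK.
by rewrite ltr0_norm // => <-; right; rewrite opprK addrC subrK.
Qed.
Lemma meas_circle z : measurable [set w : plane | normc (pt (w - z)) = e].
Proof.
have mn : mfun (fun w : plane => normc (pt (w - z))).
 by apply: meas_normc; apply: (cmfun_comp (meas_shift (- z))); exact: cmfun_pt.
have -> : [set w : plane | normc (pt (w - z)) = e] =
 setT `&` (fun w : plane => normc (pt (w - z))) @^-1` [set e] by rewrite setTI.
by apply: mn=> //; exact: measurable_set1.
Qed.
Lemma wd_near F G z a b : (\forall w \near z, F w = G w) -> wd F z a b -> wd G z a b.
Proof.
move=> FG [[h1 h2] [h3 h4]]; split; split.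
- by apply: near_eq_is_derive h1; apply: filterS FG=> w ->.
- by apply: near_eq_is_derive h2; apply: filterS FG=> w ->.
- by apply: near_eq_is_derive h3; apply: filterS FG=> w ->.
- by apply: near_eq_is_derive h4; apply: filterS FG=> w ->.
Qed.
Lemma wd_Pt z : normc (pt z) <> e -> wd Pt z (PtA z) (disc z)%:C.
Proof.
move=> ze; have e2 : 0 < e ^+ 2 by rewrite exprn_gt0.
have eE (x : plane) : (e < normc (pt x)) = (e ^+ 2 < sq x).
 by rewrite -normc_pt2 ltr_sqr ?nnegrE ?normc_ge0 // ltW.
have eE' (x : plane) : (normc (pt x) < e) = (sq x < e ^+ 2).
 by rewrite -normc_pt2 ltr_sqr ?nnegrE ?normc_ge0 // ltW.
rewrite /PtA /disc; case: (ltgtP e (normc (pt z)))=> [h|h|h]; last by case: ze.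
- have n0 : pt z != 0 by rewrite -normc_gt0 (lt_trans e0).
 have w1 := wd_inv n0 (wd_pt z); rewrite oppr0 mul0r mulN1r in w1.
 apply: wd_near w1; have d0 : 0 < sq z - e ^+ 2 by rewrite subr_gt0 -eE.
 have /cvgrPdist_lt/(_ _ d0) := @ccont_sq z; apply: filterS=> w wz.
 by rewrite Pt_out // ltW // eE; have := ler_norm (sq z - sq w); lra.
- have w1 := wdZ (e ^+ 2)^-1%:C (wdJ (wd_pt z)); rewrite conjc0 conjc1 mulr0 mulr1 in w1.
 apply: wd_near w1; have d0 : 0 < e ^+ 2 - sq z by rewrite subr_gt0 -eE'.
 have /cvgrPdist_lt/(_ _ d0) := @ccont_sq z; apply: filterS=> w wz.
 by rewrite Pt_in // ltW // eE'; have := ler_norm (sq w - sq z); rewrite distrC; lra.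
Qed.
Lemma cmfun_Pt : cmfun Pt.
Proof.
apply: cmfunM; first by apply: cmfunJ; exact: cmfun_pt.
apply/cmfun_real/meas_inv/measurable_funX; apply: measurable_maxr; last exact: mcst.
by apply: meas_normc; exact: cmfun_pt.
Qed.
Lemma meas_disc : mfun disc.
Proof.
apply: measurable_fun_if=> //.
by apply: measurable_fun_ler; [apply: meas_normc; exact: cmfun_pt|exact: mcst].
Qed.
Lemma cmfun_PtA : cmfun PtA.
Proof.
apply: cmfun_ifb; last exact: cmfun_cst.
 by apply: measurable_fun_ltr; [exact: mcst|apply: meas_normc; exact: cmfun_pt].
by apply/cmfunN/cmfunV; rewrite (_ : (fun _ => _) = fun z => pt z * pt z) //; apply: cmfunM; exact: cmfun_pt.
Qed.
Lemma disc_ge0 z : 0 <= disc z.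
Proof. by rewrite /disc; case: ifP=> // _; rewrite invr_ge0 sqr_ge0. Qed.
Lemma ibp_Pt r z G : Ck 1 G -> bsupp r G ->
 cI (fun w => Pt (w - z) * dz G w) = - cI (fun w => PtA (w - z) * G w) /\
 cI (fun w => Pt (w - z) * dzb G w) = - cI (fun w => (disc (w - z))%:C * G w).
Proof.
have ei : 0 <= (e ^+ 2)^-1 by rewrite invr_ge0 sqr_ge0.
have le3 : (e ^+ 2)^-1 <= 3 / e ^+ 2 by rewrite -[leLHS]mul1r ler_wpM2r // ler1n.
have mS := meas_shift (- z).
apply: (@cint_ibp_lip r (fun w => Pt (w - z)) (fun w => PtA (w - z)) (fun w => (disc (w - z))%:C)
 (3 / e ^+ 2) e^-1).
- exact: (cmfun_comp mS cmfun_Pt).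
- exact: (cmfun_comp mS cmfun_PtA).
- exact: (cmfun_comp mS (cmfun_real meas_disc)).
- by move=> w; exact: Pt_bound.
- move=> v u h vE; apply: le_trans (Pt_lip _ _) _; apply: ler_wpM2l; first by rewrite divr_ge0 ?sqr_ge0.
 have -> : pt (h *: v + u - z) - pt (u - z) = h%:C * pt v.
 by case: v {vE}=> v1 v2; apply: complex_ext=> /=; rewrite /GRing.scale /=; ring.
 rewrite normcM normc_real -[leRHS]mulr1; apply: ler_wpM2l=> //.
 by case: vE=> -> /=; rewrite ?expr0n /= ?expr1n ?addr0 ?add0r sqrtr1.
- exists [set w | normc (pt (w - z)) = e]; split; [exact: meas_circle|exact: circle_null|].
 move=> w /= H; apply: contrapT=> nz; apply: H.
 have nz' : normc (pt (w - z)) <> e := nz.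
 exact: (wd_shift (wd_Pt nz')).
- move=> w; rewrite /PtA; case: ifP=> [h|_]; last by rewrite normc0 divr_ge0 ?sqr_ge0.
 rewrite normcNE normcV normcX; apply: le_trans le3.
 have p0 := lt_trans e0 h.
 by rewrite lef_pV2 ?posrE ?exprn_gt0 // ler_sqr ?nnegrE ?(ltW p0) ?(ltW e0) // ltW.
- move=> w; rewrite normc_ger0 ?disc_ge0 // /disc; case: ifP=> _ //.
 by rewrite divr_ge0 ?sqr_ge0.
Qed.
Lemma rintg_disc : rintg disc.
Proof.
apply: (le_rintg meas_disc _ (rintg_box e (e ^+ 2)^-1))=> z.
rewrite ger0_norm ?disc_ge0 // /disc; case: ifP=> h; last by case: ifP=> // _; rewrite invr_ge0 sqr_ge0.
by rewrite ifT // (le_trans (le_normc_pt z)).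
Qed.

(* Green's formula gives the mass of the disc: [Pt] differs from the Cauchy kernel only inside the disc, where the
 derivatives of the cutoffs tend to zero. *)
Lemma cint_disc : cI (fun z => (disc z)%:C) = 1.
Proof.
have [c [c0 Hc]] := @dchi_bound; pose K := 2 * c * e ^+ 2; have K0 : 0 <= K by rewrite /K mulr_ge0 ?sqr_ge0 // mulr_ge0.
pose dd n z : C := (Pt z - (pt z)^-1) * dzb (chi n) z.
pose f n z := (disc z)%:C * chi n z + dd n z.
have id := cintg_real rintg_disc; have dg := disc_ge0.
have rn n : (n.+1%:R ^+ 2)^-1 <= (rate n)%:num :> R.
 by rewrite /= lef_pV2 ?posrE ?exprn_gt0 // expr2 ler_peMl // ler1n.
have fb n z : normc (f n z - (disc z)%:C) <= disc z * (normc (chi n z - 1) + K * (rate n)%:num).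
 have -> : f n z - (disc z)%:C = (disc z)%:C * (chi n z - 1) + dd n z by rewrite /f; ring.
 apply: normcD_le; rewrite normcM normc_ger0 // mulrDr lerD2l.
 have [h|h] := leP e (normc (pt z)); first by rewrite /dd Pt_out // subrr mul0r normc0 mulr_ge0 // mulr_ge0.
 have [_ b _] := Hc n z; have e2 : 0 < e ^+ 2 by rewrite exprn_gt0.
 have -> : disc z = (e ^+ 2)^-1 by rewrite /disc ltW.
 have -> : (e ^+ 2)^-1 * (K * (rate n)%:num) = 2 * c * (rate n)%:num.
 by rewrite /K; move: (rate n)%:num=> t; field; rewrite gt_eqF.
 rewrite /dd normcM; apply: le_trans (ler_wpM2l (normc_ge0 _) b) _; rewrite !mulrA.
 apply: ler_pM (rn n); rewrite ?invr_ge0 ?sqr_ge0 ?mulr_ge0 ?normc_ge0 //.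
 rewrite mulrAC; apply: ler_wpM2r=> //.
 apply: (le_via ((e^-1 + (normc (pt z))^-1) * normc (pt z))).
 apply: ler_wpM2r; rewrite ?normc_ge0 //; apply: normcD_le.
 by rewrite normcNE normcV lerD2r Pt_bound.
 rewrite mulrDl -[leRHS]/(1 + 1); apply: lerD; first by rewrite mulrC ler_pdivrMr // mul1r ltW.
 by have [->|z0] := eqVneq (normc (pt z)) 0; rewrite ?mulr0 // mulVf.
have mchi n : cmfun (chi n) := ccont_cmfun (Ck_cont (@Ck_chi 0 n)).
(* Integration by parts for [Pt] cancels the integral of [disc] times the cutoff, and Cauchy-Pompeiu
   at 0 leaves the value [chi n 0], which is 1. *)
have cf n : cintg (f n) /\ cI (f n) = 1.
 have C1 := @Ck_chi 1 n; have bc := @bsupp_chi n; have cdc := Ck_cont (Ck_dzb C1); have [_ bdc] := bsupp_dz bc.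
 have [M [M0 HM]] := cb_bounded cdc bdc.
 have i1 : cintg (fun z => Pt z * dzb (chi n) z).
 apply: (@bb_cintg n.+1%:R (e^-1 * M)).
 - by apply: cmfunM; [exact: cmfun_Pt|exact: ccont_cmfun].
 - by move=> z /bdc ->; rewrite mulr0.
 - by move=> z; rewrite normcM; apply: ler_pM; rewrite ?normc_ge0 ?Pt_bound.
 have i2 := cintg_inv_pt 0 cdc bdc; have e2 := cauchy_pompeiu 0 C1 bc.
 have s0 (k F : plane -> C) w : k (w - 0) * F w = k w * F w by rewrite subr0.
 rewrite (funext (s0 (fun w => (pt w)^-1) _)) in i2 e2.
 have [_ e1] := ibp_Pt 0 C1 bc.
 rewrite (funext (s0 Pt _)) (funext (s0 (fun w => (disc w)%:C) _)) in e1.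
 have i3 : cintg (fun z => (disc z)%:C * chi n z).
 apply: (le_cintg _ _ (rintg_normc id)); first by apply: cmfunM=> //; exact: cintg_cmfun.
 by move=> z; rewrite normcM -[leRHS]mulr1 ler_wpM2l ?normc_ge0 // normc_chi.
 have E : f n = fun z => (disc z)%:C * chi n z + (Pt z * dzb (chi n) z - (pt z)^-1 * dzb (chi n) z).
 by apply/funext=> z; rewrite /f /dd mulrBl.
 have i12 := cintgB i1 i2; rewrite E (cintD i3 i12) (cintB i1 i2) e1 e2; split; first exact: cintgD.
 rewrite opprK addrA subrr add0r /chi /cut /sq /= !expr0n /= addr0 mul0r subr0 /flat ltr01 hornerC mul1r invr1.
 by rewrite -expRD subrr expR0.
have ig : rintg (fun z => (2 + K) * disc z) := rintgZ (2 + K) rintg_disc.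
apply: normc_eq_small=> d d0.
have [||N /(_ N (leqnn _))] := cint_cvg (fun n => (cf n).1) id ig _ _ d0; last by rewrite (cf N).2 normc_distC.
- apply: aeW=> z /= n; apply: (le_trans (fb n z)); rewrite mulrC; apply: ler_wpM2r=> //; apply: lerD.
 apply: normcD_le; rewrite normcNE -[leRHS]/(1 + 1) (_ : normc 1 = 1) ?lerD2r ?normc_chi //.
 by rewrite -[1]/((1 : R)%:C) normc_real normr1.
 by rewrite ler_piMr // /= invf_le1 // ler1n.
- apply: aeW=> z /= b b0; have K1 : 0 < disc z * (1 + K) + 1 by rewrite ltr_wpDl // mulr_ge0 // addr_ge0.
 have t0 := divr_gt0 b0 K1; have [N1 H1] := chi_cvg z t0; have [N2 H2] := rate_small t0.
 exists (maxn N1 N2)=> n; rewrite geq_max=> /andP[/H1 h1 /H2 h2]; apply: (le_trans (fb n z)).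
 apply: (le_via ((disc z * (1 + K)) * (b / (disc z * (1 + K) + 1)))).
 rewrite -mulrA; apply: ler_wpM2l=> //; rewrite mulrDl mul1r; apply: lerD=> //.
 exact: ler_wpM2l.
 by rewrite mulrCA ler_piMr ?(ltW b0) // ler_pdivrMr // mul1r lerDl.
Qed.

End truncated_kernel.

(** * Measurability of integrals with a parameter *)

Section parametric_integral.

Lemma meas_Rintegral (F : plane * plane -> R) : mfun F ->
 mfun (fun z => \int[mu]_w F (z, w)).
Proof.
move=> mF; rewrite /Rintegral.
have -> : (fun z => fine (\int[mu]_w (F (z, w))%:E)%E) =
 fine \o (fun z => \int[mu]_w (Num.max (F (z, w)) 0)%:E - \int[mu]_w (Num.max (- F (z, w)) 0)%:E)%E.
 apply/funext=> z /=; congr fine; rewrite integralE; congr (_ - _)%E;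
 by apply: eq_integral=> w _; rewrite ?funeposE ?funenegE /= -?EFinN EFin_max.
apply: mcomp; first exact: fine_measurable.
by apply: emeasurable_funB; apply: (@meas_tonelli (fun zw => Num.max _ 0))=> [|zw];
 rewrite ?le_max ?lexx ?orbT //; apply: measurable_maxr=> //; exact: mcomp.
Qed.
Lemma cmfun_cint (F : plane * plane -> C) : cmfun F -> cmfun (fun z => cI (fun w => F (z, w))).
Proof.
move=> [m1 m2]; split.
- rewrite (_ : (fun _ => _) = fun z => pi^-1 * \int[mu]_w Re (F (z, w))).
 by apply: mfunM=> //; exact: (@meas_Rintegral (fun zw => Re (F zw))).
 by apply/funext=> z; rewrite cintE.
- rewrite (_ : (fun _ => _) = fun z => pi^-1 * \int[mu]_w Im (F (z, w))).
 by apply: mfunM=> //; exact: (@meas_Rintegral (fun zw => Im (F zw))).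
 by apply/funext=> z; rewrite cintE.
Qed.
Lemma cint_mkcond (b : plane -> bool) (f : plane -> C) :
 cint [set z | b z] f = cI (fun z => if b z then f z else 0).
Proof.
rewrite !cintE; congr Complex; congr (_ * _); rewrite Rintegral_mkcond;
 apply: eq_Rintegral=> z _; rewrite /patch /=; case: ifPn=> h; case: ifPn=> // h'.
- by move: h; rewrite inE /= (negbTE h').
- by move: h; rewrite notin_setE /= h'.
- by move: h; rewrite inE /= (negbTE h').
- by move: h; rewrite notin_setE /= h'.
Qed.
Lemma bounded_norm_LpC (p r M : R) (f : plane -> C) : 0 < p -> bsupp r f ->
 (forall z, normc (f z) <= M) -> (nLp p f < +oo)%E.
Proof.
move=> p0 fr fM; rewrite norm_LpCE; apply: poweR_lty; rewrite /powint area_intE.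
have [_ h] := (rintgP _).1 (rintg_box r (M `^ p)).
apply: lte_mul_pinfty=> //; first by rewrite lee_fin invr_ge0 pi_ge0.
apply: le_lt_trans h; apply: le_integral_lower=> z; rewrite lee_fin ?powR_ge0 //.
rewrite ger0_norm; last by case: ifP=> // _; exact: powR_ge0.
case: (leP `|z| r)=> zr; last by rewrite fr // normc0 powR0 // gt_eqF.
by apply: ler_powR_nneg=> //; [exact: ltW|exact: normc_ge0].
Qed.

End parametric_integral.

(** * Power integrals at infinity *)

Section tail.

Definition tail_pow (q r t : R) : R := if r <= t then t `^ (- q) else 0.

Lemma tail_pow_ge0 q r t : 0 <= tail_pow q r t.
Proof. by rewrite /tail_pow; case: ifP=> // _; exact: powR_ge0. Qed.
Lemma meas_tail_pow q r : mfun (tail_pow q r).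
Proof.
apply: measurable_fun_if=> //; first exact: measurable_fun_ler.
exact: measurable_funTS (meas_powR_fun _).
Qed.
Lemma integral_tail_pow q r : 1 < q -> 0 < r ->
 (\int[leb]_t (tail_pow q r t)%:E = (r `^ (1 - q) / (q - 1))%:E)%E.
Proof.
move=> q1 r0; have s0 : 0 < q - 1 by rewrite subr_gt0.
pose F (t : R) : R := - (q - 1)^-1 * t `^ (1 - q).
have dF (t : R) : 0 < t -> is_derive t (1 : R) F (t `^ (- q)).
 move=> t0; have := is_deriveZ (- (q - 1)^-1) (is_derive1_powR (1 - q) t0).
 rewrite /GRing.scale /= -[in (1 - q) * _](opprB q 1) mulrA mulrNN mulVf ?gt_eqF // mul1r.
 by rewrite opprB addrAC subrr add0r.
have cF (t : R) : 0 < t -> {for t, continuous F}.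
 by move=> t0; apply: differentiable_continuous; apply/derivable1_diffP; case: (dF t t0).
have -> : (\int[leb]_t (tail_pow q r t)%:E = \int[leb]_(t in `[r, +oo[) (t `^ (- q))%:E)%E.
 rewrite [RHS]integral_mkcond; apply: eq_integral=> t _; rewrite patchE /tail_pow.
 by rewrite (_ : (t \in _) = (r <= t)); [case: ifP|rewrite mem_setE in_itv /= andbT].
rewrite (@ge0_continuous_FTC2y R _ F r 0).
- by rewrite sub0e -EFinN /F mulNr opprK mulrC.
- by move=> t _; exact: powR_ge0.
- apply: continuous_in_subspaceT=> t; rewrite inE /= in_itv /= andbT=> rt.
 have t0 := lt_le_trans r0 rt.
 apply: differentiable_continuous; apply/derivable1_diffP.
 by case: (is_derive1_powR (- q) t0).
- apply/cvgrPdist_le=> e e0; near=> t.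
 have t0 : 0 < t by near: t; exact: nbhs_pinfty_gt.
 rewrite sub0r /F mulNr opprK ger0_norm ?mulr_ge0 ?powR_ge0 ?invr_ge0 ?(ltW s0) //.
 rewrite mulrC ler_pdivrMr // -opprB powRN.
 have es : 0 < e * (q - 1) by rewrite mulr_gt0.
 rewrite -[leRHS]invrK lef_pV2 ?posrE ?powR_gt0 ?invr_gt0 //.
 apply: (le_via ((((e * (q - 1))^-1 `^ (q - 1)^-1)) `^ (q - 1))).
 by rewrite -powRrM mulVf ?gt_eqF // powRr1 // invr_ge0 ltW.
 apply: ler_powR_nneg; [exact: ltW|exact: powR_ge0|].
 by near: t; apply: nbhs_pinfty_ge; exact: num_real.
- by move=> t rt; case: (dF t (lt_trans r0 rt)).
- by apply: cvg_at_right_filter; exact: cF.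
- by move=> t; rewrite in_itv /= andbT=> rt; rewrite derive1E; case: (dF t (lt_trans r0 rt)).
Unshelve. all: by end_near. Qed.
Lemma integral_one_plus_abs q : 1 < q ->
 (\int[leb]_t ((1 + `|t : R|) `^ (- q))%:E < +oo)%E.
Proof.
move=> q1; pose T : R -> R := tail_pow q 1.
have mT : mfun (fun t => (T t)%:E) by apply/mEFin; exact: meas_tail_pow.
have T0 t : (0 <= (T t)%:E)%E by rewrite lee_fin tail_pow_ge0.
have m1 : mfun (fun t : R => (T (t - -1))%:E).
 by apply: (mcomp mT); apply: mfunB=> //; exact: mcst.
have m2 : mfun (fun t : R => (T (1 - t))%:E).
 by apply: (mcomp mT); apply: mfunB=> //; exact: mcst.
apply: (@le_lt_trans _ _ (\int[leb]_t ((T (t - -1))%:E + (T (1 - t))%:E))%E).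
 apply: ge0_le_integral=> //.
 - apply/mEFin/(mcomp (meas_powR_fun _)).
 by apply: mfunD; [exact: mcst|exact: normr_measurable].
 - by apply: emeasurable_funD.
 - move=> t _; rewrite -EFinD lee_fin opprK addrC.
 have [t0|t0] := lerP 0 t.
 by rewrite ler_wpDr ?tail_pow_ge0 // /T /tail_pow lerDr t0 ger0_norm.
 by rewrite ler_wpDl ?tail_pow_ge0 // /T /tail_pow lerDl oppr_ge0 (ltW t0) addrC ltr0_norm.
rewrite ge0_integralD //.
rewrite (ge0_integral_shift1 (-1) mT) // (ge0_integral_refl1 1 mT) // integral_tail_pow //.
by rewrite -EFinD ltry.
Qed.
Lemma ge0_integral_prod (f g : R -> R) : mfun f -> mfun g ->
 (forall x, 0 <= f x) -> (forall x, 0 <= g x) -> (\int[leb]_x (g x)%:E < +oo)%E ->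
 (\int[@lam2 R]_z (f z.1 * g z.2)%:E = (\int[leb]_x (f x)%:E) * (\int[leb]_x (g x)%:E))%E.
Proof.
move=> mf mg f0 g0 goo; pose G (z : R * R) : \bar R := (f z.1 * g z.2)%:E.
have mG : mfun G.
 apply/mEFin; apply: mfunM.
 exact: (mcomp mf mfst).
 exact: (mcomp mg msnd).
have G0 z : (0 <= G z)%E by rewrite lee_fin mulr_ge0.
have mEf : mfun (fun t => (f t)%:E) by exact/mEFin.
have mEg : mfun (fun t => (g t)%:E) by exact/mEFin.
rewrite (fubini_tonelli1 (m1 := leb) (m2 := leb) G mG G0) /fubini_F /G /=.
set c := (\int[leb]_x (g x)%:E)%E in goo *.
have c0 : (0 <= c)%E by apply: integral_ge0=> t _; rewrite lee_fin.
have E x : (\int[leb]_y (f x * g y)%:E = (f x)%:E * c)%E.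
 under eq_integral do rewrite EFinM.
 by rewrite ge0_integralZl_EFin // => y _; rewrite lee_fin.
under eq_integral do rewrite E.
by rewrite ge0_integralZr // => y _; rewrite lee_fin.
Qed.

End tail.

(** * The Beurling transform on dbar-derivatives of smooth functions *)

Section beurling_on_smooth.
Implicit Types (z w : plane) (W F : plane -> C).

Lemma beurling_trunc_PtA (e : R) (f : plane -> C) z :
 beurling_trunc e f z = - cI (fun w => - (PtA e (w - z) * f w)).
Proof.
rewrite /beurling_trunc cint_mkcond; congr (- _); apply: eq_cintT=> w.
rewrite /PtA -normcNE -[pt (w - z)]/(pt w - pt z) opprB; case: ifP=> _; last by rewrite mul0r oppr0.
by rewrite mulNr opprK mulrC -(opprB (pt w)) sqrrN.
Qed.
Lemma PtA_bound (e : R) z : 0 < e -> normc (PtA e z) <= (e ^+ 2)^-1.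
Proof.
move=> e0; rewrite /PtA; case: ifP=> [h|_]; last by rewrite normc0 invr_ge0 sqr_ge0.
rewrite normcNE normcV normcX; have p0 := lt_trans e0 h.
by rewrite lef_pV2 ?posrE ?exprn_gt0 // ler_sqr ?nnegrE ?(ltW p0) ?(ltW e0) // ltW.
Qed.
(** Two integrations by parts against [Pt]: one takes d off the kernel, the derivatives of W are
    interchanged, and the other puts dbar on the kernel, which produces the normalized indicator of
    the disc. *)
Lemma beurling_trunc_dzb (e r : R) W z : 0 < e -> Ck 2 W -> bsupp r W ->
 beurling_trunc e (dzb W) z = cI (fun w => (disc e (w - z))%:C * dz W w).
Proof.
move=> e0 CW bW; have [b1 b2] := bsupp_dz bW.
have [h1 _] := ibp_Pt e0 z (Ck_dzb CW) b2.
have [_ h2] := ibp_Pt e0 z (Ck_dz CW) b1.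
have E : cI (fun w => Pt e (w - z) * dz (dzb W) w) = cI (fun w => Pt e (w - z) * dzb (dz W) w).
 by apply: eq_cintT=> w; rewrite (Ck_sym _ CW).
have [M [M0 HM]] := cb_bounded (Ck_cont (Ck_dzb CW)) b2.
have i : cintg (fun w => PtA e (w - z) * dzb W w).
 apply: (@bb_cintg r ((e ^+ 2)^-1 * M)).
 - apply: cmfunM; last exact: ccont_cmfun (Ck_cont (Ck_dzb CW)).
 exact: cmfun_comp (meas_shift (- z)) (cmfun_PtA e).
 - by move=> w /b2 ->; rewrite mulr0.
 - by move=> w; rewrite normcM; apply: ler_pM; rewrite ?normc_ge0 ?PtA_bound.
by rewrite beurling_trunc_PtA cintN // -h1 E h2 opprK.
Qed.
Lemma mass_disc (e : R) : 0 < e -> aint (fun z => (disc e z)%:E) = 1%E.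
Proof.
move=> e0; apply/(area_int_cint 1 (rintg_disc e) (disc_ge0 e)); exact: cint_disc.
Qed.
Lemma disc_average F r z : ccont F -> bsupp r F -> forall d, 0 < d ->
 exists2 a, 0 < a & forall e, 0 < e -> e < a ->
 normc (cI (fun w => (disc e (w - z))%:C * F w) - F z) <= d.
Proof.
move=> cF bF d d0; have [a a0 Ha] := ccont_at z cF d0; exists a=> // e e0 ea.
have iD := cintg_real (rintg_disc e).
have iDs : cintg (fun w => (disc e (w - z))%:C) := cintg_shift (- z) iD.
have cD : cI (fun w => (disc e (w - z))%:C) = 1.
 by rewrite (cint_shift (- z) (cintg_cmfun iD)) cint_disc.
have [M [M0 HM]] := cb_bounded cF bF.
have iF : cintg (fun w => (disc e (w - z))%:C * F w).
 apply: (@bb_cintg r ((e ^+ 2)^-1 * M)).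
 - by apply: cmfunM; [exact: cintg_cmfun iDs|exact: ccont_cmfun].
 - by move=> w /bF ->; rewrite mulr0.
 - move=> w; rewrite normcM normc_ger0 ?disc_ge0 //; apply: ler_pM; rewrite ?disc_ge0 ?normc_ge0 //.
 by rewrite /disc; case: ifP=> // _; rewrite invr_ge0 sqr_ge0.
have -> : F z = cI (fun w => F z * (disc e (w - z))%:C) by rewrite cintZ // cD mulr1.
rewrite -cintB //; last exact: cintgZ.
rewrite -lee_fin; apply: le_trans (normc_cint_area _) _.
 by apply/cintg_cmfun/cintgB=> //; exact: cintgZ.
have ig : rintg (fun w => d * disc e (w - z)).
 by apply: rintgZ; exact: (integrable_shift (- z) (rintg_disc e)).
have -> : d%:E = aint (fun w => (d * disc e (w - z))%:E).
 apply/esym/(area_int_cint d ig)=> [w|]; first by rewrite mulr_ge0 ?disc_ge0 ?ltW.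
 rewrite (eq_cintT (g := fun w => d%:C * (disc e (w - z))%:C)); last by move=> w; rewrite rmorphM.
 by rewrite cintZ // cD mulr1.
apply: le_area_int=> w; rewrite lee_fin ?normc_ge0 //.
rewrite [F z * _]mulrC -mulrBr normcM normc_ger0 ?disc_ge0 // mulrC.
rewrite /disc; case: ifP=> h; last by rewrite !mulr0.
apply: ler_wpM2r; first by rewrite invr_ge0 sqr_ge0.
have -> : w = z - (z - w) by rewrite opprB addrC subrK.
by apply: Ha; rewrite distrC (le_lt_trans (le_normc_pt _)) // (le_lt_trans h).
Qed.
(** The truncations are disc averages of the continuous function [dz W], so the principal value
    exists at every point. *)
Lemma beurling_dzb W r : Ck 2 W -> bsupp r W -> beurling (dzb W) = dz W.
Proof.
move=> CW bW; apply/funext=> z.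
have av := disc_average z (Ck_cont (Ck_dz CW)) (bsupp_dz bW).1.
have lim_of (g : C -> R) : (forall a b, `|g a - g b| <= normc (a - b)) ->
 lim ((fun e => g (beurling_trunc e (dzb W) z)) @ 0^'+) = g (dz W z).
 move=> gl; apply: cvg_lim=> //; apply/cvgrPdist_le=> d d0.
 have [a a0 Ha] := av d d0; near=> e.
 have e0 : 0 < e by near: e; exact: nbhs_right_gt.
 have ea : e < a by near: e; exact: nbhs_right_lt.
 by rewrite distrC; apply: le_trans (gl _ _) _; rewrite (beurling_trunc_dzb z e0 CW bW) Ha.
rewrite /beurling lim_of; last by move=> a b; rewrite -raddfB; exact: normc_Re.
by rewrite lim_of; [case: (dz W z)|move=> a b; rewrite -raddfB; exact: normc_Im].
Unshelve. all: by end_near. Qed.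
Lemma beurling_norm_ge0 (p : R) : 0 < p -> (0 <= beurling_norm p)%E.
Proof.
move=> p0; apply: (le_via (nLp p (beurling (fun=> 0)))); first exact: norm_LpC_ge0.
apply: ereal_sup_ubound; exists (fun=> 0)=> //=.
by split; [split; [split; exact: mcst|]|]; rewrite norm_LpC0.
Qed.
Lemma Ck_norm_LpC_lty (p r : R) W : 0 < p -> ccont W -> bsupp r W -> (nLp p W < +oo)%E.
Proof.
by move=> p0 cW bW; have [M [_ HM]] := cb_bounded cW bW; exact: bounded_norm_LpC p0 bW HM.
Qed.
(** [beurling_norm] is a supremum over the unit ball, so W is rescaled. The scalar is the inverse of
    n + e / (b + 1), where n is the norm of [dzb W], so that n may be 0. *)
Lemma dz_le_beurling (p b r : R) W : 0 < p -> (beurling_norm p <= b%:E)%E ->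
 Ck 2 W -> bsupp r W -> (nLp p (dz W) <= b%:E * nLp p (dzb W))%E.
Proof.
move=> p0 pb CW bW; have [b1 b2] := bsupp_dz bW.
have b0 : 0 <= b by rewrite -lee_fin (le_trans (beurling_norm_ge0 p0)).
have [c1 c2] := (Ck_cont (Ck_dz CW), Ck_cont (Ck_dzb CW)).
have := Ck_norm_LpC_lty p0 c1 b1; have := Ck_norm_LpC_lty p0 c2 b2.
have := norm_LpC_ge0 p (dz W); have := norm_LpC_ge0 p (dzb W).
have H (t : R) : 0 < t -> (t%:E * nLp p (dzb W) <= 1)%E -> (t%:E * nLp p (dz W) <= b%:E)%E.
 move=> t0 tW; apply: le_trans pb.
 have CT : Ck 2 (fun z => t%:C * W z) by exact: CkZ.
 have bT : bsupp r (fun z => t%:C * W z) by move=> z /bW ->; rewrite mulr0.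
 have [dT dbT] : dz (fun z => t%:C * W z) = (fun z => t%:C * dz W z) /\
 dzb (fun z => t%:C * W z) = (fun z => t%:C * dzb W z).
 have [-> ->] := dzM (Ck_cst 1 t%:C) (CkS CW); have [-> ->] := dz_cst t%:C.
 by split; apply/funext=> z; rewrite mul0r addr0.
 have nt : normc (t%:C : C) = t by rewrite normc_real gtr0_norm.
 rewrite -{1}nt -(norm_LpCZ _ p0 (ccont_cmfun c1)) -dT -(beurling_dzb CT bT) dbT.
 have eN := norm_LpCZ t%:C p0 (ccont_cmfun c2); rewrite nt in eN.
 apply: ereal_sup_ubound; exists (fun z => t%:C * dzb W z)=> //=.
 split; last by rewrite eN.
 by split; [apply: cmfunM; [exact: cmfun_cst|exact: ccont_cmfun]|rewrite eN (le_lt_trans tW) // ltry].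
move: H; case: (nLp p (dz W))=> // d; case: (nLp p (dzb W))=> // n H.
rewrite !lee_fin=> n0 d0 _ _; apply/ler_addgt0Pr=> e e0.
have b10 : 0 < b + 1 by lra.
have m0 : 0 < n + e / (b + 1) by rewrite ltr_wpDl // divr_gt0.
have := H (n + e / (b + 1))^-1; rewrite invr_gt0 -!EFinM !lee_fin.
rewrite ler_pdivrMl // mulr1 lerDl divr_ge0 ?(ltW e0) ?(ltW b10) // ler_pdivrMl // => /(_ m0 isT) h.
apply: (le_trans h); rewrite mulrDl [n * b]mulrC lerD2l mulrAC ler_pdivrMr //.
by rewrite ler_pM2l // lerDl.
Qed.

End beurling_on_smooth.

(** * Bounding the Beurling norm from a dense class *)

Section beurling_transfer.
Implicit Types (z w : plane) (W F : plane -> C).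

(** Outside the disc of radius e, 1 + |x| and 1 + |y| are at most (1/e + 1) |z|, so |z|^(-2) is at
    most A / ((1 + |x|)(1 + |y|)). The q-th power of this product is integrable for q > 1. *)
Lemma norm_LpC_PtA (q e : R) : 1 < q -> 0 < e -> (nLp q (PtA e) < +oo)%E.
Proof.
move=> q1 e0; have q0 := lt_trans ltr01 q1.
pose A := (e^-1 + 1) ^+ 2; pose g (t : R) := (1 + `|t|) `^ (- q).
have mg : mfun g.
 apply: (mcomp (meas_powR_fun _)).
 by apply: mfunD; [exact: mcst|exact: normr_measurable].
have g0 t : 0 <= g t by exact: powR_ge0.
have goo := integral_one_plus_abs q1.
rewrite norm_LpCE; apply: poweR_lty; rewrite /powint area_intE.
apply: lte_mul_pinfty=> //; first by rewrite lee_fin invr_ge0 pi_ge0.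
apply: (@le_lt_trans _ _ (\int[mu]_z ((A `^ q * g z.1) * g z.2)%:E)%E); last first.
 rewrite (ge0_integral_prod (f := fun x => A `^ q * g x) (g := g)) //; last first.
 - by move=> x; rewrite mulr_ge0 ?powR_ge0.
 - by apply: mfunM=> //; exact: mcst.
 under eq_integral do rewrite EFinM.
 rewrite ge0_integralZl_EFin ?powR_ge0 //; last first.
 - exact/mEFin.
 - by move=> x _; rewrite lee_fin.
 apply: lte_mul_pinfty=> //.
 - by rewrite mule_ge0 ?lee_fin ?powR_ge0 // integral_ge0 // => x _; rewrite lee_fin.
 - apply/fin_numM=> //; rewrite ge0_fin_numE // integral_ge0 // => x _; by rewrite lee_fin.
apply: le_integral_lower=> z; rewrite lee_fin ?powR_ge0 //.
rewrite /PtA; case: ifP=> [h|_]; last by rewrite normc0 powR0 ?gt_eqF // !mulr_ge0 ?powR_ge0.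
rewrite normcNE normcV normcX; have p0 := lt_trans e0 h; set n := normc _ in h p0 *.
have xn : `|z.1| <= n by exact: (normc_Re (pt z)).
have yn : `|z.2| <= n by exact: (normc_Im (pt z)).
have h1 : 1 + `|z.1| != 0 by rewrite gt_eqF // ltr_wpDr.
have h2 : 1 + `|z.2| != 0 by rewrite gt_eqF // ltr_wpDr.
have -> : A `^ q * g z.1 * g z.2 = (A * (1 + `|z.1|)^-1 * (1 + `|z.2|)^-1) `^ q.
 have gV t : 0 <= t -> t `^ (- q) = t^-1 `^ q.
 by move=> t0'; rewrite -[t^-1]powR_inv1 // -powRrM mulN1r.
 have [a1 a2] : 0 <= 1 + `|z.1| /\ 0 <= 1 + `|z.2| by rewrite !addr_ge0.
 have A0 : 0 <= A by exact: sqr_ge0.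
 rewrite /g !gV //; move: A a1 a2 A0=> A' a1 a2 A0.
 by rewrite !powRM ?mulr_ge0 ?invr_ge0.
apply: ler_powR_nneg; [exact: ltW|by rewrite invr_ge0 sqr_ge0|].
rewrite -mulrA -invfM ler_pdivlMr ?mulr_gt0 ?ltr_wpDr // mulrC ler_pdivrMr ?exprn_gt0 //.
have -> : A * n ^+ 2 = (n / e + n) ^+ 2 by rewrite /A; ring.
have ne : 1 <= n / e by rewrite ler_pdivlMr // mul1r ltW.
by rewrite expr2; apply: ler_pM; rewrite ?addr_ge0 // lerD.
Qed.
Lemma cmfun_beurling_trunc (e : R) (f : plane -> C) : cmfun f -> cmfun (beurling_trunc e f).
Proof.
move=> mf; rewrite (_ : beurling_trunc e f = fun z => - cI (fun w => - (PtA e (z - w) * f w))); last first.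
 apply/funext=> z; rewrite beurling_trunc_PtA; congr (- _); apply: eq_cintT=> w.
 by rewrite -opprB /PtA -[pt (- _)]/(- pt (z - w)) normcNE sqrrN.
apply: cmfunN.
apply: (@cmfun_cint (fun zw => - (PtA e (zw.1 - zw.2) * f zw.2))).
apply/cmfunN/cmfunM; last exact: (cmfun_comp msnd mf).
exact: (cmfun_comp meas_sub_plane (cmfun_PtA e)).
Qed.
Lemma disc_even (e : R) z : disc e (- z) = disc e z.
Proof. by rewrite /disc -[pt (- z)]/(- pt z) normcNE. Qed.
Lemma beurling_trunc_dzb_le (p e r : R) W : 1 < p -> 0 < e -> Ck 2 W -> bsupp r W ->
 (nLp p (beurling_trunc e (dzb W)) <= nLp p (dz W))%E.
Proof.
move=> p1 e0 CW bW; have p0 := lt_trans ltr01 p1.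
have m := ccont_cmfun (Ck_cont (Ck_dz CW)).
have md := cmfun_real (meas_disc e).
have -> : beurling_trunc e (dzb W) = fun z => cI (fun w => (disc e w)%:C * dz W (z - w)).
 apply/funext=> z; rewrite (beurling_trunc_dzb z e0 CW bW).
 rewrite -(cint_reflB z); first by apply: eq_cintT=> w; rewrite addrAC subrr add0r disc_even.
 by apply: cmfunM=> //; exact: cmfun_comp (meas_shift (- z)) md.
apply: (@young p (1 - p^-1)^-1)=> //.
- by rewrite invr_gt0 subr_gt0 invf_lt1.
- by rewrite invrK addrC subrK.
- exact: meas_disc.
- exact: disc_ge0.
- by rewrite mass_disc.
Qed.
(** The inequality with constant c on a class whose dbar-derivatives are dense; it forces B(p) <=
    c. *)
Definition beurling_dense (p c : R) := forall f : plane -> C, in_LpC p f -> forall d, 0 < d ->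
 exists u r, [/\ Ck 2 u, bsupp r u, (nLp p (fun z => (dzb u z - f z)%R) <= d%:E)%E &
 (nLp p (dz u) <= c%:E * nLp p (dzb u))%E].

(** The truncated kernel lies in L^q, so L^p convergence of [dzb (u n)] to f gives pointwise
    convergence of the truncated transforms; Fatou's lemma then carries the bound over to f. *)
Lemma beurling_trunc_le (p c e : R) f : 1 < p -> 0 <= c -> 0 < e -> beurling_dense p c -> in_LpC p f ->
 (nLp p (beurling_trunc e f) <= c%:E * nLp p f)%E.
Proof.
move=> p1 c0 e0 dense Lf; have p0 := lt_trans ltr01 p1; have p1' := ltW p1.
pose q := (1 - p^-1)^-1.
have [s0 q0 pq] := conj_exponent p1; rewrite -/q in q0 pq.
have q1 : 1 < q by rewrite invf_gt1 // gtrBl invr_gt0.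
have Koo := norm_LpC_PtA q1 e0.
have Kf : nLp q (PtA e) \is a fin_num by rewrite ge0_fin_numE // norm_LpC_ge0.
pose K := fine (nLp q (PtA e)).
have KE : nLp q (PtA e) = K%:E by rewrite fineK.
have K0 : 0 <= K by rewrite fine_ge0 // norm_LpC_ge0.
have [mf fx] : cmfun f /\ exists x, nLp p f = x%:E.
 case: Lf=> mf Lf; split=> //; exists (fine (nLp p f)).
 by rewrite fineK // ge0_fin_numE // norm_LpC_ge0.
case: fx=> x fx.
have tr_int (h : plane -> C) z : cmfun h -> (nLp p h < +oo)%E ->
 cintg (fun w => PtA e (w - z) * h w) /\
 ((normc (cI (fun w => PtA e (w - z) * h w)))%:E <= K%:E * nLp p h)%E.
 move=> mh hoo; have mk := cmfun_comp (meas_shift (- z)) (cmfun_PtA e).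
 have nk : nLp q (fun w => PtA e (w - z)) = K%:E by rewrite (norm_LpC_shift q (- z) (cmfun_PtA e)).
 have qp : q^-1 + p^-1 = 1 by rewrite addrC.
 have nkoo : (nLp q (fun w : plane => PtA e (w - z)%R) < +oo)%E by rewrite nk ltry.
 split; first exact: (hoelder_cintg q0 p0 qp mk mh nkoo hoo).
 by rewrite -nk; exact: (hoelder_cint q0 p0 qp mk mh).
have key d : 0 < d -> (nLp p (beurling_trunc e f) <= (c * (x + d))%:E)%E.
 move=> d0; have [N HN] := rate_small d0.
 have /choice[u Hu] n : exists u, exists r, [/\ Ck 2 u, bsupp r u,
 (nLp p (fun z => (dzb u z - f z)%R) <= (rate n)%:num%:E)%E &
 (nLp p (dz u) <= c%:E * nLp p (dzb u))%E].
 by apply: dense.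
 have mu_ n : cmfun (dzb (u n)) by have [r [C2 _ _ _]] := Hu n; exact: ccont_cmfun (Ck_cont (Ck_dzb C2)).
 have md n : cmfun (fun z => dzb (u n) z - f z) by exact: cmfunB.
 have moo n : (nLp p (fun z => (dzb (u n) z - f z)%R) < +oo)%E.
 by have [r [_ _ h _]] := Hu n; rewrite (le_lt_trans h) // ltry.
 apply: (@norm_LpC_Fatou p _ (fun n => beurling_trunc e (dzb (u n))) _ N)=> //.
 - by move=> n; exact: cmfun_beurling_trunc.
 - move=> z d' d'0; have K10 : 0 < K + 1 by lra.
 have [M HM] := rate_small (divr_gt0 d'0 K10).
 exists M=> n Mn; have [r [_ _ h _]] := Hu n.
 have [i1 b1] := tr_int _ z (md n) (moo n).
 have [i2 _] : cintg (fun w => PtA e (w - z) * f w) /\ _ := tr_int _ z mf Lf.2.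
 rewrite !beurling_trunc_PtA !cintN //; last first.
 have := cintgD i1 i2; congr cintg; apply/funext=> w; ring.
 rewrite !opprK -lerBlDl; apply: le_trans (normc_lerB _ _) _.
 rewrite -lee_fin normc_distC -cintB //; last first.
 have := cintgD i1 i2; congr cintg; apply/funext=> w; ring.
 rewrite (eq_cintT (g := fun w => PtA e (w - z) * (dzb (u n) w - f w))); last by move=> w; ring.
 apply: (le_trans b1); apply: (le_via (K * (d' / (K + 1)))%:E).
 rewrite EFinM; apply: lee_wpmul2l; first by rewrite lee_fin.
 by apply: le_trans h _; rewrite lee_fin HM.
 by rewrite lee_fin mulrA ler_pdivrMr // mulrC ler_pM2l // lerDl.
 - move=> n Nn; have [r [C2 bu h1 h2]] := Hu n.
 apply: le_trans (beurling_trunc_dzb_le p1 e0 C2 bu) _; apply: (le_trans h2).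
 rewrite EFinM; apply: lee_wpmul2l; first by rewrite lee_fin.
 have := norm_LpCD p1' (md n) mf.
 rewrite (_ : (fun z => _) = dzb (u n)); last by apply/funext=> z; rewrite subrK.
 move=> h; apply: (le_trans h); rewrite fx addeC EFinD leeD2l //.
 by apply: le_trans h1 _; rewrite lee_fin HN.
rewrite fx -EFinM; apply/lee_addgt0Pr=> d d0.
have c10 : 0 < c + 1 by lra.
apply: le_trans (key _ (divr_gt0 d0 c10)) _.
rewrite -EFinD lee_fin mulrDr lerD2l mulrA ler_pdivrMr // mulrC ler_pM2l // lerDl //.
Qed.
Lemma cvg_at_rate (g : R -> R) (l : R) : g e @[e --> 0^'+] --> l ->
 forall d, 0 < d -> evt n, `|g (rate n)%:num - l| <= d.
Proof.
move=> /cvgrPdist_le h d d0; have := h d d0; rewrite near_withinE=> /nbhs_ballP[a a0 H].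
have a2 : 0 < a / 2 by rewrite divr_gt0.
have [N HN] := rate_small a2; exists N=> n Nn; rewrite distrC; apply: H=> //.
rewrite /ball /= sub0r normrN gtr0_norm //; apply: le_lt_trans (HN n Nn) _; by rewrite ltr_pdivrMr // ltr_pMr // ltr1n.
Qed.

(* A one-sided limit that does not exist has the junk value 0, which only helps here. *)
Lemma lim_at_rate (g : R -> R) d : 0 < d -> evt n, exists s, `|lim (g @ 0^'+) - s| <= d /\ `|s| <= `|g (rate n)%:num|.
Proof.
move=> d0; have [cg|dg] := pselect (cvg (g @ 0^'+)).
 have [N HN] := cvg_at_rate cg d0; exists N=> n Nn; exists (g (rate n)%:num).
 by rewrite distrC HN.
exists 0%N=> n _; exists 0; rewrite (dvgP dg) subr0 normr0; split=> //; exact: ltW.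
Qed.
Lemma beurling_le_trunc (f : plane -> C) z d : 0 < d -> evt n, normc (beurling f z) <= normc (beurling_trunc (rate n)%:num f z) + d.
Proof.
move=> d0; have d2 : 0 < d / 2 by rewrite divr_gt0.
have [N1 H1] := lim_at_rate (fun e => Re (beurling_trunc e f z)) d2.
have [N2 H2] := lim_at_rate (fun e => Im (beurling_trunc e f z)) d2.
exists (maxn N1 N2)=> n; rewrite geq_max=> /andP[/H1[s [s1 s2]] /H2[t [t1 t2]]].
rewrite /beurling; set a := lim _ in s1 *; set b := lim _ in t1 *.
have -> : Complex a b = Complex s t + Complex (a - s) (b - t).
 by apply/eqP; rewrite eq_complex /= ![_ + (_ - _)]addrC !subrK !eqxx.
apply: normcD_le; apply: lerD.
 rewrite -ler_sqr ?nnegrE ?normc_ge0 // !normc_sqr /=; apply: lerD.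
 by rewrite -[leLHS]real_normK ?num_real // -[leRHS]real_normK ?num_real // ler_sqr ?nnegrE.
 by rewrite -[leLHS]real_normK ?num_real // -[leRHS]real_normK ?num_real // ler_sqr ?nnegrE.
by apply: le_trans (normc_le_ReIm _) _=> /=; lra.
Qed.
Lemma beurling_norm_le (p c : R) : 1 < p -> 0 <= c -> beurling_dense p c -> (beurling_norm p <= c%:E)%E.
Proof.
move=> p1 c0 dense; apply: ge_ereal_sup=> _ [f [Lf f1] <-].
apply: (@norm_LpC_Fatou p _ (fun n => beurling_trunc (rate n)%:num f) _ 0).
- exact: lt_trans p1.
- by move=> n; apply: cmfun_beurling_trunc; case: Lf.
- by move=> z d d0; exact: beurling_le_trunc.
- move=> n _; apply: le_trans (beurling_trunc_le p1 c0 _ dense Lf) _=> //.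
 by rewrite -[leRHS]mule1; apply: lee_wpmul2l; rewrite ?lee_fin.
Qed.
(** For a real bump W, [dzb W] is the conjugate of [dz W]. If B(p) were 0, both would be null, and
    integration by parts would make all disc averages of W around 0 vanish, whereas W takes the
    value 1 there. *)
Lemma beurling_norm_gt0 (p : R) : 1 < p -> (0 < beurling_norm p)%E.
Proof.
move=> p1; have p0 := lt_trans ltr01 p1; rewrite lt_neqAle beurling_norm_ge0 // andbT; apply/eqP=> b0.
pose W : plane -> C := chi 0.
have CW k : Ck k W := @Ck_chi k 0; have bW := @bsupp_chi 0%N.
have W0 : dzb W = fun z => (dz W z)^*.
 have := (dzJ (CW 1%N)).2; rewrite (_ : (fun z => _) = W) //.
 by apply/funext=> z; rewrite /W /chi; exact: conjc_real.
have nz : nLp p (dzb W) = 0%E.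
 rewrite W0 (eq_norm_LpC p (g := dz W)); last by move=> z; exact: normc_conj.
 apply: le_anti; rewrite norm_LpC_ge0 andbT; have := @dz_le_beurling p 0 1%:R W p0.
 by rewrite -b0 mul0e; apply.
have z0 e : 0 < e -> cI (fun w => (disc e (w - 0))%:C * W w) = 0.
 move=> e0; have [_ h] := ibp_Pt e0 0 (CW 1%N) bW.
 suff /eqP : normc (cI (fun w => Pt e (w - 0) * dzb W w)) == 0.
 by move/eqP; rewrite h normcNE normc_eq0=> /eqP.
 (* The kernel is cut to the box containing the support of W, which puts it in the dual space. *)
 pose B : plane -> C := fun w => if `|w| <= 1%:R then Pt e (w - 0) else 0.
 have mB : cmfun B.
 apply: cmfun_ifb; last exact: cmfun_cst.
 by apply: measurable_fun_ler; [exact: meas_norm_plane|exact: mcst].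
 exact: cmfun_comp (meas_shift (- 0)) (cmfun_Pt e).
 have [s0 q0 pq] := conj_exponent p1.
 have mW := ccont_cmfun (Ck_cont (Ck_dzb (CW 1%N))).
 have := hoelder_cint p0 q0 pq mW mB; rewrite nz.
 have Boo : (nLp (1 - p^-1)^-1 B < +oo)%E.
 apply: (@bounded_norm_LpC _ 1%:R e^-1)=> //.
 by move=> w; rewrite /B ltNge=> /negbTE ->.
 move=> w; rewrite /B; case: ifP=> _; first exact: Pt_bound.
 by rewrite normc0 invr_ge0 ltW.
 rewrite mul0e lee_fin=> h'; rewrite eq_le normc_ge0 andbT.
 rewrite (eq_cintT (g := fun w => dzb W w * B w)) // => w; rewrite mulrC /B.
 by case: (leP `|w| 1%:R)=> // /((bsupp_dz bW).2) ->; rewrite !mul0r.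
have W1 : W 0 = 1.
 rewrite /W /chi /cut (_ : sq 0 = 0) ?mul0r ?subr0; last by rewrite /sq /= expr0n addr0.
 by rewrite /flat ltr01 invr1 hornerC mul1r -expRD subrr expR0.
have h2 : 0 < 2^-1 :> R by rewrite invr_gt0.
have [a a0 H] := disc_average 0 (Ck_cont (CW 0%N)) bW h2.
have a2 : 0 < a / 2 by rewrite divr_gt0.
have := H (a / 2) a2; rewrite z0 // W1 sub0r normcNE normc_real normr1.
have : (1 : R) <= 2^-1 -> False by move=> ?; lra.
by move=> K /(_ ltac:(lra)).
Qed.

End beurling_transfer.

(** * Density of second derivatives of compactly supported functions *)

Section density.
Implicit Types (z w : plane) (W F : plane -> C).

Lemma norm_LpC_box (p r M : R) F : 0 < p -> 0 <= r -> bsupp r F -> (forall z, normc (F z) <= M) ->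
 (nLp p F <= (M * (2 * r) `^ (2 / p))%:E)%E.
Proof.
move=> p0 r0 Fr FM; have M0 : 0 <= M by exact: le_trans (normc_ge0 (F 0)) (FM 0).
apply: norm_LpC_le=> //; first by rewrite lee_fin mulr_ge0 ?powR_ge0.
pose A := [set z : plane | `|z| <= r]; have mA : measurable A by exact: meas_box.
have muA : (mu A <= ((2 * r) ^+ 2)%:E)%E.
 pose I : set (measurableTypeR R) := `[- r, r]%classic.
 have HI : (leb I <= (2 * r)%:E)%E.
 rewrite lebesgue_measure_itv /=; case: ifP=> _; last by rewrite lee_fin mulr_ge0.
 by rewrite -EFinB lee_fin opprK mulrDl !mul1r.
 rewrite /A boxE /lam2 product_measure1E ?measurable_itv //; try exact: measurable_itv.
 by rewrite expr2 EFinM; apply: lee_pmul.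
rewrite /powint area_intE poweR_EFin powRM ?powR_ge0 // -powRrM mulfVK ?gt_eqF //.
rewrite powR_mulrn ?mulr_ge0 //.
apply: (le_via (1 * \int[mu]_(z in A) (M `^ p)%:E)%E); last first.
 rewrite mul1e integral_cst // EFinM; apply: lee_wpmul2l=> //.
 by rewrite lee_fin powR_ge0.
apply: lee_pmul.
- by rewrite lee_fin invr_ge0 pi_ge0.
- by apply: integral_ge0=> z _; rewrite lee_fin powR_ge0.
- rewrite lee_fin invf_le1 ?pi_gt0 //.
 by have := @pihalf_ge1 R; lra.
rewrite [leRHS]integral_mkcond; apply: le_integral_lower=> z; rewrite ?lee_fin ?powR_ge0 //.
rewrite patchE; case: ifPn; first by move=> _; rewrite lee_fin; apply: ler_powR_nneg; rewrite ?normc_ge0 // ltW.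
move=> h; rewrite Fr ?normc_real ?normr0 ?powR0 ?gt_eqF //.
by move: h; rewrite notin_setE /A /= => /negP; rewrite -ltNge.
Qed.

(** E is one of the two derivatives, and H n a smooth potential for which dbar E (H n) will be an
    approximate identity k n. Growth slower than every power and first derivatives of size 1 / |z|
    are what the cutoff at infinity can absorb. *)
Variables (p : R) (H : nat -> plane -> C) (E : (plane -> C) -> plane -> C) (k : nat -> plane -> R).
Hypothesis p1 : 1 < p.
Hypothesis Edz : E = @dz R \/ E = @dzb.
Hypothesis CH : forall n m, Ck m (H n).
Hypothesis Hgrowth : forall n s, 0 < s -> exists c, 0 <= c /\ forall z, normc (H n z) <= c * (1 + sq z) `^ s.
Hypothesis Hdecay : forall n, exists c, 0 <= c /\ forall z, (1 + normc (pt z)) * normc (dz (H n) z) <= c /\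
 (1 + normc (pt z)) * normc (dzb (H n) z) <= c.

Let p0 : 0 < p := lt_trans ltr01 p1.

Lemma EM F G : Ck 2 F -> Ck 2 G -> dzb (E (fun z => F z * G z)) =
 fun z => F z * dzb (E G) z + (dzb F z * E G z + E F z * dzb G z + dzb (E F) z * G z).
Proof.
move=> CF CG; apply/funext=> z.
have [d1 d2] := dzM (CkS CF) (CkS CG).
have [[a1 a2] [b1 b2]] := (conj (Ck_dz CF) (Ck_dzb CF), conj (Ck_dz CG) (Ck_dzb CG)).
have [F1 G1] := (CkS CF, CkS CG).
case: Edz=> ->.
 rewrite d1 (dzD (CkM F1 b1) (CkM a1 G1)).2 (dzM F1 b1).2 (dzM a1 G1).2 !addrA //.
rewrite d2 (dzD (CkM F1 b2) (CkM a2 G1)).2 (dzM F1 b2).2 (dzM a2 G1).2 !addrA //.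
Qed.
Lemma Ck_E n F : Ck n.+1 F -> Ck n (E F).
Proof. by move=> CF; case: Edz=> ->; [exact: Ck_dz|exact: Ck_dzb]. Qed.

Section one_kernel.
Variables (f : plane -> C) (r : R) (n : nat).
Hypothesis if0 : cintg f.
Hypothesis fr : bsupp r f.
Hypothesis r0 : 0 <= r.

Let U := conv f (H n).
(** The growth allowed to the potential: an error of size m^(sigma - 2) on a box of side of order m
    has L^p norm of order m^(sigma - 2 + 2/p) = m^(-sigma). *)
Let sigma : R := 1 - p^-1.

Lemma sigma_gt0 : 0 < sigma. Proof. by rewrite subr_gt0 invf_lt1. Qed.
Lemma U_props : [/\ forall m, Ck m U, E U = conv f (E (H n)), dz U = conv f (dz (H n)) &
 dzb U = conv f (dzb (H n))].
Proof.
have h m := Ck_conv if0 fr m (CH n).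
have e : E U = conv f (E (H n)) by case: Edz=> ->; case: (h 0%N)=> _ [].
by split=> //; [move=> m; case: (h m)|case: (h 0%N)=> _ []|case: (h 0%N)=> _ []].
Qed.

Let Cf := pi^-1 * \int[lam2]_z normc (f z).
Let Cf0 : 0 <= Cf.
Proof.
by apply: mulr_ge0; [rewrite invr_ge0 pi_ge0|apply: fine_ge0; apply: integral_ge0=> z _; rewrite lee_fin normc_ge0].
Qed.
Lemma dU_decay : exists A, 0 <= A /\ forall z, normc (pt z) * normc (E U z) <= A /\ normc (pt z) * normc (dzb U z) <= A.
Proof.
have [c [c0 Hc]] := Hdecay n; have [_ eU _ ebU] := U_props.
exists (Cf * ((1 + 2 * r) * c)); split.
 by apply: mulr_ge0 Cf0 _; rewrite mulr_ge0 // addr_ge0 ?mulr_ge0.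
have main (G : plane -> C) z : Ck 0 G -> (forall u, (1 + normc (pt u)) * normc (G u) <= c) ->
 normc (pt z) * normc (conv f G z) <= Cf * ((1 + 2 * r) * c).
 move=> cG HG; rewrite -[normc (pt z)](ger0_norm (normc_ge0 _)) -normc_real -normcM.
 rewrite -cintZ; last exact: (conv_integrable if0 fr z (Ck_cont cG)).
 rewrite (eq_cintT (g := fun w => f w * ((normc (pt z))%:C * G (z - w)))); last first.
 by move=> w; rewrite mulrCA.
 have mG : cmfun (fun w => (normc (pt z))%:C * G (z - w)).
 by apply: cmfunM; [exact: cmfun_cst|exact: ccont_refl (Ck_cont cG)].
 apply: le_trans (fint_bound if0 fr mG (B := (1 + 2 * r) * c) _) _; last first.
 by rewrite ger0_norm // mulr_ge0 // addr_ge0 ?mulr_ge0.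
 move=> w wr; rewrite normcM normc_ger0 ?normc_ge0 //.
 have h1 : normc (pt z) <= normc (pt (z - w)) + 2 * r.
 have -> : pt z = pt (z - w) + pt w by rewrite -[pt (z - w)]/(pt z - pt w) subrK.
 apply: normcD_le; rewrite lerD2l.
 by apply: le_trans (normc_pt_le _) _; rewrite ler_pM2l.
 apply: (le_via ((1 + 2 * r) * ((1 + normc (pt (z - w))) * normc (G (z - w))))).
 rewrite mulrA; apply: ler_wpM2r; first exact: normc_ge0.
 apply: (le_trans h1); have := normc_ge0 (pt (z - w)); move: (normc _)=> t t0.
 have : 0 <= r * t by rewrite mulr_ge0.
 lra.
 by apply: ler_wpM2l=> //; rewrite addr_ge0 ?mulr_ge0.
move=> z; rewrite eU ebU; split; apply: main; last 2 first.
- exact: Ck_dzb (CH n 1).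
- by move=> u; case: (Hc u).
- by apply: Ck_E; exact: CH n 1.
- by move=> u; case: Edz=> ->; case: (Hc u).
Qed.
Lemma U_growth : exists L, 0 <= L /\ forall m z, `|z| <= m.+1%:R -> normc (U z) <= L * m.+1%:R `^ sigma.
Proof.
(* Half of sigma, because the growth hypothesis is stated in terms of |z|^2. *)
have s2 : 0 < sigma / 2 by rewrite divr_gt0 ?sigma_gt0.
have [c [c0 Hc]] := Hgrowth n s2.
pose B m := c * ((3 * (1 + r)) `^ sigma * m.+1%:R `^ sigma).
exists (Cf * (c * (3 * (1 + r)) `^ sigma)); split.
 by apply: mulr_ge0 Cf0 _; rewrite mulr_ge0 ?powR_ge0.
have q0 : 0 <= 3 * (1 + r) by rewrite mulr_ge0 // addr_ge0.
move=> m z zm; have m1 : 1 <= m.+1%:R :> R by rewrite ler1n.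
have B0 : 0 <= B m by rewrite mulr_ge0 // mulr_ge0 ?powR_ge0.
apply: le_trans (fint_bound if0 fr (B := B m) _ _) _.
- exact: ccont_refl (Ck_cont (CH n 0)).
- move=> w wr; apply: (le_trans (Hc _)); rewrite /B; apply: ler_wpM2l=> //.
 rewrite -powRM //; have {}q0 : 0 <= 3 * (1 + r) * m.+1%:R by rewrite mulr_ge0.
 have -> : (3 * (1 + r) * m.+1%:R) `^ sigma = ((3 * (1 + r) * m.+1%:R) ^+ 2) `^ (sigma / 2).
 by rewrite -powR_mulrn // -powRrM; congr (_ `^ _); lra.
 apply: ler_powR_nneg; [exact: ltW|by rewrite addr_ge0 ?sq_ge0|].
 rewrite -normc_pt2; set t := normc _.
 have t0 : 0 <= t := normc_ge0 _.
 have t1 : t <= 2 * (m.+1%:R + r).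
 apply: le_trans (normc_pt_le _) _; rewrite ler_pM2l //; apply: le_trans (ler_normB _ _) _; exact: lerD.
 have y1 : m.+1%:R + r <= (1 + r) * m.+1%:R.
 move: (m.+1%:R : R) m1=> x x1; have : 0 <= r * (x - 1) by rewrite mulr_ge0 ?subr_ge0.
 lra.
 have y2 : 1 <= (1 + r) * m.+1%:R by apply: le_trans y1; rewrite ler_wpDr.
 rewrite -[3 * _ * _]mulrA; move: ((1 + r) * m.+1%:R) y1 y2=> y y1 y2.
 have ty : t <= 2 * y by apply: (le_trans t1); rewrite ler_pM2l.
 have : t ^+ 2 <= (2 * y) ^+ 2 by rewrite ler_sqr ?nnegrE // mulr_ge0 // (le_trans _ y2).
 have : 1 <= y ^+ 2 by rewrite exprn_ege1.
 by rewrite !exprMn; move: (t ^+ 2) (y ^+ 2)=> a b; lra.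
- by rewrite ger0_norm // /B !mulrA.
Qed.
Lemma cutoff_power (x : R) : 0 < x -> x `^ sigma / x ^+ 2 * (2 * x) `^ (2 / p) = 2 `^ (2 / p) * (x^-1) `^ sigma.
Proof.
move=> x0; have xn : x != 0 by rewrite gt_eqF.
rewrite powRM ?(ltW x0) // mulrCA; congr (_ * _).
rewrite -[x^-1]powR_inv1 ?(ltW x0) // -powRrM -powR_mulrn ?(ltW x0) // -powRN.
rewrite -!powRD; [|by rewrite xn implybT..].
by congr (_ `^ _); rewrite /sigma; field; rewrite gt_eqF.
Qed.
(** The difference is (chi - 1) times the second derivative, which tends to 0 by domination, plus
    [Err], which collects the terms with at least one derivative on the cutoff. Those are of size
    |z| / m^2 times 1 / |z|, or 1 / m^2 times the slow growth of U. *)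
Lemma cutoff_dense : (nLp p (dzb (E U)) < +oo)%E -> forall e, 0 < e ->
 exists m, (nLp p (fun z => dzb (E (fun w => (chi m w * U w)%R)) z - dzb (E U) z)%R <= e%:E)%E.
Proof.
move=> goo e e0; have e2 := half_gt0 e0.
have [CU _ _ _] := U_props.
have cg : ccont (dzb (E U)) by apply: (@Ck_cont 0); apply/Ck_dzb/Ck_E.
have [A [A0 HA]] := dU_decay; have [L [L0 HL]] := U_growth.
have [c [c0 Hc]] := @dchi_bound.
pose Err m z := dzb (chi m) z * E U z + E (chi m) z * dzb U z + dzb (E (chi m)) z * U z.
have Cchi k' m := @Ck_chi k' m.
have bE m : bsupp m.+1%:R (E (chi m)).
 by case: Edz=> ->; case: (bsupp_dz (@bsupp_chi m)).
have bErr m : bsupp m.+1%:R (Err m).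
 move=> z zm; rewrite /Err (bE m z zm) ((bsupp_dz (bE m)).2 z zm) ((bsupp_dz (@bsupp_chi m)).2 z zm).
 by rewrite !mul0r !addr0.
pose K := c * A + c * A + c * L.
have K0 : 0 <= K by rewrite !addr_ge0 ?mulr_ge0.
have ErrM m z : normc (Err m z) <= K * (m.+1%:R `^ sigma / m.+1%:R ^+ 2).
 have [zm|zm] := leP `|z| m.+1%:R; last first.
 by rewrite bErr // normc0 mulr_ge0 // divr_ge0 ?powR_ge0 ?sqr_ge0.
 have m2 : 0 <= (m.+1%:R ^+ 2)^-1 :> R by rewrite invr_ge0 sqr_ge0.
 have ms : 1 <= m.+1%:R `^ sigma :> R.
 apply: (le_via (1 `^ sigma)); first by rewrite powR1.
 by apply: ler_powR_nneg; rewrite ?ler1n // ltW ?sigma_gt0.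
 have [c1 c2 [c3 c4]] := Hc m z; have [A1 A2] := HA z.
 have c5 : normc (E (chi m) z) <= c * normc (pt z) / m.+1%:R ^+ 2 by case: Edz=> ->.
 have c6 : normc (dzb (E (chi m)) z) <= c / m.+1%:R ^+ 2 by case: Edz=> ->.
 have lift t : 0 <= t -> t / m.+1%:R ^+ 2 <= t * (m.+1%:R `^ sigma / m.+1%:R ^+ 2).
 by move=> t0; rewrite mulrA; apply: ler_wpM2r=> //; rewrite ler_peMr.
 have key a b : normc a <= c * normc (pt z) / m.+1%:R ^+ 2 -> normc (pt z) * normc b <= A ->
 normc (a * b) <= c * A * (m.+1%:R `^ sigma / m.+1%:R ^+ 2).
 move=> ha hb; rewrite normcM; apply: le_trans (lift _ (mulr_ge0 c0 A0)).
 apply: (le_via (c * normc (pt z) / m.+1%:R ^+ 2 * normc b)).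
 by apply: ler_wpM2r; rewrite ?normc_ge0.
 rewrite [leLHS]mulrAC -[c * _ * _]mulrA; apply: ler_wpM2r=> //; exact: ler_wpM2l.
 rewrite /Err /K !mulrDl; apply: normcD_le; apply: lerD.
 by apply: normcD_le; apply: lerD; apply: key.
 rewrite normcM -[c * L * _]mulrA [leRHS]mulrCA [L * _]mulrC.
 apply: (le_via (c / m.+1%:R ^+ 2 * (L * m.+1%:R `^ sigma))).
 by apply: ler_pM; rewrite ?normc_ge0 // HL.
 by rewrite le_eqVlt; apply/orP; left; apply/eqP; ring.
have [N1 HN1] : evt m, (nLp p (Err m) <= (e / 2)%:E)%E.
 pose K' := K * 2 `^ (2 / p) + 1.
 have K'0 : 0 < K' by rewrite ltr_wpDl // mulr_ge0 ?powR_ge0.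
 have d0 : 0 < (e / 2 / K') `^ sigma^-1 by rewrite powR_gt0 // divr_gt0.
 have [N HN] := rate_small d0; exists N=> m Nm.
 apply: le_trans (norm_LpC_box p0 _ (bErr m) (ErrM m)) _=> //.
 rewrite -mulrA cutoff_power // mulrA lee_fin.
 apply: (le_via (K' * (rate m)%:num `^ sigma)).
 by apply: ler_wpM2r; rewrite ?powR_ge0 // lerDl.
 rewrite mulrC -ler_pdivlMr //.
 apply: (le_via (((e / 2 / K') `^ sigma^-1) `^ sigma)).
 by apply: ler_powR_nneg; rewrite ?HN // ltW // sigma_gt0.
 by rewrite -powRrM mulVf ?gt_eqF ?sigma_gt0 // powRr1 // divr_ge0 // ltW.
have mchi m := ccont_cmfun (Ck_cont (Cchi 0%N m)).
have mcg := ccont_cmfun cg.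
have [N2 HN2] : evt m, (nLp p (fun z => (chi m z - 1) * dzb (E U) z)%R <= (e / 2)%:E)%E.
 have [G0 GE] : exists G, G = dzb (E U) by exists (dzb (E U)).
 rewrite -GE in mcg goo *; clear -p0 mcg goo mchi e2.
 have cm m : cmfun (fun z => (chi m z - 1) * G0 z).
 by apply: cmfunM=> //; apply: cmfunB=> //; exact: cmfun_cst.
 have mG : mfun (fun z => 2 * normc (G0 z)).
 by apply: mfunM; [exact: mcst|exact: meas_normc].
 have dom m z : normc ((chi m z - 1) * G0 z) <= 2 * normc (G0 z).
 rewrite normcM; apply: ler_wpM2r; first exact: normc_ge0.
 apply: normcD_le; rewrite normcNE.
 have -> : normc (1 : C) = 1 by exact: (etrans (normc_real 1) (normr1 _)).
 by rewrite -[leRHS]/(1 + 1) lerD2r normc_chi.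
 apply: (norm_LpC_dominated p0 cm mG dom) e2.
 - rewrite (eq_norm_LpC p (g := fun z => 2%:R%:C * G0 z)); last first.
 move=> z; rewrite normcM !normc_real normrM.
 by rewrite [`|normc _|]ger0_norm ?normc_ge0.
 by rewrite (norm_LpCZ _ p0 mcg); apply: lte_mul_pinfty=> //; rewrite lee_fin normc_ge0.
 - move=> z; apply/cvgrPdist_le=> d d0.
 have G00 : 0 < normc (G0 z) + 1 by rewrite ltr_wpDl ?normc_ge0.
 have [N HN] := chi_cvg z (divr_gt0 d0 G00); exists N=> // m /HN h.
 rewrite sub0r normrN ger0_norm ?normc_ge0 // normcM.
 apply: (le_via (d / (normc (G0 z) + 1) * (normc (G0 z) + 1))).
 by apply: ler_pM; rewrite ?normc_ge0 // lerDl.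
 by rewrite mulfVK // gt_eqF.
pose m := maxn N1 N2; exists m.
have -> : (fun z => dzb (E (fun w => chi m w * U w)) z - dzb (E U) z) =
 fun z => (chi m z - 1) * dzb (E U) z + Err m z.
 apply/funext=> z; rewrite (EM (Cchi 2%N m) (CU 2%N)) /Err mulrBl mul1r addrAC //.
have mErr : cmfun (Err m).
 have h1 (F : plane -> C) : Ck 0 F -> cmfun F by move=> /Ck_cont/ccont_cmfun.
 apply: cmfunD; [apply: cmfunD|]; apply: cmfunM; apply: h1.
 - exact: Ck_dzb (Cchi 1%N m).
 - exact: Ck_E (CU 1%N).
 - exact: Ck_E (Cchi 1%N m).
 - exact: Ck_dzb (CU 1%N).
 - exact: Ck_dzb (Ck_E (Cchi 2%N m)).
 - exact: CU.
apply: le_trans (norm_LpCD (ltW p1) _ mErr) _.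
 by apply: cmfunM=> //; apply: cmfunB=> //; exact: cmfun_cst.
rewrite [e]splitr EFinD; apply: leeD; [apply: HN2|apply: HN1]; rewrite /m; [exact: leq_maxr|exact: leq_maxl].
Qed.

End one_kernel.

Hypothesis ck : concentrating k.
Hypothesis HK : forall n, dzb (E (H n)) = fun z => (k n z)%:C.

(** f is truncated, then convolved with a potential, which makes the second derivative a
    mollification of the truncation, then the potential is cut off; each of the three steps costs e
    / 3. *)
Lemma second_derivatives_dense (f : plane -> C) : in_LpC p f -> forall e, 0 < e ->
 exists Psi r, [/\ Ck 3 Psi, bsupp r Psi & (nLp p (fun z => (dzb (E Psi) z - f z)%R) <= e%:E)%E].
Proof.
move=> [mf foo] e e0; have e3 : 0 < e / 3 by rewrite divr_gt0.
have [N1 /(_ N1 (leqnn _)) h1] := trunc_cvg p0 mf foo e3.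
have [mt tM bt _] := truncP N1 mf; set f0 := trunc N1 f in mt tM bt h1.
have f0oo := bounded_norm_LpC p0 bt tM.
have ik n z : cintg (fun w => (k n w)%:C * f0 (z - w)).
 have i := rintg_concentrating n ck; case: ck=> mk k0 _ _.
 apply: (le_cintg (g := fun w => N1%:R * k n w)); last exact: rintgZ.
 by apply: cmfunM; [exact: cmfun_real|exact: cmfun_comp (meas_reflB z) mt].
 by move=> w; rewrite normcM normc_ger0 // mulrC; apply: ler_wpM2r.
have [n /(_ n (leqnn _)) h2] := norm_LpC_mollify p1 ck mt f0oo ik e3.
have it := bb_cintg mt bt tM.
have [CU eU _ _] := U_props n it bt.
have gU : dzb (E (conv f0 (H n))) = conv f0 (fun z => (k n z)%:C).
 by rewrite eU; have [_ [_ ->]] := Ck_conv it bt 0 (fun m => Ck_E (CH n m.+1)); rewrite HK.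
have gE : dzb (E (conv f0 (H n))) = fun z => cI (fun w => (k n w)%:C * f0 (z - w)).
 rewrite gU; apply/funext=> z; rewrite /conv -(cint_reflB z).
 by apply: eq_cintT=> w; rewrite subKr mulrC.
 case: ck=> mk _ _ _; apply: cmfunM=> //.
 exact: (cmfun_comp (meas_reflB z) (cmfun_real (mk n))).
have mg : cmfun (dzb (E (conv f0 (H n)))).
 by apply/ccont_cmfun/(@Ck_cont 0)/Ck_dzb/Ck_E.
have {}h2 : (nLp p (fun z => (dzb (E (conv f0 (H n))) z - f0 z)%R) <= (e / 3)%:E)%E by rewrite gE.
have mgf := cmfunB mg mt.
have goo : (nLp p (dzb (E (conv f0 (H n)))) < +oo)%E.
 have := norm_LpCD (ltW p1) mgf mt.
 rewrite (_ : (fun z => _) = dzb (E (conv f0 (H n)))); last by apply/funext=> z; rewrite subrK.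
 by move=> h; apply: (le_lt_trans h); apply: lte_add_pinfty f0oo; exact: (le_lt_trans h2 (ltry _)).
have [m h3] := cutoff_dense it bt (ler0n _ _) goo e3.
exists (fun w => chi m w * conv f0 (H n) w), m.+1%:R; split.
- by apply: CkM; [exact: Ck_chi|].
- by move=> z zm; rewrite bsupp_chi // mul0r.
set P := dzb (E (fun w => _)).
have mP : cmfun P.
 by apply/ccont_cmfun/(@Ck_cont 0)/Ck_dzb/Ck_E/CkM=> //; exact: Ck_chi.
have -> : (fun z => P z - f z) = fun z => (P z - dzb (E (conv f0 (H n))) z) +
 ((dzb (E (conv f0 (H n))) z - f0 z) - (f z - f0 z)).
 apply/funext=> z; move: (P z) (dzb _ z) (f0 z) (f z)=> a b c d; ring.
have mff := cmfunB mf mt.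
apply: le_trans (norm_LpCD (ltW p1) (cmfunB mP mg) (cmfunB mgf mff)) _.
have -> : e%:E = (e / 3)%:E + ((e / 3)%:E + (e / 3)%:E) :> \bar R.
 by rewrite -!EFinD; congr (_%:E); lra.
apply: (leeD h3); apply: le_trans (norm_LpCB (ltW p1) mgf mff) _; exact: (leeD h2 h1).
Qed.
End density.

(** * The two density statements and the bound at p = 2 *)

Section density_instances.
Implicit Types (z w : plane) (W F : plane -> C) (d : {posnum R}).

(** For t >= 1, ln t <= t^s / s; for smaller t = |z|^2 + d the logarithm is at most |ln d| in
    absolute value. *)
Lemma Lk_growth d (s : R) : d%:num <= 1 -> 0 < s ->
 exists c, 0 <= c /\ forall z, normc (Lk d z) <= c * (1 + sq z) `^ s.
Proof.
move=> d1 s0; exists (`|ln d%:num| + s^-1); split; first by rewrite addr_ge0 // invr_ge0 ltW.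
move=> z; have t0 : 0 < sq z + d%:num by apply: sqD_gt0.
have p1 : 1 <= (1 + sq z) `^ s.
 apply: (le_via (1 `^ s)); first by rewrite powR1.
 by apply: ler_powR_nneg; rewrite ?(ltW s0) // lerDl sq_ge0.
have p0 : 0 <= (1 + sq z) `^ s by exact: powR_ge0.
rewrite LkE normc_real mulrDl.
have [t1|t1] := lerP 1 (sq z + d%:num).
 rewrite ger0_norm ?ln_ge0 // ler_wpDl ?mulr_ge0 // mulrC ler_pdivlMr //.
 have := ln_le_sub1 (powR_gt0 s t0); rewrite ln_powR mulrC=> /le_trans; apply.
 rewrite (le_trans (y := (sq z + d%:num) `^ s)) ?gerBl //.
 by apply: ler_powR_nneg; rewrite ?(ltW s0) ?(ltW t0) // addrC lerD2r.
rewrite ler_wpDr ?mulr_ge0 ?invr_ge0 ?(ltW s0) // -[leLHS]mulr1; apply: ler_pM=> //.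
rewrite !ler0_norm ?ln_le0 ?(ltW t1) // lerN2 ler_ln ?posrE // lerDr; exact: sq_ge0.
Qed.
Lemma rk_bounds d z : [/\ 0 <= normc (pt z) * (sq z + d%:num)^-1,
 (1 + normc (pt z)) * (normc (pt z) * (sq z + d%:num)^-1) <= d%:num^-1 + 1 &
 normc (pt z) * (normc (pt z) * (sq z + d%:num)^-1) <= 1].
Proof.
have t0 : 0 < sq z + d%:num by apply: sqD_gt0.
have d0 : 0 < d%:num by [].
rewrite -normc_pt2 in t0 *; have := normc_ge0 (pt z); move: (normc _) t0=> n t0 n0.
split; first by rewrite mulr_ge0 // invr_ge0 ltW.
 rewrite mulrA ler_pdivrMr // mulrDl [X in _ <= X]mulrDl mul1r mul1r.
 have -> : d%:num^-1 * (n ^+ 2 + d%:num) = n ^+ 2 / d%:num + 1 by rewrite mulrDr mulVf ?gt_eqF // mulrC.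
 move: (d%:num : R) d0=> x x0.
 have : 2 * n <= n ^+ 2 / x + x.
 rewrite -(ler_pM2r x0) [leRHS]mulrDl mulfVK ?gt_eqF //.
 by have := sqr_ge0 (n - x); rewrite !expr2; lra.
 have := sqr_ge0 (n - 1); have := sqr_ge0 n; rewrite !expr2.
 have : 0 <= n * n / x by rewrite divr_ge0 ?mulr_ge0 // ltW.
 nra.
by rewrite mulrA ler_pdivrMr // mul1r -expr2 lerDl ltW.
Qed.
Lemma normc_PkE d z : normc (Pk d z) = normc (pt z) * (sq z + d%:num)^-1.
Proof.
have s0 : 0 < sq z + d%:num by apply: sqD_gt0.
by rewrite /Pk normcM normc_conj normc_ger0 // invr_ge0 ltW.
Qed.
Lemma Lk_decay d : exists c, 0 <= c /\ forall z, (1 + normc (pt z)) * normc (dz (Lk d) z) <= c /\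
 (1 + normc (pt z)) * normc (dzb (Lk d) z) <= c.
Proof.
exists (d%:num^-1 + 1); split; first by rewrite addr_ge0 // invr_ge0.
by move=> z; have [-> ->] := dz_Lk d; have [_ h _] := rk_bounds d z; rewrite normc_conj normc_PkE.
Qed.
Lemma Pk_growth d (s : R) : 0 < s -> exists c, 0 <= c /\ forall z, normc (Pk d z) <= c * (1 + sq z) `^ s.
Proof.
move=> s0; have D0 : 0 <= d%:num^-1 + 1 by rewrite addr_ge0 // invr_ge0.
exists (d%:num^-1 + 1); split=> // z; have [a0 h _] := rk_bounds d z; rewrite normc_PkE.
apply: (le_via (d%:num^-1 + 1)); first by apply: le_trans h; rewrite ler_peMl // lerDl normc_ge0.
rewrite ler_peMr //; apply: (le_via (1 `^ s)); first by rewrite powR1.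
by apply: ler_powR_nneg; rewrite ?(ltW s0) // lerDl sq_ge0.
Qed.
Lemma Pk_decay d : exists c, 0 <= c /\ forall z, (1 + normc (pt z)) * normc (dz (Pk d) z) <= c /\
 (1 + normc (pt z)) * normc (dzb (Pk d) z) <= c.
Proof.
pose D := d%:num^-1 + 1; have D1 : 1 <= D by rewrite lerDr invr_ge0.
have D0 : 0 <= D := le_trans ler01 D1.
exists (2 * D ^+ 2); split; first by rewrite mulr_ge0 ?sqr_ge0.
move=> z; have [a0 h _] := rk_bounds d z; have s0 : 0 < sq z + d%:num by apply: sqD_gt0.
have n0 := normc_ge0 (pt z); have DD : D <= D ^+ 2 by rewrite expr2 ler_peMl.
rewrite (wd_dz (wd_Pk d z)) (wd_dzb (wd_Pk d z)) normcNE normcX -/(Pk d z) normc_PkE normc_real.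
set t := normc (pt z) * _ in a0 h *; split.
 have tD : t <= D by apply: le_trans h; rewrite ler_peMl // lerDl.
 rewrite expr2 mulrA; apply: (le_via (D * D)); last by rewrite -expr2 ler_peMl ?sqr_ge0 // ler1n.
 by apply: ler_pM=> //; rewrite mulr_ge0 // addr_ge0.
rewrite ger0_norm ?sig_ge0 //.
have -> : sig d%:num z = (sq z + d%:num)^-1 * (d%:num / (sq z + d%:num)) by rewrite /sig; field; rewrite gt_eqF.
have q1 : d%:num / (sq z + d%:num) <= 1 by rewrite ler_pdivrMr // mul1r lerDr sq_ge0.
have si : (sq z + d%:num)^-1 <= D.
 by apply: (le_via d%:num^-1); rewrite ?lerDl // lef_pV2 ?posrE // lerDr sq_ge0.
have i0 : 0 <= (sq z + d%:num)^-1 by rewrite invr_ge0 ltW.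
apply: (le_via ((1 + normc (pt z)) * (sq z + d%:num)^-1)).
 by rewrite mulrA ler_piMr // mulr_ge0 // addr_ge0.
rewrite mulrDl mul1r -/t; have tD : t <= D by apply: le_trans h; rewrite ler_peMl // lerDl.
by apply: (le_via (D + D)); [exact: lerD|lra].
Qed.
Lemma dzb_sig_odd d z : dzb (fun z => (sig d%:num z)%:C : C) (- z) = - dzb (fun z => (sig d%:num z)%:C) z.
Proof.
have E : (fun z => (sig d%:num z)%:C : C) = fun z => d%:num%:C * (rk d z * rk d z).
 by apply/funext=> u; rewrite /sig /rk -!rmorphM /=; congr (_ %:C)%C; rewrite expr2 invfM.
have h u := wdZ d%:num%:C (wdM (wd_rk d u) (wd_rk d u)).
have rkN : rk d (- z) = rk d z by rewrite /rk /sq /= !sqrrN.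
rewrite E (wd_dzb (h (- z))) (wd_dzb (h z)) rkN -[pt (- z)]/(- pt z); ring.
Qed.
Lemma dzbdz_dense (p : R) (f : plane -> C) : 1 < p -> in_LpC p f -> forall e, 0 < e ->
 exists Psi r, [/\ Ck 3 Psi, bsupp r Psi & (nLp p (fun z => (dzb (dz Psi) z - f z)%R) <= e%:E)%E].
Proof.
move=> p1 Lf; apply: (@second_derivatives_dense p (fun n => Lk (rate n)) (@dz R) (fun n => sig (rate n)%:num))=> //.
- by left.
- by move=> n m; exact: Ck_evc.
- by move=> n s; apply: Lk_growth; exact: rate_le1.
- by move=> n; exact: Lk_decay.
- exact: concentrating_sig.
- by move=> n; rewrite (dz_Lk _).1; apply/funext=> z; exact: wd_dzb (wd_Pk _ _).
Qed.
(** The derivative is moved from the kernel to u by integration by parts; [sig] is even and its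
    derivative odd. *)
Lemma dzb_conv_sig (r : R) d u : Ck 1 u -> bsupp r u ->
 dzb (conv u (fun z => (sig d%:num z)%:C)) = fun z => cI (fun w => (sig d%:num w)%:C * dzb u (z - w)).
Proof.
move=> Cu bu; have CS m : Ck m (fun z => (sig d%:num z)%:C : C).
 have -> : (fun z => (sig d%:num z)%:C : C) = dzb (Pk d) by apply/funext=> z; rewrite (wd_dzb (wd_Pk d z)).
 exact: Ck_dzb (Ck_Pk m.+1 d).
have sN (z w : plane) : sig d%:num (z - w) = sig d%:num (w - z) by rewrite -opprB /sig /sq /= !sqrrN.
have iu := cb_cintg (Ck_cont Cu) bu.
have [_ [_ ->]] := Ck_conv iu bu 0 CS; apply/funext=> z; rewrite /conv.
have [c1 b1] := (Ck_shift (- z) (CS 1%N), bsupp_dz bu).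
have cE (F G : plane -> C) : ccont F -> ccont G -> bsupp r G -> cintg (fun w => F w * G w).
 by move=> cF cG bG; apply: (cb_cintg (r := r)) (ccontM cF cG) _=> w /bG ->; rewrite mulr0.
rewrite (eq_cintT (g := fun w => - (dzb (fun z => (sig d%:num z)%:C) (w - z) * u w))); last first.
 by move=> w; rewrite -opprB dzb_sig_odd mulrN mulrC.
have [_ e2] := dz_shift (- z) (CS 1%N); have i2 := cE _ _ (Ck_cont (Ck_dzb c1)) (Ck_cont Cu) bu; rewrite e2 in i2.
rewrite (cintN i2) -[LHS](congr1 -%R (congr1 cI (funext (fun w => congr1 (fun F => F w * u w) e2)))).
rewrite -(cint_ibp c1 Cu bu).2 -(cint_reflB z (cintg_cmfun (cE _ _ (Ck_cont c1) (Ck_cont (Ck_dzb Cu)) b1.2))).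
by apply: eq_cintT=> w; rewrite sN opprB addrC subrK.
Qed.

(* Solving the inhomogeneous Cauchy-Riemann equation for [dz Psi] turns the previous density into this one. *)
Lemma dzbdzb_dense (p : R) (f : plane -> C) : 1 < p -> in_LpC p f -> forall e, 0 < e ->
 exists Psi r, [/\ Ck 3 Psi, bsupp r Psi & (nLp p (fun z => (dzb (dzb Psi) z - f z)%R) <= e%:E)%E].
Proof.
move=> p1 Lf e e0; have e3 : 0 < e / 3 by rewrite divr_gt0.
have p0 : 0 < p := lt_trans ltr01 p1.
have [P [r1 [CP bP1 h1]]] := dzbdz_dense p1 Lf e3.
pose r := Num.max r1 0; have r0 : 0 <= r by rewrite le_max lexx orbT.
have bP : bsupp r P by move=> z zr; apply: bP1; apply: le_lt_trans zr; rewrite le_max lexx.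
pose u := dz P; pose g := dzb u; have Cu : Ck 2 u := Ck_dz CP; have [bu _] := bsupp_dz bP; have [_ bg] := bsupp_dz bu.
have cg : ccont g := Ck_cont (Ck_dzb Cu); have mg := ccont_cmfun cg.
have goo : (nLp p g < +oo)%E := Ck_norm_LpC_lty p0 cg bg.
have [M [M0 HM]] := cb_bounded cg bg.
have ik n z : cintg (fun w => (sig (rate n)%:num w)%:C * g (z - w)).
 apply: (le_cintg (g := fun w => M * sig (rate n)%:num w)).
 - by apply: cmfunM; [apply/cmfun_real; exact: meas_sig|exact: ccont_refl cg].
 - by move=> w; rewrite normcM normc_ger0 ?sig_ge0 // mulrC; apply: ler_wpM2r; rewrite ?sig_ge0.
 - by apply: rintgZ; exact: (rintg_concentrating n concentrating_sig).
have [n /(_ n (leqnn _)) h2] := norm_LpC_mollify p1 concentrating_sig mg goo ik e3.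
have iu := cb_cintg (Ck_cont Cu) bu.
(* Convolution with the smoothed Cauchy kernel makes dbar U a mollification of u, hence dbar dbar U
   a mollification of g = dbar u. *)
pose U := conv u (Pk (rate n)).
have CU m : Ck m U by case: (Ck_conv iu bu m (fun k => Ck_Pk k (rate n))).
have gE : dzb (dzb U) = fun z => cI (fun w => (sig (rate n)%:num w)%:C * g (z - w)).
 rewrite -(dzb_conv_sig (rate n) (CkS Cu) bu); congr dzb.
 have [_ [_ ->]] := Ck_conv iu bu 0 (fun k => Ck_Pk k (rate n)); congr conv.
 by apply/funext=> z; rewrite (wd_dzb (wd_Pk _ z)).
have {}h2 : (nLp p (fun z => (dzb (dzb U) z - g z)%R) <= (e / 3)%:E)%E by rewrite gE.
have mU : cmfun (dzb (dzb U)) := ccont_cmfun (Ck_cont (Ck_dzb (Ck_dzb (CU 2%N)))).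
have Uoo : (nLp p (dzb (dzb U)) < +oo)%E.
 have -> : dzb (dzb U) = fun z => (dzb (dzb U) z - g z) + g z by apply/funext=> z; rewrite subrK.
 apply: le_lt_trans (norm_LpCD (ltW p1) (cmfunB mU mg) mg) _.
 by apply: lte_add_pinfty goo; exact: le_lt_trans h2 (ltry _).
have [m h3] := @cutoff_dense p (fun n => Pk (rate n)) (@dzb) p1 (or_intror erefl) (fun n k => Ck_Pk k (rate n))
 (fun n s s0 => Pk_growth (rate n) s0) (fun n => Pk_decay (rate n)) u r n iu bu r0 Uoo _ e3.
exists (fun w => chi m w * U w), m.+1%:R; split.
- by apply: CkM; [exact: Ck_chi|exact: CU].
- by move=> z zm; rewrite bsupp_chi // mul0r.
have CcU : Ck 2 (fun w => chi m w * U w) by apply: CkM; [exact: Ck_chi|exact: CU].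
move: h3; rewrite -/U; set Q := dzb (dzb (fun w => _))=> h3; have mQ : cmfun Q := ccont_cmfun (Ck_cont (Ck_dzb (Ck_dzb CcU))).
have -> : (fun z => Q z - f z) = fun z => (Q z - dzb (dzb U) z) + ((dzb (dzb U) z - g z) + (g z - f z)).
 apply/funext=> z; move: (Q z) (dzb _ z) (g z) (f z)=> x1 x2 x3 x4; ring.
have m2 := cmfunB mU mg; have m3 := cmfunB mg Lf.1.
apply: le_trans (norm_LpCD (ltW p1) (cmfunB mQ mU) (cmfunD m2 m3)) _.
have -> : e%:E = (e / 3)%:E + ((e / 3)%:E + (e / 3)%:E) :> \bar R by rewrite -!EFinD; congr (_%:E); lra.
by apply: (leeD h3); apply: le_trans (norm_LpCD (ltW p1) m2 m3) _; exact: (leeD h2 h1).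
Qed.
Lemma powint2_cint (r : R) (F : plane -> C) : ccont F -> bsupp r F ->
 cI (fun z => F z * (F z)^*) = (fine (powint 2 F))%:C /\ powint 2 F \is a fin_num.
Proof.
move=> cF bF; have i : cintg (fun z => F z * (F z)^*).
 by apply: (cb_cintg (r := r)); [exact: ccontM (ccontJ cF)|move=> z /bF ->; rewrite mul0r].
pose g z : R := normc (F z) ^+ 2.
have ig : rintg g.
 have [h _] := i; congr rintg: h; apply/funext=> z.
 by rewrite /g normc_mul_conj.
have E : powint 2 F = aint (fun z => (g z)%:E).
 by rewrite /powint; congr area_int; apply/funext=> z; rewrite /g powR_mulrn ?normc_ge0.
rewrite E area_intE; have fI := integrable_fin_num measurableT ig; split.
 rewrite (eq_cintT (g := fun z => (g z)%:C)); last by move=> z; rewrite normc_mul_conj.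
 rewrite cintE /= /Rintegral integral0 mulr0; congr Complex.
 by rewrite -[X in fine (_ * X)%E](fineK fI).
by apply: fin_numM.
Qed.
(** Both squared norms equal minus the integral of (d dbar u) times conj u. *)
Lemma norm2_dz_dzb (r : R) (u : plane -> C) : Ck 2 u -> bsupp r u -> nLp (2 : R) (dz u) = nLp 2 (dzb u).
Proof.
move=> Cu bu; have [b1 b2] := bsupp_dz bu; suff H : powint 2 (dz u) = powint 2 (dzb u) by rewrite !norm_LpCE H.
have [e1 f1] := powint2_cint (Ck_cont (Ck_dz Cu)) b1.
have [e2 f2] := powint2_cint (Ck_cont (Ck_dzb Cu)) b2.
have CJ := CkJ (CkS Cu); have bJ : bsupp r (fun z => (u z)^*) by move=> z /bu ->; rewrite conjc0.
have [j1 j2] := dzJ (CkS Cu).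
have [_ h1] := cint_ibp (Ck_dz Cu) CJ bJ; rewrite j2 in h1.
have [h2 _] := cint_ibp (Ck_dzb Cu) CJ bJ; rewrite j1 in h2.
suff : cI (fun z => dz u z * (dz u z)^*) = cI (fun z => dzb u z * (dzb u z)^*).
 move: (powint 2 (dz u)) (powint 2 (dzb u)) e1 e2 f1 f2=> a b e1 e2 f1 f2 E0.
 by move: e2; rewrite -E0 e1=> -[e]; rewrite -(fineK f1) -(fineK f2) e.
rewrite h1 h2; congr (- _); apply: eq_cintT=> z; by rewrite (Ck_sym _ Cu).
Qed.
Lemma beurling_norm_dz_le (p c : R) : 1 < p -> 0 <= c ->
 (forall Psi r, Ck 3 Psi -> bsupp r Psi -> (nLp p (dz (dz Psi)) <= c%:E * nLp p (dzb (dz Psi)))%E) ->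
 (beurling_norm p <= c%:E)%E.
Proof.
move=> p1 c0 H; apply: beurling_norm_le=> // f Lf d d0.
have [Psi [r [CP bP h]]] := dzbdz_dense p1 Lf d0.
by exists (dz Psi), r; split; [exact: Ck_dz|case: (bsupp_dz bP)| |exact: (H _ r)].
Qed.
Lemma beurling_norm_dzb_le (p c : R) : 1 < p -> 0 <= c ->
 (forall Psi r, Ck 3 Psi -> bsupp r Psi -> (nLp p (dz (dzb Psi)) <= c%:E * nLp p (dzb (dzb Psi)))%E) ->
 (beurling_norm p <= c%:E)%E.
Proof.
move=> p1 c0 H; apply: beurling_norm_le=> // f Lf d d0.
have [Psi [r [CP bP h]]] := dzbdzb_dense p1 Lf d0.
by exists (dzb Psi), r; split; [exact: Ck_dzb|case: (bsupp_dz bP)| |exact: (H _ r)].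
Qed.
Lemma beurling_norm2 : (beurling_norm (2 : R) <= 1)%E.
Proof.
apply: (@beurling_norm_dz_le 2 1)=> //; first by rewrite ltr1n.
move=> Psi r CP bP; rewrite mul1e (norm2_dz_dzb (r := r)) //; first exact: Ck_dz.
by case: (bsupp_dz bP).
Qed.

End density_instances.

(** * The positive kernel of the half plane and Schur's test *)

Section half_plane_kernel.
Implicit Types (z w : plane) (a : plane -> C).

Lemma integral_inv_sqr (c : R) : 0 < c -> (\int[leb]_y ((y ^+ 2 + c ^+ 2)^-1)%:E = (pi / c)%:E)%E.
Proof.
move=> c0; have cn0 : c != 0 by rewrite gt_eqF.
have n1 (y : R) : y ^+ 2 + c ^+ 2 != 0 by rewrite gt_eqF // ltr_wpDl ?sqr_ge0 // exprn_gt0.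
pose F (y : R) := c^-1 * atan (c^-1 * y).
have dF (y : R) : is_derive y (1 : R) F (y ^+ 2 + c ^+ 2)^-1.
 have := is_deriveZ c^-1 (is_derive_atan_scale y cn0).
 rewrite /GRing.scale /=; congr is_derive.
 by have := n1 y=> ny; field; rewrite cn0 /= ny.
rewrite (@integralT_sym _ F (c^-1 * (pi / 2))) //.
- by congr EFin; field.
- by move=> y; rewrite invr_ge0 addr_ge0 // sqr_ge0.
- by move=> y; apply: differentiable_continuous; apply/derivable1_diffP; case: (is_derive_inv_sqD (n1 y)).
- by move=> y /=; rewrite sqrrN.
- by rewrite /F mulr0 atan0 mulr0.
by apply: cvgMr; exact: cvgy_atan_scale.
Qed.
(** The modulus of (1 / Im w) (1 / (z - w) - 1 / (z - conj w)): the two poles differ by 2 i Im w,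
    and the factor Im w cancels. *)
Definition hk z w : R := if (0 < z.2) && (0 < w.2) then
 2 / (normc (pt z - pt w) * normc (pt z - (pt w)^*)) else 0.

Lemma hk_ge0 z w : 0 <= hk z w.
Proof. by rewrite /hk; case: ifP=> // _; rewrite divr_ge0 // mulr_ge0 ?normc_ge0. Qed.
Lemma hk_sym z w : hk z w = hk w z.
Proof.
rewrite /hk andbC normc_distC.
suff -> : normc (pt z - (pt w)^*) = normc (pt w - (pt z)^*) by [].
have -> : pt z - (pt w)^* = - (pt w - (pt z)^*)^*.
 by apply: complex_ext=> /=; ring.
by rewrite normcNE normc_conj.
Qed.
Lemma meas_hk : mfun (fun zw : plane * plane => hk zw.1 zw.2).
Proof.
have m1 : cmfun (fun zw : plane * plane => pt zw.1) := cmfun_comp mfst (@cmfun_pt R).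
have m2 : cmfun (fun zw : plane * plane => pt zw.2) := cmfun_comp msnd (@cmfun_pt R).
have i1 : mfun (fun zw : plane * plane => zw.1.2).
 exact: (mcomp msnd mfst).
have i2 : mfun (fun zw : plane * plane => zw.2.2).
 exact: (mcomp msnd msnd).
apply: measurable_fun_if=> //.
 by apply: measurable_and; apply: measurable_fun_ltr=> //; exact: mcst.
apply: measurable_funTS; apply: mfunM; first exact: mcst.
apply: meas_inv; apply: mfunM; apply: meas_normc.
 exact: cmfunB.
by apply: cmfunB=> //; exact: cmfunJ.
Qed.
Lemma meas_hkl z : mfun (hk z).
Proof. exact: (mcomp meas_hk (measurable_pair1 z)). Qed.
(** Cauchy-Schwarz in the form (X + A^2)(X + B^2) >= (X + A B)^2, with X the squared horizontal
    distance, A the distance of the heights and B their sum. The bound has an explicit horizontal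
    integral. *)
Lemma hk_le z w : 0 < z.2 -> 0 < w.2 -> w.2 != z.2 ->
 hk z w <= 2 * ((w.1 - z.1) ^+ 2 + Num.sqrt `|z.2 ^+ 2 - w.2 ^+ 2| ^+ 2)^-1.
Proof.
move=> z0 w0 zw; rewrite /hk z0 w0 /= ler_pM2l // sqr_sqrtr //.
have d0 : 0 < `|z.2 ^+ 2 - w.2 ^+ 2|.
 rewrite normr_gt0 subr_eq0 eqf_sqr negb_or eq_sym zw /= gt_eqF //.
 by rewrite (lt_trans _ z0) // oppr_lt0.
have den : 0 < (w.1 - z.1) ^+ 2 + `|z.2 ^+ 2 - w.2 ^+ 2| by rewrite ltr_wpDl ?sqr_ge0.
have h : (w.1 - z.1) ^+ 2 + `|z.2 ^+ 2 - w.2 ^+ 2| <= normc (pt z - pt w) * normc (pt z - (pt w)^*).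
 rewrite -ler_sqr ?nnegrE ?mulr_ge0 ?normc_ge0 ?(ltW den) // exprMn !normc_sqr /=.
 rewrite opprK subr_sqr normrM [`|z.2 + w.2|]gtr0_norm ?addr_gt0 //.
 have : (z.1 - w.1) ^+ 2 = (w.1 - z.1) ^+ 2 by rewrite -sqrrN opprB.
 move=> ->; have : (z.2 - w.2) ^+ 2 = `|z.2 - w.2| ^+ 2 by rewrite real_normK ?num_real.
 move=> ->; have b0 : 0 < z.2 + w.2 by rewrite addr_gt0.
 move: `|z.2 - w.2| (normr_ge0 (z.2 - w.2)) (z.2 + w.2) b0 ((w.1 - z.1) ^+ 2) (sqr_ge0 (w.1 - z.1))=> A A0 B B0 X X0.
 rewrite -subr_ge0; have -> : (X + A ^+ 2) * (X + B ^+ 2) - (X + A * B) ^+ 2 = X * (A - B) ^+ 2 by ring.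
 by rewrite mulr_ge0 ?sqr_ge0.
by rewrite lef_pV2 ?posrE // (lt_le_trans den).
Qed.

(* The three ranges are [eta <= y/2], [y/2 < eta < 2y] and [2y <= eta]. *)
Definition weight_maj (s y t : R) : R := 2 / y * ind_pow s (y / 2) t +
 (y / 2) `^ (- s) * y `^ (- 2^-1) * ind_pow2 2^-1 y (t - y) + 2 * tail_pow (1 + s) (2 * y) t.

(** The square root is at least y / 2 in the lower range, t / 2 in the upper one and sqrt (y |t -
    y|) in the middle one, where the remaining singularity |t - y|^(-1/2) is integrable. *)
Lemma weight_maj_le (s y t : R) : 0 < s -> 0 < y -> 0 < t -> t != y ->
 t `^ (- s) / Num.sqrt `|y ^+ 2 - t ^+ 2| <= weight_maj s y t.
Proof.
move=> s0 y0 t0 ty; rewrite /weight_maj.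
have a1 : 0 <= 2 / y * ind_pow s (y / 2) t by rewrite mulr_ge0 ?ind_pow_ge0 // divr_ge0 // ltW.
have a2 : 0 <= (y / 2) `^ (- s) * y `^ (- 2^-1) * ind_pow2 2^-1 y (t - y).
 by rewrite !mulr_ge0 ?powR_ge0 ?ind_pow2_ge0.
have a3 : 0 <= 2 * tail_pow (1 + s) (2 * y) t by rewrite mulr_ge0 ?tail_pow_ge0.
have ts := powR_ge0 t (- s).
have sq_inv (c : R) : 0 < c -> c ^+ 2 <= `|y ^+ 2 - t ^+ 2| -> (Num.sqrt `|y ^+ 2 - t ^+ 2|)^-1 <= c^-1.
 move=> c0 h; have h' : c <= Num.sqrt `|y ^+ 2 - t ^+ 2|.
 by rewrite -(ger0_norm (ltW c0)) -sqrtr_sqr; exact: ler_wsqrtr.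
 by rewrite lef_pV2 ?posrE // (lt_le_trans c0).
have [h1|h1] := lerP t (y / 2).
 apply: (le_via (2 / y * ind_pow s (y / 2) t)); last by lra.
 rewrite /ind_pow t0 h1 /= [leRHS]mulrC; apply: ler_wpM2l=> //.
 rewrite -[2 / y]invrK invf_div; apply: sq_inv; first by rewrite divr_gt0.
 apply: (le_trans _ (ler_norm _)); rewrite exprMn.
 have y20 : 0 <= y / 2 by rewrite divr_ge0 // ltW.
 have : t ^+ 2 <= (y / 2) ^+ 2 by rewrite ler_sqr ?nnegrE // ltW.
 rewrite !exprMn; have := sqr_ge0 y; move: (y ^+ 2) (t ^+ 2)=> u v; rewrite expr2; lra.
have [h2|h2] := lerP (2 * y) t.
 apply: (le_via (2 * tail_pow (1 + s) (2 * y) t)); last by lra.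
 rewrite /tail_pow h2 opprD powRD; last by rewrite (gt_eqF t0) implybT.
 rewrite powR_inv1 ?(ltW t0) // [leRHS]mulrA [leRHS]mulrC; apply: ler_wpM2l=> //.
 rewrite -[2 / t]invrK invf_div; apply: sq_inv; first by rewrite divr_gt0.
 rewrite distrC; apply: (le_trans _ (ler_norm _)); rewrite exprMn.
 have y20 : 0 <= 2 * y by rewrite mulr_ge0 // ltW.
 have : (2 * y) ^+ 2 <= t ^+ 2 by rewrite ler_sqr ?nnegrE // ltW.
 rewrite !exprMn; have := sqr_ge0 y; move: (y ^+ 2) (t ^+ 2)=> u v; rewrite !expr2; lra.
apply: (le_via ((y / 2) `^ (- s) * y `^ (- 2^-1) * ind_pow2 2^-1 y (t - y))); last by lra.
have d0 : t - y != 0 by rewrite subr_eq0.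
have dy : `|t - y| <= y by rewrite ler_norml; apply/andP; split; lra.
rewrite ind_pow2E // dy -mulrA; apply: ler_pM=> //.
 have y20 : 0 < y / 2 by rewrite divr_gt0.
 by rewrite !powRN lef_pV2 ?posrE ?powR_gt0 //; apply: ler_powR_nneg; rewrite ?ltW.
have p0 : 0 < `|t - y| by rewrite normr_gt0.
rewrite !powRN -invfM -powRM ?(ltW y0) // powR12_sqrt ?mulr_ge0 ?(ltW y0) //.
apply: sq_inv; first by rewrite sqrtr_gt0 mulr_gt0.
rewrite sqr_sqrtr ?mulr_ge0 ?(ltW y0) // subr_sqr normrM distrC mulrC; apply: ler_wpM2l=> //.
by rewrite gtr0_norm ?addr_gt0 // lerDl ltW.
Qed.
Lemma weight_maj_ge0 s y t : 0 < y -> 0 <= weight_maj s y t.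
Proof.
move=> y0; rewrite /weight_maj !addr_ge0 ?mulr_ge0 ?powR_ge0 ?ind_pow_ge0 ?ind_pow2_ge0 ?tail_pow_ge0 //.
by rewrite invr_ge0 ltW.
Qed.
Lemma meas_weight_maj s y : mfun (weight_maj s y).
Proof.
apply: mfunD; [apply: mfunD|]; (apply: mfunM; first exact: mcst).
- exact: meas_ind_pow.
- apply: (mcomp (meas_ind_pow2 _ _)).
 by apply: mfunB=> //; exact: mcst.
- exact: meas_tail_pow.
Qed.
(** The three summands are the contributions of the three ranges, and the outer 2 comes from (y /
    2)^(-s) <= 2 y^(-s). *)
Definition weight_const (s : R) : R := 2 * ((1 - s)^-1 + 4 + 2 / s).

Lemma integral_weight_maj (s y : R) : 0 < s -> s < 1 -> 0 < y ->
 (\int[leb]_t (weight_maj s y t)%:E <= (weight_const s * y `^ (- s))%:E)%E.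
Proof.
move=> s0 s1 y0; rewrite /weight_maj.
have y20 : 0 < y / 2 by rewrite divr_gt0.
have mi : mfun (fun t => (ind_pow s (y / 2) t)%:E).
 by apply/mEFin; exact: meas_ind_pow.
have mi2 : mfun (fun t => (ind_pow2 2^-1 y t)%:E).
 by apply/mEFin; exact: meas_ind_pow2.
have mi2s : mfun (fun t : R => (ind_pow2 2^-1 y (t - y))%:E).
 by apply: (mcomp mi2); apply: mfunB=> //; exact: mcst.
have mt : mfun (fun t => (tail_pow (1 + s) (2 * y) t)%:E).
 by apply/mEFin; exact: meas_tail_pow.
have mZ (c : R) (g : R -> R) : mfun (fun t => (g t)%:E) -> mfun (fun t => (c * g t)%:E).
 by move=> /mEFin mg; apply/mEFin; apply: mfunM=> //; exact: mcst.
have c1 : 0 <= 2 / y by rewrite divr_ge0 // ltW.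
have c2 : 0 <= (y / 2) `^ (- s) * y `^ (- 2^-1) by rewrite mulr_ge0 ?powR_ge0.
under eq_integral do rewrite !EFinD.
rewrite ge0_integralD //; last 4 first.
- move=> t _; rewrite -EFinD lee_fin; apply: addr_ge0; apply: mulr_ge0=> //.
 exact: ind_pow_ge0.
 exact: ind_pow2_ge0.
- by apply: emeasurable_funD; exact: mZ.
- by move=> t _; rewrite lee_fin mulr_ge0 ?tail_pow_ge0.
- exact: mZ.
rewrite ge0_integralD //; last 4 first.
- by move=> t _; rewrite lee_fin mulr_ge0 ?ind_pow_ge0.
- exact: mZ.
- by move=> t _; rewrite lee_fin !mulr_ge0 ?powR_ge0 ?ind_pow2_ge0.
- exact: mZ.
have Z (c : R) (g : R -> R) : 0 <= c -> mfun (fun t => (g t)%:E) -> (forall t, 0 <= g t) ->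
 (\int[leb]_t (c * g t)%:E = c%:E * \int[leb]_t (g t)%:E)%E.
 move=> c0 mg g0; under eq_integral do rewrite EFinM.
 by rewrite ge0_integralZl_EFin // => t _; rewrite lee_fin.
rewrite (Z _ _ c1 mi (ind_pow_ge0 _ _)) (Z _ _ c2 mi2s); last by move=> t; exact: ind_pow2_ge0.
rewrite (Z 2 _ _ mt (tail_pow_ge0 _ _)) //.
rewrite (ge0_integral_shift1 y mi2); last by move=> t; rewrite lee_fin ind_pow2_ge0.
rewrite integral_tail_pow ?mulr_gt0 //; last by rewrite ltrDl.
have half0 : 0 < 2^-1 :> R by rewrite invr_gt0.
have half1 : 2^-1 < 1 :> R by rewrite invf_lt1 // ltr1n.
have h1 := lee_wpmul2l (c1 : (0 <= (2 / y)%:E)%E) (integral_ind_pow s0 s1 y20).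
have h2 := lee_wpmul2l (c2 : (0 <= _%:E)%E) (integral_ind_pow2 half0 half1 y0).
apply: le_trans (leeD (leeD h1 h2) (lexx _)) _.
rewrite -!EFinM -!EFinD lee_fin.
have ynz : y != 0 by rewrite gt_eqF.
have y2nz : y / 2 != 0 by rewrite gt_eqF.
have E1 : 2 / y * ((y / 2) `^ (1 - s) / (1 - s)) = (y / 2) `^ (- s) * (1 - s)^-1.
 rewrite powRD; last by rewrite y2nz implybT.
 rewrite powRr1 ?(ltW y20) //; move: ((y / 2) `^ _)=> q; field.
 by rewrite ynz subr_eq0 eq_sym lt_eqF.
have E2 : (y / 2) `^ (- s) * y `^ (- 2^-1) * (2 * (y `^ (1 - 2^-1) / (1 - 2^-1))) = (y / 2) `^ (- s) * 4.
 have e : y `^ (1 - 2^-1) = y `^ 2^-1 by congr (_ `^ _); lra.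
 rewrite e [y `^ (- _)]powRN; have := powR_gt0 2^-1 y0; move: (y `^ 2^-1) (_ `^ (- s))=> q' q q0.
 by field; rewrite gt_eqF.
have E3 : 2 * ((2 * y) `^ (1 - (1 + s)) / (1 + s - 1)) <= (y / 2) `^ (- s) * (2 / s).
 rewrite [1 + s - 1]addrAC subrr add0r opprD addrA subrr add0r mulrCA mulrA [2 * _]mulrC -!mulrA.
 apply: ler_wpM2r; first by rewrite divr_ge0 // ltW.
 rewrite !powRN lef_pV2 ?posrE ?powR_gt0 ?mulr_gt0 //; apply: ler_powR_nneg; rewrite ?(ltW s0) ?(ltW y20) //; lra.
rewrite E1 E2; apply: le_trans (lerD (lexx _) E3) _; rewrite -!mulrDr.
have S0 : 0 <= (1 - s)^-1 + 4 + 2 / s.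
 by rewrite !addr_ge0 ?invr_ge0 ?subr_ge0 ?(ltW s1) // divr_ge0 // ltW.
rewrite /weight_const mulrAC; apply: ler_wpM2r=> //.
rewrite powRM ?(ltW y0) ?invr_ge0 // mulrC; apply: ler_wpM2r; first exact: powR_ge0.
rewrite -powR_inv1 // -powRrM mulrNN mul1r -[leRHS]powRr1 //.
by rewrite ler_powR // ?ler1n // ltW.
Qed.
(** The kernel is homogeneous of degree -2, so powers of the height are natural test functions.
    Horizontal integration produces pi / sqrt |y^2 - t^2|; the line through z is null and is left
    out. *)
Lemma hk_weight (s : R) z : 0 < s -> s < 1 -> 0 < z.2 ->
 (aint (fun w => (hk z w * w.2 `^ (- s))%:E) <= (2 * weight_const s * z.2 `^ (- s))%:E)%E.
Proof.
move=> s0 s1 z0; pose G w : \bar R := (hk z w * w.2 `^ (- s))%:E.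
have mG : mfun G.
 apply/mEFin/mfunM; first exact: meas_hkl.
 exact: (mcomp (meas_powR_fun _) msnd).
have G0 w : (0 <= G w)%E by rewrite lee_fin mulr_ge0 ?hk_ge0 ?powR_ge0.
rewrite area_intE (fubini_tonelli2 (m1 := leb) (m2 := leb) G mG G0).
apply: (le_via ((pi^-1)%:E * \int[leb]_t ((2 * pi * weight_maj s z.2 t)%:E))%E).
 apply: lee_wpmul2l; first by rewrite lee_fin invr_ge0 pi_ge0.
 apply: ae_ge0_le_integral=> //.
 - by move=> t _; apply: integral_ge0=> x _; exact: G0.
 - exact: (measurable_fun_fubini_tonelli_G (m1 := leb) G mG G0).
 - by move=> t _; rewrite lee_fin !mulr_ge0 ?pi_ge0 ?weight_maj_ge0.
 - apply/mEFin/mfunM; first exact: mcst.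
 exact: meas_weight_maj.
 exists [set z.2]; split; [exact: measurable_set1|exact: lebesgue_measure_set1|].
 move=> t /= H; apply: contrapT=> nt; apply: H=> _.
 have tz : t != z.2 by apply/eqP.
 rewrite /fubini_G /G /=.
 have [t0|t0] := ltP 0 t; last first.
 rewrite integral0_eq ?lee_fin ?mulr_ge0 ?pi_ge0 ?weight_maj_ge0 // => x _.
 by rewrite /hk (_ : (0 < (x, t).2) = false) ?andbF ?mul0r //; apply/negbTE; rewrite -leNgt.
 set c := Num.sqrt `|z.2 ^+ 2 - t ^+ 2|.
 have c0 : 0 < c.
 rewrite sqrtr_gt0 normr_gt0 subr_eq0 eqf_sqr negb_or eq_sym tz /= gt_eqF //.
 by rewrite (lt_trans _ z0) // oppr_lt0.
 have mi : mfun (fun x : R => ((x ^+ 2 + c ^+ 2)^-1)%:E).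
 apply/mEFin/meas_inv/mfunD; last exact: mcst.
 exact: measurable_funX.
 have i0 x : (0 <= ((x ^+ 2 + c ^+ 2)^-1)%:E)%E by rewrite lee_fin invr_ge0 addr_ge0 ?sqr_ge0.
 apply: (le_via (\int[leb]_x ((t `^ (- s) * 2)%:E * (((x - z.1) ^+ 2 + c ^+ 2)^-1)%:E))%E).
 apply: ge0_le_integral=> //.
 - by move=> x _; exact: G0.
 - exact: (mcomp mG (measurable_pair2 t)).
 - apply: measurable_funeM; apply: (mcomp mi).
 by apply: mfunB=> //; exact: mcst.
 - move=> x _; rewrite -EFinM lee_fin mulrC -mulrA; apply: ler_wpM2l; first exact: powR_ge0.
 exact: (@hk_le z (x, t)).
 rewrite ge0_integralZl_EFin ?mulr_ge0 ?powR_ge0 //; last first.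
 apply: (mcomp mi); apply: mfunB=> //; exact: mcst.
 rewrite (ge0_integral_shift1 z.1 mi i0) integral_inv_sqr // -EFinM lee_fin.
 have -> : t `^ (- s) * 2 * (pi / c) = 2 * pi * (t `^ (- s) / c) by ring.
 by apply: ler_wpM2l; [rewrite mulr_ge0 ?pi_ge0|exact: weight_maj_le].
under eq_integral do rewrite EFinM.
have mw : mfun (fun t => (weight_maj s z.2 t)%:E).
 by apply/mEFin; exact: meas_weight_maj.
rewrite ge0_integralZl_EFin ?mulr_ge0 ?pi_ge0 //; last by move=> t _; rewrite lee_fin weight_maj_ge0.
rewrite muleA -EFinM.
have -> : pi^-1 * (2 * pi) = 2 :> R by rewrite mulrCA mulVf ?mulr1 // gt_eqF // pi_gt0.
by rewrite -mulrA EFinM; apply: lee_wpmul2l; rewrite ?lee_fin //; exact: integral_weight_maj.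
Qed.
Definition hT a z : \bar R := aint (fun w => (hk z w * normc (a w))%:E).

Lemma hT_ge0 a z : (0 <= hT a z)%E.
Proof. by apply: area_int_ge0=> w _; rewrite lee_fin mulr_ge0 ?hk_ge0 ?normc_ge0. Qed.
(** Hölder's inequality with hk |a| split into hk^(1/q) t^(-al) and hk^(1/p) t^al |a|, where t = Im
    w and al = 1 / (p q). The q-th power of the first factor carries the weight t^(-1/p); after
    Tonelli the p-th power of the second leaves the weight y^(-1/q) to be integrated in z. *)
Lemma schur (p : R) : 1 < p -> exists c, 0 < c /\ forall a, cmfun a ->
 (aint (fun z => hT a z `^ p) <= c%:E * powint p a)%E.
Proof.
move=> p1; have p0 := lt_trans ltr01 p1.
have qi0 : 0 < 1 - p^-1 by rewrite subr_gt0 invf_lt1.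
have [q [q0 qE]] : exists q : R, 0 < q /\ q^-1 = 1 - p^-1.
 by exists (1 - p^-1)^-1; rewrite invrK invr_gt0.
have qp : q^-1 + p^-1 = 1 by rewrite qE subrK.
have ip0 : 0 < p^-1 by rewrite invr_gt0.
have ip1 : p^-1 < 1 by rewrite invf_lt1.
have iq1 : q^-1 < 1 by rewrite qE gtrBl.
have iq0 : 0 < q^-1 by rewrite invr_gt0.
pose D1 := 2 * weight_const p^-1; pose D2 := 2 * weight_const q^-1.
have D0 s : 0 < s -> s < 1 -> 0 <= 2 * weight_const s.
 move=> s0 s1; rewrite mulr_ge0 // mulr_ge0 // !addr_ge0 ?invr_ge0 ?subr_ge0 ?(ltW s1) //.
 by rewrite divr_ge0 // ltW.
have D10 : 0 <= D1 by exact: D0.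
have D20 : 0 <= D2 by exact: D0.
pose al := p^-1 * q^-1.
pose c1 := D1 `^ (q^-1 * p); have c10 : 0 <= c1 by exact: powR_ge0.
exists (c1 * D2 + 1); split; first by rewrite ltr_wpDl // mulr_ge0.
move=> a ma; have mn := meas_normc ma.
pose F (zw : plane * plane) := c1 * zw.1.2 `^ (- q^-1) * (hk zw.1 zw.2 * (zw.2.2 `^ q^-1 * normc (a zw.2) `^ p)).
have F0 zw : 0 <= F zw by rewrite !mulr_ge0 ?powR_ge0 ?hk_ge0.
have mw : mfun (fun w : plane => w.2 `^ q^-1 * normc (a w) `^ p).
 apply: mfunM; last exact: meas_powR.
 exact: (mcomp (meas_powR_fun _) msnd).
have mF : mfun F.
 apply: mfunM.
 apply: mfunM; first exact: mcst.
 apply: (mcomp (meas_powR_fun _)).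
 exact: (mcomp msnd mfst).
 by apply: mfunM; [exact: meas_hk|exact: (mcomp mw msnd)].
have step z : (hT a z `^ p <= aint (fun w => (F (z, w))%:E))%E.
 have [z0|z0] := ltP 0 z.2; last first.
 rewrite /hT (_ : area_int _ _ = 0)%E; last first.
 by rewrite area_intE integral0_eq ?mule0 // => w _; rewrite /hk ltNge z0 mul0r.
 by rewrite poweR0r ?gt_eqF //; apply: area_int_ge0=> w _; rewrite lee_fin.
 pose f w : C := (hk z w `^ q^-1 * w.2 `^ (- al))%:C.
 pose g w : C := (hk z w `^ p^-1 * w.2 `^ al)%:C * a w.
 have mh b e : mfun (fun w : plane => hk z w `^ b * w.2 `^ e).
 apply: mfunM; first exact: (mcomp (meas_powR_fun _) (meas_hkl z)).
 exact: (mcomp (meas_powR_fun _) msnd).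
 have mf : cmfun f by apply: cmfun_real.
 have mg : cmfun g by apply: cmfunM=> //; exact: cmfun_real.
 have nf w : normc (f w) = hk z w `^ q^-1 * w.2 `^ (- al).
 by rewrite normc_ger0 // mulr_ge0 ?powR_ge0.
 have ng w : normc (g w) = hk z w `^ p^-1 * w.2 `^ al * normc (a w).
 by rewrite normcM normc_ger0 // mulr_ge0 ?powR_ge0.
 have hkn w : w.2 <= 0 -> hk z w = 0 by move=> w0; rewrite /hk [0 < w.2]ltNge w0 andbF.
 have T_le : (hT a z <= nLp q f * nLp p g)%E.
 apply: le_trans (hoelder_area q0 p0 qp mf mg); apply: le_area_int=> w.
 by rewrite lee_fin mulr_ge0 ?hk_ge0 ?normc_ge0.
 rewrite lee_fin nf ng; have [w0|w0] := ltP 0 w.2; last first.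
 by rewrite hkn // !powR0 ?gt_eqF // !mul0r.
 rewrite !mulrA; apply: ler_wpM2r; first exact: normc_ge0.
 rewrite -!mulrA [X in _ <= _ * X]mulrCA -powRD; last by rewrite (gt_eqF w0) implybT.
 rewrite addNr powRr0 mulr1.
 have [->|h0] := eqVneq (hk z w) 0; first by rewrite mulr_ge0 ?powR_ge0.
 by rewrite -powRD ?h0 ?implybT // qp powRr1 // hk_ge0.
 have nfq : (nLp q f <= (D1 `^ q^-1 * z.2 `^ (- al))%:E)%E.
 apply: norm_LpC_le=> //; first by rewrite lee_fin mulr_ge0 ?powR_ge0.
 rewrite poweR_EFin powRM ?powR_ge0 // -!powRrM mulVf ?gt_eqF // powRr1 //.
 have -> : - al * q = - p^-1 by rewrite /al mulNr mulfVK // gt_eqF.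
 apply: le_trans (hk_weight ip0 ip1 z0); apply: le_area_int=> w; rewrite lee_fin ?powR_ge0 //.
 rewrite nf powRM ?powR_ge0 // -!powRrM mulVf ?gt_eqF // powRr1 ?hk_ge0 //.
 by rewrite /al mulNr mulfVK ?gt_eqF.
 apply: le_trans (le_poweR (ltW p0) (hT_ge0 a z) T_le) _.
 have b0 : 0 <= D1 `^ q^-1 * z.2 `^ (- al) by rewrite mulr_ge0 ?powR_ge0.
 apply: le_trans (le_poweR (ltW p0) _ (lee_wpmul2r (norm_LpC_ge0 p g) nfq)) _.
 by rewrite mule_ge0 ?norm_LpC_ge0.
 rewrite poweRM ?norm_LpC_ge0 ?lee_fin // -powint_norm // poweR_EFin powRM ?powR_ge0 // -!powRrM.
 have -> : - al * p = - q^-1 by rewrite /al mulrC mulrN mulrA mulfV ?gt_eqF // mul1r.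
 rewrite -/c1 /powint -area_intZ ?mulr_ge0 ?powR_ge0 //; last 2 first.
 - by exact: meas_powE.
 - by move=> w; rewrite lee_fin powR_ge0.
 apply: le_area_int=> w; first by rewrite -EFinM lee_fin !mulr_ge0 ?powR_ge0.
 rewrite -EFinM lee_fin /F /=; apply: ler_wpM2l; first by rewrite mulr_ge0 ?powR_ge0.
 rewrite ng !powRM ?mulr_ge0 ?powR_ge0 ?normc_ge0 // -!powRrM mulVf ?gt_eqF // powRr1 ?hk_ge0 //.
 rewrite -mulrA; apply: ler_wpM2l; first exact: hk_ge0.
 by have -> : al * p = q^-1 by rewrite /al mulrAC mulVf ?gt_eqF // mul1r.
apply: le_trans (le_area_int _ step) _; first by move=> z; exact: poweR_ge0.
have K0 : 0 <= c1 * D2 + 1 by apply: addr_ge0=> //; exact: mulr_ge0.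
rewrite area_tonelli // /powint -area_intZ //; last 2 first.
- by exact: meas_powE.
- by move=> w; rewrite lee_fin powR_ge0.
apply: le_area_int=> w; first by apply: area_int_ge0=> z _; rewrite lee_fin.
have [w0|w0] := ltP 0 w.2; last first.
 rewrite area_intE integral0_eq ?mule0; first by rewrite -EFinM lee_fin; apply: mulr_ge0=> //; exact: powR_ge0.
 by move=> z _; rewrite /F /hk /= [0 < w.2]ltNge w0 andbF mul0r mulr0.
have -> : (fun z => (F (z, w))%:E) = fun z => ((c1 * (w.2 `^ q^-1 * normc (a w) `^ p))%:E * (hk w z * z.2 `^ (- q^-1))%:E)%E.
 by apply/funext=> z; rewrite -EFinM /F /= hk_sym; congr EFin; ring.
rewrite area_intZ; last 3 first.
- by rewrite !mulr_ge0 ?powR_ge0.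
- apply/mEFin/mfunM; first exact: meas_hkl.
 exact: (mcomp (meas_powR_fun _) msnd).
- by move=> z; rewrite lee_fin mulr_ge0 ?hk_ge0 ?powR_ge0.
have b0 : 0 <= c1 * (w.2 `^ q^-1 * normc (a w) `^ p) by rewrite !mulr_ge0 ?powR_ge0.
apply: le_trans (lee_wpmul2l (b0 : (0 <= _%:E)%E) (hk_weight iq0 iq1 w0)) _.
rewrite -!EFinM lee_fin -/D2.
have -> : c1 * (w.2 `^ q^-1 * normc (a w) `^ p) * (D2 * w.2 `^ (- q^-1)) =
 c1 * D2 * normc (a w) `^ p * (w.2 `^ q^-1 * w.2 `^ (- q^-1)) by ring.
rewrite -powRD; last by rewrite (gt_eqF w0) implybT.
by rewrite subrr powRr0 mulr1; apply: ler_wpM2r; rewrite ?powR_ge0 // lerDl.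
Qed.

End half_plane_kernel.

(** * The potentials v, v' and W and their weak derivatives *)

Section half_plane_potentials.
Implicit Types (z w : plane) (a theta psi : plane -> C).

Definition cj w : plane := (w.1, - w.2).

Definition kap z w : C := (w.2^-1)%:C * ((pt (z - w))^-1 - (pt (z - cj w))^-1).
(** In z, its d is (i/2) [kap] and its dbar is (i/2) times the conjugate of [kap]; added to y [kap],
    it cancels the term - (i/2) [kap] that d y creates. *)
Definition omk z w : C := 'i%C / 2 * ((w.2^-1)%:C * (lg (z - w) - lg (z - cj w))).
Definition Wk z w : C := (z.2)%:C * kap z w + omk z w.

Lemma normc_i : normc ('i%C : C) = 1.
Proof. by rewrite /= expr0n expr1n add0r sqrtr1. Qed.
Lemma normc_half : normc ('i%C / 2 : C) = 2^-1.
Proof.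
rewrite normcM normc_i mul1r normcV; congr (_^-1).
by rewrite -(rmorph_nat (real_complex R) 2) normc_ger0.
Qed.
Lemma kap_sub z w : z != w -> 0 < z.2 -> 0 < w.2 ->
 (pt (z - w))^-1 - (pt (z - cj w))^-1 = 2 * 'i%C * (w.2)%:C / (pt (z - w) * pt (z - cj w)).
Proof.
move=> zw z0 w0.
have n1 : pt (z - w) != 0.
 by rewrite -normc_gt0 (lt_le_trans _ (le_normc_pt _)) // normr_gt0 subr_eq0.
have n2 : pt (z - cj w) != 0.
 by apply/eqP=> /(congr1 (@Im R))/= /eqP; rewrite opprK gt_eqF // addr_gt0.
have E : pt (z - cj w) - pt (z - w) = 2 * 'i%C * (w.2)%:C.
 by apply: complex_ext=> /=; ring.
by rewrite -E; field; rewrite n1 n2.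
Qed.
Lemma normc_kap z w : z != w -> 0 < z.2 -> 0 < w.2 -> normc (kap z w) = hk z w.
Proof.
move=> zw z0 w0; have -> : hk z w = 2 / (normc (pt (z - w)) * normc (pt (z - cj w))) by rewrite /hk z0 w0.
rewrite /kap kap_sub // !normcM normcV !normcM normc_i.
rewrite !normc_real -(rmorph_nat (real_complex R) 2) normc_real normfV !gtr0_norm // mulr1 mulrA.
by congr (_ / _); rewrite mulrCA mulVf ?mulr1 // gt_eqF.
Qed.
Lemma ln_le_dist (t : R) : 1 <= t -> ln (t ^+ 2) <= 4 * (t - t^-1).
Proof.
move=> t1; have t0 : 0 < t := lt_le_trans ltr01 t1.
rewrite expr2 lnM ?posrE //.
have h1 := ln_le_sub1 t0.
have h2 : t - 1 <= 2 * (t - t^-1).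
 rewrite -(ler_pM2r t0) mulrBl mul1r -mulrA mulrBl mulVf ?gt_eqF //.
 by have : 0 <= (t - 1) * (t - 1) by [rewrite mulr_ge0 ?subr_ge0]; nra.
lra.
Qed.
(** 5 = 1 + 4. The term y [kap] gives 1. For the logarithm, t = |z - conj w| / |z - w| satisfies t -
    1/t = 4 y Im w / (|z - w| |z - conj w|), so ln (t^2) <= 4 (t - 1/t) has the factor y. *)
Lemma normc_Wk z w : z != w -> 0 < z.2 -> 0 < w.2 -> normc (Wk z w) <= hk z w * (5 * `|z.2|).
Proof.
move=> zw z0 w0; rewrite gtr0_norm //.
apply: normcD_le; rewrite normcM normc_real gtr0_norm // normc_kap //.
have -> : hk z w * (5 * z.2) = z.2 * hk z w + 4 * z.2 * hk z w by ring.
rewrite lerD2l /omk normcM normc_half normcM normc_real gtr0_norm ?invr_gt0 //.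
set A := normc (pt (z - w)); set B := normc (pt (z - cj w)).
have A0 : 0 < A by rewrite (lt_le_trans _ (le_normc_pt _)) // normr_gt0 subr_eq0.
have BA : B ^+ 2 = A ^+ 2 + 4 * (z.2 * w.2) by rewrite !normc_pt2 /sq /=; ring.
have B0 : 0 < B.
 rewrite -(@ltr_pXn2r _ 2) ?nnegrE ?normc_ge0 // expr0n BA ltr_pwDr ?sqr_ge0 //.
 by rewrite !mulr_gt0.
have hkE : hk z w = 2 / (A * B) by rewrite /hk z0 w0.
have -> : normc (lg (z - w) - lg (z - cj w)) = ln ((B / A) ^+ 2).
 rewrite normc_distC /lg -rmorphB normc_real -!normc_pt2 -/A -/B -ln_div ?posrE ?exprn_gt0 // -expr_div_n.
 rewrite ger0_norm // ln_ge0 // expr_div_n ler_pdivlMr ?exprn_gt0 // mul1r BA lerDl.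
 by rewrite ltW // !mulr_gt0.
have t1 : 1 <= B / A.
 by rewrite ler_pdivlMr // mul1r -ler_sqr ?nnegrE ?(ltW A0) ?(ltW B0) // BA lerDl ltW // !mulr_gt0.
have h := ln_le_dist t1.
have E : B / A - (B / A)^-1 = 4 * (z.2 * w.2) / (A * B).
 by have -> : 4 * (z.2 * w.2) = B ^+ 2 - A ^+ 2 by [rewrite BA; ring]; field; rewrite !gt_eqF.
rewrite E in h; rewrite hkE.
apply: (le_via (2^-1 * (w.2^-1 * (4 * (4 * (z.2 * w.2) / (A * B)))))).
 by rewrite ler_pM2l ?invr_gt0 // ler_pM2l ?invr_gt0.
by rewrite le_eqVlt; apply/orP; left; apply/eqP; field; rewrite !gt_eqF.
Qed.
Lemma meas_sub_cj : mfun (fun zw : plane * plane => zw.1 - cj zw.2).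
Proof.
apply/measurable_fun_pairP; split.
 apply: mfunB; first exact: (mcomp mfst mfst).
 exact: (mcomp mfst msnd).
rewrite [X in measurable_fun _ X](_ : _ = fun zw : plane * plane => zw.1.2 + zw.2.2); last first.
 by apply/funext=> zw /=; rewrite opprK.
apply: mfunD; first exact: (mcomp msnd mfst).
exact: (mcomp msnd msnd).
Qed.
Lemma cmfun_Kernel (g : plane -> C) : cmfun g -> cmfun (fun zw : plane * plane =>
 ((zw.2).2^-1)%:C * (g (zw.1 - zw.2) - g (zw.1 - cj zw.2))).
Proof.
move=> mg; apply: cmfunM.
 apply/cmfun_real/meas_inv; exact: (mcomp msnd msnd).
by apply: cmfunB; [exact: cmfun_comp meas_sub_plane mg|exact: cmfun_comp meas_sub_cj mg].
Qed.
Lemma cmfun_kap : cmfun (fun zw => kap zw.1 zw.2).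
Proof. exact: (cmfun_Kernel (cmfunV (@cmfun_pt R))). Qed.
Lemma cmfun_Wk : cmfun (fun zw => Wk zw.1 zw.2).
Proof.
apply: cmfunD.
 apply: cmfunM; last exact: cmfun_kap.
 by apply: cmfun_real; exact: (mcomp msnd mfst).
apply: cmfunM; first exact: cmfun_cst.
apply: (@cmfun_Kernel (fun z => lg z)).
by have := @cmfun_lg 0; congr cmfun; apply/funext=> z; rewrite subr0.
Qed.

Section fixed_pole.
Variables (w : plane) (r : R).
Hypothesis w0 : 0 < w.2.
Implicit Types F : plane -> C.

Lemma ccontJc F : ccont F -> bsupp r F -> ccont (fun z => (F z)^*) /\ bsupp r (fun z => (F z)^*).
Proof. by move=> cF bF; split; [exact: ccontJ|move=> z /bF ->; rewrite conjc0]. Qed.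
Lemma kap_pair F : ccont F -> bsupp r F -> cintg (fun z => kap z w * F z) /\
 cI (fun z => kap z w * F z) = (w.2^-1)%:C *
 (cI (fun z => (pt (z - w))^-1 * F z) - cI (fun z => (pt (z - cj w))^-1 * F z)).
Proof.
move=> cF bF; have i1 := cintg_inv_pt w cF bF; have i2 := cintg_inv_pt (cj w) cF bF.
have i3 := cintgB i1 i2; have E : (fun z => kap z w * F z) = fun z => (w.2^-1)%:C *
 ((pt (z - w))^-1 * F z - (pt (z - cj w))^-1 * F z).
 by apply/funext=> z; rewrite /kap -mulrA mulrBl.
by rewrite E cintZ // cintB //; split=> //; exact: cintgZ.
Qed.
Lemma kapJ_pair F : ccont F -> bsupp r F -> cintg (fun z => (kap z w)^* * F z) /\
 cI (fun z => (kap z w)^* * F z) = (w.2^-1)%:C *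
 (cI (fun z => ((pt (z - w))^*)^-1 * F z) - cI (fun z => ((pt (z - cj w))^*)^-1 * F z)).
Proof.
move=> cF bF; have [cJ bJ] := ccontJc cF bF; have [i e] := kap_pair cJ bJ.
have E : (fun z => (kap z w)^* * F z) = fun z => (kap z w * (F z)^*)^*.
 by apply/funext=> z; rewrite conjcM conjcK.
rewrite E; split; first exact: cintgJ.
rewrite cintJ // e conjcM conjc_real (rmorphB (@conjc R)); congr (_ * (_ - _)).
- rewrite -[LHS](cintJ (cintg_inv_pt w cJ bJ)).
 by apply: eq_cintT=> z; rewrite conjcM conjcK conjcV.
- rewrite -[LHS](cintJ (cintg_inv_pt (cj w) cJ bJ)).
 by apply: eq_cintT=> z; rewrite conjcM conjcK conjcV.
Qed.
Lemma omk_pair F : ccont F -> bsupp r F -> cintg (fun z => omk z w * F z) /\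
 cI (fun z => omk z w * F z) = 'i%C / 2 * ((w.2^-1)%:C *
 (cI (fun z => lg (z - w) * F z) - cI (fun z => lg (z - cj w) * F z))).
Proof.
move=> cF bF; have i1 := cintg_lg w cF bF; have i2 := cintg_lg (cj w) cF bF.
have i3 := cintgB i1 i2; have E : (fun z => omk z w * F z) = fun z => 'i%C / 2 * ((w.2^-1)%:C *
 (lg (z - w) * F z - lg (z - cj w) * F z)).
 by apply/funext=> z; rewrite /omk -!mulrA mulrBl.
by rewrite E cintZ ?cintZ // ?cintB //; [split=> //; do 2 apply: cintgZ|exact: cintgZ].
Qed.
Definition imc z : C := (z.2)%:C.

Lemma Ck_imc n : Ck n imc. Proof. exact: (Ck_evc n EY). Qed.
Lemma dz_imc psi : Ck 1 psi ->
 dz (fun z => imc z * psi z) = (fun z => imc z * dz psi z - 'i%C / 2 * psi z) /\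
 dzb (fun z => imc z * psi z) = (fun z => imc z * dzb psi z + 'i%C / 2 * psi z).
Proof.
move=> Cp; have [-> ->] := dzM (Ck_imc 1) Cp; split; apply/funext=> z.
 by rewrite (wd_dz (wd_im z)) !mulNr.
by rewrite (wd_dzb (wd_im z)).
Qed.
Lemma imc_pair F : ccont F -> bsupp r F -> ccont (fun z => imc z * F z) /\ bsupp r (fun z => imc z * F z).
Proof.
move=> cF bF; split; first by apply: ccontM=> //; exact: Ck_cont (Ck_imc 0).
by move=> z /bF ->; rewrite mulr0.
Qed.
Lemma Wk_pair F : ccont F -> bsupp r F -> cintg (fun z => Wk z w * F z) /\
 cI (fun z => Wk z w * F z) = cI (fun z => kap z w * (imc z * F z)) + cI (fun z => omk z w * F z).
Proof.
move=> cF bF; have [c1 b1] := imc_pair cF bF.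
have [i1 _] := kap_pair c1 b1; have [i2 _] := omk_pair cF bF.
have E : (fun z => Wk z w * F z) = fun z => kap z w * (imc z * F z) + omk z w * F z.
 by apply/funext=> z; rewrite /Wk mulrDl /imc; congr (_ + _); rewrite mulrAC mulrA mulrC mulrA.
by rewrite E cintD //; split=> //; exact: cintgD.
Qed.

Variable psi : plane -> C.
Hypotheses (Cpsi : Ck 1 psi) (bpsi : bsupp r psi) (psi0 : forall z, z.2 <= 0 -> psi z = 0).

Let cpsi := Ck_cont Cpsi.
Let Cip : Ck 1 (fun z => imc z * psi z) := CkM (Ck_imc 1) Cpsi.
Let bip : bsupp r (fun z => imc z * psi z) := (imc_pair cpsi bpsi).2.

Lemma kap_dz_imc : cI (fun z => kap z w * (imc z * dz psi z)) =
 cI (fun z => kap z w * dz (fun z => imc z * psi z) z) + 'i%C / 2 * cI (fun z => kap z w * psi z).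
Proof.
have [e1 _] := dz_imc Cpsi; have [i1 _] := kap_pair (Ck_cont (Ck_dz Cip)) (bsupp_dz bip).1.
have [i2 _] := kap_pair cpsi bpsi.
rewrite -cintZ // -cintD //; last exact: cintgZ.
by apply: eq_cintT=> z; rewrite e1; ring.
Qed.
(** Kernel form of d W = y d v: the logarithmic term removes exactly the contribution of d y. *)
Lemma Wk_dz : cI (fun z => Wk z w * dz psi z) = cI (fun z => kap z w * dz (fun z => imc z * psi z) z).
Proof.
have [c1 b1] := (Ck_cont (Ck_dz Cpsi), (bsupp_dz bpsi).1).
rewrite (Wk_pair c1 b1).2 kap_dz_imc.
have -> : cI (fun z => omk z w * dz psi z) = - ('i%C / 2 * cI (fun z => kap z w * psi z)).
 rewrite (omk_pair c1 b1).2 (kap_pair cpsi bpsi).2 (cint_lg_dz w Cpsi bpsi) (cint_lg_dz (cj w) Cpsi bpsi).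
 by rewrite -opprD !mulrN.
by rewrite addrK.
Qed.
(** Cauchy-Pompeiu for y psi gives the value at w, whose factor Im w cancels 1 / Im w, and the value
    at the reflected pole, which is 0 because psi vanishes below the real line. *)
Lemma Wk_dzb : cI (fun z => Wk z w * dzb psi z) =
 - psi w - 'i%C / 2 * (cI (fun z => kap z w * psi z) + cI (fun z => (kap z w)^* * psi z)).
Proof.
have [c1 b1] := (Ck_cont (Ck_dzb Cpsi), (bsupp_dz bpsi).2).
rewrite (Wk_pair c1 b1).2 (omk_pair c1 b1).2 !(cint_lg_dzb _ Cpsi bpsi).
have [_ e1] := dz_imc Cpsi; have [i1 e2] := kap_pair (Ck_cont (Ck_dzb Cip)) (bsupp_dz bip).2.
have [i2 _] := kap_pair cpsi bpsi.
have -> : cI (fun z => kap z w * (imc z * dzb psi z)) =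
 cI (fun z => kap z w * dzb (fun z => imc z * psi z) z) - 'i%C / 2 * cI (fun z => kap z w * psi z).
 rewrite -cintZ // -cintB //; last exact: cintgZ.
 by apply: eq_cintT=> z; rewrite e1; ring.
rewrite e2 !(cauchy_pompeiu _ Cip bip) [psi (cj w)]psi0; last by rewrite /= oppr_le0 ltW.
rewrite (kapJ_pair cpsi bpsi).2 mulr0 oppr0 subr0 /imc mulrN mulrA -rmorphM /= mulVf ?gt_eqF // mul1r.
by ring.
Qed.

End fixed_pole.

(* Off a single point, where the kernels take junk values, comparing integrands is enough. *)
Lemma area_int_le_off_point z0 (F G : plane -> R) : mfun F -> mfun G ->
 (forall w, 0 <= F w) -> (forall w, 0 <= G w) -> (forall w, w != z0 -> F w <= G w) ->
 (\int[mu]_w (F w)%:E <= \int[mu]_w (G w)%:E)%E.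
Proof.
move=> mF mG F0 G0 FG; apply: ae_ge0_le_integral=> //.
- by move=> w _; rewrite lee_fin.
- exact/mEFin.
- by move=> w _; rewrite lee_fin.
- exact/mEFin.
exists [set z0]; split.
- have -> : [set z0] = [set z0.1] `*` [set z0.2].
 by apply/seteqP; split=> [w ->|[w1 w2] /= [h1 h2]] //=; rewrite [RHS]surjective_pairing -h1 -h2.
 by apply: measurableX; exact: measurable_set1.
- exact: lam2_point.
- move=> w /= H; apply: contrapT=> nz; apply: H=> _; rewrite lee_fin FG //.
 by apply/eqP.
Qed.
Lemma ae_imp (Q S : plane -> Prop) : {ae mu, forall z, Q z} -> (forall z, Q z -> S z) -> {ae mu, forall z, S z}.
Proof. by move=> [A [mA A0 sA]] QS; exists A; split=> // z /= h; apply: sA=> /= /QS. Qed.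
Lemma ae_cint (f g : plane -> C) : cmfun f -> cmfun g -> {ae mu, forall z, f z = g z} ->
 cintg f -> cintg g /\ cI f = cI g.
Proof.
move=> [mf1 mf2] [mg1 mg2] fg [i1 i2].
have aeR (h : C -> R) : {ae mu, forall z, (h (f z))%:E = (h (g z))%:E}.
 by apply: ae_imp fg _=> z ->.
have eqI (h : C -> R) : mfun (h \o f) -> mfun (h \o g) ->
 (\int[mu]_z (h (f z))%:E = \int[mu]_z (h (g z))%:E)%E.
 move=> m1 m2; apply: ae_eq_integral=> //; [exact/mEFin|exact/mEFin|].
 by apply: ae_imp (aeR h) _=> z e _.
split; last by rewrite !cintE /Rintegral (eqI (@Re R)) // (eqI (@Im R)).
have tr (h : C -> R) : mfun (h \o f) -> mfun (h \o g) ->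
 rintg (h \o f) -> rintg (h \o g).
 move=> m1 m2 /rintgP[_ lt]; apply/rintgP; split=> //.
 rewrite -(_ : \int[mu]_z `|(h \o f) z|%:E = \int[mu]_z `|(h \o g) z|%:E)%E //.
 apply: (eqI (fun c => `|h c|)); exact: mcomp.
by split; [exact: (tr (@Re R))|exact: (tr (@Im R))].
Qed.
Lemma meas_hT a : cmfun a -> mfun (hT a).
Proof.
move=> ma; rewrite (_ : hT a = fun z => ((pi^-1)%:E * \int[mu]_w (hk z w * normc (a w))%:E)%E); last first.
 by apply/funext=> z; rewrite /hT area_intE.
apply: measurable_funeM.
apply: (@meas_tonelli (fun zw => hk zw.1 zw.2 * normc (a zw.2)))=> [|zw]; last first.
 by rewrite mulr_ge0 ?hk_ge0 ?normc_ge0.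
apply: mfunM; first exact: meas_hk.
exact: (mcomp (meas_normc ma) msnd).
Qed.

Section fixed_density.
Variables (p : R) (a : plane -> C).
Hypothesis p1 : 1 < p.
Hypothesis ma : cmfun a.
Hypothesis aoo : (nLp p a < +oo)%E.
Hypothesis a0 : forall w, w.2 <= 0 -> a w = 0.

Let p0 : 0 < p := lt_trans ltr01 p1.

Lemma hT_int_lty : (\int[mu]_z (hT a z `^ p) < +oo)%E.
Proof.
have [c [c0 /(_ a ma)]] := schur p1; rewrite powint_norm // area_intE=> h.
have := poweR_lty p aoo; rewrite -(fineK (_ : _ `^ p \is a fin_num)%E); last first.
 by rewrite ge0_fin_numE ?poweR_ge0 // poweR_lty.
have : (0 <= \int[mu]_z (hT a z `^ p))%E by apply: integral_ge0=> z _; exact: poweR_ge0.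
case: (\int[mu]_z _)%E h=> [x _ _ _||] //; first exact: ltry.
rewrite gt0_muley ?lte_fin ?invr_gt0 ?pi_gt0 // leye_eq=> /eqP h _ _.
suff : (c%:E * nLp p a `^ p < +oo)%E by rewrite h.
apply: lte_mul_pinfty; rewrite ?lee_fin ?(ltW c0) //; exact: poweR_lty.
Qed.
Lemma hT_ae : {ae mu, forall z, (hT a z < +oo)%E}.
Proof.
have mh := meas_hT ma.
have : mu.-integrable setT (fun z => hT a z `^ p)%E.
 apply/integrableP; split; first exact: (mcomp (measurable_poweR p) mh).
 by under eq_integral do rewrite gee0_abs ?poweR_ge0 //; exact: hT_int_lty.
move=> /(integrable_ae measurableT); apply: filterS=> z /(_ I).
rewrite ge0_fin_numE ?poweR_ge0 // => h; apply: (lty_poweRy _ h).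
by rewrite gt_eqF.
Qed.

Section fixed_kernel.
Variables (k : plane * plane -> C) (c : plane -> R) (theta : plane -> C) (r M : R).
Hypothesis mk : cmfun k.
Hypothesis mt : cmfun theta.
Hypothesis mc : mfun c.
Hypothesis c0 : forall z, 0 <= c z.
Hypothesis kc : forall z w, z != w -> 0 < z.2 -> 0 < w.2 -> normc (k (z, w)) <= hk z w * c z.
Hypothesis t0 : forall z, z.2 <= 0 -> theta z = 0.
Hypothesis bt : bsupp r theta.
Hypothesis cM : forall z, c z * normc (theta z) <= M.
Hypothesis ik : forall w, 0 < w.2 -> cintg (fun z => k (z, w) * theta z).

Let B z : R := c z * normc (theta z).
Let F zw : C := k zw * a zw.2 * theta zw.1.

(** Absolute integrability: the inner integral is at most pi B(z) times [hT a z], and Young's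
    inequality separates the two factors into [hT a] to the power p, integrable by Schur's test, and
    a bounded function of bounded support to the power q. The weight c covers [kap], with c = 1, and
    [Wk], with c = 5 |y|. *)
Lemma kernel_fubini : [/\ cintg (fun z => cI (fun w => k (z, w) * a w) * theta z),
 cintg (fun w => a w * cI (fun z => k (z, w) * theta z)) &
 cI (fun z => cI (fun w => k (z, w) * a w) * theta z) = cI (fun w => a w * cI (fun z => k (z, w) * theta z))].
Proof.
have mF : cmfun F.
 apply: cmfunM; last exact: (cmfun_comp mfst mt).
 by apply: cmfunM=> //; exact: (cmfun_comp msnd ma).
have mh := meas_hT ma.
have mB : mfun B by apply: mfunM=> //; exact: meas_normc.
have B0 z : 0 <= B z by rewrite mulr_ge0 ?normc_ge0.
have mna := meas_normc ma.
have FB z w : w != z -> normc (F (z, w)) <= B z * (hk z w * normc (a w)).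
 move=> wz; rewrite /F /B !normcM.
 have [w0|w0] := ltP 0 w.2; last by rewrite a0 // normc0 !(mulr0, mul0r).
 have [z0|z0] := ltP 0 z.2; last by rewrite t0 // normc0 !(mulr0, mul0r).
 have -> : c z * normc (theta z) * (hk z w * normc (a w)) =
 hk z w * c z * normc (a w) * normc (theta z) by ring.
 by apply: ler_wpM2r; [exact: normc_ge0|apply: ler_wpM2r; [exact: normc_ge0|apply: kc; rewrite // eq_sym]].
have mFz z : mfun (fun w => normc (F (z, w))).
 exact: (mcomp (meas_normc mF) (measurable_pair1 z)).
have mhz z : mfun (fun w => hk z w * normc (a w)).
 by apply: mfunM=> //; exact: meas_hkl.
have inner z : (\int[mu]_w (normc (F (z, w)))%:E <= (pi * B z)%:E * hT a z)%E.
 apply: (le_via (\int[mu]_w (B z * (hk z w * normc (a w)))%:E)%E).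
 apply: (@area_int_le_off_point z)=> //.
 - by apply: mfunM=> //; exact: mcst.
 - by move=> w; exact: normc_ge0.
 - by move=> w; rewrite !mulr_ge0 ?hk_ge0 ?normc_ge0.
 - by move=> w; exact: FB.
 under eq_integral do rewrite EFinM.
 rewrite ge0_integralZl_EFin //; last 2 first.
 - by move=> w _; rewrite lee_fin mulr_ge0 ?hk_ge0 ?normc_ge0.
 - by apply/mEFin; exact: mhz.
 rewrite /hT area_intE muleA -EFinM mulrC mulrA mulVf ?mul1r //.
 by rewrite gt_eqF // pi_gt0.
have [_ q0 pq] := conj_exponent p1; set q := (1 - p^-1)^-1 in q0 pq.
have B1 z : 0 <= pi * B z by rewrite mulr_ge0 ?pi_ge0.
have lty : (\int[mu]_z \int[mu]_w (normc (F (z, w)))%:E < +oo)%E.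
 apply: (@le_lt_trans _ _ (\int[mu]_z (hT a z `^ p + ((pi * B z) `^ q)%:E))%E).
 apply: le_integral_lower=> z.
 by apply: integral_ge0=> w _; rewrite lee_fin normc_ge0.
 apply: (le_trans (inner z)); case: (hT a z) (hT_ge0 a z)=> [x x0|_|] //.
 rewrite lee_fin in x0; rewrite poweR_EFin -EFinM -EFinD lee_fin mulrC.
 apply: le_trans (conjugate_powR x0 (B1 z) p0 q0 pq) _; apply: lerD.
 by rewrite ler_piMr ?powR_ge0 // invf_le1 // ltW.
 by rewrite ler_piMr ?powR_ge0 // invrK gerBl invr_ge0 ltW.
 by rewrite poweRyr ?gt_eqF // addye ?leey.
 have mBq : mfun (fun z => (pi * B z) `^ q).
 apply: (mcomp (meas_powR_fun q)).
 by apply: mfunM=> //; exact: mcst.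
 rewrite ge0_integralD //; last 4 first.
 - by move=> z _; exact: poweR_ge0.
 - exact: (mcomp (measurable_poweR p) mh).
 - by move=> z _; rewrite lee_fin powR_ge0.
 - exact/mEFin.
 apply: lte_add_pinfty; first exact: hT_int_lty.
 have [_ h] := (rintgP _).1 (rintg_box r ((pi * M) `^ q)).
 apply: le_lt_trans h; apply: le_integral_lower=> z; rewrite lee_fin ?powR_ge0 //.
 rewrite ger0_norm; last by case: ifP=> // _; exact: powR_ge0.
 case: (leP `|z| r)=> zr.
 apply: ler_powR_nneg; [exact: ltW|exact: B1|].
 by apply: ler_wpM2l; [exact: pi_ge0|exact: cM].
 by rewrite /B bt // normc0 !mulr0 powR0 // gt_eqF.
have mFs : cmfun (fun wz : plane * plane => F (wz.2, wz.1)).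
 apply: (cmfun_comp _ mF); apply/measurable_fun_pairP.
 by split; [exact: msnd|exact: mfst].
have [i1 e1] := cint_Fubini mF lty.
have i2 : cintg (fun w => cI (fun z => F (z, w))).
 refine (proj1 (cint_Fubini mFs _))=> /=.
 by have := lty; have -> := tonelli (meas_normc mF) (fun zw => normc_ge0 (F zw)).
have E2 : (fun w => cI (fun z => F (z, w))) = fun w => a w * cI (fun z => k (z, w) * theta z).
 apply/funext=> w; have [w0|w0] := ltP 0 w.2.
 rewrite -cintZ; last exact: ik.
 by apply: eq_cintT=> z; rewrite /F mulrAC mulrC mulrA.
 rewrite (@a0 w w0) mul0r -[RHS]cint0; apply: eq_cintT=> z.
 by rewrite /F /= (@a0 w w0) mulr0 mul0r.
have mv : cmfun (fun z => cI (fun w => k (z, w) * a w)).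
 exact: (cmfun_cint (cmfunM mk (cmfun_comp msnd ma))).
rewrite E2 in i2 e1.
(* theta z leaves the inner integral only where that integral converges; elsewhere its value is a
   default, but [hT a] is finite almost everywhere. *)
have ae : {ae mu, forall z, cI (fun w => F (z, w)) = cI (fun w => k (z, w) * a w) * theta z}.
 apply: ae_imp hT_ae _=> z hz.
 have [tz|tz] := eqVneq (theta z) 0.
 by rewrite tz mulr0 -[RHS]cint0; apply: eq_cintT=> w; rewrite /F tz mulr0.
 have iF : cintg (fun w => F (z, w)).
 apply/cintgP; split; first exact: (cmfun_comp (measurable_pair1 z) mF).
 by apply: le_lt_trans (inner z) _; apply: lte_mul_pinfty; rewrite ?lee_fin.
 have ika : cintg (fun w => k (z, w) * a w).
 have := cintgZ (theta z)^-1 iF; congr cintg; apply/funext=> w.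
 by rewrite /F mulrC mulfK.
 by rewrite mulrC -cintZ //; apply: eq_cintT=> w; rewrite /F mulrC.
have [] := ae_cint (cintg_cmfun i1) (cmfunM mv mt) ae i1.
by move=> i3 e3; split=> //; rewrite -e3 e1.
Qed.

End fixed_kernel.

Definition potv z := cI (fun w => kap z w * a w).
Definition potvJ z := cI (fun w => (kap z w)^* * a w).
Definition potW z := cI (fun w => Wk z w * a w).
Definition potG z := a z + 'i%C / 2 * (potv z + potvJ z).

Section weak.
Variables (r : R) (psi : plane -> C).
Hypotheses (Cpsi : Ck 1 psi) (bpsi : bsupp r psi).
Hypothesis psi0 : exists2 d, 0 < d & forall z, z.2 <= d -> psi z = 0.

Lemma vanish_dz z : z.2 <= 0 -> [/\ psi z = 0, dz psi z = 0 & dzb psi z = 0].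
Proof.
move=> z0; have [d d0 H] := psi0.
have w0 : wd psi z 0 0.
 apply: (@wd_near (fun=> 0)); last exact: wd_cst.
 apply/nbhs_ballP; exists d=> //= u [_ /= h]; rewrite H //.
 by move: h; rewrite /ball /= => h; have := ler_norm (u.2 - z.2); rewrite distrC; lra.
by rewrite (wd_dz w0) (wd_dzb w0) H // (le_trans z0) // ltW.
Qed.
Lemma kap_fubini (theta : plane -> C) : ccont theta -> bsupp r theta -> (forall z, z.2 <= 0 -> theta z = 0) ->
 [/\ cintg (fun z => potv z * theta z), cintg (fun w => a w * cI (fun z => kap z w * theta z)) &
 cI (fun z => potv z * theta z) = cI (fun w => a w * cI (fun z => kap z w * theta z))].
Proof.
move=> ct bt t0; have [M [_ HM]] := cb_bounded ct bt.
apply: (@kernel_fubini (fun zw => kap zw.1 zw.2) (fun=> 1) theta r M)=> //.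
- exact: cmfun_kap.
- exact: ccont_cmfun.
- by move=> z w zw z0 w0; rewrite mulr1 -[normc _]/(normc (kap z w)) normc_kap.
- by move=> z; rewrite mul1r.
- by move=> w w0; case: (kap_pair w ct bt).
Qed.
Lemma kapJ_fubini (theta : plane -> C) : ccont theta -> bsupp r theta -> (forall z, z.2 <= 0 -> theta z = 0) ->
 [/\ cintg (fun z => potvJ z * theta z), cintg (fun w => a w * cI (fun z => (kap z w)^* * theta z)) &
 cI (fun z => potvJ z * theta z) = cI (fun w => a w * cI (fun z => (kap z w)^* * theta z))].
Proof.
move=> ct bt t0; have [M [_ HM]] := cb_bounded ct bt.
apply: (@kernel_fubini (fun zw => (kap zw.1 zw.2)^*) (fun=> 1) theta r M)=> //.
- by apply: cmfunJ; exact: cmfun_kap.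
- exact: ccont_cmfun.
- by move=> z w zw z0 w0; rewrite mulr1 normc_conj -[normc _]/(normc (kap z w)) normc_kap.
- by move=> z; rewrite mul1r.
- by move=> w w0; case: (kapJ_pair w ct bt).
Qed.
Lemma W_fubini (theta : plane -> C) : ccont theta -> bsupp r theta -> (forall z, z.2 <= 0 -> theta z = 0) ->
 [/\ cintg (fun z => potW z * theta z), cintg (fun w => a w * cI (fun z => Wk z w * theta z)) &
 cI (fun z => potW z * theta z) = cI (fun w => a w * cI (fun z => Wk z w * theta z))].
Proof.
move=> ct bt t0; have [ci bi] := imc_pair ct bt; have [M [_ HM]] := cb_bounded ci bi.
apply: (@kernel_fubini (fun zw => Wk zw.1 zw.2) (fun z => 5 * `|z.2|) theta r (5 * M))=> //.
- exact: cmfun_Wk.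
- exact: ccont_cmfun.
- apply: mfunM; first exact: mcst.
 by apply: mcomp=> //; exact: msnd.
- by move=> z w zw z0 w0; exact: normc_Wk.
- by move=> z; rewrite -mulrA ler_pM2l // -normc_real -normcM HM.
- by move=> w w0; case: (Wk_pair w ct bt).
Qed.
Lemma weak_dz : cI (fun z => potW z * dz psi z) = cI (fun z => potv z * dz (fun z => imc z * psi z) z).
Proof.
have [_ bi] := imc_pair (Ck_cont Cpsi) bpsi; have Ci := CkM (Ck_imc 1) Cpsi.
have dz0 z : z.2 <= 0 -> dz psi z = 0 by move=> z0; case: (@vanish_dz z z0).
have [_ _ ->] := W_fubini (Ck_cont (Ck_dz Cpsi)) (bsupp_dz bpsi).1 dz0.
have dzi0 z : z.2 <= 0 -> dz (fun z => imc z * psi z) z = 0.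
 by move=> z0; have [h1 h2 _] := @vanish_dz z z0; rewrite (dz_imc Cpsi).1 h1 h2 !mulr0 subr0.
have [_ _ ->] := kap_fubini (Ck_cont (Ck_dz Ci)) (bsupp_dz bi).1 dzi0.
apply: eq_cintT=> w; have [w0|w0] := ltP 0 w.2; first by rewrite (Wk_dz w Cpsi bpsi).
by rewrite (@a0 w w0); exact: etrans (mul0r _) (esym (mul0r _)).
Qed.
Lemma weak_dzb : cintg (fun z => potG z * psi z) /\
 cI (fun z => potW z * dzb psi z) = - cI (fun z => potG z * psi z).
Proof.
have cp := Ck_cont Cpsi; have pz z (z0 : z.2 <= 0) : psi z = 0 by case: (vanish_dz z0).
have dz0 z : z.2 <= 0 -> dzb psi z = 0 by move=> z0; case: (@vanish_dz z z0).
have [_ _ ->] := W_fubini (Ck_cont (Ck_dzb Cpsi)) (bsupp_dz bpsi).2 dz0.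
have [i1 j1 e1] := kap_fubini cp bpsi pz; have [i2 j2 e2] := kapJ_fubini cp bpsi pz.
have ip : cintg (fun z => a z * psi z).
 have [M [M0 HM]] := cb_bounded cp bpsi.
 have [s0 q0 pq] := conj_exponent p1.
 exact: (hoelder_cintg p0 q0 pq ma (ccont_cmfun cp) aoo (bounded_norm_LpC q0 bpsi HM)).
have E : (fun z => potG z * psi z) = fun z => a z * psi z + 'i%C / 2 * (potv z * psi z + potvJ z * psi z).
 apply/funext=> z; rewrite /potG; move: (potv z) (potvJ z) (a z) (psi z)=> x1 x2 x3 x4; ring.
have i12 := cintgD i1 i2; have i3 := cintgZ ('i%C / 2) i12.
split; first by rewrite E; exact: cintgD ip i3.
have j12 := cintgD j1 j2; have j3 := cintgZ ('i%C / 2) j12; have jp := cintgD ip j3.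
have -> : cI (fun z => potG z * psi z) = cI (fun w => a w * psi w + 'i%C / 2 *
 (a w * cI (fun z => kap z w * psi z) + a w * cI (fun z => (kap z w)^* * psi z))).
 by rewrite E (cintD ip i3) (cintZ _ i12) (cintD i1 i2) e1 e2 -(cintD j1 j2) -(cintZ _ j12) -(cintD ip j3).
rewrite -(cintN jp).
apply: eq_cintT=> w; have [w0|w0] := ltP 0 w.2.
 by rewrite (Wk_dzb w0 Cpsi bpsi pz); move: (cI _) (cI _)=> x y; ring.
by rewrite (@a0 w w0) !mul0r addr0 mulr0 addr0 oppr0.
Qed.

End weak.

Lemma cmfun_potentials : [/\ cmfun potv, cmfun potvJ, cmfun potW & cmfun potG].
Proof.
have h (k : plane * plane -> C) : cmfun k -> cmfun (fun z => cI (fun w => k (z, w) * a w)).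
 move=> mk; apply: (@cmfun_cint (fun zw => k zw * a zw.2)).
 by apply: cmfunM=> //; exact: (cmfun_comp msnd ma).
have m1 : cmfun potv by exact: (h _ cmfun_kap).
have m2 : cmfun potvJ by exact: (h _ (cmfunJ cmfun_kap)).
have m3 : cmfun potW by exact: (h _ cmfun_Wk).
split; [exact: m1|exact: m2|exact: m3|].
by apply: cmfunD=> //; apply: cmfunM; [exact: cmfun_cst|exact: cmfunD].
Qed.
Lemma pot_le (k : plane -> plane -> C) (c : R) z : cmfun (fun w => k z w) -> 0 <= c ->
 (forall w, w != z -> 0 < w.2 -> normc (k z w) <= hk z w * c) ->
 ((normc (cI (fun w => k z w * a w)))%:E <= c%:E * hT a z)%E.
Proof.
move=> mk c0 kc; have mka := cmfunM mk ma.
apply: le_trans (normc_cint_area mka) _; rewrite /hT !area_intE muleCA.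
apply: lee_wpmul2l; first by rewrite lee_fin invr_ge0 pi_ge0.
have mh : mfun (fun w => hk z w * normc (a w)).
 by apply: mfunM; [exact: meas_hkl|exact: meas_normc].
rewrite -ge0_integralZl_EFin //; last 2 first.
- by move=> w _; rewrite lee_fin mulr_ge0 ?hk_ge0 ?normc_ge0.
- by apply/mEFin; exact: mh.
apply: (@area_int_le_off_point z _ (fun w => c * (hk z w * normc (a w)))).
- exact: meas_normc.
- by apply: mfunM=> //; exact: mcst.
- by move=> w; exact: normc_ge0.
- by move=> w; rewrite !mulr_ge0 ?hk_ge0 ?normc_ge0.
move=> w wz; rewrite normcM; have [w0|w0] := ltP 0 w.2; last by rewrite a0 // normc0 !mulr0.
by rewrite mulrCA mulrA; apply: ler_wpM2r; [exact: normc_ge0|exact: kc].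
Qed.

End fixed_density.

End half_plane_potentials.

(** * Cutoffs near the boundary and at infinity *)

Section half_plane_cutoffs.
Local Notation d_ n := ((@rate n)%:num).
Local Notation cutX := (1 + 'X : {poly R}).
Implicit Types (z w : plane) (n : nat) (y : R).

(* With [x := (n + 1) y - 1 > 0] and [u := 1 / x] this is [(1 + u) exp (- u)], which is also
 [(n + 1) y * flat 'X x]: hence [y] times a smooth function. *)
Definition hy n y : R := flat cutX (n.+1%:R * y - 1).
Definition hy' n y : R := n.+1%:R * flat (flatD cutX) (n.+1%:R * y - 1).

Lemma hy_derive n y : is_derive y (1 : R) (hy n) (hy' n y).
Proof.
have dlin : is_derive y (1 : R) (fun t : R => n.+1%:R * t - 1) n.+1%:R.
 have := is_deriveB (is_deriveM (is_derive_cst (n.+1%:R : R) y (1 : R)) (is_derive_id y (1 : R))) (is_derive_cst (1 : R) y 1).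
 by rewrite /GRing.scale /= mulr1 mulr0 addr0 subr0.
have := is_derive1_comp (f := flat cutX) (g := fun t : R => n.+1%:R * t - 1) (is_derive_flat cutX _) dlin.
by rewrite mulrC.
Qed.
Lemma hy_out n y : n.+1%:R * y <= 1 -> hy n y = 0 /\ hy' n y = 0.
Proof. by move=> h; rewrite /hy /hy' !flat_le0 ?subr_le0 // mulr0. Qed.
Lemma hyE n y u : 1 < n.+1%:R * y -> u = (n.+1%:R * y - 1)^-1 ->
 [/\ 0 < u, hy n y = (1 + u) * expR (- u) & y * `|hy' n y| = (u ^+ 2 + u ^+ 3) * expR (- u)].
Proof.
move=> x1 uE; have x0 : 0 < n.+1%:R * y - 1 by rewrite subr_gt0.
have u0 : 0 < u by rewrite uE invr_gt0.
split=> //; first by rewrite /hy /flat x0 -uE hornerD hornerX hornerC.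
have F0 : flat (flatD cutX) (n.+1%:R * y - 1) = u ^+ 3 * expR (- u).
 by rewrite /flat x0 -uE /flatD !(hornerE, derivD, derivC, derivX); ring.
rewrite /hy' F0 ger0_norm; last by rewrite !mulr_ge0 ?expR_ge0 ?exprn_ge0 // ltW.
have -> : y * (n.+1%:R * (u ^+ 3 * expR (- u))) = (u^-1 + 1) * u ^+ 3 * expR (- u).
 by rewrite uE invrK subrK; ring.
by congr (_ * _); field; rewrite gt_eqF.
Qed.
Lemma hy_range n y : 0 <= hy n y <= 1.
Proof.
have [h|h] := leP (n.+1%:R * y) 1; first by rewrite (hy_out h).1 lexx ler01.
have [u0 -> _] := hyE h erefl; rewrite mulr_ge0 ?expR_ge0 ?addr_ge0 ?(ltW u0) //=.
by rewrite expRN ler_pdivrMr ?expR_gt0 // mul1r expR_ge1Dx.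
Qed.
Lemma hy'_bound n y : 0 < y -> y * `|hy' n y| <= 8.
Proof.
move=> y0; have [h|h] := leP (n.+1%:R * y) 1; first by rewrite (hy_out h).2 normr0 mulr0.
have [/ltW u0 _ ->] := hyE h erefl; rewrite mulrDl; have := exprn_expR_le 2 u0; have := exprn_expR_le 3 u0.
have -> : 3`!%:R = 6 :> R by []. have -> : 2`!%:R = 2 :> R by [].
by move: (_ * _) (_ * _)=> a b; lra.
Qed.
Lemma hy_lim y : 0 < y -> exists K, 0 <= K /\ forall n, d_ n <= y / 2 ->
 `|hy n y - 1| <= K * d_ n /\ y * `|hy' n y| <= K * d_ n.
Proof.
move=> y0; exists (4 / y); split; first by rewrite divr_ge0 // ltW.
move=> n dy; have N0 : 0 < n.+1%:R :> R by [].
have Ny : 2 <= n.+1%:R * y.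
 have : n.+1%:R * d_ n <= n.+1%:R * (y / 2) by rewrite ler_pM2l.
 by rewrite mulfV ?gt_eqF // mulrA ler_pdivlMr // mul1r.
have x1 : 1 < n.+1%:R * y by lra.
have [u0 h1 h2] := hyE x1 erefl; have /andP[r0 r1] := hy_range n y.
set u := (n.+1%:R * y - 1)^-1 in u0 h1 h2.
have u1 : u <= 1 by rewrite invf_le1 ?subr_gt0 // lerBrDr; lra.
have uE : 2 * u <= 4 / y * d_ n.
 have -> : 4 / y * d_ n = 2 * (n.+1%:R * y / 2)^-1 by rewrite -[d_ n]/(n.+1%:R^-1); field; rewrite gt_eqF //= gt_eqF.
 rewrite ler_pM2l // lef_pV2 ?posrE ?subr_gt0 ?divr_gt0 ?mulr_gt0 // ler_pdivrMr //; lra.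
have e1 : expR (- u) <= 1 by rewrite -expR0 ler_expR oppr_le0 ltW.
have u2 : u ^+ 2 <= u by rewrite expr2 ler_piMr // ltW.
split; apply: le_trans uE.
 rewrite distrC ger0_norm ?subr_ge0 // h1.
 have : (1 + u) * (1 - u) <= (1 + u) * expR (- u) by rewrite ler_wpM2l ?expR_ge1Dx // addr_ge0 // ltW.
 have -> : (1 + u) * (1 - u) = 1 - u ^+ 2 by [ring]; move: ((1 + u) * expR _)=> E; lra.
rewrite h2; apply: (le_via (u ^+ 2 + u ^+ 3)).
 by rewrite ler_piMr // addr_ge0 // exprn_ge0 // ltW.
by have : u ^+ 3 <= u ^+ 2 by [rewrite exprSr ler_piMr ?sqr_ge0]; lra.
Qed.
Definition hc n z : C := (hy n z.2)%:C * chi n z.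

Lemma wd_hc n z : wd (hc n) z
 ((hy n z.2)%:C * dz (chi n) z + (hy' n z.2)%:C * (- 'i%C / 2) * chi n z)
 ((hy n z.2)%:C * dzb (chi n) z + (hy' n z.2)%:C * ('i%C / 2) * chi n z).
Proof. by apply: wdM; [exact: (wd_comp (hy_derive n z.2) (wd_im z))|exact: Ck_wd (@Ck_chi 1 n)]. Qed.
Lemma hc_out n z : n.+1%:R * z.2 <= 1 \/ n.+1%:R < `|z| -> [/\ hc n z = 0, dz (hc n) z = 0 & dzb (hc n) z = 0].
Proof.
rewrite (wd_dz (wd_hc n z)) (wd_dzb (wd_hc n z)) /hc=> -[h|h].
 by have [-> ->] := hy_out h; rewrite !mul0r addr0.
by rewrite bsupp_chi // (bsupp_dz (@bsupp_chi n)).1 // (bsupp_dz (@bsupp_chi n)).2 // !mulr0 addr0.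
Qed.
Lemma normc_hc n z : normc (hc n z) <= 1.
Proof.
have /andP[h0 h1] := hy_range n z.2; rewrite normcM normc_ger0 // -[leRHS]mulr1.
by apply: ler_pM; rewrite ?normc_ge0 ?normc_chi.
Qed.
Lemma normc_dhc n z : normc (dz (hc n) z) <= `|hy' n z.2| + normc (dz (chi n) z) /\
 normc (dzb (hc n) z) <= `|hy' n z.2| + normc (dzb (chi n) z).
Proof.
have /andP[h0 h1] := hy_range n z.2.
have key (b x : C) : normc x = 2^-1 -> normc ((hy n z.2)%:C * b + (hy' n z.2)%:C * x * chi n z) <= `|hy' n z.2| + normc b.
 move=> hx; apply: normcD_le; rewrite addrC; apply: lerD.
 rewrite !normcM normc_real hx -mulrA ler_piMr // -[leRHS]mulr1.
 by apply: ler_pM; rewrite ?normc_ge0 ?normc_chi // invf_le1 // ler1n.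
 by rewrite normcM normc_ger0 // ler_piMl ?normc_ge0.
rewrite (wd_dz (wd_hc n z)) (wd_dzb (wd_hc n z)); split; apply: key; last exact: normc_half.
by rewrite mulNr normcNE normc_half.
Qed.
Lemma dchi_le : exists c : R, 0 <= c /\ forall n z, `|z| <= n.+1%:R ->
 (normc (dz (chi n) z) <= c * normc (pt z) * d_ n /\ normc (dzb (chi n) z) <= c * normc (pt z) * d_ n) /\
 (normc (dz (chi n) z) <= 2 * c * d_ n /\ normc (dzb (chi n) z) <= 2 * c * d_ n).
Proof.
have [c [c0 Hc]] := @dchi_bound; exists c; split=> // n z zn; have [h1 h2 _] := Hc n z.
have N0 : 0 < n.+1%:R :> R by [].
have e (x : R) : x / n.+1%:R ^+ 2 = x * d_ n * d_ n by rewrite -[d_ n]/(n.+1%:R^-1); field; rewrite gt_eqF.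
have z2 : normc (pt z) * d_ n <= 2.
 rewrite ler_pdivrMr //; apply: le_trans (normc_pt_le z) _; by rewrite ler_pM2l.
have p0 := normc_ge0 (pt z); have d1 := rate_le1 n.
rewrite e in h1; rewrite e in h2.
have a1 : c * normc (pt z) * d_ n * d_ n <= c * normc (pt z) * d_ n.
 by apply: ler_piMr=> //; rewrite !mulr_ge0.
have a2 : c * normc (pt z) * d_ n * d_ n <= 2 * c * d_ n.
 by apply: ler_wpM2r=> //; rewrite -mulrA mulrC; apply: ler_wpM2r.
by split; split; [exact: le_trans h1 a1|exact: le_trans h2 a1|exact: le_trans h1 a2|exact: le_trans h2 a2].
Qed.
(** Near the boundary the gradient is of size 1 / y; the cutoff at infinity has gradient of order 1
    / n on its support, where y is at most n + 1. *)
Lemma hc_bound : exists c : R, 0 <= c /\ forall n z, 0 < z.2 ->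
 z.2 * normc (dz (hc n) z) <= c /\ z.2 * normc (dzb (hc n) z) <= c.
Proof.
have [c [c0 Hc]] := dchi_le; exists (8 + 2 * c); split; first by rewrite addr_ge0 ?mulr_ge0.
move=> n z z0; have [zn|zn] := leP `|z| n.+1%:R; last first.
 by have [_ -> ->] := hc_out (or_intror zn); rewrite normc0 mulr0 addr_ge0 ?mulr_ge0.
have zd : z.2 * d_ n <= 1.
 rewrite ler_pdivrMr // mul1r; apply: le_trans zn; rewrite norm_planeE le_max ler_norm orbT //.
have [_ [c1 c2]] := Hc n z zn; have [h1 h2] := normc_dhc n z; have h3 := hy'_bound n z0.
have key b x : normc b <= 2 * c * d_ n -> normc x <= `|hy' n z.2| + normc b -> z.2 * normc x <= 8 + 2 * c.
 move=> hb hx; apply: (le_via (z.2 * (`|hy' n z.2| + 2 * c * d_ n))).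
 by rewrite ler_pM2l //; apply: (le_trans hx); rewrite lerD2l.
 rewrite mulrDr; apply: lerD=> //; rewrite mulrCA -[leRHS]mulr1; apply: ler_wpM2l=> //; exact: mulr_ge0.
by split; [exact: key c1 h1|exact: key c2 h2].
Qed.
Lemma hc_lim z : 0 < z.2 -> forall e, 0 < e -> evt n, normc (hc n z - 1) <= e /\ (z.2 * normc (dz (hc n) z) <= e /\ z.2 * normc (dzb (hc n) z) <= e).
Proof.
move=> z0 e e0; have [K [K0 HK]] := hy_lim z0; have [c [c0 Hc]] := dchi_le.
pose L := 2 * K + 1 + z.2 * (c * normc (pt z)); have e2 := half_gt0 e0.
have cp0 : 0 <= z.2 * (c * normc (pt z)) by rewrite !mulr_ge0 ?normc_ge0 // ltW.
have L0 : 0 < L by rewrite /L; lra.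
have m0 : 0 < Num.min (e / 2 / L) (Num.min (z.2 / 2) (1 + `|z|)^-1).
 by rewrite !lt_min !divr_gt0 //= invr_gt0 ltr_wpDr.
have [N1 HN1] := rate_small m0; have [N2 HN2] := chi_cvg z e2.
exists (maxn N1 N2)=> n; rewrite geq_max=> /andP[/HN1 + /HN2 n2].
rewrite !le_min=> /and3P[d1 d2 d3].
have zn : `|z| <= n.+1%:R.
 have : 1 + `|z| <= n.+1%:R by rewrite -lef_pV2 ?posrE // ltr_wpDr.
 lra.
have dL : L * d_ n <= e / 2 by rewrite mulrC -ler_pdivlMr.
have dn0 : 0 < d_ n by [].
have [k1 k2] := HK n d2; have [[c1 c2] _] := Hc n z zn; have [g1 g2] := normc_dhc n z.
have Kd : 0 <= K * d_ n by rewrite mulr_ge0.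
have cd : 0 <= z.2 * (c * normc (pt z)) * d_ n by rewrite mulr_ge0.
have LE : L * d_ n = 2 * (K * d_ n) + d_ n + z.2 * (c * normc (pt z)) * d_ n by rewrite /L; ring.
split.
 have -> : hc n z - 1 = (hy n z.2 - 1)%:C * chi n z + (chi n z - 1).
 by rewrite /hc rmorphB mulrBl mul1r addrA subrK.
 apply: normcD_le; rewrite normcM normc_real.
 have : `|hy n z.2 - 1| * normc (chi n z) <= `|hy n z.2 - 1| * 1 by rewrite ler_wpM2l ?normc_chi.
 rewrite mulr1=> h; apply: le_trans (lerD (le_trans h k1) n2) _.
 by clear -dL LE Kd cd dn0; lra.
have key b x : normc b <= c * normc (pt z) * d_ n -> normc x <= `|hy' n z.2| + normc b -> z.2 * normc x <= e.
 move=> hb hx; apply: (le_via (z.2 * (`|hy' n z.2| + c * normc (pt z) * d_ n))).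
 by rewrite ler_pM2l //; apply: (le_trans hx); rewrite lerD2l.
 rewrite mulrDr [z.2 * (c * _ * _)]mulrA; apply: le_trans (lerD k2 (lexx _)) _.
 by clear -dL LE Kd cd dn0; lra.
by split; [exact: key c1 g1|exact: key c2 g2].
Qed.

End half_plane_cutoffs.

(** * Dominated convergence and pairings in L^p *)

Section Lp_closure.
Implicit Types (z w : plane) (f g h theta : plane -> C).
Variable p : R.
Hypothesis p1 : 1 < p.
Let p0 : 0 < p := lt_trans ltr01 p1.

Lemma Lp_comb (c d : R) f g : in_LpC p f -> in_LpC p g -> 0 <= c -> 0 <= d ->
 in_LpC p (fun z => (c * normc (f z) + d * normc (g z))%:C).
Proof.
move=> [mf fl] [mg gl] c0 d0.
have mR h e : cmfun h -> cmfun (fun z => (e * normc (h z))%:C : C).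
 by move=> mh; apply/cmfun_real/mfunM; [exact: mcst|exact: meas_normc].
have E h e : cmfun h -> 0 <= e -> nLp p (fun z => (e * normc (h z))%:C) = (e%:E * nLp p h)%E.
 move=> mh e0; rewrite -[in RHS](ger0_norm e0) -(normc_real e) -(norm_LpCZ _ p0 mh).
 by apply: eq_norm_LpC=> z; rewrite normcM !normc_real normrM [X in _ * X]ger0_norm ?normc_ge0.
have lty h e : in_LpC p h -> 0 <= e -> (e%:E * nLp p h < +oo)%E.
 by case=> mh hl e0; apply: lte_mul_pinfty; rewrite ?lee_fin.
have eD : (fun z => (c * normc (f z) + d * normc (g z))%:C) =
 fun z => (c * normc (f z))%:C + (d * normc (g z))%:C :> C.
 by apply/funext=> z; rewrite rmorphD.
rewrite eD; split; first by apply: cmfunD; exact: mR.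
apply: le_lt_trans (norm_LpCD (ltW p1) (mR f c mf) (mR g d mg)) _.
by rewrite !E //; apply: lte_add_pinfty; exact: lty.
Qed.
Lemma Lp_dom (c d : R) f g h : in_LpC p f -> in_LpC p g -> 0 <= c -> 0 <= d -> cmfun h ->
 (forall z, normc (h z) <= c * normc (f z) + d * normc (g z)) -> in_LpC p h.
Proof.
move=> Lf Lg c0 d0 mh H; split=> //.
apply: le_lt_trans (norm_LpC_mono p0 _) (Lp_comb Lf Lg c0 d0).2=> z.
by rewrite normc_ger0 ?addr_ge0 ?mulr_ge0 ?normc_ge0.
Qed.
Definition cvgLp (u : nat -> plane -> C) f := forall e, 0 < e -> evt n, (nLp p (fun z => (u n z - f z)%R) <= e%:E)%E.

Lemma cvgLp_dom (c d : R) f g h (u : nat -> plane -> C) : in_LpC p f -> in_LpC p g -> 0 <= c -> 0 <= d ->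
 cmfun h -> (forall n, cmfun (u n)) ->
 (forall n z, normc (u n z - h z) <= c * normc (f z) + d * normc (g z)) ->
 (forall z e, 0 < e -> evt n, normc (u n z - h z) <= e) -> cvgLp u h.
Proof.
move=> Lf Lg c0 d0 mh mu_ H cv; apply: (norm_LpC_dominated p0 _ _ H).
- by move=> n; exact: cmfunB.
- by apply: mfunD; apply: mfunM; try exact: mcst;
 apply: meas_normc; [case: Lf|case: Lg].
- exact: (Lp_comb Lf Lg c0 d0).2.
- move=> z; apply/cvgrPdist_le=> e e0; have [N HN] := cv z e e0; exists N=> // n /HN.
 by rewrite sub0r normrN ger0_norm ?normc_ge0.
Qed.
Lemma cvgLp_trans (u v : nat -> plane -> C) f : (forall n, cmfun (u n)) -> (forall n, cmfun (v n)) -> cmfun f ->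
 (forall n, (nLp p (fun z => (u n z - v n z)%R) <= (rate n)%:num%:E)%E) -> cvgLp v f -> cvgLp u f.
Proof.
move=> mu_ mv mf uv vf e e0; have e2 := half_gt0 e0.
have [N1 H1] := vf _ e2; have [N2 H2] := rate_small e2.
exists (maxn N1 N2)=> n; rewrite geq_max=> /andP[n1 n2].
have -> : (fun z => u n z - f z) = fun z => (u n z - v n z) + (v n z - f z).
 by apply/funext=> z; rewrite addrA subrK.
apply: le_trans (norm_LpCD (ltW p1) (cmfunB (mu_ n) (mv n)) (cmfunB (mv n) mf)) _.
rewrite [e]splitr EFinD; apply: leeD (H1 n n1).
by apply: le_trans (uv n) _; rewrite lee_fin H2.
Qed.
Lemma cvgLp_norm (u : nat -> plane -> C) f (c : \bar R) : (forall n, cmfun (u n)) -> cmfun f -> cvgLp u f ->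
 (forall e, 0 < e -> evt n, (nLp p (u n) <= c + e%:E)%E) -> (nLp p f <= c)%E.
Proof.
move=> mu_ mf uf H; apply/lee_addgt0Pr=> e e0; have e2 := half_gt0 e0.
have [N1 H1] := uf _ e2; have [N2 H2] := H _ e2; pose n := maxn N1 N2.
have -> : f = fun z => u n z - (u n z - f z) by apply/funext=> z; rewrite opprB addrC subrK.
apply: le_trans (norm_LpCB (ltW p1) (mu_ n) (cmfunB (mu_ n) mf)) _.
rewrite [e]splitr EFinD addeA; apply: leeD; [apply: H2|apply: H1]; rewrite /n; [exact: leq_maxr|exact: leq_maxl].
Qed.
Lemma Lp_pairing theta r : ccont theta -> bsupp r theta -> exists K, 0 <= K /\ forall f, in_LpC p f ->
 cintg (fun z => f z * theta z) /\ ((normc (cI (fun z => f z * theta z)))%:E <= K%:E * nLp p f)%E.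
Proof.
move=> ct bt; have [M [M0 HM]] := cb_bounded ct bt.
have [s0 q0 pq] := conj_exponent p1.
have tq := bounded_norm_LpC q0 bt HM.
exists (fine (nLp (1 - p^-1)^-1 theta)); split; first by rewrite fine_ge0 // norm_LpC_ge0.
move=> f [mf fl]; split; first exact: (hoelder_cintg p0 q0 pq mf (ccont_cmfun ct) fl tq).
rewrite fineK; last by rewrite ge0_fin_numE // norm_LpC_ge0.
by rewrite muleC; exact: (hoelder_cint p0 q0 pq mf (ccont_cmfun ct)).
Qed.
Lemma schur_norm : exists c, 0 < c /\ forall a u b, cmfun a -> 0 <= b ->
 (forall z, ((normc (u z))%:E <= b%:E * hT a z)%E) -> (nLp p u <= (b * c)%:E * nLp p a)%E.
Proof.
have [c [c0 H]] := @schur p p1; exists (c `^ p^-1); split; first exact: powR_gt0.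
move=> a u b ma b0 Hu; have bc : 0 <= b * c `^ p^-1 by rewrite mulr_ge0 ?powR_ge0.
have bp : 0 <= b `^ p by exact: powR_ge0.
apply: norm_LpC_le=> //; first by rewrite mule_ge0 ?norm_LpC_ge0.
rewrite poweRM ?norm_LpC_ge0 // -powint_norm // poweR_EFin powRM ?powR_ge0 // -powRrM mulVf ?gt_eqF //.
rewrite powRr1 ?(ltW c0) // EFinM -muleA.
apply: (le_via (aint (fun z => (b `^ p)%:E * hT a z `^ p)%E)).
 apply: le_area_int=> z; first by rewrite lee_fin powR_ge0.
 rewrite -!poweR_EFin -poweRM ?hT_ge0 ?lee_fin //.
 by apply: le_poweR; rewrite ?lee_fin ?normc_ge0 ?(ltW p0).
rewrite area_intZ //; last 2 first.
- exact: (mcomp (measurable_poweR p) (meas_hT ma)).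
- by move=> z; exact: poweR_ge0.
by apply: lee_wpmul2l; [rewrite lee_fin|exact: H].
Qed.

End Lp_closure.

(** * A smooth compactly supported mollifier *)

Section mollifier.
Implicit Types (z w : plane) (m : nat).

Definition esq (A B : ex) : ex := EAdd (EMul A A) (EMul B B).
(** The bump is an expression in arbitrary arguments, so that its translates, multiplied by cutoffs,
    are again expressions and can serve as test functions. *)
Definition ebump m (A B : ex) : ex := EFlat 1 (EAdd (EC 1) (EMul (EC (- m.+1%:R ^+ 2)) (esq A B))).
Definition bmp m z : R := ev (ebump m EX EY) z.

Lemma bumpE m z : bmp m z = flat 1 (1 - m.+1%:R ^+ 2 * sq z).
Proof. by rewrite /bmp /= /sq -!expr2 mulNr. Qed.
Lemma bump_out m z : m.+1%:R^-1 <= `|z| -> bmp m z = 0.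
Proof.
move=> h; rewrite bumpE flat_le0 // subr_le0; apply: le_trans (ler_wpM2l (sqr_ge0 _) (le_norm_sq z)).
rewrite -exprMn exprn_ege1 // mulrC -ler_pdivrMr //; by rewrite mul1r.
Qed.
Lemma rintg_bump m : rintg (bmp m).
Proof.
have h : cintg (evc (ebump m EX EY)).
 apply: (cb_cintg (r := m.+1%:R^-1)); first exact: ccont_evc.
 by move=> z /ltW h; rewrite /evc -/(bmp m z) bump_out.
by case: h.
Qed.
Definition bmass m : R := fine (aint (fun z => (bmp m z)%:E)).

Lemma bump_ge0 m z : 0 <= bmp m z. Proof. by rewrite bumpE flat_ge0. Qed.
Lemma bmassE m : aint (fun z => (bmp m z)%:E) = (bmass m)%:E.
Proof. by rewrite /bmass fineK // area_intE fin_numM // (integrable_fin_num measurableT (rintg_bump m)). Qed.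
(** With mass 0, the averages of the bump over small discs around 0 would vanish, against its
    positive value there. *)
Lemma bmass_gt0 m : 0 < bmass m.
Proof.
have F0 : (0 <= aint (fun z => (bmp m z)%:E))%E by apply: area_int_ge0=> z _; rewrite lee_fin bump_ge0.
rewrite lt_neqAle -lee_fin -bmassE F0 andbT; apply/eqP=> b0.
have b1 : 0 < bmp m 0 by rewrite bumpE (_ : sq 0 = 0) ?mulr0 ?subr0 ?flat1_gt0 // /sq /= expr0n addr0.
have cb : ccont (evc (ebump m EX EY)) by exact: ccont_evc.
have bb : bsupp m.+1%:R^-1 (evc (ebump m EX EY)).
 by move=> z /ltW h; rewrite /evc -/(bmp m z) bump_out.
have b2 : 0 < bmp m 0 / 2 by rewrite divr_gt0.
have [e e0 H] := disc_average 0 cb bb b2; have e2 := half_gt0 e0.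
have := H (e / 2) e2; rewrite ltr_pdivrMr // ltr_pMr // ltr1n=> /(_ isT).
have -> : cI (fun w => (disc (e / 2) (w - 0))%:C * evc (ebump m EX EY) w) = 0.
 apply/eqP; rewrite -normc_eq0 eq_le normc_ge0 andbT -lee_fin.
 have mk := cmfunM (cmfun_real (mcomp (meas_disc (e / 2)) (meas_shift (- 0)))) (ccont_cmfun cb).
 apply: le_trans (normc_cint_area mk) _.
 have ei : 0 <= ((e / 2) ^+ 2)^-1 by rewrite invr_ge0 sqr_ge0.
 apply: (le_via (aint (fun z => (((e / 2) ^+ 2)^-1)%:E * (bmp m z)%:E))%E); last first.
 rewrite area_intZ // ?bmassE -?b0 ?mule0 //; last by move=> z; rewrite lee_fin bump_ge0.
 by apply/mEFin; case: (rintgP (bmp m))=> h _; case: (h (rintg_bump m)).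
 apply: le_area_int=> z; first by rewrite lee_fin normc_ge0.
 rewrite -EFinM lee_fin normcM.
 rewrite !normc_real [X in _ * X]ger0_norm ?bump_ge0 //; apply: ler_wpM2r; first exact: bump_ge0.
 rewrite -[(disc _ \o _) z]/(disc (e / 2) (z - 0)) ger0_norm ?disc_ge0 // /disc.
 by case: ifP.
rewrite sub0r normcNE /evc -/(bmp m 0) normc_real gtr0_norm //.
by rewrite ler_pdivlMr // ger_pMr // => h; have : (2 : R) <= 1 by []; rewrite lern1.
Qed.
Definition erho m (A B : ex) : ex := EMul (EC (bmass m)^-1) (ebump m A B).
Definition rho m z : R := (bmass m)^-1 * bmp m z.
Definition rhoC m : plane -> C := evc (erho m EX EY).

Lemma rhoCE m z : rhoC m z = (rho m z)%:C. Proof. by []. Qed.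
Lemma rho_out m z : m.+1%:R^-1 <= `|z| -> rho m z = 0.
Proof. by move=> /bump_out h; rewrite /rho h mulr0. Qed.
Lemma concentrating_rho : concentrating rho.
Proof.
have b0 m : 0 <= (bmass m)^-1 by rewrite invr_ge0 ltW ?bmass_gt0.
have mb m : mfun (bmp m).
 by case: (rintgP (bmp m))=> h _; case: (h (rintg_bump m)).
split.
- by move=> m; apply: mfunM=> //; exact: mcst.
- by move=> m z; rewrite mulr_ge0 ?bump_ge0.
- move=> m; rewrite -(_ : aint (fun z => (bmass m)^-1%:E * (bmp m z)%:E)%E = 1%E) //.
 rewrite area_intZ ?bmassE -?EFinM ?mulVf ?gt_eqF ?bmass_gt0 //; first exact/mEFin.
 by move=> z; rewrite lee_fin bump_ge0.
- move=> r e r0 e0; have [N HN] := rate_small r0; exists N=> m /HN h.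
 rewrite (_ : (fun z => _) = fun=> 0%E); last first.
 by apply/funext=> z; case: ifP=> // rz; rewrite rho_out // (le_trans h).
 by rewrite area_intE integral0 mule0 lee_fin ltW.
Qed.
Lemma dz_rho_odd m z : dz (rhoC m) (- z) = - dz (rhoC m) z /\ dzb (rhoC m) (- z) = - dzb (rhoC m) z.
Proof.
have w1 u : wd (fun w : plane => (1 - m.+1%:R ^+ 2 * sq w)%:C) u (- (m.+1%:R ^+ 2) * (pt u)^*) (- (m.+1%:R ^+ 2) * pt u).
 apply: wd_ext (wdB (wd_cst u 1) (wdZ (m.+1%:R ^+ 2) (wd_sq u))); last 2 first.
 - by rewrite sub0r mulNr.
 - by rewrite sub0r mulNr.
 by move=> w; rewrite rmorphB rmorph1 rmorphM rmorphXn rmorph_nat.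
have w2 u := wdZ (bmass m)^-1%:C (wd_comp (is_derive_flat 1 _) (w1 u)).
have E : rhoC m = fun z => (bmass m)^-1%:C * (flat 1 (1 - m.+1%:R ^+ 2 * sq z))%:C.
 by apply/funext=> u; rewrite rhoCE /rho bumpE rmorphM.
have sN u : sq (- u) = sq u by rewrite /sq /= !sqrrN.
rewrite E !(wd_dz (w2 _)) !(wd_dzb (w2 _)) sN -[pt (- z)]/(- pt z) conjcN !mulrN //.
Qed.
Lemma conv_rhoE (f : plane -> C) m z : cmfun f ->
 conv f (rhoC m) z = cI (fun w => (rho m w)%:C * f (z - w)).
Proof.
move=> mf; have mr := ccont_cmfun (@ccont_evc (erho m EX EY)).
rewrite /conv -(cint_reflB z); first by apply: eq_cintT=> w; rewrite subKr rhoCE mulrC.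
by apply: cmfunM=> //; exact: (cmfun_comp (meas_reflB z) mr).
Qed.
Lemma conv_rho_cvg (p : R) (f : plane -> C) : 1 < p -> in_LpC p f ->
 cvgLp p (fun m => conv f (rhoC m)) f.
Proof.
move=> p1 Lf e e0; have [mf fl] := Lf.
have ik m z : cintg (fun w => (rho m w)%:C * f (z - w)).
 have bm : bsupp m.+1%:R^-1 (rhoC m) by move=> u /ltW h; rewrite rhoCE rho_out.
 have [K [_ /(_ (fun w => f (z - w)))]] := Lp_pairing p1 (@ccont_evc _ : ccont (rhoC m)) bm.
 have mfz : cmfun (fun w : plane => f (z - w)) := cmfun_comp (meas_reflB z) mf.
 case; last by move=> h _; have := h; congr cintg; apply/funext=> w; rewrite mulrC.
 split; [exact: mfz|rewrite norm_LpCE; apply: poweR_lty]; rewrite /powint area_intE.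
 have m1 : mfun (fun w => (normc (f w) `^ p)%:E).
 by exact: meas_powE.
 rewrite (ge0_integral_reflB z m1); last by move=> w; rewrite lee_fin powR_ge0.
 rewrite -area_intE -/(powint p f) powint_norm ?(lt_trans ltr01) //; exact: poweR_lty.
have [N HN] := norm_LpC_mollify p1 concentrating_rho mf fl ik e0; exists N=> m Nm.
rewrite (_ : (fun z => _) = fun z => cI (fun w => (rho m w)%:C * f (z - w)) - f z); first exact: HN.
by apply/funext=> z; rewrite conv_rhoE.
Qed.
Definition mv (A : ex) (x : R) : ex := EAdd A (EC (- x)).
Definition erhoz m z : ex := erho m (mv EX z.1) (mv EY z.2).

Lemma erhozE m z w : evc (erhoz m z) w = rhoC m (z - w).
Proof.
have sB : sq (w - z) = sq (z - w) by rewrite /sq /= -sqrrN opprB -[(w.2 - _) ^+ 2]sqrrN opprB.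
have -> : evc (erhoz m z) w = rhoC m (w - z) by [].
by rewrite !rhoCE /rho !bumpE sB.
Qed.
Lemma dz_erhoz m z w : dz (evc (erhoz m z)) w = - dz (rhoC m) (z - w) /\ dzb (evc (erhoz m z)) w = - dzb (rhoC m) (z - w).
Proof.
have C1 : Ck 1 (rhoC m) by exact: Ck_evc.
have [d1 d2] := dz_shift (- z) C1; have E : evc (erhoz m z) = fun w => rhoC m (w + - z) by [].
have [h1 h2] := dz_rho_odd m (z - w); rewrite opprB in h1; rewrite opprB in h2.
by rewrite E d1 d2; split; [exact: h1|exact: h2].
Qed.

End mollifier.

(** * Approximation of W by smooth compactly supported functions *)

Section approximation.
Implicit Types (z w : plane) (n m : nat) (D : (plane -> C) -> plane -> C) (T theta psi : plane -> C).
Variables (p : R) (a : plane -> C).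
Hypothesis p1 : 1 < p.
Hypothesis ma : cmfun a.
Hypothesis aoo : (nLp p a < +oo)%E.
Hypothesis a0 : forall w, w.2 <= 0 -> a w = 0.
Local Notation W := (potW a).
Let mpot := cmfun_potentials ma.

Definition up T : plane -> C := fun z => if 0 < z.2 then T z else 0.

Lemma cmfun_up T : cmfun T -> cmfun (up T).
Proof.
move=> mT; apply: cmfun_ifb; [|exact: mT|split; exact: mcst].
by apply: measurable_fun_ltr; [exact: mcst|exact: msnd].
Qed.
Lemma normc_up T z : normc (up T z) = if 0 < z.2 then normc (T z) else 0.
Proof. by rewrite /up; case: ifP=> // _; rewrite normc0. Qed.
Lemma Lp_hT T c : cmfun T -> 0 <= c -> (forall z, 0 < z.2 -> ((normc (T z))%:E <= c%:E * hT a z)%E) -> in_LpC p (up T).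
Proof.
move=> mT c0 H; have [s [s0 Hs]] := schur_norm p1; split; first exact: cmfun_up.
apply: (@le_lt_trans _ _ ((c * s)%:E * nLp p a)%E).
 apply: Hs=> [//|//|z]; rewrite normc_up; case: ifP=> [/H //|_].
 by rewrite mule_ge0 ?lee_fin ?hT_ge0.
by apply: lte_mul_pinfty; [rewrite lee_fin mulr_ge0 // ltW| |exact: aoo].
Qed.
Definition W0 z : C := (z.2^-1)%:C * W z.

Lemma Lp_W0 : in_LpC p (up W0).
Proof.
have [_ _ mW _] := mpot; apply: (@Lp_hT _ 5)=> //.
 by apply: cmfunM=> //; apply/cmfun_real/meas_inv; exact: msnd.
move=> z z0; rewrite /W0 normcM normc_real gtr0_norm ?invr_gt0 // EFinM.
have h : ((normc (W z))%:E <= (5 * `|z.2|)%:E * hT a z)%E.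
 apply: (pot_le ma a0 (k := Wk)); [exact: (cmfun_comp (measurable_pair1 z) cmfun_Wk)|by rewrite mulr_ge0|].
 by move=> w wz w0; apply: normc_Wk=> //; rewrite eq_sym.
have zi : (0 <= (z.2^-1)%:E)%E by rewrite lee_fin invr_ge0 ltW.
apply: le_trans (lee_wpmul2l zi h) _; rewrite muleA -EFinM gtr0_norm // mulrCA mulVf ?mulr1 //.
by rewrite gt_eqF.
Qed.
Lemma Lp_G : in_LpC p (up (potG a)).
Proof.
have [mv1 mv2 _ _] := mpot.
have Lv : in_LpC p (up (potv a)).
 apply: (Lp_hT (c := 1))=> // z z0; apply: (pot_le ma a0 (k := kap))=> //.
 exact: (cmfun_comp (measurable_pair1 z) cmfun_kap).
 by move=> w wz w0; rewrite mulr1 normc_kap // eq_sym.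
have Lv' : in_LpC p (up (potvJ a)).
 apply: (Lp_hT (c := 1))=> // z z0; apply: (pot_le ma a0 (k := fun z w => (kap z w)^*))=> //.
 by apply: cmfunJ; exact: (cmfun_comp (measurable_pair1 z) cmfun_kap).
 by move=> w wz w0; rewrite mulr1 normc_conj normc_kap // eq_sym.
have La : in_LpC p a by split; [exact: ma|exact: aoo].
have Ls := Lp_comb p1 Lv Lv' ler01 ler01.
have [_ _ _ mG] := mpot.
apply: (Lp_dom p1 La Ls ler01 ler01 (cmfun_up mG))=> z; rewrite normc_real !mul1r !normc_up.
case: ifP=> z0; last by rewrite addr_ge0 ?normc_ge0.
rewrite ger0_norm ?addr_ge0 ?normc_ge0 //; apply: normcD_le; rewrite lerD2l.
rewrite normcM normc_half; apply: le_trans (normcD _ _).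
by rewrite ler_piMl ?normc_ge0 // invf_le1 // ler1n.
Qed.
Lemma Ck_hc k n : Ck k (@hc n).
Proof.
have -> : @hc n = fun z => evc (EFlat (1 + 'X) (EAdd (EMul (EC n.+1%:R) EY) (EC (-1)))) z * chi n z by [].
by apply: CkM; [exact: Ck_evc|exact: Ck_chi].
Qed.

(* The cutoff [hc n] is [y] times a smooth function: this is how it enters a test function. *)
Definition ecut n m z : ex :=
 EMul (EMul (EFlat 'X (EAdd (EMul (EC n.+1%:R) EY) (EC (-1)))) (EC n.+1%:R))
 (EMul (EMul (EC (expR 1)) (EFlat 1 (EAdd (EC 1) (EMul (EC (- (n.+1%:R ^+ 2)^-1)) (esq EX EY)))))
 (erhoz m z)).

Lemma ecutE n m z w : imc w * evc (ecut n m z) w = hc n w * rhoC m (z - w).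
Proof.
rewrite -(erhozE m z w) /hc /chi /cut /sq /evc /imc /=.
rewrite -!rmorphM /=; congr (_ %:C)%C; rewrite -!expr2.
have -> : 1 + - n.+1%:R ^- 2 * (w.1 ^+ 2 + w.2 ^+ 2) = 1 - (w.1 ^+ 2 + w.2 ^+ 2) / n.+1%:R ^+ 2 by ring.
have -> : hy n w.2 = w.2 * (flat 'X (n.+1%:R * w.2 - 1) * n.+1%:R).
 rewrite /hy /flat; case: ifP=> x0; last by rewrite mul0r mulr0.
 have -> : w.2 * ('X.[(n.+1%:R * w.2 - 1)^-1] * expR (- (n.+1%:R * w.2 - 1)^-1) * n.+1%:R) =
 (n.+1%:R * w.2 - 1 + 1) * (n.+1%:R * w.2 - 1)^-1 * expR (- (n.+1%:R * w.2 - 1)^-1) by rewrite hornerX subrK; ring.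
 by rewrite hornerD hornerC hornerX; congr (_ * _); rewrite mulrDl mul1r mulfV // gt_eqF.
ring.
Qed.
Definition good d r phi : Prop := [/\ 0 < d, bsupp r phi & forall z, z.2 <= d -> phi z = 0].

Lemma good_ecut n m z : good n.+1%:R^-1 n.+1%:R (evc (ecut n m z)).
Proof.
have h1 w : (evc (ecut n m z) w) = (flat 'X (n.+1%:R * w.2 - 1) * n.+1%:R)%:C * (chi n w * rhoC m (z - w)).
 rewrite -(erhozE m z w) /chi /cut /sq /evc /= -!rmorphM /= -!expr2; congr (_ * (_ * flat 1 _ * _))%:C.
 by ring.
split; first by rewrite invr_gt0.
- by move=> w wn; rewrite h1 bsupp_chi // mul0r mulr0.
- move=> w wd; rewrite h1 flat_le0 ?mul0r ?mul0r //.
 by rewrite subr_le0 mulrC -ler_pdivlMr // mul1r.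
Qed.
(** The weak equation D W = T, tested against y times an expression. Unwinding [ddown] on a test
    function phi produces precisely the function y phi, so every representing function satisfies
    this form. *)
Definition wk D T := forall (e : ex) d r, good d r (evc e) ->
 cI (fun z => W z * D (fun z => imc z * evc e z) z) = - cI (fun z => T z * (imc z * evc e z)).

Lemma wk_G : wk (@dzb) (up (potG a)).
Proof.
move=> e d r [d0 br z0]; have Ce : Ck 1 (evc e) by exact: Ck_evc.
have bi : bsupp r (fun z => imc z * evc e z) by move=> z /br ->; rewrite mulr0.
have vi : exists2 d, 0 < d & forall z, z.2 <= d -> imc z * evc e z = 0.
 by exists d=> // z /z0 ->; rewrite mulr0.
have [_ ->] := weak_dzb p1 ma aoo a0 (CkM (Ck_imc 1) Ce) bi vi.
congr (- _); apply: eq_cintT=> z; rewrite /up; case: ltP=> // h.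
by rewrite z0 ?mulr0 // (le_trans h) // ltW.
Qed.
(** The Leibniz formula for D of the product of the cutoff and W, with T in the place of D W. *)
Definition Yn D n T z : C := hc n z * T z + W z * D (hc n) z.

Section direction.
Variables (D : (plane -> C) -> plane -> C) (T : plane -> C).
Hypothesis Ddz : D = @dz R \/ D = @dzb.
Hypothesis LT : in_LpC p T.
Hypothesis T0 : forall z, z.2 <= 0 -> T z = 0.

Let mW : cmfun W. Proof. by case: mpot. Qed.
Lemma Ck_D k F : Ck k.+1 F -> Ck k (D F).
Proof. by move=> CF; case: Ddz=> ->; [exact: Ck_dz|exact: Ck_dzb]. Qed.
Lemma D_hc n z : (n.+1%:R * z.2 <= 1 \/ n.+1%:R < `|z|) -> hc n z = 0 /\ D (hc n) z = 0.
Proof. by move=> /hc_out[h1 h2 h3]; case: Ddz=> ->. Qed.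
Lemma hc_low n z : z.2 <= 0 -> hc n z = 0 /\ D (hc n) z = 0.
Proof. by move=> z0; apply: D_hc; left; rewrite (le_trans _ ler01) // pmulr_rle0. Qed.
Lemma WE z : 0 < z.2 -> W z = imc z * up W0 z.
Proof. by move=> z0; rewrite /up z0 /W0 mulrA -rmorphM /= mulfV ?mul1r // gt_eqF. Qed.
Lemma Yn_bound : exists c, 0 <= c /\ forall n z,
 normc (Yn D n T z - T z) <= 2 * normc (T z) + c * normc (up W0 z).
Proof.
have [c [c0 Hc]] := @hc_bound; exists c; split=> // n z.
have [z0|z0] := ltP 0 z.2; last first.
 have [h1 h2] := hc_low n z0; rewrite /Yn h1 h2 T0 // !(mulr0, mul0r) addr0 subr0 normc0.
 by rewrite mulr0 add0r mulr_ge0 ?normc_ge0.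
have -> : Yn D n T z - T z = (hc n z - 1) * T z + W z * D (hc n) z by rewrite /Yn; ring.
apply: normcD_le; rewrite !normcM; apply: lerD.
 apply: ler_wpM2r; first exact: normc_ge0.
 apply: normcD_le; rewrite normcNE -[leRHS]/(1 + 1); apply: lerD; first exact: normc_hc.
 by rewrite -[1]/((1 : R)%:C) normc_real normr1.
rewrite (WE z0) normcM normc_real gtr0_norm // -mulrA mulrCA [leRHS]mulrC.
apply: ler_wpM2l; first exact: normc_ge0.
by case: (Hc n z z0)=> h1 h2; case: Ddz=> ->.
Qed.
Lemma cmfun_Yn n : cmfun (Yn D n T).
Proof.
have mh := ccont_cmfun (Ck_cont (Ck_hc 0 n)); have mD := ccont_cmfun (Ck_cont (Ck_D (Ck_hc 1 n))).
by case: LT=> mT _; exact: cmfunD (cmfunM mh mT) (cmfunM mW mD).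
Qed.
(** W is y times a function of L^p, and y |D (hc n)| is bounded and tends to 0 pointwise: the
    commutator term disappears by domination. *)
Lemma Yn_cvg : cvgLp p (fun n => Yn D n T) T.
Proof.
have [c [c0 Hc]] := Yn_bound; case: (LT)=> mT _.
apply: (cvgLp_dom p1 LT Lp_W0 _ c0 mT cmfun_Yn Hc)=> // z e e0.
have [z0|z0] := ltP 0 z.2; last first.
 exists 0%N=> n _; have [h1 h2] := hc_low n z0.
 by rewrite /Yn h1 h2 T0 // !(mulr0, mul0r) addr0 subr0 normc0 ltW.
have K0 : 0 < normc (T z) + normc (up W0 z) + 1 by rewrite ltr_wpDl // addr_ge0 ?normc_ge0.
have [N HN] := hc_lim z0 (divr_gt0 e0 K0); exists N=> n /HN [h1 h23].
have h2 : z.2 * normc (D (hc n) z) <= e / (normc (T z) + normc (up W0 z) + 1).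
 by case: h23=> ? ?; case: Ddz=> ->.
have -> : Yn D n T z - T z = (hc n z - 1) * T z + W z * D (hc n) z by rewrite /Yn; ring.
apply: normcD_le; rewrite !normcM (WE z0) normcM normc_real gtr0_norm //.
set q := e / _ in h1 h2 *; have q0 : 0 < q by rewrite divr_gt0.
have -> : e = q * normc (T z) + q * normc (up W0 z) + q by rewrite -mulrDr -{2}[q]mulr1 -mulrDr mulfVK // gt_eqF.
rewrite -addrA; apply: lerD; first by apply: ler_wpM2r; rewrite ?normc_ge0.
rewrite ler_wpDr ?(ltW q0) // mulrAC; apply: ler_wpM2r=> //; exact: normc_ge0.
Qed.
Lemma Lp_Yn n : in_LpC p (Yn D n T).
Proof.
have [c [c0 Hc]] := Yn_bound.
have L1 := Lp_comb p1 LT Lp_W0 (ler0n _ 2) c0.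
apply: (Lp_dom p1 LT L1 ler01 ler01 (cmfun_Yn n))=> z; rewrite !mul1r addrC.
have -> : Yn D n T z = (Yn D n T z - T z) + T z by rewrite subrK.
apply: normcD_le; rewrite lerD2r; apply: (le_trans (Hc n z)).
by rewrite normc_real ler_norm.
Qed.
Lemma Ln_supp n : cintg (fun z => hc n z * W z) /\ bsupp n.+1%:R (fun z => hc n z * W z).
Proof.
split; last by move=> z h; have [-> _] := D_hc (or_intror h); rewrite mul0r.
have bh : bsupp n.+1%:R (@hc n) by move=> z h; have [-> _] := D_hc (or_intror h).
have [i _ _] := W_fubini p1 ma aoo a0 (Ck_cont (Ck_hc 0 n)) bh (fun z h => (hc_low n h).1).
by have := i; congr cintg; apply/funext=> z; rewrite mulrC.
Qed.
(** At each z this is the weak equation tested against the cutoff times the mollifier centred at z,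
    which [ecutE] writes as y times an expression. *)
Lemma D_conv n m : wk D T -> D (conv (fun z => hc n z * W z) (rhoC m)) = conv (Yn D n T) (rhoC m).
Proof.
move=> wT; apply/funext=> z; have [iL bL] := Ln_supp n.
have Cr k : Ck k (@rhoC m) by exact: Ck_evc.
have -> : D (conv (fun z => hc n z * W z) (rhoC m)) z = conv (fun z => hc n z * W z) (D (rhoC m)) z.
 by have [_ [e1 e2]] := Ck_conv iL bL 0 Cr; case: Ddz=> ->; rewrite ?e1 ?e2.
pose Kz := evc (erhoz m z); have CK k : Ck k Kz by exact: Ck_evc.
have DK w : D (rhoC m) (z - w) = - D Kz w.
 by have [h1 h2] := dz_erhoz m z w; case: Ddz=> ->; rewrite ?h1 ?h2 opprK.
have ge := good_ecut n m z; have [d0 bp p0'] := ge.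
have E : (fun w => imc w * evc (ecut n m z) w) = fun w => hc n w * Kz w.
 by apply/funext=> w; rewrite ecutE -erhozE.
have := wT _ _ _ ge; rewrite E.
have -> : D (fun w => hc n w * Kz w) = fun w => hc n w * D Kz w + D (hc n) w * Kz w.
 by have [h1 h2] := dzM (Ck_hc 1 n) (CK 1%N); case: Ddz=> ->.
have bh : bsupp n.+1%:R (@hc n) by move=> w h; have [-> _] := D_hc (or_intror h).
have bD : bsupp n.+1%:R (D (@hc n)) by move=> w h; have [_ ->] := D_hc (or_intror h).
have W_int th : ccont th -> bsupp n.+1%:R th -> (forall w, w.2 <= 0 -> th w = 0) -> cintg (fun w => W w * th w).
 by move=> ct bt t0; have [] := W_fubini p1 ma aoo a0 ct bt t0.
have i1 : cintg (fun w => W w * (hc n w * D Kz w)).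
 apply: W_int; first exact: ccontM (Ck_cont (Ck_hc 0 n)) (Ck_cont (Ck_D (CK 1%N))).
 by move=> w /bh ->; rewrite mul0r.
 by move=> w h; have [-> _] := hc_low n h; rewrite mul0r.
have i2 : cintg (fun w => W w * (D (hc n) w * Kz w)).
 apply: W_int; first exact: ccontM (Ck_cont (Ck_D (Ck_hc 1 n))) (Ck_cont (CK 0%N)).
 by move=> w /bD ->; rewrite mul0r.
 by move=> w h; have [_ ->] := hc_low n h; rewrite mul0r.
have i3 : cintg (fun w => T w * (hc n w * Kz w)).
 have [K [_ HK]] := Lp_pairing p1 (ccontM (Ck_cont (Ck_hc 0 n)) (Ck_cont (CK 0%N)))
 (fun w h => etrans (congr1 (fun c => c * Kz w) (bh w h)) (mul0r _)).
 by case: (HK T LT).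
rewrite (eq_cintT (g := fun w => W w * (hc n w * D Kz w) + W w * (D (hc n) w * Kz w))); last first.
 by move=> w; rewrite mulrDr.
rewrite (cintD i1 i2)=> e1.
rewrite /conv (eq_cintT (g := fun w => - (W w * (hc n w * D Kz w)))); last by move=> w; rewrite DK; ring.
rewrite (cintN i1) [RHS](eq_cintT (g := fun w => T w * (hc n w * Kz w) + W w * (D (hc n) w * Kz w))); last first.
 by move=> w; rewrite /Yn -erhozE -/(Kz w); ring.
have eT : cI (fun w => T w * (imc w * evc (ecut n m z) w)) = cI (fun w => T w * (hc n w * Kz w)).
 by apply: eq_cintT=> w; rewrite -[hc n w * Kz w](congr1 (fun h => h w) E).
rewrite (cintD i3 i2) -[cI (fun w => T w * (hc n w * Kz w))]opprK -eT -e1.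
by rewrite opprD addrNK.
Qed.

End direction.

Lemma Lp_cutW n : in_LpC p (fun z => hc n z * W z).
Proof.
have [_ _ mW _] := mpot.
apply: (Lp_dom p1 Lp_W0 Lp_W0 (ler0n _ n.+1) (lexx _)).
 by apply: cmfunM; [|exact: mW]; exact: ccont_cmfun (Ck_cont (Ck_hc 0 n)).
move=> z; rewrite mul0r addr0 normcM.
have hd := or_introl erefl : @dz R = @dz R \/ @dz R = @dzb.
have [z0|z0] := ltP 0 z.2; last by have [-> _] := hc_low hd n z0; rewrite normc0 mul0r mulr_ge0 ?normc_ge0.
have [zn|zn] := leP `|z| n.+1%:R; last first.
 by have [-> _] := D_hc hd (or_intror zn); rewrite normc0 mul0r mulr_ge0 ?normc_ge0.
rewrite (WE z0) [normc (imc z * _)]normcM normc_real gtr0_norm //.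
apply: (le_via (1 * (z.2 * normc (up W0 z)))).
 by apply: ler_pM; [exact: normc_ge0|apply: mulr_ge0; [exact: ltW|exact: normc_ge0]|exact: normc_hc|exact: lexx].
rewrite mul1r; apply: ler_wpM2r; first exact: normc_ge0.
by apply: le_trans zn; rewrite norm_planeE le_max ler_norm orbT.
Qed.
(** Two candidates T are carried along, so that two representing functions can be compared through
    one sequence. The mollification index M n is chosen after the cutoff index n and exceeds it: the
    cut function lives in Im z > 1 / (n + 1) and the mollifier has radius at most 1 / (n + 2), so a
    strip above the real line stays free. *)
Lemma approx (T : bool -> plane -> C) : (forall i, in_LpC p (T i)) -> (forall i z, z.2 <= 0 -> T i z = 0) ->
 exists w : nat -> plane -> C, [/\ forall n k, Ck k (w n), forall n, bsupp n.+2%:R (w n),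
 forall n, exists2 d, 0 < d & forall z, z.2 <= d -> w n z = 0,
 cvgLp p (fun n => dzb (w n)) (up (potG a)) /\ (forall i, wk (@dz R) (T i) -> cvgLp p (fun n => dz (w n)) (T i)) &
 forall theta r, ccont theta -> bsupp r theta -> (forall z, z.2 <= 0 -> theta z = 0) -> forall e, 0 < e ->
 evt n, normc (cI (fun z => w n z * theta z) - cI (fun z => W z * theta z)) <= e].
Proof.
move=> LT T0; have G0 z : z.2 <= 0 -> up (potG a) z = 0 by move=> h; rewrite /up ltNge h.
have hdz := or_introl erefl : @dz R = @dz R \/ @dz R = @dzb.
have hdb := or_intror erefl : @dzb = @dz R \/ @dzb = @dzb.
pose Z n z := hc n z * W z.
have /choice[M HM] n : exists m, (n < m)%N /\ forall (f : plane -> C),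
 f = Yn (@dzb) n (up (potG a)) \/ (exists i, f = Yn (@dz R) n (T i)) \/ f = Z n ->
 (nLp p (fun z => (conv f (rhoC m) z - f z)%R) <= (rate n)%:num%:E)%E.
 have d0 : 0 < (rate n)%:num :> R by [].
 have [N1 H1] := conv_rho_cvg p1 (Lp_Yn hdb Lp_G G0 n) d0.
 have [N2 H2] := conv_rho_cvg p1 (Lp_Yn hdz (LT true) (T0 true) n) d0.
 have [N3 H3] := conv_rho_cvg p1 (Lp_Yn hdz (LT false) (T0 false) n) d0.
 have [N4 H4] := conv_rho_cvg p1 (Lp_cutW n) d0.
 exists (n.+1 + (N1 + (N2 + (N3 + N4))))%N; split; first exact: leq_addr.
 move=> f [->|[[[] ->]|->]]; [apply: H1|apply: H2|apply: H3|apply: H4].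
 - by rewrite addnCA leq_addr.
 - by rewrite (addnCA N1) addnCA leq_addr.
 - by rewrite (addnCA N2) (addnCA N1) addnCA leq_addr.
 - by rewrite !addnA leq_addl.
pose w n := conv (Z n) (rhoC (M n)).
have [iZ bZ] : (forall n, cintg (Z n)) /\ (forall n, bsupp n.+1%:R (Z n)).
 by split=> n; have [] := Ln_supp hdz n.
have Cr m k : Ck k (@rhoC m) by exact: Ck_evc.
have Cw n k : Ck k (w n) by have [] := Ck_conv (iZ n) (bZ n) k (Cr (M n)).
have Mn n : (M n).+1%:R^-1 <= n.+2%:R^-1 :> R by rewrite lef_pV2 ?posrE // ler_nat ltnS; case: (HM n).
have w0 n z : (forall u, Z n u != 0 -> n.+2%:R^-1 <= `|z - u|) -> w n z = 0.
 move=> H; rewrite /w /conv -[RHS]cint0; apply: eq_cintT=> u.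
 have [->|/H h] := eqVneq (Z n u) 0; first by rewrite mul0r.
 by rewrite rhoCE rho_out ?mulr0 // (le_trans (Mn n)).
exists w; split=> //.
- move=> n z zn; apply: w0=> u Zu; have un : `|u| <= n.+1%:R.
 by rewrite leNgt; apply/negP=> /bZ h; rewrite h eqxx in Zu.
 apply: (le_via 1); first by rewrite invf_le1 // ler1n.
 have := ler_distD u z 0; rewrite !subr0=> h; rewrite -(lerD2r `|u|); apply: le_trans h.
 by apply: le_trans (ltW zn); rewrite -[n.+2]add1n natrD lerD2l.
- move=> n; exists (n.+1%:R^-1 - n.+2%:R^-1); first by rewrite subr_gt0 ltf_pV2 ?posrE // ltr_nat.
 move=> z zd; apply: w0=> u Zu; have un : 1 < n.+1%:R * u.2.
 by rewrite ltNge; apply/negP=> /(fun h => D_hc hdz (or_introl h))[h _]; rewrite /Z h mul0r eqxx in Zu.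
 have u1 : n.+1%:R^-1 < u.2 by rewrite -[ltLHS]mul1r ltr_pdivrMr // mulrC.
 apply: (le_via `|z.2 - u.2|); last by rewrite norm_planeE le_max lexx orbT.
 by rewrite distrC; apply: le_trans (ler_norm _); rewrite lerBrDr; apply: le_trans (ltW u1); rewrite addrC -lerBrDr.
- have md (F : plane -> C) : Ck 0 F -> cmfun F by move=> /Ck_cont/ccont_cmfun.
 have cv D U : (D = @dz R \/ D = @dzb) -> in_LpC p U -> (forall z, z.2 <= 0 -> U z = 0) -> wk D U ->
 (forall n, (nLp p (fun z => (conv (Yn D n U) (rhoC (M n)) z - Yn D n U z)%R) <= (rate n)%:num%:E)%E) ->
 cvgLp p (fun n => D (w n)) U.
 move=> hD LU U0 wU H; apply: (cvgLp_trans p1 _ _ _ _ (Yn_cvg hD LU U0)).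
 - by move=> n; apply: md; exact: Ck_D hD _ _ (Cw n 1%N).
 - by move=> n; exact: cmfun_Yn.
 - by case: LU.
 - move=> n; rewrite /w (D_conv hD LU n (M n) wU); exact: H.
 split; first by exact: (cv _ _ hdb Lp_G G0 wk_G (fun n => (HM n).2 _ (or_introl erefl))).
 by move=> i wi; exact: (cv _ _ hdz (LT i) (T0 i) wi (fun n => (HM n).2 _ (or_intror (or_introl (ex_intro _ i erefl))))).
move=> theta r ct bt t0 e e0; have e2 := half_gt0 e0.
have [K [K0 HK]] := Lp_pairing p1 ct bt; have K1 : 0 < K + 1 by lra.
have [N1 H1] := rate_small (divr_gt0 e2 K1).
have [iW _ _] := W_fubini p1 ma aoo a0 ct bt t0.
have iZt n : cintg (fun z => Z n z * theta z) by case: (HK _ (Lp_cutW n)).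
have [N2 H2] : evt n, normc (cI (fun z => Z n z * theta z) - cI (fun z => W z * theta z)) <= e / 2.
 have ig := rintgZ 2 (rintg_normc iW).
 have E n z : Z n z * theta z - W z * theta z = (hc n z - 1) * (W z * theta z) by rewrite /Z; ring.
 apply: (cint_cvg iZt iW ig _ _ e2); apply: aeW=> z /=; [move=> n|move=> d d0].
 rewrite E normcM; apply: ler_wpM2r; first exact: normc_ge0.
 apply: normcD_le; rewrite normcNE -[leRHS]/(1 + 1); apply: lerD; first exact: normc_hc.
 by rewrite -[1]/((1 : R)%:C) normc_real normr1.
 have [z0|z0] := ltP 0 z.2; last by exists 0%N=> n _; rewrite t0 // !mulr0 subr0 normc0 ltW.
 have k0 : 0 < normc (W z * theta z) + 1 by rewrite ltr_wpDl ?normc_ge0.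
 have [N HN] := hc_lim z0 (divr_gt0 d0 k0); exists N=> n /HN[h _]; rewrite E normcM.
 apply: (le_via (d / (normc (W z * theta z) + 1) * (normc (W z * theta z) + 1))).
 by apply: ler_pM; rewrite ?normc_ge0 // lerDl.
 by rewrite mulfVK // gt_eqF.
exists (maxn N1 N2)=> n; rewrite geq_max=> /andP[n1 n2].
have dif : (nLp p (fun z => (w n z - Z n z)%R) <= (rate n)%:num%:E)%E by apply: (HM n).2; right; right.
have mw : cmfun (w n) := ccont_cmfun (Ck_cont (Cw n 0%N)).
have Ld : in_LpC p (fun z => w n z - Z n z).
 by split; [exact: cmfunB mw (Lp_cutW n).1|exact: le_lt_trans dif (ltry _)].
have [id_ bd] := HK _ Ld.
have -> : cI (fun z => w n z * theta z) = cI (fun z => (w n z - Z n z) * theta z) + cI (fun z => Z n z * theta z).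
 by rewrite -(cintD id_ (iZt n)); apply: eq_cintT=> z; rewrite -mulrDl subrK.
rewrite -addrA; apply: normcD_le; rewrite [e]splitr; apply: lerD (H2 n n2).
rewrite -lee_fin; apply: (le_trans bd); apply: (le_via (K%:E * (rate n)%:num%:E)%E).
 by apply: lee_wpmul2l=> //; rewrite lee_fin.
rewrite -EFinM lee_fin; apply: (le_via (K * (e / 2 / (K + 1)))); first by apply: ler_wpM2l=> //; exact: H1.
by rewrite mulrA ler_pdivrMr // mulrC ler_pM2l // lerDl.
Qed.
End approximation.

(** * Norm comparison for the weak derivatives of W *)

Section weak_derivative_norms.
Implicit Types (z w : plane) (n : nat) (F T psi : plane -> C).

Lemma dzB F G : Ck 1 F -> Ck 1 G -> dz (fun z => F z - G z) = (fun z => dz F z - dz G z) /\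
 dzb (fun z => F z - G z) = (fun z => dzb F z - dzb G z).
Proof.
by move=> CF CG; split; apply/funext=> z; have h := wdB (Ck_wd z CF) (Ck_wd z CG);
 rewrite ?(wd_dz h) ?(wd_dzb h).
Qed.
Lemma CkB n F G : Ck n F -> Ck n G -> Ck n (fun z => F z - G z).
Proof.
move=> CF /(CkZ (-1))/(CkD CF); congr (Ck n); apply/funext=> z; by rewrite mulN1r.
Qed.
(** Conjugation exchanges [dz] and [dzb] and preserves norms, so the reverse inequality has the same
    constant. *)
Lemma dzb_le_beurling (p b r : R) F : 0 < p -> (beurling_norm p <= b%:E)%E -> Ck 2 F -> bsupp r F ->
 (nLp p (dzb F) <= b%:E * nLp p (dz F))%E.
Proof.
move=> p0 pb CF bF; have bJ : bsupp r (fun z => (F z)^*) by move=> z /bF ->; rewrite conjc0.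
have := dz_le_beurling p0 pb (CkJ CF) bJ; have [-> ->] := dzJ (CkS CF).
by rewrite !(@eq_norm_LpC p (fun z => (_ z)^*) _ (fun z => normc_conj _)).
Qed.
Definition zero_low psi := exists2 d, 0 < d & forall z, z.2 <= d -> psi z = 0 :> C.

Section fixed_exponent.
Variable p : R.
Hypothesis p1 : 1 < p.

Lemma cvgLp_compare (u v : nat -> plane -> C) f g b : 0 <= b -> (forall n, cmfun (u n)) -> (forall n, cmfun (v n)) ->
 cmfun f -> cmfun g -> cvgLp p u f -> cvgLp p v g ->
 (forall n, (nLp p (u n) <= b%:E * nLp p (v n))%E) -> (nLp p f <= b%:E * nLp p g)%E.
Proof.
move=> b0 mu_ mv mf mg uf vg H; apply: (cvgLp_norm p1 mu_ mf uf)=> e e0.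
have b1 : 0 < b + 1 by rewrite ltr_wpDl.
have [N HN] := vg _ (divr_gt0 e0 b1); exists N=> n nN; apply: (le_trans (H n)).
apply: (le_via (b%:E * (nLp p g + (e / (b + 1))%:E))%E); last first.
 rewrite ge0_muleDr ?norm_LpC_ge0 ?lee_fin ?divr_ge0 ?(ltW e0) ?(ltW b1) //; apply: leeD; first exact: lexx.
 by rewrite -EFinM lee_fin mulrCA ler_piMr ?(ltW e0) // ler_pdivrMr // mul1r lerDl.
apply: lee_wpmul2l; first by rewrite lee_fin.
have -> : v n = fun z => g z + (v n z - g z) by apply/funext=> z; rewrite addrC subrK.
apply: le_trans (norm_LpCD (ltW p1) mg (cmfunB (mv n) mg)) _; apply: leeD; [exact: lexx|exact: HN].
Qed.

Section fixed_density.
Variable a : plane -> C.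
Hypothesis ma : cmfun a.
Hypothesis aoo : (nLp p a < +oo)%E.
Hypothesis a0 : forall w, w.2 <= 0 -> a w = 0.
Local Notation W := (potW a).
Local Notation G := (up (potG a)).

Let LG : in_LpC p G. Proof. exact: Lp_G. Qed.
Let p0 : 0 < p := lt_trans ltr01 p1.

Let Ck_cmfun n F : Ck n F -> cmfun F. Proof. by move=> /Ck_cont/ccont_cmfun. Qed.
(** The weak equation against all C^1 functions supported away from the real line; it is what the
    limit function is shown to satisfy, and what makes it a representing function. *)
Definition weak_of T := forall psi r, Ck 1 psi -> bsupp r psi -> zero_low psi ->
 cI (fun z => W z * dz psi z) = - cI (fun z => T z * psi z).

Let zero_Lp (i : bool) : in_LpC p (fun _ : plane => 0 : C).
Proof. by split; [exact: cmfun_cst|rewrite norm_LpC0]. Qed.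
(** [dz (w n)] inherits the Cauchy property from [dzb (w n)] through the Beurling bound; its limit,
    set to 0 outside the upper half plane, is the derivative sought. *)
Lemma exists_weak b : (beurling_norm p <= b%:E)%E ->
 exists k, [/\ in_LpC p k, forall z, z.2 <= 0 -> k z = 0, (nLp p k <= b%:E * nLp p G)%E & weak_of k].
Proof.
move=> pb; have b0 : 0 < b by have := lt_le_trans (beurling_norm_gt0 p1) pb; rewrite lte_fin.
have [w [Cw bw w0 [cb _] cw]] := approx p1 ma aoo a0 zero_Lp (fun _ _ _ => erefl).
have mu_ n : cmfun (dz (w n)) by exact: Ck_cmfun (Ck_dz (Cw n 1%N)).
have mv n : cmfun (dzb (w n)) by exact: Ck_cmfun (Ck_dzb (Cw n 1%N)).
have [|k [mk ck]] := norm_LpC_complete (ltW p1) mu_.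
 move=> e e0; have eb : 0 < e / b / 2 by rewrite !divr_gt0.
 have [N HN] := cb _ eb; exists N=> n m nN mN.
 have bB : bsupp (Num.max n.+2%:R m.+2%:R) (fun z => w n z - w m z).
 by move=> z; rewrite gt_max=> /andP[/bw -> /bw ->]; rewrite subr0.
 have := dz_le_beurling p0 pb (CkB (Cw n 2%N) (Cw m 2%N)) bB; have [-> ->] := dzB (Cw n 1%N) (Cw m 1%N).
 move=> h; apply: (le_trans h).
 have -> : e%:E = (b%:E * ((e / b / 2)%:E + (e / b / 2)%:E))%E.
 by rewrite -EFinD -EFinM -splitr mulrCA mulfV ?mulr1 // gt_eqF.
 apply: lee_wpmul2l; first by rewrite lee_fin ltW.
 have -> : (fun z => dzb (w n) z - dzb (w m) z) = fun z => (dzb (w n) z - G z) - (dzb (w m) z - G z).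
 by apply/funext=> z; rewrite opprB addrA subrK.
 apply: le_trans (norm_LpCB (ltW p1) (cmfunB (mv n) LG.1) (cmfunB (mv m) LG.1)) _.
 by apply: leeD; exact: HN.
have nk : (nLp p k <= b%:E * nLp p G)%E.
 apply: (cvgLp_compare (ltW b0) mu_ mv mk LG.1 ck cb)=> n; exact: dz_le_beurling p0 pb (Cw n 2%N) (bw n).
have Lk : in_LpC p k.
 split; [exact: mk|apply: (le_lt_trans nk)]; apply: lte_mul_pinfty; [by rewrite lee_fin ltW|by []|exact: LG.2].
have uk : (nLp p (up k) <= nLp p k)%E.
 by apply: norm_LpC_mono p0 _=> z; rewrite normc_up; case: ifP=> // _; exact: normc_ge0.
exists (up k); split.
- by split; [exact: cmfun_up|exact: le_lt_trans uk Lk.2].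
- by move=> z z0; rewrite /up ltNge z0.
- exact: le_trans uk nk.
move=> psi r Cp bp zp.
have -> : cI (fun z => up k z * psi z) = cI (fun z => k z * psi z).
 apply: eq_cintT=> z; rewrite /up; case: ltP=> // z0; have [-> _ _] := vanish_dz zp z0.
 exact: etrans (mulr0 _) (esym (mulr0 _)).
apply: normc_eq_small=> e e0; have e2 := half_gt0 e0.
have z1 z : z.2 <= 0 -> dz psi z = 0 by move=> z0; have [_ -> _] := vanish_dz zp z0.
have [N1 H1] := cw _ _ (Ck_cont (Ck_dz Cp)) (bsupp_dz bp).1 z1 _ e2.
have [K [K0 HK]] := Lp_pairing p1 (Ck_cont Cp) bp.
have K1 : 0 < K + 1 by rewrite ltr_wpDl.
have [N2 H2] := ck _ (divr_gt0 e2 K1); pose n := maxn N1 N2.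
have h1 := H1 n (leq_maxl _ _); have h2 := H2 n (leq_maxr _ _).
rewrite (cint_ibp (Cw n 1%N) Cp bp).1 in h1.
have Ld : in_LpC p (fun z => dz (w n) z - k z).
 by split; [exact: cmfunB|exact: le_lt_trans h2 (ltry _)].
have Lu : in_LpC p (dz (w n)) := conj (mu_ n) (Ck_norm_LpC_lty p0 (Ck_cont (Ck_dz (Cw n 1%N))) (bsupp_dz (bw n)).1).
have [iu _] := HK _ Lu; have [ik _] := HK _ Lk; have [_ bd] := HK _ Ld.
have h3 : normc (cI (fun z => dz (w n) z * psi z) - cI (fun z => k z * psi z)) <= e / 2.
 rewrite -(cintB iu ik) (eq_cintT (g := fun z => (dz (w n) z - k z) * psi z)); last by move=> z; rewrite mulrBl.
 rewrite -lee_fin; apply: (le_trans bd); apply: (le_via (K%:E * (e / 2 / (K + 1))%:E)%E).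
 by apply: lee_wpmul2l=> //; rewrite lee_fin.
 by rewrite -EFinM lee_fin mulrA ler_pdivrMr // mulrC ler_pM2l // lerDl.
move: h1 h3; move: (cI _) (cI _) (cI _)=> x y t h1 h3.
have -> : y - - x = - (- t - y) - (t - x) by ring.
by apply: normcD_le; rewrite !normcNE [e]splitr; exact: lerD.
Qed.
Lemma up_le_weak b T : (beurling_norm p <= b%:E)%E -> in_LpC p T -> (forall z, z.2 <= 0 -> T z = 0) ->
 wk a (@dz R) T -> (nLp p G <= b%:E * nLp p T)%E.
Proof.
move=> pb LT T0 wT; have b0 : 0 < b by have := lt_le_trans (beurling_norm_gt0 p1) pb; rewrite lte_fin.
have [w [Cw bw w0 [cb ct] cw]] := approx p1 ma aoo a0 (T := fun=> T) (fun=> LT) (fun=> T0).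
apply: (cvgLp_compare (ltW b0) _ _ LG.1 LT.1 cb (ct true wT))=> n.
- exact: Ck_cmfun (Ck_dzb (Cw n 1%N)).
- exact: Ck_cmfun (Ck_dz (Cw n 1%N)).
- exact: dzb_le_beurling p0 pb (Cw n 2%N) (bw n).
Qed.
(** Both functions are L^p limits of the same sequence [dz (w n)]. *)
Lemma weak_norm_unique T1 T2 : in_LpC p T1 -> in_LpC p T2 -> (forall z, z.2 <= 0 -> T1 z = 0) ->
 (forall z, z.2 <= 0 -> T2 z = 0) -> wk a (@dz R) T1 -> wk a (@dz R) T2 -> (nLp p T1 <= nLp p T2)%E.
Proof.
move=> L1 L2 t1 t2 w1 w2; pose T (i : bool) := if i then T1 else T2.
have LT i : in_LpC p (T i) by case: i; [exact: L1|exact: L2].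
have T0 i z : z.2 <= 0 -> T i z = 0 by case: i; [exact: t1|exact: t2].
have [w [Cw _ _ [_ ct] _]] := approx p1 ma aoo a0 LT T0.
have mu_ n : cmfun (dz (w n)) by exact: Ck_cmfun (Ck_dz (Cw n 1%N)).
rewrite -[leRHS]mul1e; apply: (cvgLp_compare ler01 mu_ mu_ L1.1 L2.1 (ct true w1) (ct false w2))=> n.
by rewrite mul1e.
Qed.
(** Serves the case B(p) = +oo, where the right side of the upper bound is +oo * 0 = 0. Here dbar of
    w n tends to 0. By Cauchy-Pompeiu at z and at its reflection, where w n vanishes, w n / y is
    bounded by the positive kernel applied to dbar of w n; hence w n / y tends to 0 in L^p and the
    pairings of W vanish. *)
Lemma weak_zero : nLp p G = 0%E -> weak_of (fun=> 0).
Proof.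
move=> G0 psi r Cp bp zp; have [w [Cw bw w0 [cb _] cw]] := approx p1 ma aoo a0 zero_Lp (fun _ _ _ => erefl).
have -> : cI (fun z => (0 : C) * psi z) = 0 by rewrite -[RHS](@cint0); apply: eq_cintT=> z; exact: mul0r.
rewrite oppr0.
have z1 z : z.2 <= 0 -> dz psi z = 0 by move=> z0; have [_ -> _] := vanish_dz zp z0.
have cd := Ck_cont (Ck_dz Cp); have [bd _] := bsupp_dz bp; have [ci bi] := imc_pair cd bd.
have [K [K0 HK]] := Lp_pairing p1 ci bi; have [s [s0 Hs]] := schur_norm p1.
apply: normc_eq_small=> e e0; have e2 := half_gt0 e0.
have Ks : 0 < K * s + 1 by rewrite ltr_wpDl // mulr_ge0 // ltW.
have [N1 H1] := cw _ _ cd bd z1 _ e2; have [N2 H2] := cb _ (divr_gt0 e2 Ks).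
pose n := maxn N1 N2; have h1 := H1 n (leq_maxl _ _); have h2 := H2 n (leq_maxr _ _).
have mv : cmfun (dzb (w n)) := Ck_cmfun (Ck_dzb (Cw n 1%N)).
have h3 : (nLp p (dzb (w n)) <= (e / 2 / (K * s + 1))%:E)%E.
 have -> : dzb (w n) = fun z => (dzb (w n) z - G z) + G z by apply/funext=> z; rewrite subrK.
 by apply: le_trans (norm_LpCD (ltW p1) (cmfunB mv LG.1) LG.1) _; rewrite G0 adde0.
have v0 z : z.2 <= 0 -> dzb (w n) z = 0 by move=> z0; have [_ _ ->] := vanish_dz (w0 n) z0.
pose V z : C := (z.2^-1)%:C * w n z.
have bV z : ((normc (up V z))%:E <= 1%:E * hT (dzb (w n)) z)%E.
 rewrite normc_up; case: ifP=> z0; last by rewrite mul1e hT_ge0.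
 have cv := Ck_cont (Ck_dzb (Cw n 1%N)); have [_ bv] := bsupp_dz (bw n).
 have [_ e1] := kap_pair z cv bv.
 rewrite !(cauchy_pompeiu _ (Cw n 1%N) (bw n)) in e1.
 have cz0 : w n (cj z) = 0.
 have [d d0 Hd] := w0 n; rewrite Hd //= (le_trans _ (ltW d0)) // oppr_le0 ltW //.
 rewrite cz0 oppr0 subr0 mulrN in e1.
 rewrite -normcNE -[- V z]e1; apply: (pot_le mv v0 (k := fun z w => kap w z))=> //.
 exact: (cmfun_comp (measurable_pair2 z) cmfun_kap).
 by move=> u uz u0; rewrite mulr1 normc_kap // hk_sym.
have nV : (nLp p (up V) <= s%:E * nLp p (dzb (w n)))%E by rewrite -[s]mul1r; exact: Hs.
have LV : in_LpC p (up V).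
 split; last first.
 apply: (le_lt_trans nV); apply: lte_mul_pinfty; [by rewrite lee_fin ltW|by []|].
 exact: le_lt_trans h3 (ltry _).
 apply: cmfun_up; apply: cmfunM; last exact: Ck_cmfun (Cw n 0%N).
 by apply/cmfun_real/meas_inv; exact: msnd.
have [_ bK] := HK _ LV.
(* The factor y taken from w n is harmless on the bounded support of psi. *)
have e1 : cI (fun z => w n z * dz psi z) = cI (fun z => up V z * (imc z * dz psi z)).
 apply: eq_cintT=> z; rewrite /up; case: ltP=> z0; last by rewrite (z1 z z0) !mulr0.
 by rewrite /V /imc mulrACA -rmorphM /= mulVf ?gt_eqF // mul1r.
rewrite subr0; have h4 : normc (cI (fun z => w n z * dz psi z)) <= e / 2.
 rewrite e1 -lee_fin; apply: (le_trans bK).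
 apply: (le_via (K%:E * (s%:E * (e / 2 / (K * s + 1))%:E))%E).
 apply: lee_wpmul2l; [by rewrite lee_fin|apply: (le_trans nV)].
 by apply: lee_wpmul2l=> //; rewrite lee_fin ltW.
 by rewrite -!EFinM lee_fin mulrA mulrA ler_pdivrMr // mulrC ler_pM2l // lerDl.
move: h1 h4; move: (cI _) (cI _)=> x y h1 h4.
have -> : x = y - (y - x) by ring.
by apply: normcD_le; rewrite normcNE [e]splitr; exact: lerD.
Qed.

End fixed_density.
End fixed_exponent.
End weak_derivative_norms.

(** * Test functions on the half plane *)

Section test_functions.
Implicit Types (z w : plane) (phi : plane -> C).

Lemma test_Ck1 phi : test_fun phi -> Ck 1 phi.
Proof.
move=> [s1 s2 _ _].
have d1 v z : is_derive z v (fun w => Re (phi w)) ('D_v (fun w => Re (phi w)) z).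
 by apply: DeriveDef=> //; apply: diff_derivable; exact: (s1 [::]).
have d2 v z : is_derive z v (fun w => Im (phi w)) ('D_v (fun w => Im (phi w)) z).
 by apply: DeriveDef=> //; apply: diff_derivable; exact: (s2 [::]).
have dv v z : isD v phi z (dir_deriv v phi z) by split; [exact: d1|exact: d2].
have cv v : ccont (dir_deriv v phi).
 by split=> z; apply: differentiable_continuous; [exact: (s1 [:: v])|exact: (s2 [:: v])].
have c0 : ccont phi.
 by split=> z; apply: differentiable_continuous; [exact: (s1 [::])|exact: (s2 [::])].
have ii : 'i%C * 'i%C = -1 :> C by rewrite -expr2 sqr_i.
have cz : ccont (dz phi).
 apply: ccontM; first exact: ccont_cst.
 apply: ccontD; first exact: cv.
 have := ccontM (ccont_cst (- 'i%C)) (cv (0, 1)); congr ccont; apply/funext=> z; by rewrite mulNr.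
have czb : ccont (dzb phi).
 apply: ccontM; first exact: ccont_cst.
 by apply: ccontD; [exact: cv|apply: ccontM; [exact: ccont_cst|exact: cv]].
apply: Ck_succ=> //; [move=> z|exact: Ck_zero|exact: Ck_zero].
have hz : dz phi z = 2^-1 * (dir_deriv (1, 0) phi z - 'i%C * dir_deriv (0, 1) phi z) by [].
have hb : dzb phi z = 2^-1 * (dir_deriv (1, 0) phi z + 'i%C * dir_deriv (0, 1) phi z) by [].
have [x1 x2] := (dv (1, 0) z, dv (0, 1) z).
rewrite hz hb; move: (dir_deriv (1, 0) phi z) (dir_deriv (0, 1) phi z) x1 x2=> x y x1 x2.
have n2 := @complex2_neq0; split; [move: x1|move: x2]; apply: isD_ext=> //.
 by field.
have -> : 'i%C * (2^-1 * (x - 'i%C * y) - 2^-1 * (x + 'i%C * y)) = - ('i%C * 'i%C) * y by field.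
by rewrite ii opprK mul1r.
Qed.
Lemma test_bsupp phi : test_fun phi -> exists r, bsupp r phi.
Proof.
move=> [_ _ /compact_bounded[M [_ /(_ (M + 1))HM]] _]; exists (M + 1)=> z zM.
apply/eqP; apply: contraTT zM=> z0; rewrite -leNgt; apply: HM; first by rewrite ltrDl.
exact: subset_closure.
Qed.
(** The heights of the points of the compact support form a closed set that misses 0, hence a whole
    neighbourhood of 0. *)
Lemma test_zero_low phi : test_fun phi -> zero_low phi.
Proof.
move=> [_ _ cK Ku]; set K := closure _ in cK Ku.
have sK : compact (@snd R R @` K).
 by apply: continuous_compact=> //; apply: continuous_subspaceT=> z; exact: cvg_snd.
have cS : closed (@snd R R @` K) by apply: compact_closed sK; exact: norm_hausdorff.
have : nbhs (0 : R) (~` (@snd R R @` K)).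
 by apply: open_nbhs_nbhs; split; [exact: closed_openC|move=> [z /Ku z0 h]; rewrite /upper /= h ltxx in z0].
move=> /nbhs_ballP[e /= e0 He]; exists (e / 2); first by rewrite divr_gt0.
move=> z zd; apply/eqP; apply: contraT=> z0; have zK : K z by exact: subset_closure.
have zu : 0 < z.2 := Ku _ zK.
exfalso; apply: (He z.2); last by exists z.
by rewrite /ball /= sub0r normrN gtr0_norm // (le_lt_trans zd) // ltr_pdivrMr // ltr_pMr // ltr1n.
Qed.
Lemma test_evc (e : ex) d r : good d r (evc e) -> test_fun (evc e).
Proof.
move=> [d0 br z0]; pose B := [set z : plane | `|z| <= r] `&` [set z | d <= z.2].
have cB : closed B.
 apply: closedI; first by apply: compact_closed (@box_compact r); exact: norm_hausdorff.
 by apply: (@preimage_closed _ _ (@snd R R) [set x | d <= x]); [move=> z _; exact: cvg_snd|exact: closed_ge].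
have sB : closure [set z | evc e z != 0] `<=` B.
 rewrite [X in _ `<=` X](_ : _ = closure B); last by rewrite -(closure_id B).1.
 apply: closureS=> z /= nz; split; rewrite /= leNgt; apply/negP=> h; move: nz.
 by rewrite br ?eqxx.
 by rewrite z0 ?eqxx // ltW.
split.
- exact: smooth_ev.
- exact: (smooth_ev (EC 0)).
- by apply: subclosed_compact (@closed_closure _ _) (@box_compact r) _=> z /sB[].
- by move=> z /sB[_ /= h]; rewrite /upper /= (lt_le_trans d0).
Qed.

End test_functions.

(** * From the operators on the half plane to the potentials *)

Section norms_on_half_plane.
Implicit Types (z w : plane) (f g k phi : plane -> C).

(** f / y, extended by 0: its L^p(C) norm is the L^p(H) norm of f. *)
Definition density f : plane -> C := up (fun z => (z.2^-1)%:C * f z).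

Lemma density_pt f w : 0 < w.2 -> density f w = (w.2^-1)%:C * f w.
Proof. by rewrite /density /up=> ->. Qed.
Lemma density_low f w : w.2 <= 0 -> density f w = 0.
Proof. by move=> w0; rewrite /density /up ltNge w0. Qed.
Lemma density_imc k z : (forall z, z.2 <= 0 -> k z = 0) -> density (fun z => imc z * k z) z = k z.
Proof.
move=> k0; have [z0|z0] := ltP 0 z.2; last by rewrite density_low // k0.
by rewrite density_pt // mulrA -rmorphM /= mulVf ?mul1r // gt_eqF.
Qed.
Lemma mulIm2 f w : 0 < w.2 -> mulIm (- 2%:Z) f w = (w.2^-1)%:C * density f w.
Proof.
move=> w0; rewrite density_pt // mulrA -rmorphM /mulIm /=; congr (_%:C * _).
by rewrite -invfM -expr2.
Qed.
Lemma Cdown_potv f z : Cdown (mulIm (- 2%:Z) f) z = potv (density f) z.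
Proof.
rewrite /Cdown cint_upper; apply: eq_cintT=> w; case: ltP=> w0; last first.
 by rewrite density_low //; exact: (esym (mulr0 _)).
by rewrite mulIm2 // mulrCA mulrA.
Qed.
Lemma Cbardown_potvJ f z : Cbardown (mulIm (- 2%:Z) f) z = potvJ (density f) z.
Proof.
rewrite /Cbardown cint_upper; apply: eq_cintT=> w; case: ltP=> w0; last first.
 by rewrite density_low //; exact: (esym (mulr0 _)).
have cB (u v : C) : (u - v)^* = u^* - v^* := rmorphB (@conjc R) u v.
rewrite mulIm2 // /kap conjcM conjc_real cB !conjcV mulrCA mulrA.
congr (_ * (_^-1 - _^-1) * _); apply: complex_ext=> /=; ring.
Qed.

Section fixed_function.
Variables (p : R) (f : plane -> C).
Hypothesis p1 : 1 < p.
Hypothesis Lf : in_LpH p f.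
Local Notation a := (density f).
Local Notation T := (ddown (distr_of (dbardown_inv f))).

Let p0 : 0 < p := lt_trans ltr01 p1.

Lemma density_norm g : norm_LpH p g = nLp p (density g).
Proof. exact: norm_LpHE. Qed.
Lemma density_Lp g : in_LpH p g -> in_LpC p (density g).
Proof.
move=> [/cmeasurable_upper mg ng]; split; last by rewrite -density_norm.
have -> : density g = fun z => (z.2^-1)%:C * (if 0 < z.2 then g z else 0).
 by apply/funext=> z; rewrite /density /up; case: ifP=> // _; rewrite mulr0.
by apply: cmfunM mg; apply/cmfun_real/meas_inv; exact: msnd.
Qed.

Let ma : cmfun a := (density_Lp Lf).1.
Let aoo : (nLp p a < +oo)%E := (density_Lp Lf).2.
Let a0 := @density_low f.

Lemma norm_potG : norm_LpH p (fun z => f z + 'i%C / 2 * (dbardown_inv f z + ddown_inv f z)) = nLp p (up (potG a)).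
Proof.
rewrite density_norm; congr (nLp p); apply/funext=> z; have [z0|z0] := ltP 0 z.2; last first.
 by rewrite density_low // /up ltNge z0.
rewrite density_pt // [RHS]/up z0 /potG density_pt // -Cdown_potv -Cbardown_potvJ mulrDr; congr (_ + _).
rewrite -[dbardown_inv f z]/((z.2 ^ 1)%:C * Cdown (mulIm (- 2%:Z) f) z).
rewrite -[ddown_inv f z]/((z.2 ^ 1)%:C * Cbardown (mulIm (- 2%:Z) f) z) expr1z.
rewrite -mulrDr mulrCA; congr (_ * _); rewrite mulrA -rmorphM /= mulVf ?mul1r // gt_eqF //.
Qed.
(** The minimal solution is y v, so the powers of y in [ddown] leave minus the pairing of v with d
    (y^2 phi). Since y^2 phi is y times y phi, [weak_dz] turns it into the pairing of W with d (y
    phi). *)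
Lemma ddown_pairing phi : test_fun phi -> T phi = - cI (fun z => potW a z * dz (fun z => imc z * phi z) z).
Proof.
move=> tp; have Cp := test_Ck1 tp; have [r br] := test_bsupp tp; have [d d0 zp] := test_zero_low tp.
have [_ bi] := imc_pair (Ck_cont Cp) br; have Ci := CkM (Ck_imc 1) Cp.
have zi : zero_low (fun z => imc z * phi z) by exists d=> // z /zp ->; rewrite mulr0.
rewrite (weak_dz p1 ma aoo a0 Ci bi zi).
have E : mulIm 2 phi = fun z => imc z * (imc z * phi z).
 by apply/funext=> z; rewrite /mulIm /imc mulrA -rmorphM.
rewrite /ddown /distr_mulIm /distr_dz /distr_of E; congr (- _); rewrite cint_upper.
have zii : zero_low (fun z => imc z * (imc z * phi z)) by exists d=> // z /zp ->; rewrite !mulr0.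
apply: eq_cintT=> z; case: ltP=> z0; last by have [_ -> _] := vanish_dz zii z0; exact: (esym (mulr0 _)).
rewrite -[dbardown_inv f z]/((z.2 ^ 1)%:C * Cdown (mulIm (- 2%:Z) f) z) Cdown_potv /mulIm expr1z mulrACA -rmorphM /=.
by rewrite -[z.2 ^ _]/(z.2^-1) mulfV ?gt_eqF // mul1r.
Qed.
Lemma pairing_density g phi : test_fun phi -> distr_of g phi = cI (fun z => density g z * (imc z * phi z)).
Proof.
move=> tp; rewrite /distr_of cint_upper; apply: eq_cintT=> z; case: ltP=> z0; last first.
 by rewrite density_low //; exact: (esym (mul0r _)).
by rewrite density_pt // mulrACA -rmorphM /= mulVf ?mul1r // gt_eqF.
Qed.
Lemma represents_wk g : represents g T -> wk a (@dz R) (density g).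
Proof.
move=> rg e d r ge; have te := test_evc ge.
have := rg _ te; rewrite (ddown_pairing te) (pairing_density _ te)=> <-.
by rewrite opprK.
Qed.
Lemma weak_represents k : in_LpC p k -> (forall z, z.2 <= 0 -> k z = 0) -> weak_of a k ->
 [/\ in_LpH p (fun z => imc z * k z), represents (fun z => imc z * k z) T &
 norm_LpH p (fun z => imc z * k z) = nLp p k].
Proof.
move=> Lk k0 wk_; have Ek : density (fun z => imc z * k z) = k by apply/funext=> z; exact: density_imc.
have nk : norm_LpH p (fun z => imc z * k z) = nLp p k by rewrite density_norm Ek.
split; [|move=> phi tp|exact: nk].
 split; last by rewrite nk; exact: Lk.2.
 apply/cmeasurable_upper; apply: cmfun_up; apply: cmfunM Lk.1; apply: ccont_cmfun; exact: Ck_cont (Ck_imc 0).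
have Cp := test_Ck1 tp; have [r br] := test_bsupp tp; have [d d0 zp] := test_zero_low tp.
rewrite (ddown_pairing tp) (pairing_density _ tp) Ek (wk_ _ r) ?opprK //.
- exact: CkM (Ck_imc 1) Cp.
- by move=> z /br ->; rewrite mulr0.
- by exists d=> // z /zp ->; rewrite mulr0.
Qed.
(** y k belongs to the set of representing functions, and every other member has norm no smaller. *)
Lemma weak_distr_norm k : in_LpC p k -> (forall z, z.2 <= 0 -> k z = 0) -> weak_of a k ->
 distr_norm_LpH p T = nLp p k.
Proof.
move=> Lk k0 wk_; have [L1 r1 n1] := weak_represents Lk k0 wk_; apply/eqP; rewrite eq_le; apply/andP; split.
 by apply: ereal_inf_lbound; exists (fun z => imc z * k z).
apply: le_ereal_inf_tmp=> _ [g [Lg rg] <-]; rewrite density_norm.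
have := represents_wk r1; have -> : density (fun z => imc z * k z) = k by apply/funext=> z; exact: density_imc.
move=> w1; apply: (weak_norm_unique p1 ma aoo a0 Lk (density_Lp Lg) k0 _ w1 (represents_wk rg)).
exact: density_low.
Qed.
Lemma distr_norm_le : (distr_norm_LpH p T <= beurling_norm p * nLp p (up (potG a)))%E.
Proof.
have b0 := beurling_norm_gt0 p1; have n0 := norm_LpC_ge0 p (up (potG a)).
case E : (beurling_norm p) b0=> [b| |] // b0.
 have pb : (beurling_norm p <= b%:E)%E by rewrite E.
 have [k [Lk k0 nk wk_]] := exists_weak p1 ma aoo a0 pb.
 by rewrite (weak_distr_norm Lk k0 wk_).
(* Here B(p) = +oo; the product is +oo unless G is null. *)
have [n1|n1] := eqVneq (nLp p (up (potG a))) 0%E; last by rewrite gt0_mulye ?leey // lt0e n1.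
have L0 : in_LpC p (fun _ : plane => 0 : C) by split; [exact: cmfun_cst|rewrite norm_LpC0].
rewrite (weak_distr_norm L0 (fun _ _ => erefl) (weak_zero p1 ma aoo a0 n1)) norm_LpC0 //.
by apply: mule_ge0; [exact: leey|exact: n0].
Qed.
Lemma distr_norm_ge : ((beurling_norm p)^-1 * nLp p (up (potG a)) <= distr_norm_LpH p T)%E.
Proof.
have b0 := beurling_norm_gt0 p1; apply: le_ereal_inf_tmp=> _ [g [Lg rg] <-].
case E : (beurling_norm p) b0=> [b| |] // b0; last first.
 (* For B(p) = +oo the inverse is 0 and the lower bound only says that a norm is nonnegative. *)
 by rewrite invey mul0e density_norm norm_LpC_ge0.
have pb : (beurling_norm p <= b%:E)%E by rewrite E.
have bp : 0 < b by rewrite -lte_fin.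
have h := up_le_weak p1 ma aoo a0 pb (density_Lp Lg) (@density_low g) (represents_wk rg).
rewrite inver gt_eqF // density_norm; apply: (le_via (b^-1%:E * (b%:E * nLp p (density g)))%E).
 by apply: lee_wpmul2l=> //; rewrite lee_fin invr_ge0 ltW.
by rewrite muleA -EFinM mulVf ?mul1e // gt_eqF.
Qed.

End fixed_function.
End norms_on_half_plane.

(** * Sharpness of both constants *)

Section sharpness.
Implicit Types (z w : plane) (n : nat) (f h F X Psi : plane -> C).

Lemma zero_low_dz F : zero_low F -> zero_low (dz F) /\ zero_low (dzb F).
Proof.
move=> [d d0 Hd]; have hs z : z.2 <= d / 2 -> dz F z = 0 /\ dzb F z = 0.
 move=> zd; have w0 : wd F z 0 0.
 apply: (@wd_near (fun=> 0)); last exact: wd_cst.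
 apply/nbhs_ballP; exists (d / 2)=> /=; first by rewrite divr_gt0.
 move=> u [_ /= hu]; rewrite Hd //; have := ler_norm (u.2 - z.2).
 by move: hu; rewrite /ball /= distrC; move: zd; clear; lra.
 by rewrite (wd_dz w0) (wd_dzb w0).
by split; exists (d / 2); rewrite ?divr_gt0 // => z /hs[].
Qed.
Lemma zero_low_at F z : zero_low F -> z.2 <= 0 -> F z = 0.
Proof. by move=> [d d0 Hd] z0; rewrite Hd // (le_trans z0) // ltW. Qed.

(* With [v] the derivative of [y h] and [f] equal to [y^2] times the antiholomorphic derivative of [v],
 both minimal solutions are explicit: they are [y] times the two derivatives of [y h]. *)
Section explicit_solution.
Variables (p r : R) (h : plane -> C).
Hypothesis p1 : 1 < p.
Hypothesis Ch : Ck 3 h.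
Hypothesis bh : bsupp r h.
Hypothesis lh : zero_low h.

Let H z := imc z * h z.
Let v := dz H.
Let f z : C := imc z * (imc z * dzb v z).
Let W z := imc z * (imc z * dz h z).

Let CH : Ck 3 H := CkM (Ck_imc 3) Ch.
Lemma bH : bsupp r H.
Proof. by move=> z /bh; rewrite /H=> ->; rewrite mulr0. Qed.
Lemma lH : zero_low H.
Proof. by case: lh=> d d0 hd; exists d=> // z /hd; rewrite /H=> ->; rewrite mulr0. Qed.
Let bv : bsupp r v := (bsupp_dz bH).1.
Let Cv : Ck 2 v := Ck_dz CH.
Let p0 : 0 < p := lt_trans ltr01 p1.

Let lv : zero_low v := (zero_low_dz lH).1.

Lemma aE : density f = fun z => imc z * dzb v z.
Proof.
apply/funext=> z; apply: density_imc=> u u0.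
by rewrite (zero_low_at (zero_low_dz lv).2 u0) mulr0.
Qed.
Lemma W_split z : W z = imc z * v z + 'i%C / 2 * H z.
Proof. by rewrite /W /v /H (dz_imc (Ck_le (isT : (1 <= 3)%N) Ch)).1; ring. Qed.

Let CW : Ck 2 W := CkM (Ck_imc 2) (CkM (Ck_imc 2) (Ck_dz Ch)).
Lemma bW : bsupp r W.
Proof. by move=> z /(bsupp_dz bh).1; rewrite /W=> ->; rewrite !mulr0. Qed.
Lemma lW : zero_low W.
Proof. by have [[d d0 hd] _] := zero_low_dz lh; exists d=> // z /hd; rewrite /W=> ->; rewrite !mulr0. Qed.
Lemma Lf : in_LpH p f.
Proof.
have Ca : ccont (density f) by rewrite aE; exact: ccontM (Ck_cont (Ck_imc 0)) (Ck_cont (Ck_dzb Cv)).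
have ba : bsupp r (density f) by rewrite aE=> z /(bsupp_dz bv).2 ->; rewrite mulr0.
split; last by rewrite density_norm //; exact: Ck_norm_LpC_lty p0 Ca ba.
apply/cmeasurable_upper/cmfun_up; apply: cmfunM; first exact: ccont_cmfun (Ck_cont (Ck_imc 0)).
by apply: cmfunM; [exact: ccont_cmfun (Ck_cont (Ck_imc 0))|exact: ccont_cmfun (Ck_cont (Ck_dzb Cv))].
Qed.
Lemma dzbv z : dzb v z = dz (dzb H) z.
Proof. by rewrite /v -(Ck_sym z (Ck_le (isT : (2 <= 3)%N) CH)). Qed.
Lemma inv_pair z : cintg (fun w => (pt (w - z))^-1 * dzb v w) /\
 cintg (fun w => ((pt (w - z))^*)^-1 * dzb v w).
Proof.
have cv := Ck_cont (Ck_dzb Cv); have [_ bdv] := bsupp_dz bv; split; first exact: cintg_inv_pt z cv bdv.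
have [cJ bJ] := ccontJc cv bdv; have := cintgJ (cintg_inv_pt z cJ bJ); congr cintg.
by apply/funext=> w; rewrite conjcM conjcK conjcV.
Qed.
Lemma cv1 z : cI (fun w => (pt (w - z))^-1 * dzb v w) = - v z.
Proof. exact: cauchy_pompeiu z (CkS Cv) bv. Qed.
Lemma cv2 z : cI (fun w => ((pt (w - z))^*)^-1 * dzb v w) = - dzb H z.
Proof.
rewrite -(cauchy_pompeiuJ z (CkS (Ck_dzb CH)) (bsupp_dz bH).2).
by apply: eq_cintT=> w; rewrite dzbv.
Qed.
Lemma cj_low F z : zero_low F -> 0 < z.2 -> F (cj z) = 0.
Proof. by move=> lF z0; apply: zero_low_at lF _; rewrite /= oppr_le0 ltW. Qed.
(** The pole at z gives v z by Cauchy-Pompeiu. For the reflected kernel, dbar v = d (dbar H), so the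
    conjugate formula applies at conj z, where dbar H vanishes. Taking v to be d of a function
    supported in the half plane is what removes this second term. *)
Lemma potv_explicit z : 0 < z.2 -> potv (density f) z = v z.
Proof.
move=> z0; have [i1 _] := inv_pair z; have [_ i2] := inv_pair (cj z).
have -> : v z = - (cI (fun w => (pt (w - z))^-1 * dzb v w) - cI (fun w => ((pt (w - cj z))^*)^-1 * dzb v w)).
 by rewrite cv1 cv2 (cj_low (zero_low_dz lH).2 z0) oppr0 subr0 opprK.
rewrite -(cintB i1 i2) -(cintN (cintgB i1 i2)) aE; apply: eq_cintT=> w.
have [w0|w0] := ltP 0 w.2; last by rewrite (zero_low_at (zero_low_dz lv).2 w0) !mulr0 subr0 oppr0.
rewrite /kap /imc mulrACA -rmorphM /= mulVf ?gt_eqF // mul1r -mulrBl -mulNr; congr (_ * _).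
have -> : pt (z - w) = - pt (w - z) by apply/eqP; rewrite eq_complex /= !opprB !eqxx.
have -> : pt (z - cj w) = - (pt (w - cj z))^*.
 by apply/eqP; rewrite eq_complex /= opprB !opprK addrC eqxx addrC eqxx.
by rewrite !invrN; ring.
Qed.
Lemma potvJ_explicit z : 0 < z.2 -> potvJ (density f) z = dzb H z.
Proof.
move=> z0; have [_ i1] := inv_pair z; have [i2 _] := inv_pair (cj z).
have -> : dzb H z = - (cI (fun w => ((pt (w - z))^*)^-1 * dzb v w) - cI (fun w => (pt (w - cj z))^-1 * dzb v w)).
 by rewrite cv1 cv2 (cj_low lv z0) oppr0 subr0 opprK.
rewrite -(cintB i1 i2) -(cintN (cintgB i1 i2)) aE; apply: eq_cintT=> w.
have [w0|w0] := ltP 0 w.2; last by rewrite (zero_low_at (zero_low_dz lv).2 w0) !mulr0 subr0 oppr0.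
have cB (x y : C) : (x - y)^* = x^* - y^* := rmorphB (@conjc R) x y.
have P1 : (pt (z - w))^* = - (pt (w - z))^*.
 by apply: complex_ext=> /=; ring.
have P2 : (pt (z - cj w))^* = - pt (w - cj z).
 by apply: complex_ext=> /=; ring.
rewrite /kap conjcM conjc_real cB !conjcV P1 P2 /imc mulrACA -rmorphM /= mulVf ?gt_eqF // mul1r.
rewrite -mulrBl -mulNr; congr (_ * _).
by rewrite !invrN; ring.
Qed.
Lemma weak_explicit : weak_of (density f) (dz W).
Proof.
move=> psi s Cp bp lp; rewrite (weak_dz p1 (density_Lp p1 Lf).1 (density_Lp p1 Lf).2 (@density_low f) Cp bp lp).
have C1 := CkS Cv; have CH1 : Ck 1 H := Ck_le (isT : (1 <= 3)%N) CH.
rewrite -(cint_ibp (CkS CW) Cp bp).1.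
have i1 : cintg (fun z => v z * (imc z * dz psi z)).
 apply: (@cb_cintg r); last by move=> z /bv ->; rewrite mul0r.
 exact: ccontM (Ck_cont C1) (ccontM (Ck_cont (Ck_imc 0)) (Ck_cont (Ck_dz Cp))).
have i2 : cintg (fun z => H z * dz psi z).
 apply: (@cb_cintg r); last by move=> z /bH ->; rewrite mul0r.
 exact: ccontM (Ck_cont CH1) (Ck_cont (Ck_dz Cp)).
have i3 : cintg (fun z => v z * psi z).
 apply: (@cb_cintg r); last by move=> z /bv ->; rewrite mul0r.
 exact: ccontM (Ck_cont C1) (Ck_cont Cp).
rewrite (eq_cintT (f := fun z => W z * dz psi z)
 (g := fun z => v z * (imc z * dz psi z) + 'i%C / 2 * (H z * dz psi z))); last by move=> z; rewrite W_split; ring.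
rewrite (cintD i1 (cintgZ _ i2)) (cintZ _ i2) (cint_ibp CH1 Cp bp).1 -/v mulrN.
rewrite -(cintZ _ i3) -(cintB i1 (cintgZ _ i3)); apply: eq_cintT=> z.
rewrite (dz_imc Cp).1; have [z0|z0] := ltP 0 z.2; first by rewrite potv_explicit //; ring.
by have [-> -> _] := vanish_dz lp z0; rewrite !(mulr0, subr0).
Qed.
Lemma explicit_norms : exists f, [/\ in_LpH p f, distr_norm_LpH p (ddown (distr_of (dbardown_inv f))) = nLp p (dz W) &
 nLp p (up (potG (density f))) = nLp p (dzb W)].
Proof.
exists f; split; first exact: Lf.
 apply: (weak_distr_norm p1 Lf _ _ weak_explicit).
 have cW := Ck_cont (Ck_dz CW); split; first exact: ccont_cmfun.
 exact: Ck_norm_LpC_lty p0 cW (bsupp_dz bW).1.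
 by move=> z z0; exact: zero_low_at (zero_low_dz lW).1 z0.
congr (nLp p); apply/funext=> z; rewrite /up; case: ltP=> z0; last by rewrite (zero_low_at (zero_low_dz lW).2 z0).
rewrite /potG potv_explicit // potvJ_explicit // aE.
have -> : W = fun z => imc z * v z + 'i%C / 2 * H z by apply/funext=> u; exact: W_split.
have CH1 : Ck 1 H := Ck_le (isT : (1 <= 3)%N) CH.
have h1 := Ck_wd z (CkM (Ck_imc 1) (CkS Cv)); have h2 := wdZ ('i%C / 2) (Ck_wd z CH1).
by rewrite (wd_dzb (wdD h1 h2)) (dz_imc (CkS Cv)).2; ring.
Qed.

End explicit_solution.

Lemma cmfun_shift F (h : plane) : cmfun F -> cmfun (fun z => F (z + h)).
Proof. exact: cmfun_comp (meas_shift h). Qed.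

Section translation.
Variables (p r : R) (X : plane -> C).
Hypothesis p1 : 1 < p.
Hypothesis CX : Ck 2 X.
Hypothesis bX : bsupp r X.

(** Exceeds |r| by at least 1, which lifts the support of the translate to Im z >= 1. *)
Definition height n : R := n.+1%:R + `|r|.
(** The explicit W = y^2 d h for the translate of h to the given height, with X standing for d h
    before translation. *)
Definition lifted n z := imc z * (imc z * X (z + (0, - height n))).

Lemma height_gt0 n : 0 < height n.
Proof. by rewrite ltr_pwDl. Qed.
Lemma dz_lifted n : dz (lifted n) = (fun z => imc z * (imc z * dz X (z + (0, - height n))) - 'i%C * (imc z * X (z + (0, - height n)))) /\
 dzb (lifted n) = (fun z => imc z * (imc z * dzb X (z + (0, - height n))) + 'i%C * (imc z * X (z + (0, - height n)))).
Proof.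
have C1 := Ck_shift (0, - height n) (CkS CX); have [e1 e2] := dz_shift (0, - height n) (CkS CX).
have [h1 h2] := dz_imc C1; have [H1 H2] := dz_imc (CkM (Ck_imc 1) C1).
have n2 := @complex2_neq0; split; apply/funext=> z.
 by rewrite /lifted H1 h1 e1; field.
by rewrite /lifted H2 h2 e2; field.
Qed.
(** After translation back and division by the squared height s^2, the factor y^2 has become (1 + y
    / s)^2, tending to 1 on the bounded support, and the term from the derivative of y^2 is of order
    1 / s. *)
Lemma lifted_cvg (D : (plane -> C) -> plane -> C) (c : C) : normc c = 1 -> Ck 1 (D X) -> bsupp r (D X) ->
 (forall n, D (lifted n) = fun z => imc z * (imc z * D X (z + (0, - height n))) + c * (imc z * X (z + (0, - height n)))) ->
 (forall n, cmfun (D (lifted n))) ->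
 cvgLp p (fun n z => ((height n)^-1 ^+ 2)%:C * D (lifted n) (z + (0, height n))) (D X).
Proof.
move=> c1 CD bD E mD; pose K := (1 + `|r|) ^+ 2; have K0 : 0 <= K by exact: sqr_ge0.
have p0 : 0 < p := lt_trans ltr01 p1.
have LD : in_LpC p (D X).
 by split; [exact: ccont_cmfun (Ck_cont CD)|exact: Ck_norm_LpC_lty p0 (Ck_cont CD) bD].
have LX : in_LpC p X.
 by split; [exact: ccont_cmfun (Ck_cont CX)|exact: Ck_norm_LpC_lty p0 (Ck_cont CX) bX].
have b n z : normc (((height n)^-1 ^+ 2)%:C * D (lifted n) (z + (0, height n)) - D X z) <=
 (rate n)%:num * (K * normc (D X z) + K * normc (X z)).
 have zz : z + (0, height n) + (0, - height n) = z.
 by case: z=> x y; congr (_, _); rewrite /= ?addr0 ?addrK.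
 rewrite E zz; have [zr|zr] := leP `|z| r; last first.
 rewrite (bD z zr) (bX zr) !(mulr0, addr0) subr0 normc0.
 by rewrite mulr0 addr0 mulr0.
 have z2 : `|z.2| <= `|r|.
 apply: (le_via `|z|); first by rewrite norm_planeE le_max lexx orbT.
 exact: le_trans zr (ler_norm _).
 have t1 : (height n)^-1 <= (rate n)%:num.
 by rewrite /= lef_pV2 ?posrE ?height_gt0 // lerDl.
 have t0 : 0 < (height n)^-1 by rewrite invr_gt0 height_gt0.
 have r1 : (rate n)%:num <= 1 :> R by rewrite /= invf_le1 // ler1n.
 have th : (height n)^-1 * height n = 1 by rewrite mulVf // gt_eqF ?height_gt0.
 set t := (height n)^-1 in t1 t0 th *; set s := height n in th *.
 have -> : (t ^+ 2)%:C * (imc (z + (0, s)) * (imc (z + (0, s)) * D X z) + c * (imc (z + (0, s)) * X z)) - D X z =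
 (2 * (t * z.2) + (t * z.2) ^+ 2)%:C * D X z + (t * (1 + t * z.2))%:C * (c * X z).
 have -> : imc (z + (0, s)) = (z.2 + s)%:C by [].
 have -> : 2 * (t * z.2) + (t * z.2) ^+ 2 = t ^+ 2 * ((z.2 + s) * (z.2 + s)) - 1.
 by have -> : t ^+ 2 * ((z.2 + s) * (z.2 + s)) = (t * z.2 + t * s) ^+ 2 by [ring]; rewrite th; ring.
 have -> : t * (1 + t * z.2) = t ^+ 2 * (z.2 + s).
 by have -> : t ^+ 2 * (z.2 + s) = t * (t * s + t * z.2) by [ring]; rewrite th.
 by rewrite rmorphB !rmorphM /= rmorph1; ring.
 apply: normcD_le; rewrite !normcM !normc_real c1 mul1r [leRHS]mulrDr.
 have tz : `|t * z.2| <= t * `|r| by rewrite normrM (gtr0_norm t0) ler_pM2l.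
 have tr : t * `|r| <= `|r| by rewrite ler_piMl // (le_trans t1).
 apply: lerD; rewrite [leRHS]mulrA; apply: ler_wpM2r; rewrite ?normc_ge0 //.
 apply: (le_via (t * K)); last by apply: ler_wpM2r.
 apply: (le_trans (ler_normD _ _)); rewrite normrM ger0_norm // normrX.
 have q2 : `|t * z.2| ^+ 2 <= t * `|r| * `|r|.
 by rewrite expr2; apply: ler_pM; rewrite // (le_trans tz).
 rewrite /K; move: tz q2; move: `|t * z.2| => q tz q2; have := normr_ge0 r; move: `|r| tz q2 tr=> m tz q2 tr m0.
 by apply: (le_via (2 * (t * m) + t * m * m)); [lra|nra].
 apply: (le_via (t * K)); last by apply: ler_wpM2r.
 rewrite normrM gtr0_norm // ler_pM2l //; apply: (le_trans (ler_normD _ _)); rewrite normr1.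
 rewrite /K; apply: (le_via (1 + `|r|)); first by rewrite lerD2l (le_trans tz).
 by rewrite expr2 ler_peMl ?addr_ge0 // lerDl.
apply: (cvgLp_dom p1 LD LX K0 K0 LD.1 _ _ _).
- by move=> n; apply: cmfunM; [exact: cmfun_cst|exact: cmfun_shift].
- move=> n z; apply: (le_trans (b n z)); rewrite ler_piMl //.
 by apply: addr_ge0; apply: mulr_ge0; rewrite ?normc_ge0.
 by rewrite /= invf_le1 // ler1n.
move=> z e e0; pose B := K * normc (D X z) + K * normc (X z).
have B0 : 0 <= B by apply: addr_ge0; apply: mulr_ge0; rewrite ?normc_ge0.
have B1 : 0 < B + 1 by rewrite ltr_wpDl.
have [N HN] := rate_small (divr_gt0 e0 B1); exists N=> n nN; apply: (le_trans (b n z)).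
apply: (le_via (e / (B + 1) * B)); first by apply: ler_wpM2r=> //; exact: HN.
by rewrite mulrAC ler_pdivrMr // ler_pM2l // lerDl.
Qed.

End translation.

Lemma lifted_norms (p r : R) Psi : 1 < p -> Ck 3 Psi -> bsupp r Psi -> forall n,
 exists f, [/\ in_LpH p f,
 distr_norm_LpH p (ddown (distr_of (dbardown_inv f))) = nLp p (dz (lifted r (dz Psi) n)) &
 nLp p (up (potG (density f))) = nLp p (dzb (lifted r (dz Psi) n))].
Proof.
move=> p1 C3 bP n; pose s : plane := (0, - height r n).
have bh : bsupp (r + height r n) (fun z => Psi (z + s)).
 move=> z zr; apply: bP; have := ler_normB (z + s) s; rewrite addrK.
 have -> : `|s| = height r n by rewrite norm_planeE /= normr0 normrN gtr0_norm ?height_gt0 // max_r // ltW ?height_gt0.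
 by move: zr; clear; lra.
have lh : zero_low (fun z => Psi (z + s)).
 exists 2^-1; first by rewrite invr_gt0.
 move=> z z2; apply: bP; apply: (@lt_le_trans _ _ `|(z + s).2|); last by rewrite norm_planeE le_max lexx orbT.
 rewrite /= /height -normrN; apply: lt_le_trans (ler_norm _).
 have := ler_norm r; have : 1 <= n.+1%:R :> R by rewrite ler1n.
 by move: (n.+1%:R)=> m; move: z2; clear; lra.
have [f [Lf h1 h2]] := explicit_norms p1 (Ck_shift s C3) bh lh; exists f.
have [E _] := dz_shift s (Ck_le (isT : (1 <= 3)%N) C3); rewrite E in h1 h2.
by split; [exact: Lf|exact: h1|exact: h2].
Qed.
(** Norms are invariant under translation, and the same scalar rescales both sides, so an inequality
    for the lifted functions survives in the limit. *)
Lemma lifted_compare (p r c : R) Psi : 1 < p -> 0 <= c -> Ck 3 Psi -> bsupp r Psi ->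
 let V n := lifted r (dz Psi) n in
 ((forall n, nLp p (dz (V n)) <= c%:E * nLp p (dzb (V n)))%E ->
 (nLp p (dz (dz Psi)) <= c%:E * nLp p (dzb (dz Psi)))%E) /\
 ((forall n, nLp p (dzb (V n)) <= c%:E * nLp p (dz (V n)))%E ->
 (nLp p (dzb (dz Psi)) <= c%:E * nLp p (dz (dz Psi)))%E).
Proof.
move=> p1 c0 C3 bP V; have p0 : 0 < p := lt_trans ltr01 p1.
have CX := Ck_dz C3; have [bX _] := bsupp_dz bP; have [b1 b2] := bsupp_dz bX.
have CV n : Ck 1 (V n).
 by apply: CkM (Ck_imc 1) (CkM (Ck_imc 1) _); exact: Ck_shift (CkS CX).
have m1 n : cmfun (dz (V n)) := ccont_cmfun (Ck_cont (Ck_dz (CV n))).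
have m2 n : cmfun (dzb (V n)) := ccont_cmfun (Ck_cont (Ck_dzb (CV n))).
have [n1 n2] : normc (- 'i%C : C) = 1 /\ normc ('i%C : C) = 1 by rewrite normcNE normc_i.
pose S (F : nat -> plane -> C) n z : C := ((height r n)^-1 ^+ 2)%:C * F n (z + (0, height r n)).
have k1 : cvgLp p (S (fun n => dz (V n))) (dz (dz Psi)) := lifted_cvg p1 CX bX n1 (Ck_dz CX) b1
 (fun n => etrans (dz_lifted r CX n).1 (funext (fun z => congr1 (fun x => _ + x) (esym (mulNr _ _))))) m1.
have k2 : cvgLp p (S (fun n => dzb (V n))) (dzb (dz Psi)) :=
 lifted_cvg p1 CX bX n2 (Ck_dzb CX) b2 (fun n => (dz_lifted r CX n).2) m2.
have mX1 := ccont_cmfun (Ck_cont (Ck_dz CX)); have mX2 := ccont_cmfun (Ck_cont (Ck_dzb CX)).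
have ms (F : nat -> plane -> C) : (forall n, cmfun (F n)) -> forall n, cmfun (S F n).
 by move=> mF n; apply: cmfunM; [exact: cmfun_cst|exact: cmfun_shift].
have ns (F : nat -> plane -> C) : (forall n, cmfun (F n)) -> forall n,
 nLp p (S F n) = (((height r n)^-1 ^+ 2)%:E * nLp p (F n))%E.
 move=> mF n; rewrite (norm_LpCZ _ p0 (cmfun_shift _ (mF n))) (norm_LpC_shift _ _ (mF n)).
 by rewrite normc_ger0 // sqr_ge0.
have cmp (F G : nat -> plane -> C) : (forall n, cmfun (F n)) -> (forall n, cmfun (G n)) ->
 (forall n, nLp p (F n) <= c%:E * nLp p (G n))%E ->
 (forall n, nLp p (S F n) <= c%:E * nLp p (S G n))%E.
 move=> mF mG h n; rewrite (ns F mF) (ns G mG) muleCA; apply: lee_wpmul2l; last exact: h.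
 by rewrite lee_fin sqr_ge0.
split=> h; first exact: (cvgLp_compare p1 c0 (ms _ m1) (ms _ m2) mX1 mX2 k1 k2 (cmp _ _ m1 m2 h)).
exact: (cvgLp_compare p1 c0 (ms _ m2) (ms _ m1) mX2 mX1 k2 k1 (cmp _ _ m2 m1 h)).
Qed.
(** An admissible c bounds d d Psi by dbar d Psi, and the functions dbar d Psi are dense. The
    maximum with 0 admits c of any sign. *)
Lemma sharp_upper (p c : R) : 1 < p ->
 (forall f, in_LpH p f -> distr_norm_LpH p (ddown (distr_of (dbardown_inv f))) <= c%:E * nLp p (up (potG (density f))))%E ->
 (beurling_norm p <= (Num.max c 0)%:E)%E.
Proof.
move=> p1 H; have c0 : 0 <= Num.max c 0 by rewrite le_max lexx orbT.
apply: (beurling_norm_dz_le p1 c0)=> Psi r C3 bP; apply: (lifted_compare p1 c0 C3 bP).1=> n.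
have [f [Lf h1 h2]] := lifted_norms p1 C3 bP n; have := H f Lf; rewrite h1 h2=> h.
apply: (le_trans h); apply: lee_wpmul2r; first exact: norm_LpC_ge0.
by rewrite lee_fin le_max lexx.
Qed.
(** Lifting conj Psi bounds dbar d (conj Psi) by 1 / c times d d (conj Psi). After conjugation this
    bounds d dbar Psi by dbar dbar Psi, and the functions dbar dbar Psi are dense. *)
Lemma sharp_lower (p c : R) : 1 < p -> 0 < c ->
 (forall f, in_LpH p f -> c%:E * nLp p (up (potG (density f))) <= distr_norm_LpH p (ddown (distr_of (dbardown_inv f))))%E ->
 (beurling_norm p <= c^-1%:E)%E.
Proof.
move=> p1 c0 H; have i0 : 0 <= c^-1 by rewrite invr_ge0 ltW.
apply: (beurling_norm_dzb_le p1 i0)=> Psi r C3 bP.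
have bJ : bsupp r (fun z => (Psi z)^*) by move=> z /bP ->; rewrite conjc0.
have C1 : Ck 1 Psi := Ck_le (isT : (1 <= 3)%N) C3.
have hc : (nLp p (dzb (dz (fun z => (Psi z)^*))) <= c^-1%:E * nLp p (dz (dz (fun z => (Psi z)^*))))%E.
 apply: (lifted_compare p1 i0 (CkJ C3) bJ).2=> n.
 have [f [Lf h1 h2]] := lifted_norms p1 (CkJ C3) bJ n; have := H f Lf; rewrite h1 h2=> h.
 have vc : c^-1 * c = 1 by rewrite mulVf // gt_eqF.
 apply: le_trans (lee_wpmul2l _ h); last by rewrite lee_fin.
 rewrite muleA -EFinM vc mul1e; exact: lexx.
have [e1 _] := dzJ C1; have [e2 e3] := dzJ (CkS (Ck_dzb C3)); rewrite e1 e2 e3 in hc.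
by move: hc; rewrite !(@eq_norm_LpC p (fun z => (_ z)^*) _ (fun z => normc_conj _)).
Qed.

End sharpness.
End half_plane.

Theorem theorem7p1 (R : realType) :
  let D (p : R) (f : R * R -> complex R) : \bar R :=
    distr_norm_LpH p (ddown (distr_of (dbardown_inv f))) in
  let N (p : R) (f : R * R -> complex R) : \bar R :=
    norm_LpH p (fun z =>
      f z + ('i%C / 2) * (dbardown_inv f z + ddown_inv f z)) in
  (forall f : R * R -> complex R, in_LpH 2 f -> D 2 f = N 2 f) /\
  (forall p : R, 1 < p ->
    [/\ forall f : R * R -> complex R, in_LpH p f ->
          ((beurling_norm p)^-1 * N p f <= D p f)%E /\
          (D p f <= beurling_norm p * N p f)%E,
        forall c : R, ((beurling_norm p)^-1 < c%:E)%E ->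
          ~ (forall f : R * R -> complex R, in_LpH p f ->
               (c%:E * N p f <= D p f)%E) &
        forall c : R, (c%:E < beurling_norm p)%E ->
          ~ (forall f : R * R -> complex R, in_LpH p f ->
               (D p f <= c%:E * N p f)%E)]).
Proof.
move=> D N; have NE p f : 1 < p -> N p f = nLp p (up (potG (density f))) by move=> p1; exact: norm_potG.
have dle p f : 1 < p -> in_LpH p f -> (D p f <= beurling_norm p * N p f)%E.
 by move=> p1 Lf; rewrite NE //; exact: distr_norm_le.
have dge p f : 1 < p -> in_LpH p f -> ((beurling_norm p)^-1 * N p f <= D p f)%E.
 by move=> p1 Lf; rewrite NE //; exact: distr_norm_ge.
have N0 p f : 1 < p -> (0 <= N p f)%E by move=> p1; rewrite NE //; exact: norm_LpC_ge0.
split=> [f Lf|p p1].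
 have p1 : 1 < 2 :> R by rewrite ltr1n.
 (* B(2) <= 1 turns the upper bound into D <= N and, since then 1 / B(2) >= 1, the lower bound into
    N <= D. *)
 have b1 := @beurling_norm2 R; have b0 := beurling_norm_gt0 p1.
 apply/eqP; rewrite eq_le; apply/andP; split.
 by apply: (le_trans (dle _ _ p1 Lf)); rewrite -[leRHS]mul1e; apply: lee_wpmul2r; [exact: N0|exact: b1].
 apply: le_trans (dge _ _ p1 Lf); rewrite -[leLHS]mul1e; apply: lee_wpmul2r; first exact: N0.
 by rewrite inve_ge1 // ltW.
have b0 := beurling_norm_gt0 p1; split=> [f Lf|c bc H|c cb H].
- by split; [exact: dge|exact: dle].
(* An admissible c > 1 / B(p) is positive and would give B(p) <= 1 / c, that is, c <= 1 / B(p). *)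
- have c0 : 0 < c by rewrite -lte_fin; apply: le_lt_trans bc; rewrite inve_ge0 ltW.
 have h : (beurling_norm p <= c^-1%:E)%E.
 by apply: (sharp_lower p1 c0) => f Lf; rewrite -NE; [exact: H|exact: p1].
 suff : ((beurling_norm p)^-1 < (beurling_norm p)^-1)%E by rewrite ltxx.
 apply: (lt_le_trans bc); case: (beurling_norm p) h b0 => [b| |] //; rewrite lee_fin lte_fin => h b0.
 by rewrite inver gt_eqF // lee_fin -[c]invrK lef_pV2 ?posrE // invr_gt0.
have h : (beurling_norm p <= (Num.max c 0)%:E)%E.
 by apply: (sharp_upper p1) => f Lf; rewrite -NE; [exact: H|exact: p1].
(* An admissible c <= 0 would give B(p) <= 0, against positivity; an admissible c > 0 would give
   B(p) <= c. *)
have [c0|c0] := leP c 0.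
 by rewrite max_r // in h; have := lt_le_trans b0 h; rewrite ltxx.
by rewrite max_l ?(ltW c0) // in h; have := le_lt_trans h cb; rewrite ltxx.
Qed.
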